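(* Let $p(\cdot):\mathbb{R}^n\to(1,\infty)$ be a measurable function (variable exponent) satisfying \[ 1<p_-:=\operatorname*{ess\,inf}_{x\in\mathbb{R}^n}p(x),\qquad p_+:=\operatorname*{ess\,sup}_{x\in\mathbb{R}^n}p(x)<\infty, \] let $p'(\cdot)$ be defined by $1/p(x)+1/p'(x)=1$, and let $w:\mathbb{R}^n\to[0,\infty]$ be a weight satisfying \[ \sup_{B}\frac{1}{|B|}\,\|w\chi_B\|_{L^{p(\cdot)}(\mathbb{R}^n)}\,\|w^{-1}\chi_B\|_{L^{p'(\cdot)}(\mathbb{R}^n)}<\infty, \] where the supremum is taken over all balls $B\subseteq\mathbb{R}^n$. Suppose $C\subseteq\mathbb{R}^n$ is a nonempty open cone with the vertex at the origin. If $a\in\mathcal{M}^0_{L^{p(\cdot)}(\mathbb{R}^n,w)}$, then \[ \|a\|_{L^\infty(\mathbb{R}^n)}\le\|W_C(a)\|_{\mathcal{B}(L^{p(\cdot)}(C,w))}, \qquad \frac12\,\|a\|_{L^\infty(\mathbb{R}^n)}\le\|W_C(a)\|_{\mathcal{B}(L^{p(\cdot)}(C,w)),\kappa}. \] In particular, for $a\in\mathcal{M}^0_{L^{p(\cdot)}(\mathbb{R}^n,w)}$, \[ W_{\mathbb{R}^n}(a)\in\mathcal{K}(L^{p(\cdot)}(\mathbb{R}^n,w))\Longleftrightarrow a=0 \qquad\text{and}\qquad W_C(a)\in\mathcal{K}(L^{p(\cdot)}(C,w))\Longleftrightarrow a=0 \] (where $a=0$ means $a=0$ a.e.).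
   Context: Spaces. For a variable exponent $q(\cdot)$, $L^{q(\cdot)}(\mathbb{R}^n)$ is the space of measurable $f:\mathbb{R}^n\to\mathbb{C}$ (modulo a.e. equality) with $m_{q(\cdot)}(f/\lambda):=\int_{\mathbb{R}^n}|f(x)/\lambda|^{q(x)}\,dx<\infty$ for some $\lambda>0$, with norm $\|f\|_{L^{q(\cdot)}(\mathbb{R}^n)}:=\inf\{\lambda>0: m_{q(\cdot)}(f/\lambda)\le1\}$. A weight is a measurable function $w:\mathbb{R}^n\to[0,\infty]$ with $0<w<\infty$ a.e. $L^{p(\cdot)}(\mathbb{R}^n,w)$ is the space of measurable $f$ with $fw\in L^{p(\cdot)}(\mathbb{R}^n)$, with norm $\|f\|_{L^{p(\cdot)}(\mathbb{R}^n,w)}:=\|fw\|_{L^{p(\cdot)}(\mathbb{R}^n)}$. For a measurable set $\Omega\subseteq\mathbb{R}^n$ of positive measure, $r_\Omega$ is the operator of restriction from $\mathbb{R}^n$ to $\Omega$, $e_\Omega$ is the operator of extension by $0$ from $\Omega$ to $\mathbb{R}^n$, and $L^{p(\cdot)}(\Omega,w)$ is the space of measurable $f:\Omega\to\mathbb{C}$ with norm $\|e_\Omega f\|_{L^{p(\cdot)}(\mathbb{R}^n,w)}<\infty$. An open set $C\subseteq\mathbb{R}^n$ is an open cone with the vertex at the origin if $x\in C$ implies $\alpha x\in C$ for all $\alpha>0$. Multipliers and Wiener-Hopf type operators. Write $X(\Omega)=L^{p(\cdot)}(\Omega,w)$. $F$ is the Fourier transform, $(Fu)(\xi)=\int_{\mathbb{R}^n}u(x)e^{-ix\xi}\,dx$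 for Schwartz functions $u$, and $F^{-1}$ is its inverse; both are extended by continuity to $L^2(\mathbb{R}^n)$. $\mathcal{M}^0_{X(\mathbb{R}^n)}$ is the set of $a\in L^\infty(\mathbb{R}^n)$ such that \[ \sup\left\{\frac{\|F^{-1}aFu\|_{X(\mathbb{R}^n)}}{\|u\|_{X(\mathbb{R}^n)}}: u\in (L^2(\mathbb{R}^n)\cap X(\mathbb{R}^n))\setminus\{0\}\right\}<\infty . \] For such $a$, $W_\Omega(a)u:=r_\Omega F^{-1}aFe_\Omega u$ for $u\in L^2(\Omega)\cap X(\Omega)$; this operator is bounded in the norm of $X(\Omega)$. Under the stated hypotheses $L^2(\Omega)\cap X(\Omega)$ is dense in $X(\Omega)$, and $W_\Omega(a)$ also denotes the extension by continuity to a bounded linear operator on $X(\Omega)$. Operator notation. $\mathcal{B}(\mathcal{X})$ and $\mathcal{K}(\mathcal{X})$ are the spaces of bounded and of compact linear operators on a Banach space $\mathcal{X}$. For a bounded subset $G$ of a Banach space, $\kappa(G)$ is the infimum of the numbers $r$ such that $G$ can be covered by a finite family of sets of diameter at most $r$. For $A\in\mathcal{B}(\mathcal{X})$, $\|A\|_{\mathcal{B}(\mathcal{X}),\kappa}:=\frac12\,\kappa(A(B_{\mathcal{X}}))$, where $B_{\mathcal{X}}$ is the closed unit ball of $\mathcal{X}$ (note the factor $\frac12$). *)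

(* Defs.v *)
From HB Require Import structures.
From mathcomp Require Import all_boot all_order all_algebra.
From mathcomp Require Import generic_quotient ring_quotient.
From mathcomp Require Import all_classical all_reals all_analysis.
From mathcomp Require Import measurable_realfun ess_sup_inf.
From mathcomp Require Import complex.

Set Implicit Arguments.
Unset Strict Implicit.
Unset Printing Implicit Defensive.
Import Order.TTheory GRing.Theory Num.Theory.
Import numFieldNormedType.Exports.
Local Open Scope classical_set_scope.
Local Open Scope ring_scope.

(* The Lebesgue measure on R^n is built in three steps: iterated product of the
   one-dimensional measure on n-tuples (Borel sets), transport to the row
   vectors 'rV[R]_n, and Caratheodory completion. *)
Section LebesgueMeasureRn.
Context (R : realType).

Section Cons.
Context (n : nat).
Variable m : {sigma_finite_measure set (n.-tuple R) -> \bar R}.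

Let lam : {sigma_finite_measure set (measurableTypeR R) -> \bar R} :=
  @lebesgue_measure R.

Definition tuple_cons (z : measurableTypeR R * n.-tuple R) : n.+1.-tuple R :=
  [tuple of z.1 :: z.2].

Lemma measurable_tuple_cons : measurable_fun setT tuple_cons.
Proof. exact: measurable_cons. Qed.

Definition cons_measure : set (n.+1.-tuple R) -> \bar R :=
  pushforward (lam \x m)%E tuple_cons.

Let cons0 : cons_measure set0 = 0%E.
Proof. by rewrite /cons_measure /pushforward preimage_set0 measure0. Qed.

Let cons_ge0 A : (0 <= cons_measure A)%E.
Proof. by rewrite /cons_measure /pushforward measure_ge0. Qed.

Let cons_sigma_additive : semi_sigma_additive cons_measure.
Proof.
move=> F mF tF mUF.
have mpre A : measurable A -> measurable (tuple_cons @^-1` A).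
  by move=> mA; rewrite -[X in measurable X]setTI; exact: measurable_tuple_cons.
rewrite /cons_measure /pushforward preimage_bigcup.
apply: measure_semi_sigma_additive.
- by move=> k; exact: mpre.
- apply/trivIsetP => /= i j _ _ ij; rewrite -preimage_setI.
  by move/trivIsetP : tF => /(_ _ _ _ _ ij) ->//; rewrite preimage_set0.
- by rewrite -preimage_bigcup; exact: mpre.
Qed.

HB.instance Definition _ := isMeasure.Build _ _ _ cons_measure
  cons0 cons_ge0 cons_sigma_additive.

Let cons_sigma_finite : sigma_finite setT cons_measure.
Proof.
have /sigma_finiteP[G [TG ndG Goo]] := sigma_finiteT lam.
have /sigma_finiteP[H [TH ndH Hoo]] := sigma_finiteT m.
pose u (t : n.+1.-tuple R) : measurableTypeR R * n.-tuple R :=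
  (thead t, [tuple of behead t]).
have uK : cancel u tuple_cons by move=> t; rewrite [RHS]tuple_eta.
have cK : cancel tuple_cons u.
  by case=> x t; congr pair => //; apply/val_inj.
have mu : measurable_fun setT u.
  apply/measurable_fun_pair; first exact: measurable_tnth.
  exact: measurable_behead.
exists (fun k => u @^-1` (G k `*` H k)).
  rewrite -preimage_bigcup (_ : \bigcup_k _ = setT)// predeqE => -[x y]; split=> // _.
  have [i _ Gx] : (\bigcup_k G k) x by rewrite -TG.
  have [j _ Hy] : (\bigcup_k H k) y by rewrite -TH.
  exists (maxn i j) => //; split => /=.
  - by move: x Gx; exact/subsetPset/ndG/leq_maxl.
  - by move: y Hy; exact/subsetPset/ndH/leq_maxr.
move=> k; have [mG Gy] := Goo k; have [mH Hy] := Hoo k; split.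
  by rewrite -[X in measurable X]setTI; apply: mu => //; exact: measurableX.
rewrite /cons_measure /pushforward -comp_preimage.
rewrite (_ : u \o tuple_cons = id); last by apply/funext => z /=; rewrite cK.
by rewrite preimage_id product_measure1E// lte_mul_pinfty// ge0_fin_numE.
Qed.

HB.instance Definition _ := Measure_isSigmaFinite.Build _ _ _ cons_measure
  cons_sigma_finite.

End Cons.

Fixpoint lebesgue_tuple n : {sigma_finite_measure set (n.-tuple R) -> \bar R} :=
  match n with
  | 0 => \d_([tuple] : 0.-tuple R)
  | n'.+1 => cons_measure (lebesgue_tuple n')
  end.

Section Rows.
Context (n : nat).

Definition rV_tuple (x : 'rV[R]_n) : n.-tuple R := [tuple x ord0 i | i < n].
Definition tuple_rV (t : n.-tuple R) : 'rV[R]_n := \row_i tnth t i.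

(* The sigma-algebra making the coordinates measurable, i.e. the Borel sets. *)
Definition borel_rV := g_sigma_algebra_preimageType rV_tuple.

Definition borel_lebesgue : set borel_rV -> \bar R :=
  pushforward (lebesgue_tuple n) (tuple_rV : _ -> borel_rV).

Lemma tuple_rVK : cancel tuple_rV rV_tuple.
Proof. by move=> t; apply: eq_from_tnth => i; rewrite tnth_mktuple mxE. Qed.

Lemma measurable_tuple_rV :
  measurable_fun [set: n.-tuple R] (tuple_rV : _ -> borel_rV).
Proof.
move=> _ _ [B mB <-]; rewrite !setTI -comp_preimage.
by rewrite (_ : _ \o _ = id) ?preimage_id//; apply/funext => t; exact: tuple_rVK.
Qed.

Let borel0 : borel_lebesgue set0 = 0%E.
Proof. by rewrite /borel_lebesgue /pushforward preimage_set0 measure0. Qed.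

Let borel_ge0 A : (0 <= borel_lebesgue A)%E.
Proof. by rewrite /borel_lebesgue /pushforward measure_ge0. Qed.

Let borel_sigma_additive : semi_sigma_additive borel_lebesgue.
Proof.
move=> F mF tF mUF.
have mpre (A : set borel_rV) : measurable A -> measurable (tuple_rV @^-1` A).
  by move=> mA; rewrite -[X in measurable X]setTI; exact: measurable_tuple_rV.
rewrite /borel_lebesgue /pushforward preimage_bigcup.
apply: measure_semi_sigma_additive.
- by move=> k; exact: mpre.
- apply/trivIsetP => /= i j _ _ ij; rewrite -preimage_setI.
  by move/trivIsetP : tF => /(_ _ _ _ _ ij) ->//; rewrite preimage_set0.
- by rewrite -preimage_bigcup; exact: mpre.
Qed.

HB.instance Definition _ := isMeasure.Build _ _ _ borel_lebesgue
  borel0 borel_ge0 borel_sigma_additive.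

(* R^n with the Lebesgue-measurable sets; as a type it is 'rV[R]_n. *)
Definition Rn : measurableType _ := caratheodory_type (borel_lebesgue^*)%mu.

Definition leb : {measure set Rn -> \bar R} :=
  @completed_measure_extension _ _ _ borel_lebesgue.

End Rows.
End LebesgueMeasureRn.
Arguments Rn : clear implicits.
Arguments leb {R n}.


(* Modular and Luxemburg norm of a [0, +oo]-valued function g with variable
   exponent q. They see a complex function only through its modulus, so the norm
   of f in L^q(w) is the one of |f| w, see wabs below. *)
Definition modular d (T : measurableType d) (R : realType)
    (mu : {measure set T -> \bar R}) (q : T -> R) (g : T -> \bar R) : \bar R :=
  (\int[mu]_x (`|g x| `^ q x))%E.

HB.lock Definition luxemburg d (T : measurableType d) (R : realType)
    (mu : {measure set T -> \bar R}) (q : T -> R) (g : T -> \bar R) : \bar R :=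
  ereal_inf [set l%:E | l in
    [set l : R | 0 < l /\ (modular mu q (fun x => l^-1%:E * g x) <= 1)%E]].
Canonical locked_luxemburg := Unlockable luxemburg.unlock.

Section Luxemburg.
Context d (T : measurableType d) (R : realType).
Variable mu : {measure set T -> \bar R}.
Local Open Scope ereal_scope.
Implicit Types (q : T -> R) (g h k : T -> \bar R) (c l : R).
Local Notation modular := (modular mu).
Local Notation luxemburg := (luxemburg mu).

Lemma luxE q g : luxemburg q g = ereal_inf [set l%:E | l in
  [set l | (0 < l)%R /\ modular q (fun x => l^-1%:E * g x) <= 1]].
Proof. by rewrite unlock. Qed.

Lemma measurable_poweR_var q g : (forall x, 1 < q x)%R ->
  (forall x, 0 <= g x) ->
  measurable_fun [set: T] q -> measurable_fun [set: T] g ->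
  measurable_fun [set: T] (fun x => g x `^ q x).
Proof.
move=> q1 g0 mq mg.
rewrite (_ : (fun _ => _) = (fun x => if g x == +oo then +oo else
    if g x == 0 then 0 else (expR (q x * ln (fine (g x))))%:E)); last first.
  apply/funext => x; have := g0 x; have := q1 x.
  case: (g x) => [r||//] qx r0; last by rewrite eqxx poweRyr// gt_eqF ?(lt_trans _ qx).
  rewrite /= eqe /powR; case: eqP => [_|//].
  by rewrite gt_eqF ?(lt_trans _ qx).
apply: measurable_fun_ifT => //.
  by apply: measurable_fun_eqe => //.
apply: measurable_fun_ifT => //.
  by apply: measurable_fun_eqe => //.
apply/measurable_EFinP; apply: (measurableT_comp (@measurable_expR R)).
apply: measurable_funM => //; apply: (measurableT_comp (@measurable_ln R)).
exact: (measurableT_comp _ mg).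
Qed.

Lemma poweR_convex (t r : R) (a b : \bar R) : (0 < t < 1)%R -> (1 < r)%R ->
  0 <= a -> 0 <= b ->
  (t%:E * a + (1 - t)%:E * b) `^ r <= t%:E * a `^ r + (1 - t)%:E * b `^ r.
Proof.
move=> /andP[t0 t1] r1.
have r0 : (0 < r)%R by rewrite (lt_trans _ r1).
have s0 : (0 < 1 - t)%R by rewrite subr_gt0.
move=> a0 b0.
have [->|ay] := eqVneq a +oo.
  rewrite [X in _ <= _ * X + _]poweRyr ?gt_eqF// [X in _ <= X + _]gt0_muley ?lte_fin//.
  rewrite addye ?leey// gt_eqF// (lt_le_trans ltNy0)// mule_ge0 ?poweR_ge0//.
  by rewrite lee_fin ltW.
have [->|by_] := eqVneq b +oo.
  rewrite [X in _ <= _ + _ * X]poweRyr ?gt_eqF// [X in _ <= _ + X]gt0_muley ?lte_fin//.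
  rewrite addey ?leey// gt_eqF// (lt_le_trans ltNy0)// mule_ge0 ?poweR_ge0//.
  by rewrite lee_fin ltW.
case: a ay a0 => [a _|//|//]; case: b by_ b0 => [b _|//|//].
rewrite !lee_fin => b0 a0.
have t01 : (0 <= t <= 1)%R by rewrite !ltW.
have := @convex_powR R r (ltW r1) (Itv01 (ltW t0) (ltW t1)) a b.
by rewrite !inE /= !in_itv /= !andbT => /(_ a0 b0).
Qed.

Lemma lux_ge0 q g : 0 <= luxemburg q g.
Proof. by rewrite unlock; apply/ereal_infP => _ [l [l0 _] <-]; rewrite lee_fin ltW. Qed.

Lemma lux_le q g l : (0 < l)%R -> modular q (fun x => l^-1%:E * g x) <= 1 ->
  luxemburg q g <= l%:E.
Proof. by move=> l0 m1; rewrite unlock; apply: ereal_inf_lbound; exists l. Qed.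

Lemma lux_lt q g (u : \bar R) : luxemburg q g < u ->
  exists l, [/\ (0 < l)%R, modular q (fun x => l^-1%:E * g x) <= 1 & l%:E < u].
Proof. by rewrite unlock => /ereal_inf_lt[_ [l [l0 m1] <-] lu]; exists l. Qed.

Lemma lux_triangle q g h k : (forall x, 1 < q x)%R ->
  measurable_fun [set: T] q -> measurable_fun [set: T] g ->
  measurable_fun [set: T] h -> measurable_fun [set: T] k ->
  (forall x, 0 <= g x) -> (forall x, 0 <= h x) -> (forall x, 0 <= k x) ->
  (forall x, k x <= g x + h x) ->
  luxemburg q k <= luxemburg q g + luxemburg q h.
Proof.
move=> q1 mq mg mh mk g0 h0 k0 kgh.
have mZ c f : measurable_fun [set: T] f ->
    measurable_fun [set: T] (fun x => c%:E * f x).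
  by move=> mf; apply: emeasurable_funM.
have mod_abs c f : (0 < c)%R -> (forall x, 0 <= f x) ->
    modular q (fun x => c%:E * f x) = \int[mu]_x (c%:E * f x) `^ q x.
  move=> c0 f0; apply: eq_integral => x _.
  by rewrite gee0_abs// mule_ge0// lee_fin ltW.
have [gy|] := eqVneq (luxemburg q g) +oo.
  by rewrite gy addye ?leey// gt_eqF// (lt_le_trans _ (lux_ge0 q h)).
rewrite -ltey => gy.
have [hy|] := eqVneq (luxemburg q h) +oo.
  by rewrite hy addey ?leey// gt_eqF// (lt_le_trans _ (lux_ge0 q g)).
rewrite -ltey => hy.
have gfin : luxemburg q g \is a fin_num by rewrite ge0_fin_numE// lux_ge0.
have hfin : luxemburg q h \is a fin_num by rewrite ge0_fin_numE// lux_ge0.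
apply/lee_addgt0Pr => e e0.
have e20 : (0 < e / 2)%R by rewrite divr_gt0.
have [l [l0 lm1 lg]] : exists l, [/\ (0 < l)%R,
    modular q (fun x => l^-1%:E * g x) <= 1 & l%:E < luxemburg q g + (e / 2)%:E].
  by apply: lux_lt; rewrite lteDl.
have [m [m0 mm1 mh']] : exists l, [/\ (0 < l)%R,
    modular q (fun x => l^-1%:E * h x) <= 1 & l%:E < luxemburg q h + (e / 2)%:E].
  by apply: lux_lt; rewrite lteDl.
have lm0 : (0 < l + m)%R by rewrite addr_gt0.
apply: (@le_trans _ _ (l + m)%:E); last first.
  rewrite EFinD [in leRHS](splitr e) EFinD addeACA.
  by apply: leeD; exact: ltW.
apply: lux_le => //.
have il0 : (0 < l^-1)%R by rewrite invr_gt0.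
have im0 : (0 < m^-1)%R by rewrite invr_gt0.
have ilm0 : (0 < (l + m)^-1)%R by rewrite invr_gt0.
rewrite !mod_abs// in lm1 mm1 *.
pose t := (l / (l + m))%R.
have t01 : (0 < t < 1)%R.
  by rewrite /t divr_gt0//= ltr_pdivrMr// mul1r ltrDl.
have t0 : (0 <= t)%R by case/andP: t01 => /ltW.
have s0 : (0 <= 1 - t)%R by case/andP: t01 => _ /ltW; rewrite subr_ge0.
have mgq : measurable_fun [set: T] (fun x => (l^-1%:E * g x) `^ q x).
  apply: measurable_poweR_var => //; last exact: mZ.
  by move=> x; rewrite mule_ge0// lee_fin ltW.
have mhq : measurable_fun [set: T] (fun x => (m^-1%:E * h x) `^ q x).
  apply: measurable_poweR_var => //; last exact: mZ.
  by move=> x; rewrite mule_ge0// lee_fin ltW.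
have mkq : measurable_fun [set: T] (fun x => ((l + m)^-1%:E * k x) `^ q x).
  apply: measurable_poweR_var => //; last exact: mZ.
  by move=> x; rewrite mule_ge0// lee_fin ltW.
apply: (@le_trans _ _ (\int[mu]_x (t%:E * (l^-1%:E * g x) `^ q x +
                                   (1 - t)%:E * (m^-1%:E * h x) `^ q x))).
  apply: ge0_le_integral => //.
  - by move=> x _; exact: poweR_ge0.
  - by apply: emeasurable_funD; exact: mZ.
  - move=> x _; have gl0 : 0 <= l^-1%:E * g x by rewrite mule_ge0// lee_fin ltW.
    have hm0 : 0 <= m^-1%:E * h x by rewrite mule_ge0// lee_fin ltW.
    apply: le_trans (poweR_convex t01 (q1 x) gl0 hm0).
    apply: gt0_ler_poweR => //.
    + by rewrite ltW// (lt_trans _ (q1 x)).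
    + by rewrite in_itv/= leey andbT mule_ge0// lee_fin ltW.
    + by rewrite in_itv/= leey andbT adde_ge0// mule_ge0// lee_fin.
    rewrite !muleA -!EFinM.
    have -> : (t * l^-1 = (l + m)^-1)%R.
      by rewrite /t mulrAC divff ?mul1r// gt_eqF.
    have -> : ((1 - t) * m^-1 = (l + m)^-1)%R.
      rewrite /t -[X in (X - _)%R](@divff _ (l + m)%R) ?gt_eqF// -mulrBl.
      by rewrite addrC addKr mulrAC divff ?mul1r// gt_eqF.
    rewrite -ge0_muleDr//; apply: lee_wpmul2l => //.
    by rewrite lee_fin ltW.
rewrite ge0_integralD//.
- rewrite !ge0_integralZl_EFin//; [|by move=> x _; exact: poweR_ge0..].
  rewrite -[leRHS](_ : t%:E * 1 + (1 - t)%:E * 1 = 1).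
    by apply: leeD; apply: lee_wpmul2l => //; rewrite lee_fin.
  by rewrite !mule1 -EFinD addrC subrK.
- by move=> x _; rewrite mule_ge0// ?lee_fin// poweR_ge0.
- exact: mZ.
- by move=> x _; rewrite mule_ge0// ?lee_fin// poweR_ge0.
- exact: mZ.
Qed.

Lemma lux_scale q g c : (0 < c)%R ->
  luxemburg q (fun x => c%:E * g x) <= c%:E * luxemburg q g.
Proof.
move=> c0; rewrite -lee_pdivrMl//.
rewrite (luxE q g); apply/ereal_infP => _ [l [l0 m1] <-].
rewrite lee_pdivrMl// -EFinM; apply: lux_le; first by rewrite mulr_gt0.
rewrite (_ : (fun x => _) = (fun x => l^-1%:E * g x))//.
apply/funext => x; rewrite muleA -EFinM invfM mulrAC mulVf ?mul1r//.
by rewrite gt_eqF.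
Qed.

Lemma luxZ q g c : (0 < c)%R -> luxemburg q (fun x => c%:E * g x) = c%:E * luxemburg q g.
Proof.
move=> c0; apply/eqP; rewrite eq_le lux_scale//=.
rewrite -lee_pdivlMl//.
have := @lux_scale q (fun x => c%:E * g x) c^-1; rewrite invr_gt0 => /(_ c0).
congr (_ <= _); congr (luxemburg q _); apply/funext => x.
by rewrite muleA -EFinM mulVf ?mul1e// gt_eqF.
Qed.

Lemma lux0 q : (forall x, 0 < q x)%R -> luxemburg q (cst 0) = 0.
Proof.
move=> q0; apply/eqP; rewrite eq_le lux_ge0 andbT.
apply/lee_addgt0Pr => e e0; rewrite add0e; apply: lux_le => //.
rewrite /modular (eq_integral (cst 0)) ?integral0// => x _.
by rewrite /= mulr0 normr0 powR0// gt_eqF.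
Qed.

Lemma ae_eq_lux q g h : (forall x, 1 < q x)%R ->
  measurable_fun [set: T] q -> measurable_fun [set: T] g ->
  measurable_fun [set: T] h -> ae_eq mu setT g h -> luxemburg q g = luxemburg q h.
Proof.
move=> q1 mq mg mh gh.
suff E l : modular q (fun x => l^-1%:E * g x) = modular q (fun x => l^-1%:E * h x).
  rewrite unlock; congr ereal_inf; apply/seteqP.
  by split=> _ [l [l0 m1] <-]; exists l => //; split=> //; rewrite ?E// -E.
have mZ f : measurable_fun [set: T] f ->
    measurable_fun [set: T] (fun x => `|l^-1%:E * f x| `^ q x).
  move=> mf; apply: measurable_poweR_var => //.
  by apply: measurableT_comp => //; apply: emeasurable_funM.
apply: ae_eq_integral => //; [exact: mZ|exact: mZ|].
by apply: filterS gh => x /= /[apply] ->.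
Qed.

Lemma lux_eq0 q g : (forall x, 1 < q x)%R ->
  measurable_fun [set: T] q -> measurable_fun [set: T] g ->
  (forall x, 0 <= g x) -> luxemburg q g = 0 -> ae_eq mu setT g (cst 0).
Proof.
move=> q1 mq mg g0 lg0.
have mgq : measurable_fun [set: T] (fun x => g x `^ q x).
  exact: measurable_poweR_var.
have I0 : \int[mu]_x (g x `^ q x) = 0.
  apply/eqP; rewrite eq_le integral_ge0 ?andbT; last by move=> x _; exact: poweR_ge0.
  apply/lee_addgt0Pr => e e0; rewrite add0e.
  have me0 : (0 < Num.min e 1)%R by rewrite lt_min e0 ltr01.
  have [l [l0 m1]] : exists l, [/\ (0 < l)%R,
      modular q (fun x => l^-1%:E * g x) <= 1 & l%:E < (Num.min e 1)%:E].
    by apply: lux_lt; rewrite lg0 lte_fin.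
  rewrite lte_fin lt_min => /andP[le l1].
  apply: (@le_trans _ _ (l%:E * 1)); last by rewrite mule1 lee_fin ltW.
  apply: (@le_trans _ _ (l%:E * modular q (fun x => l^-1%:E * g x))); last first.
    by rewrite lee_pmul2l.
  have il0 : (0 < l^-1)%R by rewrite invr_gt0.
  have mlg : measurable_fun [set: T] (fun x => `|l^-1%:E * g x| `^ q x).
    apply: measurable_poweR_var => //.
    by apply: measurableT_comp => //; apply: emeasurable_funM.
  rewrite /modular -ge0_integralZl_EFin//; last 2 first.
    by move=> x _; exact: poweR_ge0.
    exact: ltW.
  apply: ge0_le_integral => //.
  - by move=> x _; exact: poweR_ge0.
  - by apply: emeasurable_funM.
  - move=> x _; rewrite gee0_abs ?mule_ge0 ?lee_fin ?(ltW il0)//.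
    rewrite poweRM ?lee_fin ?(ltW il0)// muleA poweR_EFin -EFinM.
    apply: lee_pemull; first exact: poweR_ge0.
    rewrite lee_fin -[leLHS](@mulfV _ l) ?gt_eqF//.
    rewrite ler_pM2l// -[leLHS]powRr1 ?(ltW il0)//.
    by apply: ler_powR; [rewrite invf_ge1// ltW | exact: ltW].
have : \int[mu]_x `|g x `^ q x| = 0.
  by rewrite -[RHS]I0; apply: eq_integral => x _; rewrite gee0_abs// poweR_ge0.
move=> /(ae_eq_integral_abs mu measurableT mgq).
apply: filterS => x /= /[apply] /poweR_eq0_eq0; exact.
Qed.
End Luxemburg.

Section VarLebesgue.
Context d (T : measurableType d) (R : realType).
Variable mu : {measure set T -> \bar R}.
Implicit Types (f g : T -> R[i]) (Om : set T).
Local Notation cabs := (@ComplexField.Normc.normc R).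
Local Notation Re := (@complex.Re R).
Local Notation Im := (@complex.Im R).

(* R[i] carries no sigma-algebra: measurability is that of both parts. *)
Definition cmeasurable f : Prop :=
  measurable_fun [set: T] (Re \o f) /\ measurable_fun [set: T] (Im \o f).

(* extension by 0 outside Om *)
Definition ext0 Om f : T -> R[i] := patch (fun=> 0) Om f.

Definition wabs (w : T -> \bar R) f : T -> \bar R :=
  fun x => ((cabs (f x))%:E * w x)%E.

Record exponent := Exponent {
  exponent_fun :> T -> R;
  measurable_exponent : measurable_fun [set: T] exponent_fun;
  exponent_gt1 : forall x, 1 < exponent_fun x }.

Record weight := Weight {
  weight_fun :> T -> \bar R;
  measurable_weight : measurable_fun [set: T] weight_fun;
  weight_ge0 : forall x, (0 <= weight_fun x)%E;
  weight_ae : {ae mu, forall x, (0 < weight_fun x < +oo)%E} }.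

Lemma ext0D Om f g : ext0 Om (f + g) = ext0 Om f + ext0 Om g.
Proof.
by apply/funext => x; rewrite /ext0 /patch [RHS]/GRing.add/=; case: ifP; rewrite ?addr0.
Qed.

Lemma ext0Z Om (c : R[i]) f : ext0 Om (c *: f) = c *: ext0 Om f.
Proof.
by apply/funext => x; rewrite /ext0 /patch [RHS]/GRing.scale/=; case: ifP; rewrite ?scaler0.
Qed.

Lemma ext00 Om : ext0 Om 0 = 0.
Proof. by apply/funext => x; rewrite /ext0 /patch; case: ifP. Qed.

Lemma cmeasurable0 : cmeasurable 0.
Proof. by split; exact: measurable_cst. Qed.

Lemma cmeasurableD f g : cmeasurable f -> cmeasurable g -> cmeasurable (f + g).
Proof.
move=> [mf1 mf2] [mg1 mg2]; split.
  rewrite (_ : _ \o _ = (Re \o f) \+ (Re \o g)); first exact: measurable_funD.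
  by apply/funext => x; rewrite /= [(f + g) x]/(f x + g x); case: (f x) (g x) => ? ? [].
rewrite (_ : _ \o _ = (Im \o f) \+ (Im \o g)); first exact: measurable_funD.
by apply/funext => x; rewrite /= [(f + g) x]/(f x + g x); case: (f x) (g x) => ? ? [].
Qed.

Lemma cmeasurableZ c f : cmeasurable f -> cmeasurable (c *: f).
Proof.
move=> [mf1 mf2]; split.
  rewrite (_ : _ \o _ = (fun x => Re c * Re (f x) - Im c * Im (f x))).
    by apply: measurable_funB; apply: measurable_funM.
  by apply/funext => x; rewrite /= [(c *: f) x]/(c * f x); case: (f x) c => ? ? [].
rewrite (_ : _ \o _ = (fun x => Re c * Im (f x) + Im c * Re (f x))).
  by apply: measurable_funD; apply: measurable_funM.
by apply/funext => x; rewrite /= [(c *: f) x]/(c * f x); case: (f x) c => ? ? [].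
Qed.

Lemma cabs_ge0 z : 0 <= cabs z.
Proof. by case: z => a b; rewrite sqrtr_ge0. Qed.

Lemma ler_cabsD (y z : R[i]) : cabs (y + z) <= cabs y + cabs z.
Proof.
have := ler_normD y z; rewrite !normc_def -rmorphD/= lecR.
by case: y => a b; case: z => a' b'.
Qed.

Lemma measurable_wabs (w : weight) f : cmeasurable f ->
  measurable_fun [set: T] (wabs w f).
Proof.
move=> [mf1 mf2]; apply: emeasurable_funM; last exact: measurable_weight.
apply/measurable_EFinP.
rewrite (_ : (fun _ => _) = Num.sqrt \o (fun x => Re (f x) ^+ 2 + Im (f x) ^+ 2)).
  apply: (measurableT_comp (continuous_measurable_fun (@sqrt_continuous R))).
  by apply: measurable_funD; apply: measurable_funX.
by apply/funext => x /=; case: (f x).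
Qed.

Lemma wabs_ge0 (w : weight) f x : (0 <= wabs w f x)%E.
Proof. by rewrite mule_ge0// ?weight_ge0// lee_fin cabs_ge0. Qed.

Section Space.
Local Open Scope quotient_scope.
Variables (p : exponent) (w : weight) (Om : set T).

(* A function on Om is a total function whose values outside Om are irrelevant:
   it is measurable on Om iff its extension by 0 is measurable, and the classes
   below are taken modulo equality a.e. on Om. *)
Definition Lpw_norm f : \bar R := luxemburg mu p (wabs w (ext0 Om f)).

Definition Lpw : {pred T -> R[i]} :=
  mem [set f | cmeasurable (ext0 Om f) /\ (Lpw_norm f < +oo)%E].

Lemma LpwP f : f \in Lpw <-> cmeasurable (ext0 Om f) /\ (Lpw_norm f < +oo)%E.
Proof. by split; rewrite inE. Qed.

Lemma Lpw_normD f g : cmeasurable (ext0 Om f) -> cmeasurable (ext0 Om g) ->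
  (Lpw_norm (f + g)%R <= Lpw_norm f + Lpw_norm g)%E.
Proof.
move=> mf mg; apply: lux_triangle; rewrite ?ext0D.
- exact: exponent_gt1.
- exact: measurable_exponent.
- exact: measurable_wabs.
- exact: measurable_wabs.
- by apply: measurable_wabs; exact: cmeasurableD.
- exact: wabs_ge0.
- exact: wabs_ge0.
- exact: wabs_ge0.
move=> x; rewrite /wabs -ge0_muleDl ?lee_fin ?cabs_ge0//.
apply: lee_wpmul2r; first exact: weight_ge0.
by rewrite -EFinD lee_fin; exact: ler_cabsD.
Qed.

Lemma exponent_gt0 x : 0 < p x.
Proof. by rewrite (lt_trans _ (exponent_gt1 p x)). Qed.

Lemma Lpw_norm0 : Lpw_norm 0 = 0%E.
Proof.
rewrite /Lpw_norm ext00 -[RHS](@lux0 _ _ _ mu p exponent_gt0); congr luxemburg.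
by apply/funext => x; rewrite /wabs ComplexField.Normc.normc0 mul0e.
Qed.

Lemma Lpw_normZ c f : Lpw_norm (c *: f) = ((cabs c)%:E * Lpw_norm f)%E.
Proof.
have [->|c0] := eqVneq c 0.
  by rewrite scale0r Lpw_norm0 ComplexField.Normc.normc0 mul0e.
rewrite /Lpw_norm -luxZ; last first.
  rewrite lt_neqAle cabs_ge0 andbT eq_sym; apply: contra c0 => /eqP.
  by move=> /ComplexField.Normc.eq0_normc ->.
congr luxemburg; apply/funext => x; rewrite ext0Z /wabs.
rewrite (_ : (c *: ext0 Om f) x = c * ext0 Om f x)//.
by rewrite ComplexField.Normc.normcM EFinM muleA.
Qed.

Lemma Lpw_submod_closed : submod_closed Lpw.
Proof.
split; first by apply/LpwP; rewrite Lpw_norm0 ext00; split => //; exact: cmeasurable0.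
move=> c f g /LpwP[mf nf] /LpwP[mg ng]; apply/LpwP.
have mcf : cmeasurable (ext0 Om (c *: f)) by rewrite ext0Z; exact: cmeasurableZ.
split; first by rewrite ext0D; exact: cmeasurableD.
apply: le_lt_trans (Lpw_normD mcf mg) _.
apply: lte_add_pinfty; last exact: ng.
rewrite Lpw_normZ; apply: lte_mul_pinfty; [|by []|exact: nf].
by rewrite lee_fin cabs_ge0.
Qed.

HB.instance Definition _ := GRing.isSubmodClosed.Build _ _ Lpw Lpw_submod_closed.

Record LpwFun := MkLpwFun { Lpw_val :> T -> R[i]; Lpw_valP : Lpw_val \in Lpw }.
HB.instance Definition _ := [isSub for Lpw_val].
HB.instance Definition _ := [Choice of LpwFun by <:].
HB.instance Definition _ := [SubChoice_isSubLmodule of LpwFun by <:].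

Definition Lpw_null : {pred LpwFun} :=
  mem [set f : LpwFun | {ae mu, forall x, Om x -> f x = 0}].

Lemma Lpw_nullP (f : LpwFun) :
  f \in Lpw_null <-> {ae mu, forall x, Om x -> f x = 0}.
Proof. by split; rewrite inE. Qed.

Lemma Lpw_null_zmod_closed : zmod_closed Lpw_null.
Proof.
split; first by apply/Lpw_nullP; exact: nearW.
move=> f g /Lpw_nullP f0 /Lpw_nullP g0; apply/Lpw_nullP.
apply: filterS2 f0 g0 => x /= f0 g0 Ox.
by transitivity (f x - g x) => //; rewrite f0// g0// subr0.
Qed.

HB.instance Definition _ := GRing.isZmodClosed.Build _ Lpw_null Lpw_null_zmod_closed.

(* L^p(Om, w): a complex vector space with a real-valued norm. It is not made a
   normedModType R[i], as the norm of such a type takes its values in R[i]. *)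
Definition LpwSpace := Quotient.quot Lpw_null.
HB.instance Definition _ := Choice.on LpwSpace.
HB.instance Definition _ := EqQuotient.on LpwSpace.
HB.instance Definition _ := GRing.Zmodule.on LpwSpace.
HB.instance Definition _ := ZmodQuotient.on LpwSpace.

Definition Lpw_repr (x : LpwSpace) : T -> R[i] := Lpw_val (repr x).
Coercion Lpw_repr : LpwSpace >-> Funclass.

Definition Lpw_class (f : LpwFun) : LpwSpace := \pi_LpwSpace f.

Lemma Lpw_classP (f g : LpwFun) : Lpw_class f = Lpw_class g <->
  {ae mu, forall x, Om x -> f x = g x}.
Proof.
split=> [/eqP|fg].
  rewrite /Lpw_class -[_ == _]/(f == g %[mod LpwSpace]).
  rewrite -Quotient.idealrBE => /Lpw_nullP; apply: filterS => x /= + Ox => /(_ Ox) fg0.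
  by apply/eqP; rewrite -subr_eq0; apply/eqP.
apply/eqP; rewrite /Lpw_class -[_ == _]/(f == g %[mod LpwSpace]).
rewrite -Quotient.idealrBE; apply/Lpw_nullP; apply: filterS fg => x /= /[apply] fgx.
by transitivity (f x - g x) => //; rewrite fgx subrr.
Qed.

Lemma Lpw_classK (x : LpwSpace) : Lpw_class (repr x) = x.
Proof. exact: reprK. Qed.

Lemma Lpw_reprK (f : LpwFun) : {ae mu, forall x, Om x -> Lpw_class f x = f x}.
Proof. by apply/Lpw_classP; rewrite Lpw_classK. Qed.

Lemma ae_eq_Lpw_norm (f g : LpwFun) : {ae mu, forall x, Om x -> f x = g x} ->
  Lpw_norm f = Lpw_norm g.
Proof.
move=> fg; have /LpwP[mf _] := Lpw_valP f; have /LpwP[mg _] := Lpw_valP g.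
apply: ae_eq_lux.
- exact: exponent_gt1.
- exact: measurable_exponent.
- exact: measurable_wabs.
- exact: measurable_wabs.
apply: filterS fg => x fgx _; rewrite /wabs /ext0 /patch.
by case: ifPn => // /set_mem Ox; rewrite fgx.
Qed.

Definition Lpw_fnorm (x : LpwSpace) : R := fine (Lpw_norm x).

Lemma Lpw_norm_fin (f : LpwFun) : Lpw_norm f \is a fin_num.
Proof.
have /LpwP[_ nf] := Lpw_valP f.
by rewrite ge0_fin_numE; [exact: nf | exact: lux_ge0].
Qed.

Lemma Lpw_fnorm_class (f : LpwFun) : Lpw_fnorm (Lpw_class f) = fine (Lpw_norm f).
Proof. by congr fine; apply: ae_eq_Lpw_norm; exact: Lpw_reprK. Qed.

Lemma Lpw_classD (f g : LpwFun) : Lpw_class (f + g) = Lpw_class f + Lpw_class g.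
Proof. exact: raddfD. Qed.

Lemma Lpw_fnormD (x y : LpwSpace) : Lpw_fnorm (x + y) <= Lpw_fnorm x + Lpw_fnorm y.
Proof.
rewrite -(Lpw_classK x) -(Lpw_classK y) -Lpw_classD !Lpw_fnorm_class.
set f := repr x; set g := repr y.
rewrite -fineD; [|exact: Lpw_norm_fin|exact: Lpw_norm_fin].
apply: fine_le; [exact: Lpw_norm_fin| |].
  by rewrite fin_numD; apply/andP; split; exact: Lpw_norm_fin.
have /LpwP[mf _] := Lpw_valP f; have /LpwP[mg _] := Lpw_valP g.
exact: Lpw_normD.
Qed.

Lemma Lpw_fnorm_eq0 (x : LpwSpace) : Lpw_fnorm x = 0 -> x = 0.
Proof.
rewrite -(Lpw_classK x) Lpw_fnorm_class; set f := repr x => f0.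
have {}f0 : Lpw_norm f = 0%E by rewrite -[LHS]fineK ?f0//; exact: Lpw_norm_fin.
have /LpwP[mf _] := Lpw_valP f.
have := lux_eq0 (exponent_gt1 p) (measurable_exponent p) (measurable_wabs w mf)
  (wabs_ge0 w _) f0.
move=> wf0; rewrite -[RHS](raddf0 (\pi_LpwSpace)); apply/Lpw_classP.
apply: filterS2 wf0 (weight_ae w) => t /= /(_ I) + /andP[w0 _] Ot.
rewrite /wabs /ext0 /patch mem_set// => /eqP.
rewrite mule_eq0 (gt_eqF w0) orbF eqe => /eqP.
exact: ComplexField.Normc.eq0_normc.
Qed.

Definition Lpw_scale (c : R[i]) (x : LpwSpace) : LpwSpace := Lpw_class (c *: repr x).

Lemma Lpw_classZ c (f : LpwFun) : Lpw_class (c *: f) = Lpw_scale c (Lpw_class f).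
Proof.
apply/Lpw_classP; apply: filterS (Lpw_reprK f) => x /= /[apply] fx.
by transitivity (c * f x) => //; rewrite -fx.
Qed.

Lemma Lpw_scaleA a b x : Lpw_scale a (Lpw_scale b x) = Lpw_scale (a * b) x.
Proof. by rewrite -(Lpw_classK x) -!Lpw_classZ scalerA. Qed.

Lemma Lpw_scale1 : left_id 1 Lpw_scale.
Proof. by move=> x; rewrite -(Lpw_classK x) -!Lpw_classZ scale1r. Qed.

Lemma Lpw_scaleDr : right_distributive Lpw_scale +%R.
Proof.
move=> c x y; rewrite -(Lpw_classK x) -(Lpw_classK y).
by rewrite -!Lpw_classZ -!Lpw_classD -Lpw_classZ scalerDr.
Qed.

Lemma Lpw_scaleDl x : {morph Lpw_scale^~ x : a b / a + b}.
Proof.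
by move=> a b; rewrite -(Lpw_classK x) -!Lpw_classZ -Lpw_classD scalerDl.
Qed.

HB.instance Definition _ := GRing.Zmodule_isLmodule.Build R[i] LpwSpace
  Lpw_scaleA Lpw_scale1 Lpw_scaleDr Lpw_scaleDl.

Lemma Lpw_fnormZ c (x : LpwSpace) : Lpw_fnorm (c *: x) = cabs c * Lpw_fnorm x.
Proof.
rewrite -(Lpw_classK x) -[_ *: _]Lpw_classZ !Lpw_fnorm_class.
rewrite -[X in fine X]/(Lpw_norm (c *: (repr x : T -> R[i]))) Lpw_normZ.
by rewrite fineM//; exact: Lpw_norm_fin.
Qed.

Lemma cabs_nat k : cabs k%:R = k%:R.
Proof.
rewrite -[k%:R in LHS]/((k%:R : R[i])) -(rmorph_nat (real_complex R) k)/=.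
by rewrite expr0n addr0 sqrtr_sqr normr_nat.
Qed.

Lemma Lpw_fnormMn (x : LpwSpace) k : Lpw_fnorm (x *+ k) = Lpw_fnorm x *+ k.
Proof. by rewrite -scaler_nat Lpw_fnormZ cabs_nat mulr_natl. Qed.

Lemma Lpw_fnormN (x : LpwSpace) : Lpw_fnorm (- x) = Lpw_fnorm x.
Proof.
rewrite -scaleN1r Lpw_fnormZ (_ : cabs (-1) = 1) ?mul1r//.
by rewrite /= oppr0 sqrrN expr1n expr0n addr0 sqrtr1.
Qed.

HB.instance Definition _ := Num.Zmodule_isNormed.Build R LpwSpace
  Lpw_fnormD Lpw_fnorm_eq0 Lpw_fnormMn Lpw_fnormN.
HB.instance Definition _ := PseudoMetric.copy LpwSpace (pseudoMetric_normed LpwSpace).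
HB.instance Definition _ := isPointed.Build LpwSpace 0.
HB.instance Definition _ := NormedZmod_PseudoMetric_eq.Build R LpwSpace erefl.

End Space.
End VarLebesgue.

Section EuclideanFourier.
Context (R : realType) (n : nat).
Local Notation V := 'rV[R]_n.
Local Notation C := R[i].
Local Notation Re := (@complex.Re R).
Local Notation Im := (@complex.Im R).
Local Notation cabs := (@ComplexField.Normc.normc R).
Local Notation mu := (@leb R n).
Implicit Types (x xi c : V) (u f g a : V -> C).

Definition dotv x xi : R := \sum_i x ord0 i * xi ord0 i.

Definition eball c (r : R) : set V := [set x | Num.sqrt (dotv (x - c) (x - c)) < r].

Definition open_cone (K : set V) : Prop :=
  open K /\ forall x (al : R), K x -> 0 < al -> K (al *: x).

Definition cis (t : R) : C := (cos t +i* sin t)%C.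

Definition cintegral f : C :=
  (\int[mu]_x (Re (f x)) +i* \int[mu]_x (Im (f x)))%C.

(* pderiv [:: i1; ...; ik] h is the partial derivative d_i1 ... d_ik h *)
Definition pderiv (s : seq 'I_n) (h : V -> R) : V -> R :=
  foldr (fun i k => fun x => 'D_(delta_mx ord0 i) (k : V -> R^o) x) h s.

Definition schwartz_real (h : V -> R) : Prop :=
  (forall s x, differentiable (pderiv s h : V -> R^o) x) /\
  (forall (s : seq 'I_n) (al : 'I_n -> nat), exists M : R, forall x,
     `|(\prod_i x ord0 i ^+ al i) * pderiv s h x| <= M).

Definition schwartz u : Prop :=
  schwartz_real (Re \o u) /\ schwartz_real (Im \o u).

Definition fourier_schwartz u : V -> C :=
  fun xi => cintegral (fun x => u x * cis (- dotv x xi)).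

Definition L2_norm f : \bar R :=
  ('N[mu]_2%:E[EFin \o (cabs \o f)])%E.

Definition L2 f : Prop := cmeasurable (f : Rn R n -> C) /\ (L2_norm f < +oo)%E.

Definition Linfty_norm f : \bar R :=
  ('N[mu]_+oo[EFin \o (cabs \o f)])%E.

Definition Linfty f : Prop :=
  cmeasurable (f : Rn R n -> C) /\ (Linfty_norm f < +oo)%E.

(* g is the value at f of the extension by continuity to L^2 of the Fourier
   transform of Schwartz functions *)
Definition is_fourier f g : Prop := L2 g /\
  exists u_ : nat -> V -> C, [/\ forall k, schwartz (u_ k),
    L2_norm (u_ k - f) @[k --> \oo] --> 0%E &
    L2_norm (fourier_schwartz (u_ k) - g) @[k --> \oo] --> 0%E].

Definition fourier f : V -> C := xget 0 [set g | is_fourier f g].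

(* the inverse of fourier on L^2, the values being taken modulo a.e. equality *)
Definition inv_fourier g : V -> C :=
  xget 0 [set f | L2 f /\ {ae mu, forall xi, fourier f xi = g xi}].

(* F^-1 a F u *)
Definition fourier_mult a u : V -> C := inv_fourier (fun xi => a xi * fourier u xi).

(* On the null set where w is 0 or +oo, the conventions 0 * +oo = 0, 0^-1 = +oo
   and +oo^-1 = 0 of \bar R apply; they do not affect the norms. *)
Definition muckenhoupt (p p' : V -> R) (w : V -> \bar R) : Prop :=
  (ereal_sup [set ((mu (eball c r))^-1 *
       luxemburg mu p (fun x => w x * (\1_(eball c r) x)%:E) *
       luxemburg mu p' (fun x => (w x)^-1 * (\1_(eball c r) x)%:E))%E
     | c in [set: V] & r in [set r : R | (0 < r)%R]] < +oo)%E.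

End EuclideanFourier.

Section Operators.
Local Open Scope ereal_scope.
Context (R : realType) (X : pseudoMetricNormedZmodType R).
Implicit Types (T : X -> X) (G : set X).

Definition unit_ball : set X := [set x | (`|x| <= 1)%R].

Definition op_norm T : \bar R := ereal_sup [set (`|T x|)%:E | x in unit_ball].

Definition diam G : \bar R := ereal_sup [set `|x - y|%:E | x in G & y in G].

(* Kuratowski measure of noncompactness *)
Definition kuratowski G : \bar R := ereal_inf [set r%:E | r in
  [set r : R | (0 <= r)%R /\ exists m (S : 'I_m -> set X),
     G `<=` \bigcup_i S i /\ forall i, diam (S i) <= r%:E]].

Definition op_kappa T : \bar R := 2^-1%:E * kuratowski (T @` unit_ball).

End Operators.

Section WienerHopf.
Context (R : realType) (n : nat).
Variables (p : exponent (Rn R n) R) (w : weight (@leb R n)).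
Implicit Types (a : 'rV[R]_n -> R[i]).

Definition multiplier a : Prop := Linfty a /\
  (ereal_sup [set Lpw_norm p w setT (fourier_mult a u) / (`|u|)%:E
     | u in [set u : LpwSpace p w setT | L2 u /\ (u != 0)%R]] < +oo)%E.

Section OnDomain.
Variable Om : set (Rn R n).
Local Notation X := (LpwSpace p w Om).

Definition bounded_linear (T : X -> X) : Prop :=
  linear T /\ exists M : R, forall x, `|T x| <= M * `|x|.

Definition compact_linear (T : X -> X) : Prop :=
  bounded_linear T /\ precompact (T @` unit_ball (X := X)).

(* The bounded linear operator given by r_Om F^-1 a F e_Om on the classes of
   L^2(Om) in X(Om); functions on Om are total functions considered on Om only,
   so that r_Om is the identity. *)
Definition wiener_hopf a : X -> X :=
  xget (fun=> 0) [set T : X -> X | bounded_linear T /\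
    forall x : X, L2 (ext0 Om x) ->
      {ae @leb R n, forall t, Om t -> T x t = fourier_mult a (ext0 Om x) t}].

End OnDomain.
End WienerHopf.
Arguments wiener_hopf {R n} p w Om a _.

(* Main.v *)
Require Import Defs.
From HB Require Import structures.
From mathcomp Require Import all_boot all_order all_algebra.
From mathcomp Require Import all_classical all_reals all_analysis.
From mathcomp Require Import measurable_realfun ess_sup_inf complex.
From mathcomp Require Import ring lra.
Set Implicit Arguments.
Unset Strict Implicit.
Unset Printing Implicit Defensive.
Import Order.TTheory GRing.Theory Num.Theory.
Import numFieldNormedType.Exports.
Local Open Scope classical_set_scope.
Local Open Scope ring_scope.
Local Notation cabs := (@ComplexField.Normc.normc _).
Local Notation Re := (@complex.Re _).
Local Notation Im := (@complex.Im _).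

(* Let z be an essential value of a with |z| close to the norm of a. A modulated
   Gaussian whose Fourier transform concentrates near a density point of {a ~ z}
   satisfies F^-1 a F u = z u up to a sup-norm error which does not depend on
   the centre of u. The Muckenhoupt condition makes the weighted norm of
   indicators of cubes doubling, so that such errors and the Gaussian tails are
   small relative to the norm of u, uniformly in the centre. A cone contains
   infinitely many disjoint cubes of any given size; the Gaussians truncated to
   such cubes and normalized have images of norm at least |z| - e. Two of these
   images differ by at least |z| - e: compare them on the cube of smaller norm,
   where the image of the packet of the other cube is negligible. Hence the
   bounds on the norm, on the measure of noncompactness, and on compactness. *)

(** On the cube of half-side 2^J s to which a packet is truncated, the sup-norm error e weighs up to
    e D^J times the norm of the indicator of the core cube of half-side s, D being the doubling
    constant. So e has to be chosen after J, while s depends on e. There is no circle because the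
    tail estimate is scale invariant: J depends only on the tolerance and on D, for all centres,
    frequencies and widths. In the estimates the bound of the multiplier on the weighted space acts
    only on the discarded tails; the rest of each image is controlled pointwise, through the L^1
    norm of (a - z) F u. The centre of u only changes the phase of F u, so this control is the same
    for all centres. Fourier theory on L^2 rests on finite combinations of modulated Gaussians:
    their transforms, inversion and Parseval's identity are explicit, and as they are dense, pairing
    with them characterizes the transform of every square integrable function. The density point is
    replaced by a dyadic cell almost filled by {a ~ z}; dyadic step functions being dense in L^2,
    such a cell exists without a differentiation theorem. *)

Lemma ge0_integral_transfer d d' (T : measurableType d) (T' : measurableType d')
    (R : realType) (m : {measure set T -> \bar R}) (m' : {measure set T' -> \bar R})
    (phi : T -> T') : measurable_fun setT phi ->
  (forall A, measurable A -> m (phi @^-1` A) = m' A) ->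
  forall f : T' -> \bar R, measurable_fun setT f -> (forall x, 0 <= f x)%E ->
  (\int[m']_x f x = \int[m]_x f (phi x))%E.
Proof.
move=> mphi mm' f mf f0.
transitivity (\int[pushforward m phi]_x f x)%E.
  by apply: eq_measure_integral => A mA _; symmetry; exact: mm'.
by rewrite ge0_integral_pushforward.
Qed.

(** * Lebesgue measure on R^n: sigma-finiteness and Borel sets *)

Section LebesgueRn.
Context (R : realType).
Local Notation lam := (@lebesgue_measure R).

Section Fixed.
Context (n : nat).
Local Notation mu := (@leb R n).

Lemma borel_lebesgue_sigma_finite : sigma_finite setT (@borel_lebesgue R n).
Proof.
have [F FT Foo] := sigma_finiteT (lebesgue_tuple R n).
exists (fun k => rV_tuple (n:=n) @^-1` F k) => [|k].
  by rewrite -preimage_bigcup -FT preimage_setT.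
have [mF Fy] := Foo k; split.
  by rewrite -[X in measurable X]setTI; exists (F k) => //.
rewrite /borel_lebesgue /pushforward -comp_preimage (_ : _ \o _ = id).
  by rewrite preimage_id.
by apply/funext => t; exact: tuple_rVK.
Qed.

Lemma leb_sigma_finite : sigma_finite [set: Rn R n] mu.
Proof. exact/completed_measure_extension_sigma_finite/borel_lebesgue_sigma_finite. Qed.

(** [leb] is declared as a measure only; this copy carries the sigma-finite structure that product
    measures and Fubini require. *)
Definition lebs : set (Rn R n) -> \bar R := mu.
HB.instance Definition _ := Measure.copy lebs mu.
HB.instance Definition _ := Measure_isSigmaFinite.Build _ _ _ lebs leb_sigma_finite.

Lemma measurable_borel (A : set (borel_rV R n)) :
  measurable A -> measurable (A : set (Rn R n)).
Proof. by move=> mA; exact: caratheodory_measurable_mu_ext. Qed.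

Lemma leb_borel (A : set (borel_rV R n)) : measurable A ->
  mu A = borel_lebesgue A.
Proof. by move=> mA; rewrite /leb /= /completed_measure_extension measurable_mu_extE. Qed.

Lemma measurable_fun_borel d (T : measurableType d) (f : borel_rV R n -> T) :
  measurable_fun setT f -> measurable_fun [set: Rn R n] f.
Proof. by move=> mf _ B mB; apply: measurable_borel; exact: mf. Qed.

Lemma borel_coord i : measurable_fun [set: borel_rV R n] (fun x => x ord0 i).
Proof.
move=> _ B mB; rewrite setTI.
exists ((fun t => tnth t i) @^-1` B).
  by rewrite -[X in measurable X]setTI; exact: measurable_tnth.
by rewrite setTI; apply/seteqP; split=> x /=; rewrite tnth_mktuple.
Qed.

Lemma measurable_coord i : measurable_fun [set: Rn R n] (fun x => x ord0 i).
Proof. by apply: measurable_fun_borel; exact: borel_coord. Qed.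

End Fixed.
End LebesgueRn.

(** * Complex integrals and square integrable functions *)

Section ComplexNumbers.
Context (R : realType).
Implicit Types (x y z : R[i]) (r : R).

Lemma ReD x y : Re (x + y) = Re x + Re y. Proof. by case: x; case: y. Qed.
Lemma ImD x y : Im (x + y) = Im x + Im y. Proof. by case: x; case: y. Qed.
Lemma ReN x : Re (- x) = - Re x. Proof. by case: x. Qed.
Lemma ImN x : Im (- x) = - Im x. Proof. by case: x. Qed.
Lemma ReM x y : Re (x * y) = Re x * Re y - Im x * Im y.
Proof. by case: x; case: y. Qed.
Lemma ImM x y : Im (x * y) = Re x * Im y + Im x * Re y.
Proof. by case: x; case: y. Qed.
Lemma cext x y : Re x = Re y -> Im x = Im y -> x = y.
Proof. by case: x => a b; case: y => c d /= -> ->. Qed.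

Lemma cabsM x y : cabs (x * y) = cabs x * cabs y.
Proof. exact: ComplexField.Normc.normcM. Qed.
Lemma cabs0 : cabs (0 : R[i]) = 0. Proof. exact: ComplexField.Normc.normc0. Qed.
Lemma cabs1 : cabs (1 : R[i]) = 1. Proof. exact: ComplexField.Normc.normc1. Qed.
Lemma cabs_eq0 x : cabs x = 0 -> x = 0.
Proof. exact: ComplexField.Normc.eq0_normc. Qed.
Lemma cabsN x : cabs (- x) = cabs x.
Proof. by case: x => a b /=; rewrite !sqrrN. Qed.
Lemma cabsB x y : cabs (x - y) = cabs (y - x).
Proof. by rewrite -cabsN opprB. Qed.
Lemma cabsC x : cabs (conjc x) = cabs x.
Proof. by case: x => a b /=; rewrite sqrrN. Qed.
Lemma conjcM x y : conjc (x * y) = conjc x * conjc y. Proof. exact: rmorphM. Qed.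
Lemma conjcD x y : conjc (x + y) = conjc x + conjc y. Proof. exact: rmorphD. Qed.
Lemma conjc_prod (I : Type) (s : seq I) (F : I -> R[i]) :
  conjc (\prod_(i <- s) F i) = \prod_(i <- s) conjc (F i).
Proof. exact: rmorph_prod. Qed.
Lemma cabsr r : cabs (r%:C%C) = `|r|.
Proof. by rewrite /= expr0n/= addr0 sqrtr_sqr. Qed.
Lemma sqr_cabs x : cabs x ^+ 2 = Re x ^+ 2 + Im x ^+ 2.
Proof. by case: x => a b /=; rewrite sqr_sqrtr// addr_ge0// sqr_ge0. Qed.
Lemma ler_Re_cabs x : `|Re x| <= cabs x.
Proof.
case: x => a b /=; rewrite -[leLHS]sqrtr_sqr ler_wsqrtr//.
by rewrite lerDl sqr_ge0.
Qed.
Lemma ler_Im_cabs x : `|Im x| <= cabs x.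
Proof.
case: x => a b /=; rewrite -[leLHS]sqrtr_sqr ler_wsqrtr//.
by rewrite lerDr sqr_ge0.
Qed.
Lemma ler_cabs_ReIm x : cabs x <= `|Re x| + `|Im x|.
Proof.
rewrite -ler_sqr ?nnegrE ?cabs_ge0 ?addr_ge0//.
rewrite sqr_cabs sqrrD !real_normK ?num_real// lerD2r lerDl.
by rewrite mulrn_wge0// mulr_ge0.
Qed.
Lemma ler_cabsB x y : cabs (x - y) <= cabs x + cabs y.
Proof. by rewrite -(cabsN y) ler_cabsD. Qed.
Lemma ler_cabs_sub x y : cabs x - cabs y <= cabs (x - y).
Proof. by rewrite lerBlDr -{1}(subrK y x) ler_cabsD. Qed.
Lemma cabs_prod (I : Type) (s : seq I) (P : pred I) (F : I -> R[i]) :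
  cabs (\prod_(i <- s | P i) F i) = \prod_(i <- s | P i) cabs (F i).
Proof.
by rewrite (big_morph (fun z => cabs z) cabsM cabs1).
Qed.
Lemma cisD (s t : R) : cis (s + t) = cis s * cis t.
Proof. by apply: cext; rewrite /= ?cosD ?sinD// addrC. Qed.
Lemma cis0 : cis (0 : R) = 1.
Proof. by rewrite /cis cos0 sin0. Qed.
Lemma cisN (t : R) : cis (- t) = conjc (cis t).
Proof. by rewrite /cis /= cosN sinN. Qed.
Lemma cabs_cis (t : R) : cabs (cis t) = 1.
Proof. by rewrite /= cos2Dsin2 sqrtr1. Qed.
Lemma cis_sum (I : Type) (s : seq I) (F : I -> R) :
  cis (\sum_(i <- s) F i) = \prod_(i <- s) cis (F i).
Proof. exact: (big_morph _ cisD cis0). Qed.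
End ComplexNumbers.

Lemma ae_eq_integrable d (T : measurableType d) (R : realType)
    (mu : {measure set T -> \bar R}) (f g : T -> \bar R) :
  measurable_fun setT g -> ae_eq mu setT f g -> mu.-integrable setT f ->
  mu.-integrable setT g.
Proof.
move=> mg fg /integrableP[mf fi]; apply/integrableP; split=> //.
rewrite (_ : integral _ _ _ = \int[mu]_x `|f x|)%E//.
apply: ae_eq_integral => //; [exact: measurableT_comp|exact: measurableT_comp|].
by apply: filterS fg => x /= /[apply] ->.
Qed.

Section ComplexIntegral.
Context d (T : measurableType d) (R : realType).
Variable mu : {measure set T -> \bar R}.
Implicit Types (f g h : T -> R[i]) (c : R[i]).

Definition cint f : R[i] := (\int[mu]_x Re (f x) +i* \int[mu]_x Im (f x))%C.

Definition cintegrable f : Prop :=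
  mu.-integrable setT (fun x => (Re (f x))%:E) /\
  mu.-integrable setT (fun x => (Im (f x))%:E).

Lemma cmeasurable_cabs f : cmeasurable f -> measurable_fun setT (fun x => cabs (f x)).
Proof.
move=> [mf1 mf2].
rewrite (_ : (fun _ => _) = Num.sqrt \o (fun x => Re (f x) ^+ 2 + Im (f x) ^+ 2)).
  apply: (measurableT_comp (continuous_measurable_fun (@sqrt_continuous R))).
  by apply: measurable_funD; apply: measurable_funX.
by apply/funext => x /=; case: (f x).
Qed.

Lemma cmeasurable_fun f (a b : T -> R) : measurable_fun setT a ->
  measurable_fun setT b -> (forall x, f x = (a x +i* b x)%C) -> cmeasurable f.
Proof.
move=> ma mb E; split.
  by rewrite (_ : _ \o _ = a)//; apply/funext => x /=; rewrite E.
by rewrite (_ : _ \o _ = b)//; apply/funext => x /=; rewrite E.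
Qed.

Lemma cmeasurable_cst c : cmeasurable (fun _ : T => c).
Proof. by split; exact: measurable_cst. Qed.

Lemma cmeasurable_real (a : T -> R) : measurable_fun setT a ->
  cmeasurable (fun x => (a x)%:C%C).
Proof. by move=> ma; apply: (@cmeasurable_fun _ a (fun=> 0)). Qed.

Lemma cmeasurable_add f g : cmeasurable f -> cmeasurable g ->
  cmeasurable (fun x => f x + g x).
Proof. exact: cmeasurableD. Qed.

Lemma cmeasurable_opp f : cmeasurable f -> cmeasurable (fun x => - f x).
Proof.
move=> [m1 m2]; split.
  by rewrite (_ : _ \o _ = \- (Re \o f)); [exact: measurableT_comp|apply/funext => x; exact: ReN].
by rewrite (_ : _ \o _ = \- (Im \o f)); [exact: measurableT_comp|apply/funext => x; exact: ImN].
Qed.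

Lemma cmeasurable_sub f g : cmeasurable f -> cmeasurable g ->
  cmeasurable (fun x => f x - g x).
Proof. by move=> mf mg; apply: cmeasurable_add => //; exact: cmeasurable_opp. Qed.

Lemma cmeasurable_mul f g : cmeasurable f -> cmeasurable g ->
  cmeasurable (fun x => f x * g x).
Proof.
move=> [f1 f2] [g1 g2].
apply: (@cmeasurable_fun _ (fun x => Re (f x) * Re (g x) - Im (f x) * Im (g x))
   (fun x => Re (f x) * Im (g x) + Im (f x) * Re (g x))).
- by apply: measurable_funB; exact: measurable_funM.
- by apply: measurable_funD; exact: measurable_funM.
- by move=> x; apply: cext; rewrite ?ReM ?ImM.
Qed.

Lemma cmeasurable_conj f : cmeasurable f -> cmeasurable (fun x => conjc (f x)).
Proof.
move=> [m1 m2]; apply: (@cmeasurable_fun _ (Re \o f) (\- (Im \o f))) => //.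
  exact: measurableT_comp.
by move=> x /=; case: (f x).
Qed.

Lemma cmeasurable_cis (a : T -> R) : measurable_fun setT a ->
  cmeasurable (fun x => cis (a x)).
Proof.
move=> ma; apply: (@cmeasurable_fun _ (@cos R \o a) (@sin R \o a)) => //.
  apply: measurableT_comp => //; apply: continuous_measurable_fun; exact: continuous_cos.
apply: measurableT_comp => //; apply: continuous_measurable_fun; exact: continuous_sin.
Qed.

Lemma cmeasurable_prod (I : Type) (s : seq I) (F : I -> T -> R[i]) :
  (forall i, cmeasurable (F i)) -> cmeasurable (fun x => \prod_(i <- s) F i x).
Proof.
move=> mF; elim: s => [|i s IH].
  by under eq_fun do rewrite big_nil; exact: cmeasurable_cst.
by under eq_fun do rewrite big_cons; exact: cmeasurable_mul.
Qed.

Lemma cintegrable_meas f : cintegrable f -> cmeasurable f.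
Proof.
by move=> [/integrableP[m1 _] /integrableP[m2 _]]; split; apply/measurable_EFinP.
Qed.

Lemma cintegrable_dom f (g : T -> \bar R) : cmeasurable f -> mu.-integrable setT g ->
  (forall x, (cabs (f x))%:E <= `|g x|)%E -> cintegrable f.
Proof.
move=> [m1 m2] ig fg; split; apply: (le_integrable measurableT _ _ ig).
- exact/measurable_EFinP.
- move=> x _; apply: le_trans (fg x); rewrite lee_fin; exact: ler_Re_cabs.
- exact/measurable_EFinP.
- move=> x _; apply: le_trans (fg x); rewrite lee_fin; exact: ler_Im_cabs.
Qed.

Lemma cintegrable_cabs f : cintegrable f ->
  mu.-integrable setT (fun x => (cabs (f x))%:E).
Proof.
move=> fi; have mf := cintegrable_meas fi; case: fi => i1 i2.
apply: (@le_integrable _ _ _ _ _ measurableT _ (fun x => `|(Re (f x))%:E| + `|(Im (f x))%:E|)%E).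
- by apply/measurable_EFinP; exact: cmeasurable_cabs.
- move=> x _ /=; rewrite lee_fin ger0_norm ?cabs_ge0// ger0_norm ?addr_ge0//.
  exact: ler_cabs_ReIm.
- by apply: integrableD => //; exact: integrable_abse.
Qed.

Lemma cintegrableP f : cintegrable f <->
  cmeasurable f /\ (\int[mu]_x (cabs (f x))%:E < +oo)%E.
Proof.
split=> [fi|[mf fi]].
  split; first exact: cintegrable_meas.
  have /integrableP[_] := cintegrable_cabs fi.
  by under eq_integral do rewrite gee0_abs ?lee_fin ?cabs_ge0//.
apply: (@cintegrable_dom _ (fun x => (cabs (f x))%:E)) => //.
  apply/integrableP; split; first by apply/measurable_EFinP; exact: cmeasurable_cabs.
  by under eq_integral do rewrite gee0_abs ?lee_fin ?cabs_ge0//.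
by move=> x; rewrite gee0_abs ?lee_fin ?cabs_ge0.
Qed.

Lemma eq_cint f g : f =1 g -> cint f = cint g.
Proof. by move=> /funext ->. Qed.

Lemma ae_eq_cint f g : cmeasurable f -> cmeasurable g ->
  {ae mu, forall x, f x = g x} -> cint f = cint g.
Proof.
move=> [f1 f2] [g1 g2] fg; rewrite /cint /Rintegral; congr (fine _ +i* fine _)%C.
  apply: ae_eq_integral => //; [exact/measurable_EFinP|exact/measurable_EFinP|].
  by apply: filterS fg => x /= -> .
apply: ae_eq_integral => //; [exact/measurable_EFinP|exact/measurable_EFinP|].
by apply: filterS fg => x /= -> .
Qed.

Lemma cintD f g : cintegrable f -> cintegrable g ->
  cint (fun x => f x + g x) = cint f + cint g.
Proof.
move=> [f1 f2] [g1 g2]; apply: cext; rewrite ?ReD ?ImD /=.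
  by under eq_Rintegral do rewrite ReD; rewrite RintegralD.
by under eq_Rintegral do rewrite ImD; rewrite RintegralD.
Qed.

Lemma cintegrableZ c f : cintegrable f -> cintegrable (fun x => c * f x).
Proof.
move=> [f1 f2]; split.
  rewrite (_ : (fun _ => _) = (fun x => (Re c)%:E * (Re (f x))%:E - (Im c)%:E * (Im (f x))%:E)%E).
    by apply: integrableB => //; exact: integrableZl.
  by apply/funext => x; rewrite ReM EFinB !EFinM.
rewrite (_ : (fun _ => _) = (fun x => (Re c)%:E * (Im (f x))%:E + (Im c)%:E * (Re (f x))%:E)%E).
  by apply: integrableD => //; exact: integrableZl.
by apply/funext => x; rewrite ImM EFinD !EFinM.
Qed.

Let integrableZr (k : R) (u : T -> R) : mu.-integrable setT (EFin \o u) ->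
  mu.-integrable setT (fun x => (k * u x)%:E).
Proof.
move=> iu; rewrite (_ : (fun _ => _) = (fun x => k%:E * (u x)%:E)%E).
  exact: integrableZl.
by apply/funext => x; rewrite EFinM.
Qed.

Lemma cintZ c f : cintegrable f -> cint (fun x => c * f x) = c * cint f.
Proof.
move=> [f1 f2]; apply: cext; rewrite ?ReM ?ImM /=.
  under eq_Rintegral do rewrite ReM.
  by rewrite RintegralB//=; [rewrite !RintegralZl| exact: integrableZr..].
under eq_Rintegral do rewrite ImM.
by rewrite RintegralD//=; [rewrite !RintegralZl| exact: integrableZr..].
Qed.

Lemma cintegrableN f : cintegrable f -> cintegrable (fun x => - f x).
Proof.
move=> fi; rewrite (_ : (fun _ => _) = (fun x => -1 * f x)); first exact: cintegrableZ.
by apply/funext => x; rewrite mulN1r.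
Qed.

Lemma cintB f g : cintegrable f -> cintegrable g ->
  cint (fun x => f x - g x) = cint f - cint g.
Proof.
move=> fi gi; rewrite cintD//; last exact: cintegrableN.
congr (_ + _); rewrite -mulN1r -cintZ//; apply: eq_cint => x.
by rewrite mulN1r.
Qed.

Lemma cintegrable_conj f : cintegrable f -> cintegrable (fun x => conjc (f x)).
Proof.
move=> /cintegrableP[mf fi]; apply/cintegrableP; split; first exact: cmeasurable_conj.
by under eq_integral do rewrite cabsC.
Qed.

Lemma cint_conj f : cintegrable f -> cint (fun x => conjc (f x)) = conjc (cint f).
Proof.
move=> [f1 f2]; apply: cext => /=.
  by apply: eq_Rintegral => x _; case: (f x).
rewrite -mulN1r -RintegralZl//; apply: eq_Rintegral => x _.
by case: (f x) => a b /=; rewrite mulN1r.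
Qed.

(** Real and imaginary parts are bounded separately, which costs a factor 2 but no rotation of the
    integral. The bound only serves for error terms, where constants are harmless. *)
Lemma cint_le f : cintegrable f ->
  ((cabs (cint f))%:E <= 2%:E * \int[mu]_x (cabs (f x))%:E)%E.
Proof.
move=> fi; have ia := cintegrable_cabs fi; have [f1 f2] := fi.
have iaf : (\int[mu]_x (cabs (f x))%:E \is a fin_num)%E by exact: integrable_fin_num.
rewrite -(fineK iaf) -EFinM lee_fin.
apply: le_trans (ler_cabs_ReIm _) _; rewrite mulr_natl mulr2n /=.
apply: lerD.
  apply: le_trans (le_normr_Rintegral measurableT f1) _.
  apply: le_Rintegral => //; first exact: integrable_norm.
  by move=> x _; exact: ler_Re_cabs.
apply: le_trans (le_normr_Rintegral measurableT f2) _.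
apply: le_Rintegral => //; first exact: integrable_norm.
by move=> x _; exact: ler_Im_cabs.
Qed.

End ComplexIntegral.

Section ComplexFubini.
Context d1 d2 (T1 : measurableType d1) (T2 : measurableType d2) (R : realType).
Variable m1 : {sigma_finite_measure set T1 -> \bar R}.
Variable m2 : {sigma_finite_measure set T2 -> \bar R}.

(** The inner real integral is a [fine] part, so it agrees with the extended one where that one is
    finite, that is almost everywhere; hence the detour through [Eae]. *)
Lemma Rintegrable_fubini_F (g : T1 * T2 -> R) :
  (m1 \x m2)%E.-integrable setT (EFin \o g) ->
  m1.-integrable setT (fun x => (\int[m2]_y g (x, y))%:E) /\
  (\int[m1]_x (\int[m2]_y g (x, y))%R)%R = \int[(m1 \x m2)%E]_z g z.
Proof.
move=> gi.
have iF := integrable_fubini_F gi.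
have Eae : ae_eq m1 setT (fubini_F m2 (EFin \o g)) (fun x => (\int[m2]_y g (x, y))%:E).
  have /integrable_ae := iF => /(_ measurableT); apply: filterS => x /= /(_ I) fx _.
  by rewrite /Rintegral fineK.
have mF : measurable_fun setT (fun x => (\int[m2]_y g (x, y))%:E).
  apply/measurable_EFinP/measurableT_comp => //; exact: measurable_int iF.
split.
  exact: ae_eq_integrable mF Eae iF.
rewrite /Rintegral -(integral12_prod_meas1 gi); congr fine.
by apply: ae_eq_integral => //; [exact: measurable_int iF|exact: ae_eq_sym].
Qed.

Lemma Rintegrable_fubini_G (g : T1 * T2 -> R) :
  (m1 \x m2)%E.-integrable setT (EFin \o g) ->
  m2.-integrable setT (fun y => (\int[m1]_x g (x, y))%:E) /\
  (\int[m2]_y (\int[m1]_x g (x, y))%R)%R = \int[(m1 \x m2)%E]_z g z.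
Proof.
move=> gi.
have iG : m2.-integrable setT (fubini_G m1 (EFin \o g)).
  apply/integrableP; split; first exact: measurable_fubini_G gi.
  have mg := measurable_int _ gi.
  apply: le_lt_trans ((integrable21ltyP m1 m2 mg).1 gi).
  apply: ge0_le_integral => //.
  - by apply: measurableT_comp => //; exact: measurable_fubini_G gi.
  - apply: (measurable_fun_fubini_tonelli_G (abse \o (EFin \o g))) => //.
    + exact: measurableT_comp.
    + by move=> y; exact: abse_ge0.
  - move=> y _; apply: le_abse_integral => //.
    exact: (measurableT_comp mg (measurable_pair2 y)).
have Eae : ae_eq m2 setT (fubini_G m1 (EFin \o g)) (fun y => (\int[m1]_x g (x, y))%:E).
  have /integrable_ae := iG => /(_ measurableT); apply: filterS => x /= /(_ I) fx _.
  by rewrite /Rintegral fineK.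
have mG : measurable_fun setT (fun y => (\int[m1]_x g (x, y))%:E).
  apply/measurable_EFinP/measurableT_comp => //; exact: measurable_int iG.
split.
  exact: ae_eq_integrable mG Eae iG.
rewrite /Rintegral -(integral21_prod_meas1 gi); congr fine.
by apply: ae_eq_integral => //; [exact: measurable_int iG|exact: ae_eq_sym].
Qed.

Lemma cintegrable_F (f : T1 * T2 -> R[i]) : cintegrable (m1 \x m2)%E f ->
  cintegrable m1 (fun x => cint m2 (fun y => f (x, y))).
Proof.
by move=> [f1 f2]; split; [have [] := Rintegrable_fubini_F f1|have [] := Rintegrable_fubini_F f2].
Qed.

Lemma cint_fubini (f : T1 * T2 -> R[i]) : cintegrable (m1 \x m2)%E f ->
  cint m1 (fun x => cint m2 (fun y => f (x, y))) =
  cint m2 (fun y => cint m1 (fun x => f (x, y))).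
Proof.
move=> [f1 f2]; rewrite /cint /=; congr (_ +i* _)%C.
  by rewrite (Rintegrable_fubini_F f1).2 (Rintegrable_fubini_G f1).2.
by rewrite (Rintegrable_fubini_F f2).2 (Rintegrable_fubini_G f2).2.
Qed.

Lemma cmeasurable_pair1 (f : T1 -> R[i]) : cmeasurable f ->
  cmeasurable (fun z : T1 * T2 => f z.1).
Proof.
by move=> [h1 h2]; split; [exact: (measurableT_comp h1)|exact: (measurableT_comp h2)].
Qed.

Lemma cmeasurable_pair2 (f : T2 -> R[i]) : cmeasurable f ->
  cmeasurable (fun z : T1 * T2 => f z.2).
Proof.
by move=> [h1 h2]; split; [exact: (measurableT_comp h1)|exact: (measurableT_comp h2)].
Qed.

Lemma cintegrable_tensor (a : T1 -> R[i]) (b : T2 -> R[i]) (k : T1 * T2 -> R[i]) :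
  cintegrable m1 a -> cintegrable m2 b -> cmeasurable k ->
  (forall z, cabs (k z) <= 1) ->
  cintegrable (m1 \x m2)%E (fun z => a z.1 * b z.2 * k z).
Proof.
move=> /cintegrableP[ma ia] /cintegrableP[mb ib] mk k1.
apply/cintegrableP; split.
  apply: cmeasurable_mul => //; apply: cmeasurable_mul.
    exact: cmeasurable_pair1.
  exact: cmeasurable_pair2.
have mab : measurable_fun setT (fun z : T1 * T2 => (cabs (a z.1))%:E * (cabs (b z.2))%:E)%E.
  apply: emeasurable_funM; apply/measurable_EFinP.
    exact: (measurableT_comp (cmeasurable_cabs ma)).
  exact: (measurableT_comp (cmeasurable_cabs mb)).
apply: (@le_lt_trans _ _ (\int[(m1 \x m2)%E]_z ((cabs (a z.1))%:E * (cabs (b z.2))%:E)))%E.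
  apply: ge0_le_integral => //.
  - by move=> z _; rewrite lee_fin cabs_ge0.
  - apply/measurable_EFinP/cmeasurable_cabs/cmeasurable_mul => //.
    by apply: cmeasurable_mul; [exact: cmeasurable_pair1|exact: cmeasurable_pair2].
  - move=> z _; rewrite -EFinM lee_fin !cabsM ler_piMr// mulr_ge0 ?cabs_ge0//.
rewrite fubini_tonelli1//; last by move=> z; rewrite -EFinM lee_fin mulr_ge0 ?cabs_ge0.
rewrite /fubini_F /=.
under eq_integral => x _.
  rewrite ge0_integralZl//; last 3 first.
  - exact/measurable_EFinP/cmeasurable_cabs.
  - by move=> y _; rewrite lee_fin cabs_ge0.
  - by rewrite lee_fin cabs_ge0.
  over.
rewrite ge0_integralZr//.
- by rewrite lte_mul_pinfty// ?integral_ge0// ?ge0_fin_numE// ?integral_ge0// => x _; rewrite lee_fin cabs_ge0.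
- exact/measurable_EFinP/cmeasurable_cabs.
- by move=> y _; rewrite lee_fin cabs_ge0.
- by apply: integral_ge0 => y _; rewrite lee_fin cabs_ge0.
Qed.

End ComplexFubini.

Section SquareIntegrable.
Context d (T : measurableType d) (R : realType).
Variable mu : {measure set T -> \bar R}.
Implicit Types (f g h : T -> R[i]) (c : R[i]).

(** The square of the L^2 norm: no root appears, and [sqnD] with its factors 2 stands in for
    Minkowski's inequality. *)
Definition sqn f : \bar R := (\int[mu]_x (cabs (f x) ^+ 2)%:E)%E.
Variant sqi f : Prop := Sqi of cmeasurable f & (sqn f < +oo)%E.

Lemma sqn_ge0 f : (0 <= sqn f)%E.
Proof. by apply: integral_ge0 => x _; rewrite lee_fin sqr_ge0. Qed.

Lemma sqn0 : sqn (fun=> 0) = 0%E.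
Proof. by rewrite /sqn; under eq_integral do rewrite cabs0 expr0n; rewrite integral0. Qed.

Lemma measurable_sq f : cmeasurable f ->
  measurable_fun setT (fun x => (cabs (f x) ^+ 2)%:E).
Proof. by move=> mf; apply/measurable_EFinP/measurable_funX; exact: cmeasurable_cabs. Qed.

Lemma le_sqn f g : cmeasurable f -> cmeasurable g ->
  (forall x, cabs (f x) <= cabs (g x)) -> (sqn f <= sqn g)%E.
Proof.
move=> mf mg fg; apply: ge0_le_integral => //.
- by move=> x _; rewrite lee_fin sqr_ge0.
- exact: measurable_sq.
- exact: measurable_sq.
- by move=> x _; rewrite lee_fin ler_sqr ?nnegrE ?cabs_ge0.
Qed.

Lemma ae_eq_sqn f g : cmeasurable f -> cmeasurable g ->
  {ae mu, forall x, f x = g x} -> sqn f = sqn g.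
Proof.
move=> mf mg fg; apply: ae_eq_integral => //; [exact: measurable_sq|exact: measurable_sq|].
by apply: filterS fg => x /= ->.
Qed.

Lemma sqnZ c f : cmeasurable f ->
  sqn (fun x => c * f x) = ((cabs c ^+ 2)%:E * sqn f)%E.
Proof.
move=> mf; rewrite /sqn -ge0_integralZl//.
- by apply: eq_integral => x _; rewrite cabsM exprMn EFinM.
- exact: measurable_sq.
- by move=> x _; rewrite lee_fin sqr_ge0.
- by rewrite lee_fin sqr_ge0.
Qed.

Lemma sqnD f g : cmeasurable f -> cmeasurable g ->
  (sqn (fun x => f x + g x)%R <= 2%:E * sqn f + 2%:E * sqn g)%E.
Proof.
move=> mf mg; rewrite /sqn -!ge0_integralZl//; try (by move=> *; rewrite lee_fin sqr_ge0);
  try exact: measurable_sq.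
rewrite -ge0_integralD//; try (by move=> *; rewrite -EFinM lee_fin mulr_ge0// sqr_ge0);
  try (apply: emeasurable_funM => //; exact: measurable_sq).
apply: ge0_le_integral => //.
- by move=> *; rewrite lee_fin sqr_ge0.
- by apply: measurable_sq; exact: cmeasurable_add.
- by apply: emeasurable_funD; apply: emeasurable_funM => //; exact: measurable_sq.
move=> x _; rewrite -!EFinM -EFinD lee_fin.
apply: (@le_trans _ _ ((cabs (f x) + cabs (g x)) ^+ 2)).
  by rewrite ler_sqr ?nnegrE ?addr_ge0 ?cabs_ge0// ler_cabsD.
have := sqr_ge0 (cabs (f x) - cabs (g x)); nra.
Qed.

Lemma sqnN f : sqn (fun x => - f x) = sqn f.
Proof. by apply: eq_integral => x _; rewrite cabsN. Qed.

Lemma sqnB f g : cmeasurable f -> cmeasurable g ->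
  (sqn (fun x => f x - g x)%R <= 2%:E * sqn f + 2%:E * sqn g)%E.
Proof.
move=> mf mg; rewrite -(sqnN g); apply: sqnD => //; exact: cmeasurable_opp.
Qed.

Lemma sqn_conj f : sqn (fun x => conjc (f x)) = sqn f.
Proof. by apply: eq_integral => x _; rewrite cabsC. Qed.

Lemma sqiD f g : sqi f -> sqi g -> sqi (fun x => f x + g x).
Proof.
move=> [mf f2] [mg g2]; split; first exact: cmeasurable_add.
apply: le_lt_trans (sqnD mf mg) _.
by rewrite lte_add_pinfty// lte_mul_pinfty.
Qed.

Lemma sqiZ c f : sqi f -> sqi (fun x => c * f x).
Proof.
move=> [mf f2]; split; first by apply: cmeasurable_mul => //; exact: cmeasurable_cst.
by rewrite sqnZ// lte_mul_pinfty// lee_fin sqr_ge0.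
Qed.

Lemma sqiN f : sqi f -> sqi (fun x => - f x).
Proof. by move=> [mf f2]; split; [exact: cmeasurable_opp|rewrite sqnN]. Qed.

Lemma sqiB f g : sqi f -> sqi g -> sqi (fun x => f x - g x).
Proof. by move=> sf sg; apply: sqiD => //; exact: sqiN. Qed.

Lemma sqi_conj f : sqi f -> sqi (fun x => conjc (f x)).
Proof. by move=> [mf f2]; split; [exact: cmeasurable_conj|rewrite sqn_conj]. Qed.

Lemma sqi_le f g : cmeasurable f -> sqi g ->
  (forall x, cabs (f x) <= cabs (g x)) -> sqi f.
Proof. by move=> mf [mg g2] fg; split=> //; exact: le_lt_trans (le_sqn mf mg fg) _. Qed.

Lemma cabs_mul_le (x y : R[i]) (t : R) : 0 < t ->
  2 * cabs (x * y) <= t * cabs x ^+ 2 + t^-1 * cabs y ^+ 2.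
Proof.
move=> t0; rewrite cabsM.
have := sqr_ge0 (t * cabs x - cabs y).
have -> : t * cabs x ^+ 2 + t^-1 * cabs y ^+ 2 = t^-1 * ((t * cabs x) ^+ 2 + cabs y ^+ 2).
  by field; rewrite gt_eqF.
rewrite sqrrB => h.
rewrite -(ler_pM2l t0) [leRHS]mulrA mulfV ?gt_eqF// mul1r.
by have := h; rewrite -mulr_natl; lra.
Qed.

Lemma sqi_mul f g : sqi f -> sqi g -> cintegrable mu (fun x => f x * g x).
Proof.
move=> [mf f2] [mg g2]; apply/cintegrableP; split; first exact: cmeasurable_mul.
apply: (@le_lt_trans _ _ (sqn f + sqn g)%E); last exact: lte_add_pinfty.
rewrite /sqn -ge0_integralD//; try (by move=> *; rewrite lee_fin sqr_ge0);
  try exact: measurable_sq.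
apply: ge0_le_integral => //.
- by move=> *; rewrite lee_fin cabs_ge0.
- exact/measurable_EFinP/cmeasurable_cabs/cmeasurable_mul.
- by apply: emeasurable_funD; exact: measurable_sq.
move=> x _; rewrite -EFinD lee_fin.
have := @cabs_mul_le (f x) (g x) 1 ltr01; rewrite invr1 !mul1r.
by have := cabs_ge0 (f x * g x); lra.
Qed.

(** A substitute for Cauchy-Schwarz: 2 |f g| <= t |f|^2 + |g|^2 / t is integrated, its 2 absorbing
    that of [cint_le]. The free parameter [t] exploits one small factor when the other is merely
    finite. *)
Lemma cint_mul_le f g (t : R) : 0 < t -> sqi f -> sqi g ->
  ((cabs (cint mu (fun x => f x * g x)))%:E <= t%:E * sqn f + t^-1%:E * sqn g)%E.
Proof.
move=> t0 sf sg; have [mf f2] := sf; have [mg g2] := sg.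
have ti0 : 0 < t^-1 by rewrite invr_gt0.
apply: le_trans (cint_le (sqi_mul sf sg)) _.
rewrite -ge0_integralZl//; last 2 first.
- exact/measurable_EFinP/cmeasurable_cabs/cmeasurable_mul.
- by move=> x _; rewrite lee_fin cabs_ge0.
rewrite /sqn -!ge0_integralZl//; try (by move=> *; rewrite lee_fin sqr_ge0);
  try exact: measurable_sq; try (by rewrite lee_fin ltW).
rewrite -ge0_integralD//; try (by move=> *; rewrite -EFinM lee_fin mulr_ge0 ?sqr_ge0// ltW);
  try (apply: emeasurable_funM => //; exact: measurable_sq).
apply: ge0_le_integral => //.
- by move=> x _; rewrite -EFinM lee_fin mulr_ge0// cabs_ge0.
- by apply: emeasurable_funM => //; apply/measurable_EFinP/cmeasurable_cabs/cmeasurable_mul.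
- by apply: emeasurable_funD; apply: emeasurable_funM => //; exact: measurable_sq.
by move=> x _; rewrite -!EFinM -EFinD lee_fin cabs_mul_le.
Qed.

Lemma cint_mul_cvg0 (u : nat -> T -> R[i]) (c : nat -> R[i]) (z : R[i]) g : sqi g ->
  (forall k, sqi (u k)) -> (forall e : R, 0 < e -> \forall k \near \oo, (sqn (u k) <= e%:E)%E) ->
  (forall k, z = cint mu (fun x => u k x * g x)) -> z = 0.
Proof.
move=> sg su u0 zE; apply: cabs_eq0; apply/eqP; rewrite eq_le cabs_ge0 andbT.
apply/ler_addgt0Pr => e e0; rewrite add0r.
have gfin : sqn g \is a fin_num by rewrite ge0_fin_numE ?sqn_ge0//; case: sg.
set G := fine (sqn g).
have G0 : 0 <= G by rewrite fine_ge0// sqn_ge0.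
(* Large enough for t^-1 G <= e / 2; the other term is then made small by the choice of [k]. G + 1
   keeps [t] positive when g vanishes. *)
pose t := (G + 1) * 2 / e.
have t0 : 0 < t by rewrite /t divr_gt0// mulr_gt0// ltr_wpDl.
have tG : t^-1 * G <= e / 2.
  have G1 : 0 < G + 1 by rewrite ltr_wpDl.
  rewrite -subr_ge0 (_ : _ - _ = e / (2 * (G + 1))).
    by rewrite divr_ge0 ?ltW// mulr_gt0.
  by rewrite /t; field; rewrite !gt_eqF.
have et0 : 0 < e / 2 / t by apply: divr_gt0 => //; apply: divr_gt0.
have [k uk] := filter_ex (u0 _ et0).
have := cint_mul_le t0 (su k) sg; rewrite -zE -lee_fin => /le_trans; apply.
rewrite -(fineK gfin) -/G [in leRHS](splitr e) EFinD; apply: leeD; last first.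
  by rewrite -EFinM lee_fin.
apply: (@le_trans _ _ (t%:E * (e / 2 / t)%:E)%E).
  by rewrite lee_pmul2l.
by rewrite -EFinM lee_fin mulrC divfK// gt_eqF.
Qed.

End SquareIntegrable.

Section Transfer.
Context d d' (T : measurableType d) (T' : measurableType d') (R : realType).
Variables (m : {measure set T -> \bar R}) (m' : {measure set T' -> \bar R}).
Variables (phi : T -> T') (mphi : measurable_fun setT phi).
Hypothesis mm' : forall A, measurable A -> m (phi @^-1` A) = m' A.

Lemma cmeasurable_comp (f : T' -> R[i]) : cmeasurable f ->
  cmeasurable (fun x => f (phi x)).
Proof. by move=> [m1 m2]; split; [exact: (measurableT_comp m1)|exact: (measurableT_comp m2)]. Qed.

Lemma cintegrable_transfer (f : T' -> R[i]) : cmeasurable f ->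
  cintegrable m' f <-> cintegrable m (fun x => f (phi x)).
Proof.
move=> mf.
have E : (\int[m']_x (cabs (f x))%:E = \int[m]_x (cabs (f (phi x)))%:E)%E.
  apply: (ge0_integral_transfer mphi mm').
    exact/measurable_EFinP/cmeasurable_cabs.
  by move=> x; rewrite lee_fin cabs_ge0.
split=> /cintegrableP[_ h]; apply/cintegrableP; split => //.
- exact: cmeasurable_comp.
- by rewrite -E.
- by rewrite E.
Qed.

Lemma Rintegral_transfer (g : T' -> R) : measurable_fun setT g ->
  m.-integrable setT (fun x => (g (phi x))%:E) ->
  \int[m']_x g x = \int[m]_x g (phi x).
Proof.
move=> mg gi; rewrite /Rintegral; congr fine.
have mge : measurable_fun setT (EFin \o g) by exact/measurable_EFinP.
rewrite [LHS]integralE [RHS]integralE.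
rewrite (ge0_integral_transfer mphi mm' (measurable_funepos mge))//.
rewrite (ge0_integral_transfer mphi mm' (measurable_funeneg mge))//.
change (fun x0 : T => (g (phi x0))%:E) with ((EFin \o g) \o phi).
by rewrite (funepos_comp (EFin \o g) phi) (funeneg_comp (EFin \o g) phi).
Qed.

Lemma cint_transfer (f : T' -> R[i]) : cmeasurable f ->
  cintegrable m (fun x => f (phi x)) -> cint m' f = cint m (fun x => f (phi x)).
Proof.
move=> [m1 m2] [i1 i2].
by rewrite /cint (Rintegral_transfer m1)// (Rintegral_transfer m2).
Qed.

End Transfer.

Section TensorIntegral.
Context d1 d2 (T1 : measurableType d1) (T2 : measurableType d2) (R : realType).
Variable m1 : {sigma_finite_measure set T1 -> \bar R}.
Variable m2 : {sigma_finite_measure set T2 -> \bar R}.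

Lemma cint_iterated (f : T1 * T2 -> R[i]) : cintegrable (m1 \x m2)%E f ->
  cint m1 (fun x => cint m2 (fun y => f (x, y))) = cint (m1 \x m2)%E f.
Proof.
move=> [f1 f2]; rewrite /cint /=; congr (_ +i* _)%C.
  by rewrite (Rintegrable_fubini_F f1).2.
by rewrite (Rintegrable_fubini_F f2).2.
Qed.

Lemma cint_tensor (a : T1 -> R[i]) (b : T2 -> R[i]) :
  cintegrable m1 a -> cintegrable m2 b ->
  cintegrable (m1 \x m2)%E (fun z => a z.1 * b z.2) /\
  cint (m1 \x m2)%E (fun z => a z.1 * b z.2) = cint m1 a * cint m2 b.
Proof.
move=> ia ib.
have iab : cintegrable (m1 \x m2)%E (fun z => a z.1 * b z.2).
  rewrite (_ : (fun _ => _) = (fun z : T1 * T2 => a z.1 * b z.2 * 1)); last first.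
    by apply/funext => z; rewrite mulr1.
  apply: cintegrable_tensor => //; first exact: cmeasurable_cst.
  by move=> z; rewrite cabs1.
split=> //; rewrite -cint_iterated//=.
under eq_cint do rewrite cintZ// mulrC.
by rewrite cintZ// mulrC.
Qed.

End TensorIntegral.

Section ProductIntegral.
Context (R : realType).
Let lam : {sigma_finite_measure set (measurableTypeR R) -> \bar R} :=
  @lebesgue_measure R.

Lemma cint_tuple_prod n (h : 'I_n -> R -> R[i]) :
  (forall i, cintegrable lam (h i)) ->
  cintegrable (lebesgue_tuple R n) (fun t => \prod_i h i (tnth t i)) /\
  cint (lebesgue_tuple R n) (fun t => \prod_i h i (tnth t i)) =
  \prod_i cint lam (h i).
Proof.
elim: n h => [|n IH] h hi.
  have E : (fun t : 0.-tuple R => \prod_i h i (tnth t i)) = (fun=> 1).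
    by apply/funext => t; rewrite big_ord0.
  rewrite E big_ord0; split.
    split => /=; apply/integrableP; split=> //=.
      by rewrite integral_cst//= normr1 mul1e diracT ltry.
    by rewrite integral_cst//= normr0 mul0e.
  rewrite /cint /= !Rintegral_cst//= ?mul0r ?mul1r.
  by rewrite indicE in_setT.
have [iI vI] := IH (fun i => h (lift ord0 i)) (fun i => hi _).
have [i1 v1] := cint_tensor (hi ord0) iI.
have E : (fun z : R * n.-tuple R => \prod_i h i (tnth (tuple_cons z) i)) =
         (fun z => h ord0 z.1 * \prod_i h (lift ord0 i) (tnth z.2 i)).
  apply/funext => z; rewrite big_ord_recl; congr (_ * _).
  by apply: eq_bigr => i _; rewrite tnthS.
have mh : cmeasurable (fun t : n.+1.-tuple R => \prod_i h i (tnth t i)).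
  apply: cmeasurable_prod => i; have mi := cintegrable_meas (hi i).
  exact: (@cmeasurable_comp _ _ _ _ _ _ (measurable_tnth i) (h i)).
have mm A : measurable A -> (lam \x lebesgue_tuple R n)%E (@tuple_cons R n @^-1` A) =
    lebesgue_tuple R n.+1 A by [].
have mc := @measurable_tuple_cons R n.
split.
  by apply/(cintegrable_transfer mc mm mh); rewrite E.
by rewrite (cint_transfer mc mm mh) E// v1 vI big_ord_recl.
Qed.

Section Rows.
Context (n : nat).
Local Notation mu := (@leb R n).

(** Two transfers: from tuples to rows along [tuple_rV], and between the Borel sets and their
    completion along the identity. *)
Lemma cint_leb (f : 'rV[R]_n -> R[i]) : cmeasurable (f : borel_rV R n -> R[i]) ->
  cintegrable (lebesgue_tuple R n) (fun t => f (tuple_rV t)) ->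
  cintegrable mu f /\ cint mu f = cint (lebesgue_tuple R n) (fun t => f (tuple_rV t)).
Proof.
move=> mf fi.
have mT := @measurable_tuple_rV R n.
have mid : measurable_fun setT (fun x : Rn R n => x : borel_rV R n).
  by move=> _ B mB; rewrite setTI; exact: measurable_borel.
have m1 A : measurable A -> lebesgue_tuple R n ((@tuple_rV R n : _ -> borel_rV R n) @^-1` A) =
  @borel_lebesgue R n A by [].
have m2 (A : set (borel_rV R n)) : measurable A ->
  mu ((fun x : Rn R n => x : borel_rV R n) @^-1` A) = @borel_lebesgue R n A.
  exact: leb_borel.
have bi : cintegrable (@borel_lebesgue R n) f.
  exact: (iffRL (@cintegrable_transfer _ _ _ _ R _ (@borel_lebesgue R n) _ mT m1 f mf)).
have li : cintegrable mu (f : Rn R n -> R[i]).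
  exact: (iffLR (@cintegrable_transfer _ _ _ _ R mu (@borel_lebesgue R n) _ mid m2 f mf)).
split=> //.
rewrite -(@cint_transfer _ _ _ _ R (lebesgue_tuple R n) (@borel_lebesgue R n) _ mT m1 f mf fi).
by symmetry; exact: (@cint_transfer _ _ _ _ R mu (@borel_lebesgue R n) _ mid m2 f mf li).
Qed.

Lemma cmeasurable_coords (h : 'I_n -> R -> R[i]) :
  (forall i, cmeasurable (h i : measurableTypeR R -> R[i])) ->
  cmeasurable (fun x : borel_rV R n => \prod_i h i (x ord0 i)).
Proof.
move=> mh; apply: cmeasurable_prod => i.
exact: (@cmeasurable_comp _ _ (borel_rV R n) (measurableTypeR R) R _ (@borel_coord R n i) (h i) (mh i)).
Qed.

Lemma cint_leb_prod (h : 'I_n -> R -> R[i]) : (forall i, cintegrable lam (h i)) ->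
  cintegrable mu (fun x => \prod_i h i (x ord0 i)) /\
  cint mu (fun x => \prod_i h i (x ord0 i)) = \prod_i cint lam (h i).
Proof.
move=> hi; have [ii vi] := cint_tuple_prod hi.
have E : (fun t : n.-tuple R => \prod_i h i (tuple_rV t ord0 i)) =
         (fun t => \prod_i h i (tnth t i)).
  by apply/funext => t; apply: eq_bigr => i _; rewrite mxE.
have [] := @cint_leb (fun x => \prod_i h i (x ord0 i)).
- by apply: cmeasurable_coords => i; exact: (cintegrable_meas (hi i)).
- by rewrite E.
- by rewrite E vi.
Qed.

Lemma cint_real d (T : measurableType d) (m : {measure set T -> \bar R}) (f : T -> R) :
  cint m (fun x => (f x)%:C%C) = (\int[m]_x f x)%:C%C.
Proof. by apply: cext => //=; rewrite Rintegral_cst//= mul0r. Qed.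

Lemma cintegrable_real d (T : measurableType d) (m : {measure set T -> \bar R}) (f : T -> R) :
  cintegrable m (fun x => (f x)%:C%C) <-> m.-integrable setT (EFin \o f).
Proof. by split=> [[]//|fi]; split => //=; exact: integrable0. Qed.

Lemma Rintegral_leb_prod (f : 'I_n -> R -> R) :
  (forall i, lam.-integrable setT (EFin \o f i)) ->
  mu.-integrable setT (fun x => (\prod_i f i (x ord0 i))%:E) /\
  \int[mu]_x (\prod_i f i (x ord0 i)) = \prod_i \int[lam]_x f i x.
Proof.
move=> fi.
have [|h1 h2] := @cint_leb_prod (fun i x => (f i x)%:C%C).
  by move=> i; apply/cintegrable_real.
have E : (fun x : Rn R n => \prod_i (f i (x ord0 i))%:C%C) =
         (fun x => (\prod_i f i (x ord0 i))%:C%C).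
  by apply/funext => x; rewrite rmorph_prod.
rewrite E in h1 h2; split; first by case: h1.
move: h2; rewrite cint_real; under [RHS]eq_bigr do rewrite cint_real.
by rewrite -rmorph_prod => /complexI.
Qed.

End Rows.
End ProductIntegral.

(** * Boxes and open sets of R^n *)

Section OpenBoxes.
Context (R : realType) (n : nat).
Local Notation mu := (@leb R n).
Local Notation B := (borel_rV R n).

(** These boxes, possibly empty, are the pi-system from which the induction over measurable sets
    starts. *)
Definition hbox (al be : 'I_n -> R) : set 'rV[R]_n :=
  [set x | forall i, al i < x ord0 i <= be i].

Lemma borel_coord_set i (D : set R) : measurable D ->
  measurable ([set x | D (x ord0 i)] : set B).
Proof. by move=> mD; rewrite -[X in measurable X]setTI; exact: borel_coord. Qed.

Lemma borel_forall (D : 'I_n -> set R) : (forall i, measurable (D i)) ->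
  measurable ([set x | forall i, D i (x ord0 i)] : set B).
Proof.
move=> mD.
rewrite (_ : [set _ | _] = \bigcap_(i in [set: 'I_n]) [set x | D i (x ord0 i)]).
  apply: fin_bigcap_measurable; first exact: finite_finset.
  by move=> i _; exact: borel_coord_set.
by apply/seteqP; split => [x h i _|x h i]; exact: h.
Qed.

Lemma borel_hbox al be : measurable (hbox al be : set B).
Proof.
rewrite (_ : hbox _ _ = [set x | forall i, `]al i, be i]%classic (x ord0 i)]).
  exact: (@borel_forall (fun i => `]al i, be i]%classic)).
by apply/seteqP; split => x h i; have := h i; rewrite /= in_itv.
Qed.

(** Balls of row vectors are those of the sup norm, so an open set is the union of the countably
    many boxes with rational centre and half-side 1/(m+1) that it contains. *)
Lemma borel_open (A : set 'rV[R]_n) : open A -> measurable (A : set B).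
Proof.
move=> oA.
pose bx (z : 'rV[rat]_n * nat) : set B :=
  [set x | forall i, `]ratr (z.1 ord0 i) - z.2.+1%:R^-1, ratr (z.1 ord0 i) + z.2.+1%:R^-1[%classic (x ord0 i)].
rewrite (_ : A = \bigcup_(z in [set z | bx z `<=` A]) bx z).
  rewrite bigcup_mkcond.
  apply: countable_bigcupT_measurable => // z; case: ifP => // _.
  exact: (@borel_forall (fun i => `]ratr (z.1 ord0 i) - z.2.+1%:R^-1,
    ratr (z.1 ord0 i) + z.2.+1%:R^-1[%classic)).
apply/seteqP; split => [x Ax|x [z zA]]; last exact: zA.
have /nbhs_ballP[e /= e0 eA] : nbhs x A by exact: open_nbhs_nbhs.
have [m me] : exists m, m.+1%:R^-1 < e / 2.
  have e20 : 0 < e / 2 by rewrite divr_gt0.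
  have [m _ /(_ m (leqnn _))] := near_infty_natSinv_lt (PosNum e20).
  by exists m.
have m0 : 0 < m.+1%:R^-1 :> R by rewrite invr_gt0 ltr0n.
have qx i : exists q : rat, x ord0 i - m.+1%:R^-1 < ratr q < x ord0 i + m.+1%:R^-1.
  have : x ord0 i - m.+1%:R^-1 < x ord0 i + m.+1%:R^-1.
    by rewrite ltrBlDr -addrA ltrDl addr_gt0.
  by move=> /rat_in_itvoo[q]; rewrite in_itv => ?; exists q.
have [q hq] := choice qx.
exists ((\row_i q i), m); last first.
  move=> i /=; rewrite in_itv/= mxE.
  by move: (hq i) => /andP[]; move: m.+1%:R^-1 => dl; lra.
move=> y hy; apply: eA; split => // i j.
have := hy j; have := hq j; rewrite /= in_itv/= !mxE !ord1 /ball/=.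
move: me; move: m.+1%:R^-1 => dl me /andP[? ?] /andP[? ?].
by rewrite ltr_norml; lra.
Qed.

Lemma borel_continuous (f : 'rV[R]_n -> R) : continuous f ->
  measurable_fun setT (f : B -> R).
Proof.
move=> cf; apply: (measurability _ (RGenOpens.measurableE R)).
move=> _ [_ [a [b ->] <-]]; rewrite setTI; apply: borel_open.
by apply: open_comp => // x _; exact: cf.
Qed.

Lemma leb_hbox al be : (forall i, al i <= be i) ->
  mu (hbox al be) = (\prod_i (be i - al i))%:E.
Proof.
move=> ab.
have Ei i : lebesgue_measure.-integrable setT (fun x : R => (\1_(`]al i, be i]) x)%:E).
  apply/integrableP; split; first exact/measurable_EFinP/measurable_indic.
  under eq_integral do rewrite gee0_abs ?lee_fin//.
  by rewrite integral_indic// setIT/= lebesgue_measure_itv/=; case: ifP => // _; rewrite ltry.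
have [h1 h2] := Rintegral_leb_prod Ei.
have Eb : (fun x : 'rV[R]_n => \prod_i (\1_(`]al i, be i]) (x ord0 i) : R)) = \1_(hbox al be).
  apply/funext => x; rewrite indicE; case: (asboolP (hbox al be x)) => hx.
    rewrite mem_set// big1// => i _; rewrite indicE mem_set//=.
    by rewrite in_itv/=; exact: hx.
  rewrite memNset//; apply/eqP/prodf_eq0.
  have [i hi] : exists i, ~ (al i < x ord0 i <= be i) by apply/existsNP.
  by exists i => //; rewrite indicE memNset//= in_itv.
have mb : measurable (hbox al be : set (Rn R n)).
  by apply: measurable_borel; exact: borel_hbox.
have fm : mu (hbox al be) \is a fin_num.
  have := integrable_fin_num measurableT h1.
  rewrite (_ : integral _ _ _ = \int[mu]_x (\1_(hbox al be) x)%:E)%E; last first.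
    by apply: eq_integral => x _; rewrite -[in RHS]Eb.
  by rewrite integral_indic// setIT.
rewrite -[LHS]fineK//; congr EFin.
transitivity (\int[mu]_x (\1_(hbox al be) x : R)).
  by rewrite /Rintegral integral_indic// setIT.
rewrite -Eb h2; apply: eq_bigr => i _.
rewrite /Rintegral integral_indic// setIT/= lebesgue_measure_itv/= lte_fin.
have [//|abi] := ltP (al i) (be i).
by have /eqP -> : al i == be i by [rewrite eq_le ab abi]; rewrite subrr.
Qed.

End OpenBoxes.

(** * Induction over square integrable functions *)

Section DominatedSquare.
Context d (T : measurableType d) (R : realType).
Variable mu : {measure set T -> \bar R}.
Implicit Types (f : T -> R[i]).

Lemma sqn_dct (u : nat -> T -> R[i]) f (g : T -> R) :
  (forall k, cmeasurable (u k)) -> cmeasurable f -> measurable_fun setT g ->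
  (\int[mu]_x (g x ^+ 2)%:E < +oo)%E ->
  (forall k x, cabs (u k x - f x) <= g x) ->
  (forall x, cabs (u k x - f x) @[k --> \oo] --> (0:R)) ->
  forall e : R, 0 < e -> \forall k \near \oo, (sqn mu (fun x => u k x - f x)%R <= e%:E)%E.
Proof.
move=> mu_ mf mg ig ug uf e e0.
have [|||||_ _ h] := @dominated_convergence _ _ _ mu setT measurableT
  (fun k x => (cabs (u k x - f x) ^+ 2)%:E) (cst 0%E) (fun x => (g x ^+ 2)%:E).
- by move=> k; apply: measurable_sq; exact: cmeasurable_sub.
- exact: measurable_cst.
- apply: aeW => x _; apply: cvg_EFin; first exact: nearW.
  rewrite [X in _ --> X](_ : _ = 0 ^+ 2 :> R); last by rewrite expr0n.
  rewrite /comp/=; under eq_fun do rewrite expr2.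
  by rewrite expr2; apply: cvgM; exact: uf.
- apply/integrableP; split; first exact/measurable_EFinP/measurable_funX.
  by under eq_integral do rewrite gee0_abs ?lee_fin ?sqr_ge0//.
- apply: aeW => x k _ /=; rewrite lee_fin ger0_norm ?sqr_ge0//.
  by rewrite ler_sqr ?nnegrE ?cabs_ge0// (le_trans _ (ug k x))// cabs_ge0.
rewrite integral0 in h.
have : \forall k \near \oo, (\int[mu]_x (cabs (u k x - f x) ^+ 2)%:E < e%:E)%E.
  have [_ hc] := (fine_cvgP _ _).1 h.
  have := (fine_cvgP _ _).1 h; move=> [hfin /cvgr_lt hlt].
  have := hlt _ e0; apply: filterS2 hfin => k /= hk; rewrite -lte_fin.
  by rewrite fineK.
by apply: filterS => k /ltW.
Qed.

End DominatedSquare.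

Section SquareInductionIndic.
Context d (T : measurableType d) (R : realType).
Variable mu : {measure set T -> \bar R}.

Definition cindic (A : set T) : T -> R[i] := fun x => (\1_A x : R)%:C%C.

Lemma cmeasurable_cindic (A : set T) : measurable A -> cmeasurable (cindic A).
Proof. by move=> mA; apply: cmeasurable_real; exact: measurable_indic. Qed.

Lemma cabs_cindic (A : set T) x : cabs (cindic A x) = \1_A x.
Proof. by rewrite cabsr ger0_norm// indicE. Qed.

Lemma cabs_cindicB (A C : set T) x :
  cabs (cindic A x - cindic C x) = `|\1_A x - \1_C x|.
Proof. by rewrite /cindic -rmorphB cabsr. Qed.

Lemma sqn_cindic (A : set T) : measurable A -> sqn mu (cindic A) = mu A.
Proof.
move=> mA; rewrite /sqn (eq_integral (fun x => (\1_A x)%:E)).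
  by rewrite integral_indic// setIT.
by move=> x _; rewrite cabs_cindic indicE; case: (_ \in _); rewrite /= ?expr0n ?expr1n.
Qed.

Lemma sqi_cindic (A : set T) : measurable A -> (mu A < +oo)%E -> sqi mu (cindic A).
Proof. by move=> mA fA; split; [exact: cmeasurable_cindic|rewrite sqn_cindic]. Qed.

Variable P : (T -> R[i]) -> Prop.
Hypothesis PD : forall f g, sqi mu f -> sqi mu g -> P f -> P g -> P (fun x => f x + g x).
Hypothesis PZ : forall c f, sqi mu f -> P f -> P (fun x => c * f x).
Hypothesis PC : forall f, sqi mu f -> (forall e : R, 0 < e ->
  exists g, [/\ sqi mu g, P g & (sqn mu (fun x => f x - g x)%R <= e%:E)%E]) -> P f.

(** [PC] asks for L^2 approximants; dominated convergence supplies them from pointwise limits. *)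
Lemma P_lim (u : nat -> T -> R[i]) f (g : T -> R) :
  (forall k, P (u k)) -> (forall k, sqi mu (u k)) -> sqi mu f -> measurable_fun setT g ->
  (\int[mu]_x (g x ^+ 2)%:E < +oo)%E ->
  (forall k x, cabs (u k x - f x) <= g x) ->
  (forall x, cabs (u k x - f x) @[k --> \oo] --> (0:R)) -> P f.
Proof.
move=> Pu su sf mg ig ug uf; apply: PC => // e e0; have [mf _] := sf.
have mu_ k : cmeasurable (u k) by case: (su k).
have [k hk] := filter_ex (sqn_dct mu_ mf mg ig ug uf e0).
exists (u k); split => //; apply: le_trans hk.
rewrite le_eqVlt; apply/orP; left; apply/eqP.
by apply: eq_integral => x _; rewrite cabsB.
Qed.

Lemma P_ae f g : sqi mu f -> sqi mu g -> {ae mu, forall x, f x = g x} -> P g -> P f.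
Proof.
move=> sf sg fg Pg; apply: PC => // e e0; exists g; split => //.
rewrite (@ae_eq_sqn _ _ _ mu _ (fun=> 0)).
- rewrite /sqn; under eq_integral do rewrite cabs0 expr0n.
  by rewrite integral0 lee_fin ltW.
- by apply: cmeasurable_sub; [case: sf|case: sg].
- exact: cmeasurable_cst.
- by apply: filterS fg => x ->; rewrite subrr.
Qed.

Lemma sqi_sub (A : set T) (C : set T) : measurable A -> measurable C -> A `<=` C ->
  (mu C < +oo)%E -> sqi mu (cindic A).
Proof.
move=> mA mC AC fC; apply: sqi_cindic => //.
by apply: le_lt_trans fC; apply: le_measure; rewrite ?inE.
Qed.

Lemma int_indic2 (C : set T) : measurable C -> (mu C < +oo)%E ->
  (\int[mu]_x (((\1_C x : R) ^+ 2)%:E) < +oo)%E.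
Proof.
move=> mC fC; rewrite (eq_integral (fun x => (cabs (cindic C x) ^+ 2)%:E)).
  by rewrite -/(sqn mu _) sqn_cindic.
by move=> x _; rewrite cabs_cindic.
Qed.

Hypothesis P_set0 : P (cindic set0).

(** By disjointness the indicators of finite unions are sums, and they converge in L^2 to that of
    the countable union. The ambient set [C] of finite measure provides the dominating function. *)
Lemma P_bigcup (F : (set T)^nat) (C : set T) : measurable C -> (mu C < +oo)%E ->
  (forall k, measurable (F k)) -> trivIset setT F -> (forall k, F k `<=` C) ->
  (forall k, P (cindic (F k))) -> P (cindic (\bigcup_k F k)).
Proof.
move=> mC fC mF tF FC PF.
pose U k := \big[setU/set0]_(j < k) F j.
have mU k : measurable (U k) by apply: bigsetU_measurable.
have UC k : U k `<=` C by rewrite /U -bigcup_mkord => x [j _]; exact: FC.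
have mUF : measurable (\bigcup_k F k) by exact: bigcup_measurable.
have UFC : \bigcup_k F k `<=` C by move=> x [j _]; exact: FC.
have PU k : P (cindic (U k)).
  elim: k => [|k IH].
    by rewrite /U big_ord0; exact: P_set0.
  rewrite (_ : cindic _ = (fun x => cindic (U k) x + cindic (F k) x)).
    by apply: PD => //; [exact: (sqi_sub (mU k) mC (UC k) fC)|exact: (sqi_sub (mF k) mC (FC k) fC)].
  apply/funext => x; rewrite /cindic -rmorphD; congr (_%:C)%C.
  rewrite /U big_ord_recr/= !indicE in_setU -/(U k).
  have [xU|xU] := boolP (x \in U k); have [xF|xF] := boolP (x \in F k) => //=;
    rewrite ?addr0 ?add0r//.
  exfalso; move: xU xF; rewrite !inE /U -bigcup_mkord => -[j /= jk Fj] Fk.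
  have := tF j k I I; move=> /(_ (ex_intro _ x (conj Fj Fk))) jkE.
  by move: jk; rewrite jkE ltnn.
apply: (@P_lim (fun k => cindic (U k)) _ (\1_C)) => //.
- by move=> k; exact: (sqi_sub (mU k) mC (UC k) fC).
- exact: (sqi_sub mUF mC UFC fC).
- exact: int_indic2.
- move=> k x; rewrite cabs_cindicB !indicE.
  case: (boolP (x \in C)) => [_|xC].
    by case: (_ \in _); case: (_ \in _); rewrite ?subrr ?subr0 ?sub0r ?normrN ?normr1 ?normr0.
  rewrite !memNset ?subrr ?normr0//; apply: contraNnot xC; rewrite inE.
    exact: UFC.
  exact: UC.
- move=> x; apply: cvg_near_cst.
  have [[j _ Fj]|nF] := pselect ((\bigcup_k F k) x).
    apply: filterS (nbhs_infty_gt j) => k jk; rewrite cabs_cindicB !indicE.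
    rewrite (mem_set (A := \bigcup_k F k)); last by exists j.
    rewrite mem_set ?subrr ?normr0//.
    by rewrite /U -bigcup_mkord; exists j.
  apply: nearW => k; rewrite cabs_cindicB !indicE.
  rewrite (memNset nF) memNset ?subrr ?normr0// /U -bigcup_mkord => -[j _ Fj].
  by apply: nF; exists j.
Qed.

Hypothesis P_indic : forall A : set T, measurable A -> (mu A < +oo)%E -> P (cindic A).

Lemma P_sum (s : seq R) (A : R -> set T) :
  (forall y, y != 0 -> measurable (A y) /\ (mu (A y) < +oo)%E) ->
  P (fun x => (\sum_(y <- s) y * \1_(A y) x)%:C%C) /\
  sqi mu (fun x => (\sum_(y <- s) y * \1_(A y) x)%:C%C).
Proof.
move=> hA.
have P0 : P (fun=> 0) /\ sqi mu (fun=> 0).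
  rewrite -(_ : cindic set0 = fun=> 0); last by apply/funext => x; rewrite /cindic indic0.
  by split; [exact: P_set0|apply: sqi_cindic => //; rewrite measure0].
elim: s => [|y s [IH sIH]].
  by under eq_fun do rewrite big_nil; exact: P0.
have E : (fun x : T => (\sum_(z <- (y :: s)) z * \1_(A z) x)%:C%C) =
    (fun x => y%:C%C * cindic (A y) x + (\sum_(z <- s) z * \1_(A z) x)%:C%C).
  by apply/funext => x; rewrite big_cons rmorphD rmorphM.
(* The value 0 contributes nothing and has to be set apart, since its level set may have infinite
   measure. *)
have [y0|y0] := eqVneq y 0.
  by rewrite E y0; under eq_fun do rewrite rmorph0 mul0r add0r.
have [mA fA] := hA _ y0.
have s1 := sqi_cindic mA fA.
rewrite E; split.
  by apply: PD => //; [exact: sqiZ|apply: PZ => //; exact: P_indic].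
by apply: sqiD => //; exact: sqiZ.
Qed.

Import HBNNSimple.

Lemma P_ge0 (f : T -> R) : (forall x, 0 <= f x) -> sqi mu (fun x => (f x)%:C%C) ->
  P (fun x => (f x)%:C%C).
Proof.
move=> f0 sf; have [[mf _] f2] := sf.
have mfe : measurable_fun setT (EFin \o f) by exact/measurable_EFinP.
pose u := nnsfun_approx measurableT mfe.
have cu x : (u k x) @[k --> \oo] --> f x.
  have := @cvg_nnsfun_approx _ _ _ _ measurableT _ mfe (fun x _ => f0 x) x I.
  by move=> /fine_cvg.
have uf k x : u k x <= f x.
  have := @nd_nnsfun_approx _ _ _ _ measurableT _ mfe.
  rewrite -/u => nd; have ndx : nondecreasing_seq (fun k => u k x).
    by move=> a b ab; have /lefP := nd a b ab; exact.
  rewrite -(cvg_lim (@Rhausdorff R) (cu x)).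
  by apply: nondecreasing_cvgn_le ndx _ _; apply/cvg_ex; exists (f x); exact: cu.
have u0 k x : 0 <= u k x by exact: fun_ge0.
have if2 : (\int[mu]_x ((f x ^+ 2)%:E) < +oo)%E.
  rewrite (eq_integral (fun x => (cabs ((f x)%:C%C) ^+ 2)%:E)) => [//|x _].
  by rewrite cabsr ger0_norm.
have uE k : exists s : seq R, (fun x : T => (u k x)%:C%C) =
  (fun x => (\sum_(y <- s) y * \1_(u k @^-1` [set y]) x)%:C%C).
  by eexists; apply/funext => x; rewrite {1}(fimfunE (u k)) fsbig_finite.
(* Chebyshev: where [u k] takes the value y one has 0 <= y <= f, so y^2 times the measure of the
   level set is at most the integral of f^2. *)
have hA k y : y != 0 -> measurable (u k @^-1` [set y]) /\ (mu (u k @^-1` [set y]) < +oo)%E.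
  move=> y0; have mA : measurable (u k @^-1` [set y]).
    by rewrite -[X in measurable X]setTI; exact: measurable_funP.
  split=> //.
  have y2 : 0 < y ^+ 2 by rewrite exprn_even_gt0.
  have : ((y ^+ 2)%:E * mu (u k @^-1` [set y]) < +oo)%E.
    apply: le_lt_trans if2; rewrite -(setIT (u k @^-1` _)) -integral_indic//.
    rewrite -ge0_integralZl//.
    - apply: ge0_le_integral => //.
      + by move=> x _; rewrite -EFinM lee_fin mulr_ge0// ltW.
      + by apply: emeasurable_funM => //; exact/measurable_EFinP/measurable_indic.
      + exact/measurable_EFinP/measurable_funX.
      + move=> x _; rewrite -EFinM lee_fin indicE; case: (boolP (_ \in _)) => [|_].
          rewrite inE/= => <-; rewrite mulr1 ler_sqr ?nnegrE//.
        by rewrite mulr0 sqr_ge0.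
    - exact/measurable_EFinP/measurable_indic.
    - by rewrite lee_fin ltW.
  by apply: contraTT; rewrite -!leNgt !leye_eq => /eqP ->; rewrite gt0_muley ?lte_fin.
apply: (@P_lim (fun k x => (u k x)%:C%C) _ f) => //.
- by move=> k; have [s ->] := uE k; exact: (P_sum s (hA k)).1.
- by move=> k; have [s ->] := uE k; exact: (P_sum s (hA k)).2.
- move=> k x; rewrite -rmorphB cabsr distrC ger0_norm ?subr_ge0//.
  by rewrite lerBlDr lerDl.
- move=> x; under eq_fun do rewrite -rmorphB cabsr.
  rewrite -(@normr0 _ R) -(subrr (f x)); apply: cvg_norm.
  by apply: cvgB; [exact: cu|exact: cvg_cst].
Qed.

(** The positive and negative parts of Re f and Im f are dominated by |f|, hence square integrable.
    Both density results of the proof, for Gaussians and for dyadic step functions, come from this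
    induction. *)
Lemma sqi_ind_indic f : sqi mu f -> P f.
Proof.
move=> sf; have [[m1 m2] _] := sf.
have H (g : T -> R) : measurable_fun setT g -> (forall x, `|g x| <= cabs (f x)) ->
    sqi mu (fun x => (g x)%:C%C) /\ P (fun x => (g x)%:C%C).
  move=> mg gf.
  have K (h : T -> R) : measurable_fun setT h -> (forall x, 0 <= h x <= `|g x|) ->
      sqi mu (fun x => (h x)%:C%C) /\ P (fun x => (h x)%:C%C).
    move=> mh hg; have s1 : sqi mu (fun x => (h x)%:C%C).
      apply: (sqi_le (g := f)) => //; first exact: cmeasurable_real.
      move=> x; rewrite cabsr; have /andP[h0 h1] := hg x.
      by rewrite ger0_norm// (le_trans h1).
    by split=> //; apply: P_ge0 => // x; have /andP[] := hg x.
  have [sp Pp] : sqi mu (fun x => (Num.max (g x) 0)%:C%C) /\ P (fun x => (Num.max (g x) 0)%:C%C).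
    apply: K; first exact: measurable_maxr.
    move=> x; rewrite le_max lexx orbT ge_max normr_ge0 andbT.
    exact: ler_norm.
  have [sm Pm] : sqi mu (fun x => (Num.max (- g x) 0)%:C%C) /\ P (fun x => (Num.max (- g x) 0)%:C%C).
    apply: K; first by apply: measurable_maxr => //; exact: measurableT_comp.
    move=> x; rewrite le_max lexx orbT ge_max normr_ge0 andbT/=.
    by rewrite -normrN ler_norm.
  rewrite (_ : (fun _ => _) = (fun x => (Num.max (g x) 0)%:C%C + (-1) * (Num.max (- g x) 0)%:C%C)).
    split; first by apply: sqiD => //; exact: sqiZ.
    by apply: PD => //; [exact: sqiZ|exact: PZ].
  apply/funext => x; rewrite mulN1r -rmorphB; congr (_%:C)%C.
  by rewrite !maxEle oppr_le0; case: ltgtP => // [_|_|->]; rewrite ?subr0 ?sub0r ?opprK ?oppr0 ?subrr.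
have [s1 P1] := H _ m1 (fun x => ler_Re_cabs (f x)).
have [s2 P2] := H _ m2 (fun x => ler_Im_cabs (f x)).
rewrite (_ : f = (fun x => (Re (f x))%:C%C + 'i%C * (Im (f x))%:C%C)).
  by apply: PD => //; [exact: sqiZ|exact: PZ].
by apply/funext => x; rewrite -complexE.
Qed.

End SquareInductionIndic.

Section SquareInduction.
Context (R : realType) (n : nat).
Local Notation mu := (@leb R n).
Local Notation B := (borel_rV R n).
Local Notation T := (Rn R n).
Local Notation cindic := (@cindic _ T R).

Definition cube0 (N : nat) : set T := hbox (fun=> - N%:R) (fun=> N%:R : R).

Lemma measurable_hbox al be : measurable (hbox al be : set T).
Proof. by apply: measurable_borel; exact: borel_hbox. Qed.

Lemma leb_hbox_fin al be : (mu (hbox al be) < +oo)%E.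
Proof.
have [ab|/existsNP[i /negP]] := pselect (forall i, al i <= be i).
  by rewrite leb_hbox// ltry.
rewrite -ltNge => h; rewrite (_ : hbox al be = set0) ?measure0//.
rewrite -subset0 => x /(_ i) /andP[h1 h2].
by have := lt_le_trans h1 (le_trans h2 (ltW h)); rewrite ltxx.
Qed.

Lemma hboxI al be al' be' : hbox al be `&` hbox al' be' =
  hbox (fun i => Num.max (al i) (al' i)) (fun i => Num.min (be i) (be' i)) :> set 'rV[R]_n.
Proof.
apply/seteqP; split => [x [h h'] i|x h].
  by rewrite gt_max le_min; have /andP[-> ->] := h i; exact: h'.
split => i; have := h i; rewrite gt_max le_min.
  by move=> /andP[/andP[-> _] /andP[->]].
by move=> /andP[/andP[_ ->] /andP[_ ->]].
Qed.

Lemma cube0_cvg (x : 'rV[R]_n) : \forall N \near \oo, cube0 N x.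
Proof.
near=> N => i; apply/andP.
have : `|x ord0 i| < N%:R.
  have : \sum_j `|x ord0 j| < N%:R.
    near: N; exact: nbhs_infty_gtr.
  by apply: le_lt_trans; rewrite (bigD1 i)//= lerDl sumr_ge0.
by rewrite ltr_norml => /andP[-> /ltW ->].
Unshelve. all: by end_near. Qed.

Definition hboxes : set (set 'rV[R]_n) :=
  [set A | exists al be, A = hbox al be].

(** Each half-space x_i > a is a countable union of boxes, so the coordinates are measurable for the
    sigma-algebra that the boxes generate. *)
Lemma borel_hboxes : @measurable _ B = <<s hboxes >>.
Proof.
apply/seteqP; split; last first.
  apply: smallest_sub; first exact: sigma_algebra_measurable.
  by move=> _ [al [be ->]]; exact: borel_hbox.
pose G : measurableType _ := g_sigma_algebraType hboxes.
have mcoord i : measurable_fun [set: G] (fun x : 'rV[R]_n => x ord0 i).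
  apply: (measurability _ (RGenOInfty.measurableE R)).
  move=> _ [_ [a ->] <-]; rewrite setTI.
  rewrite (_ : _ @^-1` _ = \bigcup_N
     hbox (fun j => if j == i then a else - N%:R) (fun=> N%:R)).
    by apply: bigcup_measurable => N _; apply: sub_sigma_algebra; exists
      (fun j => if j == i then a else - N%:R), (fun=> N%:R).
  apply/seteqP; split => [x /=|x [N _ /(_ i)]]; last first.
    by rewrite eqxx /= in_itv/= andbT => /andP[].
  rewrite in_itv/= andbT => ax; have [N _ /(_ N (leqnn _)) hN] := cube0_cvg x.
  exists N => // j; have /andP[h1 h2] := hN j; rewrite h2 andbT.
  by case: eqP => [->|].
have mG : measurable_fun [set: G] (@rV_tuple R n).
  apply/measurable_fun_tnthP => i.
  rewrite (_ : _ \o _ = (fun x : 'rV[R]_n => x ord0 i)); first exact: mcoord.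
  by apply/funext => x /=; rewrite tnth_mktuple.
move=> _ [A mA <-]; exact: mG.
Qed.

(** By definition of the outer measure, A has Borel covers of measure at most mu A + 1/(k+1); their
    intersection is the envelope. It carries results from the Borel sets to the completion. *)
Lemma borel_envelope (A : set T) : measurable A -> (mu A < +oo)%E ->
  exists Bo : set T, [/\ measurable (Bo : set B), A `<=` Bo & mu (Bo `\` A) = 0%E].
Proof.
move=> mA Afin.
have Af : mu A \is a fin_num by rewrite ge0_fin_numE.
have covk (k : nat) : exists F : (set B)^nat, (forall j, measurable (F j)) /\
    A `<=` \bigcup_j F j /\ (mu (\bigcup_j F j : set T) <= mu A + (k.+1%:R^-1)%:E)%E.
  have k0 : (0 < k.+1%:R^-1 :> R)%R by rewrite invr_gt0 ltr0n.
  have [_ [F [mF AF] <-] ltF] := lb_ereal_inf_adherent k0 Af.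
  exists F; split=> //; split=> //; apply: le_trans (ltW ltF).
  apply: le_trans (@measure_sigma_subadditive _ R (Rn R n) mu _ F _ _ (@subset_refl _ _)) _.
  - by move=> j; exact: measurable_borel.
  - by apply: bigcup_measurable => j _; exact: measurable_borel.
  by apply: lee_nneseries => [//|j _]; rewrite leb_borel.
have [F hF] := choice covk.
pose Bo : set T := \bigcap_k \bigcup_j F k j.
have mBo : measurable (Bo : set B).
  apply: bigcapT_measurable => k.
  by apply: bigcup_measurable => j _; exact: (hF k).1.
have mBo' : measurable (Bo : set T) by exact: measurable_borel.
have ABo : A `<=` Bo by move=> x Ax k _; exact: (hF k).2.1.
exists Bo; split=> //.
have BoA : (mu Bo <= mu A)%E.
  apply/lee_addgt0Pr => e e0.
  have [k _ /(_ k (leqnn _)) ke] := near_infty_natSinv_lt (PosNum e0).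
  apply: le_trans (_ : (mu A + (k.+1%:R^-1)%:E <= _)%E); last first.
    by apply: leeD => //; rewrite lee_fin ltW.
  apply: le_trans ((hF k).2.2); apply: le_measure; rewrite ?inE//.
    by apply: bigcup_measurable => j _; apply: measurable_borel; exact: (hF k).1.
  by move=> x; exact.
have BoE : mu Bo = mu A.
  by apply/eqP; rewrite eq_le BoA/=; apply: le_measure; rewrite ?inE.
have IA : Bo `&` A = A by rewrite setIidr.
have BoF : (mu Bo < +oo)%E by rewrite BoE.
have := measureD mBo' mA BoF; rewrite IA => E.
by transitivity (mu A - mu A)%E; [rewrite -{1}BoE; exact: E|rewrite subee].
Qed.

Variable P : (T -> R[i]) -> Prop.
Hypothesis PD : forall f g, sqi mu f -> sqi mu g -> P f -> P g -> P (fun x => f x + g x).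
Hypothesis PZ : forall c f, sqi mu f -> P f -> P (fun x => c * f x).
Hypothesis PC : forall f, sqi mu f -> (forall e : R, 0 < e ->
  exists g, [/\ sqi mu g, P g & (sqn mu (fun x => f x - g x)%R <= e%:E)%E]) -> P f.
Hypothesis PB : forall al be, P (cindic (hbox al be)).

Let mcube N : measurable (cube0 N). Proof. exact: measurable_hbox. Qed.
Let fcube N : (mu (cube0 N) < +oo)%E. Proof. exact: leb_hbox_fin. Qed.

Let P0 : P (cindic set0).
Proof.
rewrite (_ : cindic set0 = (fun x => 0 * cindic (hbox (fun=> 0) (fun=> 0)) x)).
  apply: PZ; last exact: PB.
  by apply: sqi_cindic; [exact: measurable_hbox|exact: leb_hbox_fin].
by apply/funext => x; rewrite mul0r /cindic indic0.
Qed.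

(** Cutting with [cube0 N] keeps all measures finite, so that complements and countable disjoint
    unions stay within reach of [PD] and [P_bigcup]. *)
Let P_borel N (A : set T) : measurable (A : set B) -> P (cindic (A `&` cube0 N)).
Proof.
move=> mA.
have HG : <<s hboxes >> (A : set B) by rewrite -borel_hboxes.
move: A HG {mA}.
apply: (@dynkin_induction _ B hboxes (fun A => P (cindic (A `&` cube0 N)))).
- exact: borel_hboxes.
- by move=> _ _ [al [be ->]] [al' [be' ->]]; rewrite hboxI; eexists; eexists.
- by rewrite setTI; exact: PB.
- by move=> _ [al [be ->]]; rewrite /cube0 hboxI; exact: PB.
- move=> A mA PA.
  have mA' : measurable (A : set T) by exact: measurable_borel.
  rewrite (_ : cindic _ = (fun x => cindic (cube0 N) x + (-1) * cindic (A `&` cube0 N) x)).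
    have s1 : sqi mu (cindic (A `&` cube0 N)).
      exact: (sqi_sub (measurableI _ _ mA' (mcube N)) (mcube N) (@subIsetr _ _ _) (fcube N)).
    apply: PD; [exact: (sqi_cindic (mcube N) (fcube N))|exact: sqiZ|exact: PB|].
    exact: (PZ _ s1 PA).
  apply/funext => x; rewrite mulN1r /cindic -rmorphB; congr (_%:C)%C.
  rewrite !indicE !in_setI in_setC.
  by case: (x \in A); case: (x \in cube0 N); rewrite /= ?subrr ?subr0.
- move=> F mF tF PF; rewrite setI_bigcupl.
  have mF' k : measurable (F k `&` cube0 N : set T).
    by apply: (measurableI _ _ _ (mcube N)); exact: measurable_borel.
  have t1 : trivIset setT (fun k => F k `&` cube0 N : set T) by exact: trivIset_setIr.
  have t2 k : F k `&` cube0 N `<=` cube0 N by exact: subIsetr.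
  exact: (@P_bigcup _ T R mu P PD PC P0 (fun k => F k `&` cube0 N) (cube0 N)
    (mcube N) (fcube N) mF' t1 t2 PF).
Qed.

Let P_indic (A : set T) : measurable A -> (mu A < +oo)%E -> P (cindic A).
Proof.
move=> mA fA.
have mAN N : measurable (A `&` cube0 N) by exact: measurableI.
have fAN N : (mu (A `&` cube0 N) < +oo)%E.
  by apply: le_lt_trans fA; apply: le_measure; rewrite ?inE.
have PN N : P (cindic (A `&` cube0 N)).
  have [Bo [mBo ABo Bo0]] := borel_envelope (mAN N) (fAN N).
  have mBo' : measurable (Bo : set T) by exact: measurable_borel.
  have s1 : sqi mu (cindic (A `&` cube0 N)) by exact: (sqi_cindic (mAN N) (fAN N)).
  have s2 : sqi mu (cindic (Bo `&` cube0 N)).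
    exact: (sqi_sub (measurableI _ _ mBo' (mcube N)) (mcube N) (@subIsetr _ _ _) (fcube N)).
  apply: (P_ae PC s1 s2 _ (P_borel N mBo)).
  exists (Bo `\` (A `&` cube0 N)); split; [exact: (measurableD mBo' (mAN N))|exact: Bo0|].
  move=> x /= h; apply: contrapT => h'; apply: h.
  rewrite /cindic !indicE; congr (_%:R%:C)%C.
  have [xA|xA] := pselect ((A `&` cube0 N) x).
    by rewrite !mem_set//; split; [exact: ABo|exact: (proj2 xA)].
  rewrite !memNset// => -[xB xC]; exact: h'.
apply: (P_lim PC (u := fun N => cindic (A `&` cube0 N)) (g := \1_A)).
- exact: PN.
- by move=> N; exact: (sqi_cindic (mAN N) (fAN N)).
- exact: (sqi_cindic mA fA).
- exact: measurable_indic.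
- exact: (int_indic2 mA fA).
- move=> k x; rewrite cabs_cindicB. rewrite [X in `|X - _|]indicE !indicE in_setI.
  by case: (x \in A); case: (x \in _); rewrite /= ?subrr ?subr0 ?sub0r ?normrN ?normr1 ?normr0.
- move=> x; apply: cvg_near_cst.
  apply: filterS (cube0_cvg x) => N xN; rewrite cabs_cindicB !indicE in_setI.
  by rewrite (mem_set xN) andbT subrr normr0.
Qed.

(* Pi-lambda theorem for bounded Borel sets, then completion, then simple functions. *)
Lemma sqi_ind f : sqi mu f -> P f.
Proof. exact: (sqi_ind_indic PD PZ PC P0 P_indic). Qed.

End SquareInduction.

(** * Gaussians and their Fourier transforms *)

Section RealLine.
Context (R : realType).
Local Notation lam := (@lebesgue_measure R).
Implicit Types l c b x t xi : R.

(* The decay condition makes the boundary terms of [-N, N] vanish. *)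
Lemma Rintegral_derive0 (F f : R -> R) (A : R) : continuous f ->
  (forall x : R, is_derive x 1 F (f x)) -> lam.-integrable setT (EFin \o f) ->
  (forall x, `|F x| * `|x| <= A) -> \int[lam]_x f x = 0.
Proof.
move=> cf dF fi FA.
pose f_ (N : nat) := (EFin \o f) \_ `[- N.+1%:R, N.+1%:R]%classic.
have mf : measurable_fun setT (EFin \o f) by exact: measurable_int fi.
have cF : continuous F.
  by move=> x; apply/differentiable_continuous/derivable1_diffP; case: (dF x).
have [|||||_ _ h] := @dominated_convergence _ _ _ lam setT measurableT f_ (EFin \o f)
    (abse \o (EFin \o f)).
- by move=> N; apply/(measurable_restrictT _ (measurable_itv _)); apply: (measurable_funS _ _ mf).
- by [].
- apply: aeW => x _; apply: cvg_near_cst.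
  have : \forall N \near \oo, `|x| < N%:R by exact: nbhs_infty_gtr.
  apply: filterS => N; rewrite ltr_norml => /andP[h1 h2].
  rewrite /f_ /patch mem_set//= in_itv/= -natr1.
  by apply/andP; split; lra.
- exact: integrable_abse.
- by apply: aeW => x N _; rewrite /f_ /patch /=; case: ifP => // _; rewrite [leLHS](_ : _ = 0%E) ?lee_fin//; exact: abse0.
have E N : (\int[lam]_x f_ N x = (F N.+1%:R - F (- N.+1%:R))%:E)%E.
  rewrite /f_ -integral_mkcond/=.
  have N0 : - N.+1%:R < N.+1%:R :> R.
    by rewrite -subr_gt0 opprK -natrD ltr0n.
  rewrite (@continuous_FTC2 _ f F)//.
  - exact: continuous_subspaceT.
  - split=> [x _||]; [by case: (dF x)|exact/cvg_at_right_filter/cF|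
      exact/cvg_at_left_filter/cF].
  - by move=> x _; rewrite derive1E; have [_ ->] := dF x.
have F0 : (F N.+1%:R - F (- N.+1%:R)) @[N --> \oo] --> (0 : R).
  apply: (@squeeze_cvgr _ _ _ _ (fun N : nat => - (2 * A * N.+1%:R^-1)) (fun N : nat => 2 * A * N.+1%:R^-1)).
  - apply: nearW => N; rewrite -ler_norml.
    have N0 : 0 < N.+1%:R :> R by rewrite ltr0n.
    have h1 := FA N.+1%:R; have h2 := FA (- N.+1%:R).
    rewrite normrN in h2; rewrite (ger0_norm (ltW N0)) -ler_pdivlMr// in h1.
    rewrite (ger0_norm (ltW N0)) -ler_pdivlMr// in h2.
    rewrite (le_trans (ler_normB _ _))// -mulrA mulr_natl mulr2n.
    by apply: lerD.
  - rewrite -oppr0 -(mulr0 (2 * A)); apply: cvgN; apply: cvgM; first exact: cvg_cst.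
    exact: cvg_harmonic.
  - rewrite -(mulr0 (2 * A)); apply: cvgM; first exact: cvg_cst.
    exact: cvg_harmonic.
rewrite /Rintegral -[RHS]/(fine 0%:E); congr fine.
apply/esym/(cvg_unique _ _ h); first exact: ereal_hausdorff.
rewrite (_ : [sequence _]_n = EFin \o (fun N => F N.+1%:R - F (- N.+1%:R))); last first.
  by apply/funext => N /=; rewrite E.
by apply: cvg_EFin; [exact: nearW|exact: F0].
Qed.

(** [l] is the precision, the inverse of the variance: products of Gaussians add precisions and the
    Fourier transform inverts them. *)
Definition gexp (l c x : R) : R := expR (- (l * (x - c) ^+ 2 / 2)).

Lemma gexp_ge0 l c x : 0 <= gexp l c x. Proof. exact: expR_ge0. Qed.

Lemma is_derive_gexp l c x : is_derive x 1 (gexp l c) (- (l * (x - c)) * gexp l c x).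
Proof.
have dq : is_derive x 1 (fun x => - (l * (x - c) ^+ 2 / 2)) (- (l * (x - c))).
  rewrite (_ : (fun _ => _) = (- (l / 2)) *: ((id - cst c) ^+ 2)); last first.
    apply/funext => y; rewrite -[RHS]/(- (l / 2) * ((y - c) * (y - c))).
    by rewrite expr2; field.
  apply: is_derive_eq; rewrite /GRing.scale/= -[(id - cst c) x]/(x - c).
  by rewrite expr1 subr0 mulr1; field.
by have := is_derive1_comp (is_derive_expR _) dq; rewrite mulrC.
Qed.

Lemma continuous_gexp l c : continuous (gexp l c).
Proof.
move=> x; apply/differentiable_continuous/derivable1_diffP.
by case: (is_derive_gexp l c x).
Qed.

Lemma measurable_gexp l c : measurable_fun setT (gexp l c).
Proof. by apply: continuous_measurable_fun; exact: continuous_gexp. Qed.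

Lemma gexp_normal l c : 0 < l ->
  gexp l c = normal_fun c (Num.sqrt l^-1).
Proof.
move=> l0; apply/funext => x; rewrite /gexp /normal_fun.
rewrite sqr_sqrtr ?invr_ge0 ?ltW//; congr expR.
by rewrite -mulr_natr; field; exact: lt0r_neq0.
Qed.

Lemma integrable_gexp l c : 0 < l -> lam.-integrable setT (EFin \o gexp l c).
Proof.
move=> l0; have s0 : Num.sqrt l^-1 != 0 by rewrite gt_eqF// sqrtr_gt0 invr_gt0.
have p0 := normal_peak_gt0 s0.
have := @integrable_normal_pdf R c (Num.sqrt l^-1).
move=> /(integrableZl measurableT (normal_peak (Num.sqrt l^-1))^-1).
rewrite (_ : (fun x => _) = EFin \o gexp l c)//.
by apply/funext => x /=; rewrite normal_pdfE// -EFinM mulKf ?gt_eqF// gexp_normal.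
Qed.

Lemma Rintegral_gexp l c : 0 < l -> \int[lam]_x gexp l c x = Num.sqrt (2 * pi / l).
Proof.
move=> l0; have s0 : Num.sqrt l^-1 != 0 by rewrite gt_eqF// sqrtr_gt0 invr_gt0.
have p0 := normal_peak_gt0 s0.
have h : \int[lam]_x normal_pdf c (Num.sqrt l^-1) x = 1.
  by rewrite /Rintegral integral_normal_pdf.
rewrite normal_pdfE// RintegralZl//= in h; last first.
  by have := integrable_gexp c l0; rewrite gexp_normal.
rewrite gexp_normal//; apply: (mulfI (lt0r_neq0 p0)).
rewrite h /normal_peak sqr_sqrtr ?invr_ge0 ?ltW//.
rewrite (_ : l^-1 * pi *+ 2 = 2 * pi / l) ?mulVf//; last by rewrite -mulr_natl; ring.
by rewrite gt_eqF// sqrtr_gt0 divr_gt0// mulr_gt0// pi_gt0.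
Qed.

(* y <= 1 + l y^2/4 up to constants, absorbed by half of the Gaussian *)
Lemma gexp_lin l c : 0 < l -> exists2 K : R, 0 <= K &
  forall x, `|x - c| * gexp l c x <= K * gexp (l / 2) c x.
Proof.
move=> l0; exists (1 + 4 / l); first by rewrite addr_ge0// divr_ge0// ltW.
move=> x; set y := x - c.
have -> : gexp l c x = gexp (l / 2) c x * expR (- (l * y ^+ 2 / 4)).
  by rewrite /gexp -expRD; congr expR; rewrite -/y; field.
rewrite mulrCA mulrC ler_wpM2r ?gexp_ge0// expRN ler_pdivrMr ?expR_gt0//.
have h1 := expR_ge1Dx (l * y ^+ 2 / 4).
have k0 : 0 < 1 + 4 / l by rewrite ltr_wpDr// divr_ge0// ltW.
apply: le_trans (ler_wpM2l (ltW k0) h1).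
have -> : (1 + 4 / l) * (1 + l * y ^+ 2 / 4) = 1 + y ^+ 2 + (4 / l + l * y ^+ 2 / 4).
  by field; rewrite gt_eqF.
have h2 : `|y| <= 1 + y ^+ 2.
  by rewrite -(real_normK (num_real y)); have := sqr_ge0 (`|y| - 1); nra.
have h3 : 0 <= 4 / l by rewrite divr_ge0// ltW.
have h4 : 0 <= l * y ^+ 2 / 4 by rewrite divr_ge0// mulr_ge0 ?sqr_ge0// ltW.
by apply: le_trans h2 _; rewrite lerDl addr_ge0.
Qed.

Lemma gexp_le1 l c x : 0 <= l -> gexp l c x <= 1.
Proof. by move=> l0; rewrite -expR0 ler_expR oppr_le0 divr_ge0// mulr_ge0// sqr_ge0. Qed.

Section GaussFourier.
Variables (l c th : R).
Hypothesis l0 : 0 < l.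

Let ph (t x : R) := t * (x - c) + th.
Let f (t x : R) := gexp l c x * cos (ph t x).
Let g (t x : R) := (x - c) * gexp l c x * sin (ph t x).

Let cph t : continuous (ph t).
Proof.
move=> x; apply: cvgD; last exact: cvg_cst.
by apply: cvgM; [exact: cvg_cst|apply: cvgB; [exact: cvg_id|exact: cvg_cst]].
Qed.

Let cf t : continuous (f t).
Proof.
move=> x; apply: cvgM; first exact: continuous_gexp.
by apply: continuous_comp; [exact: cph|exact: continuous_cos].
Qed.

Let cg t : continuous (g t).
Proof.
move=> x; apply: cvgM; last by apply: continuous_comp; [exact: cph|exact: continuous_sin].
apply: cvgM; last exact: continuous_gexp.
by apply: cvgB; [exact: cvg_id|exact: cvg_cst].
Qed.

Let fi t : lam.-integrable setT (EFin \o f t).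
Proof.
apply: (le_integrable measurableT _ _ (integrable_gexp c l0)).
  apply/measurable_EFinP; apply: continuous_measurable_fun; exact: cf.
move=> x _; rewrite /= lee_fin normrM ler_piMr// ler_norml cos_geN1 cos_le1//.
Qed.

Let gi t : lam.-integrable setT (EFin \o g t).
Proof.
have [K K0 hK] := gexp_lin c l0.
have l20 : 0 < l / 2 by rewrite divr_gt0.
have := integrableZl measurableT K (integrable_gexp c l20).
apply: le_integrable => //; first by apply/measurable_EFinP; apply: continuous_measurable_fun; exact: cg.
move=> x _; rewrite /= lee_fin !normrM (ger0_norm K0) !(ger0_norm (gexp_ge0 _ _ _)).
apply: le_trans (hK x); rewrite ler_piMr// ?mulr_ge0 ?gexp_ge0//.
by rewrite ler_norml sin_geN1 sin_le1.
Qed.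

Let dph (t x : R) : is_derive t 1 (ph^~ x) (x - c).
Proof.
rewrite (_ : ph^~ x = (x - c) *: id + cst th); last first.
  by apply/funext => s; rewrite /ph mulrC.
by apply: is_derive_eq; rewrite addr0 /GRing.scale/= mulr1.
Qed.

Let dphx (t x : R) : is_derive x 1 (ph t) t.
Proof.
rewrite (_ : ph t = t *: (id - cst c) + cst th); last first.
  by apply/funext => s.
by apply: is_derive_eq; rewrite subr0 addr0 /GRing.scale/= mulr1.
Qed.

Let df (t x : R) : is_derive t 1 (f^~ x) (- g t x).
Proof.
have h := is_derive1_comp (is_derive_cos _) (dph t x).
rewrite (_ : f^~ x = gexp l c x *: (cos \o ph^~ x))//.
by apply: is_derive_eq; rewrite /GRing.scale/= /g; ring.
Qed.

Let J t := \int[lam]_x f t x.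

(** Differentiation under the integral gives minus the integral of [g]. The derivative of the
    Gaussian times the sine is - l g + t f and integrates to 0, which turns this into - (t / l)
    J. *)
Let dJ (t : R) : is_derive t 1 J (- (t / l) * J t).
Proof.
have [K K0 hK] := gexp_lin c l0.
have l20 : 0 < l / 2 by rewrite divr_gt0.
pose G x := K * gexp (l / 2) c x.
have G0 x : 0 <= G x by rewrite mulr_ge0// gexp_ge0.
have iG : lam.-integrable setT (EFin \o G).
  by have := integrableZl measurableT K (integrable_gexp c l20).
have It : t \in `]t - 1, t + 1[ by rewrite in_itv/=; apply/andP; split; lra.
have d1 s x : partial1of2 f s x = - g s x.
  by rewrite partial1of2E; have [_ ->] := df s x.
have Gub s x : `]t - 1, t + 1[%classic s -> setT x -> `|partial1of2 f s x| <= G x.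
  move=> _ _; rewrite d1 normrN /g !normrM (ger0_norm (gexp_ge0 _ _ _)).
  apply: le_trans (hK x); rewrite ler_piMr// ?mulr_ge0 ?gexp_ge0//.
  by rewrite ler_norml sin_geN1 sin_le1.
have dfd s x : `]t - 1, t + 1[%classic s -> setT x -> derivable (f^~ x) s 1.
  by move=> _ _; case: (df s x).
have h1 := derivable_under_integral measurableT It (fun s _ => fi s) dfd G0 iG Gub.
have h2 := differentiation_under_integral measurableT It (fun s _ => fi s) dfd G0 iG Gub.
apply: DeriveDef => //; rewrite -derive1E h2.
have ig := gi t.
transitivity (- (\int[lam]_x g t x)).
  rewrite -mulN1r -RintegralZl//; apply: eq_Rintegral => x _.
  by rewrite d1 mulN1r.
have dh x : is_derive x 1 (fun x => gexp l c x * sin (ph t x)) (- l * g t x + t * f t x).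
  have e1 := is_derive_gexp l c x.
  have e2 := is_derive1_comp (is_derive_sin _) (dphx t x).
  rewrite (_ : (fun _ => _) = gexp l c * (sin \o ph t))//.
  by apply: is_derive_eq; rewrite /GRing.scale/= /g /f; ring.
have i1 : lam.-integrable setT (EFin \o (fun x => - l * g t x)).
  by have := integrableZl measurableT (- l) (gi t).
have i2 : lam.-integrable setT (EFin \o (fun x => t * f t x)).
  by have := integrableZl measurableT t (fi t).
have := @Rintegral_derive0 _ _ (K + `|c|) _ dh.
rewrite RintegralD// !RintegralZl//.
have -> : (- l * (\int[lam]_x g t x) + t * (\int[lam]_x f t x) = 0) =
  (- (\int[lam]_x g t x) = - (t / l) * J t).
  apply/propext; rewrite /J; split => h.
    apply: (mulfI (lt0r_neq0 l0)); apply/eqP; rewrite -subr_eq0 -h; apply/eqP.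
    by field; rewrite gt_eqF.
  rewrite mulNr -mulrN h; field; exact: lt0r_neq0.
apply.
- move=> x; apply: cvgD; apply: cvgM; [exact: cvg_cst|exact: cg|exact: cvg_cst|exact: cf].
- have := integrableD measurableT i1 i2; by [].
- move=> x; rewrite normrM (ger0_norm (gexp_ge0 _ _ _)).
  have s1 : `|sin (ph t x)| <= 1 by rewrite ler_norml sin_geN1 sin_le1.
  apply: (@le_trans _ _ (gexp l c x * `|x|)).
    by rewrite ler_wpM2r// ler_piMr// gexp_ge0.
  rewrite -{2}(subrK c x); apply: (@le_trans _ _ (gexp l c x * (`|x - c| + `|c|))).
    by rewrite ler_wpM2l ?gexp_ge0// ler_normD.
  rewrite mulrDr; apply: lerD.
    rewrite mulrC; apply: le_trans (hK x) _; rewrite ler_piMr// gexp_le1// ltW//.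
  by rewrite ler_piMl// gexp_le1// ltW.
Qed.

(** The differential equation makes J times exp (t^2 / (2 l)), written [gexp (- l^-1) 0], constant.
    The phase [th] is there so that sine integrals are covered as well. *)
Lemma Rintegral_gexp_cos t :
  \int[lam]_x (gexp l c x * cos (t * (x - c) + th)) =
  cos th * Num.sqrt (2 * pi / l) * expR (- (t ^+ 2 / (2 * l))).
Proof.
pose H s := J s * gexp (- l^-1) 0 s.
have dH (s : R) : is_derive s 1 H 0.
  have e1 := is_derive_gexp (- l^-1) 0 s.
  have e2 := dJ s.
  rewrite (_ : H = J * gexp (- l^-1) 0)//.
  by apply: is_derive_eq; rewrite /GRing.scale/=; field; rewrite gt_eqF.
have Hc s : H s = H 0 by apply: is_derive_0_is_cst.
have J0 : J 0 = cos th * Num.sqrt (2 * pi / l).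
  rewrite /J /f /ph; under eq_Rintegral do rewrite mul0r add0r mulrC.
  by rewrite RintegralZl ?Rintegral_gexp//; exact: integrable_gexp.
have := Hc t; rewrite /H {2}/gexp subr0 expr0n/= mulr0 mul0r oppr0 expR0 mulr1 J0.
rewrite -[X in X = _ -> _]/(J t * _) -/(J t) => <-.
rewrite -mulrA -expRD (_ : _ + _ = 0) ?expR0 ?mulr1//.
by rewrite subr0; field; rewrite gt_eqF.
Qed.

End GaussFourier.

Definition gatom (l c b x : R) : R[i] := (gexp l c x)%:C%C * cis (b * x).

Lemma cabs_gatom l c b x : cabs (gatom l c b x) = gexp l c x.
Proof. by rewrite cabsM cabs_cis mulr1 cabsr ger0_norm// gexp_ge0. Qed.

Lemma cmeasurable_gatom l c b : cmeasurable (gatom l c b : measurableTypeR R -> R[i]).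
Proof.
apply: cmeasurable_mul; first by apply: cmeasurable_real; exact: measurable_gexp.
by apply: cmeasurable_cis; apply: measurable_funM.
Qed.

Lemma cintegrable_gatom l c b : 0 < l -> cintegrable lam (gatom l c b).
Proof.
move=> l0; apply: (cintegrable_dom (cmeasurable_gatom l c b) (integrable_gexp c l0)).
by move=> x; rewrite cabs_gatom /= ger0_norm// gexp_ge0.
Qed.

(** Centre and frequency are exchanged up to a sign and the precision is inverted. With t = b - xi
    the phase is t (x - c) + t c, so [Rintegral_gexp_cos] applies with th = t c for the real part
    and th = t c - pi / 2 for the imaginary part. *)
Lemma gatom_fourier l c b xi : 0 < l ->
  cint lam (fun x => gatom l c b x * cis (- (x * xi))) =
  (Num.sqrt (2 * pi / l))%:C%C * cis (b * c) * gatom l^-1 b (- c) xi.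
Proof.
move=> l0.
have E (x : R) : gatom l c b x * cis (- (x * xi)) =
    (gexp l c x)%:C%C * cis ((b - xi) * (x - c) + (b - xi) * c).
  by rewrite /gatom -mulrA -cisD; congr (_ * cis _); ring.
have sE (u : R) : sin u = cos (u - pi / 2).
  by rewrite cosB cos_pihalf sin_pihalf mulr0 add0r mulr1.
set t := b - xi.
have -> : gatom l^-1 b (- c) xi = (expR (- (t ^+ 2 / (2 * l))))%:C%C * cis (- c * xi).
  by congr (_%:C%C * _); congr expR; rewrite /t; field; rewrite gt_eqF.
rewrite mulrAC mulrA -mulrA -cisD.
have -> : - c * xi + b * c = t * c by rewrite /t; ring.
rewrite -rmorphM (eq_cint lam E); apply: cext.
  rewrite /cint /= mul0r subr0.
  under eq_Rintegral do rewrite mul0r subr0.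
  by rewrite Rintegral_gexp_cos// -/t; ring.
rewrite /cint /= mul0r addr0.
under eq_Rintegral do rewrite mul0r addr0 sE -addrA.
by rewrite Rintegral_gexp_cos// -sE -/t; ring.
Qed.

End RealLine.

(** * Gaussians as Schwartz functions *)

Section PartialDerivatives.
Context (R : realType) (n : nat).
Local Notation V := 'rV[R]_n.
Local Notation e_ i := (delta_mx ord0 i : V).
Implicit Types (f g h : V -> R).

Definition has_partials h (x : V) (dh : 'I_n -> R) : Prop :=
  differentiable (h : V -> R^o) x /\ forall i, 'D_(e_ i) (h : V -> R^o) x = dh i.

Lemma has_partials_cst (k : R) x : has_partials (fun=> k) x (fun=> 0).
Proof. by split=> [|i]; [exact: differentiable_cst|exact: derive_cst]. Qed.

Lemma has_partials_coord i x :
  has_partials (fun x : V => x ord0 i) x (fun j => (j == i)%:R).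
Proof.
split=> [|j]; first exact: (differentiable_coord x ord0 i).
rewrite /derive; apply: cvg_lim => //.
apply: (@cvg_trans _ ((cst (j == i)%:R : R -> R) @ 0^')); last exact: cvg_cst.
apply: near_eq_cvg; near=> t.
rewrite /= !mxE eqxx/= addrK eq_sym -[RHS]/(t^-1 * (t * (i == j)%:R)) mulKf//.
near: t; exact: nbhs_dnbhs_neq.
Unshelve. all: by end_near. Qed.

Lemma has_partialsD f g x df dg : has_partials f x df -> has_partials g x dg ->
  has_partials (fun x => f x + g x) x (fun i => df i + dg i).
Proof.
move=> [f1 f2] [g1 g2]; split=> [|i]; first exact: differentiableD.
by rewrite -f2 -g2; apply: deriveD; exact: diff_derivable.
Qed.

Lemma has_partialsM f g x df dg : has_partials f x df -> has_partials g x dg ->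
  has_partials (fun x => f x * g x) x (fun i => f x * dg i + g x * df i).
Proof.
move=> [f1 f2] [g1 g2]; split=> [|i]; first exact: differentiableM.
by rewrite -f2 -g2; apply: deriveM; exact: diff_derivable.
Qed.

Lemma has_partialsZ k f x df : has_partials f x df ->
  has_partials (fun x => k * f x) x (fun i => k * df i).
Proof.
move=> hf; have [h1 h2] := has_partialsM (has_partials_cst k x) hf.
by split=> // i; rewrite h2 mulr0 addr0.
Qed.

Lemma has_partials_sum (I : Type) (s : seq I) (F : I -> V -> R) x (dF : I -> 'I_n -> R) :
  (forall j, has_partials (F j) x (dF j)) ->
  has_partials (fun x => \sum_(j <- s) F j x) x (fun i => \sum_(j <- s) dF j i).
Proof.
move=> hF; elim: s => [|j s IH].
  under eq_fun do rewrite big_nil; have [h1 h2] := has_partials_cst 0 x.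
  by split=> // i; rewrite h2 big_nil.
under eq_fun do rewrite big_cons; have [h1 h2] := has_partialsD (hF j) IH.
by split=> // i; rewrite h2 big_cons.
Qed.

Lemma has_partials_comp (u : R -> R) (du : R) f x df : is_derive (f x) 1 u du ->
  has_partials f x df -> has_partials (fun x => u (f x)) x (fun i => du * df i).
Proof.
move=> [u1 u2] [f1 f2].
have du1 : differentiable u (f x) by apply/derivable1_diffP.
have dc : differentiable (u \o f : V -> R^o) x by exact: differentiable_comp.
split=> // i; have e1 : 'd f x (e_ i) = df i by rewrite -f2 deriveE.
rewrite -[X in 'D__ X _]/(u \o f) deriveE// diff_comp//= e1.
by rewrite deriv1E//= derive1E u2 mulrC.
Qed.

Lemma has_partials_eq f x df df' : has_partials f x df -> df =1 df' ->
  has_partials f x df'.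
Proof. by move=> h /funext <-. Qed.

Definition gq (l c : 'I_n -> R) (x : V) : R :=
  \sum_i (- (l i * (x ord0 i - c i) ^+ 2 / 2)).

Definition gphase (b : 'I_n -> R) (x : V) : R := \sum_i b i * x ord0 i.

Lemma has_partials_gexp l c x :
  has_partials (fun x => expR (gq l c x)) x
    (fun i => - l i * (x ord0 i - c i) * expR (gq l c x)).
Proof.
have hq : has_partials (gq l c) x
    (fun i => \sum_j - (l j * (x ord0 j - c j)) * (i == j)%:R).
  apply: has_partials_sum => j.
  apply: (has_partials_comp (u := fun t => - (l j * (t - c j) ^+ 2 / 2)));
    last exact: has_partials_coord.
  rewrite (_ : (fun _ => _) = (- (l j / 2)) *: ((id - cst (c j)) ^+ 2)); last first.
    apply/funext => y; rewrite -[RHS]/(- (l j / 2) * ((y - c j) * (y - c j))).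
    by rewrite expr2; field.
  apply: is_derive_eq; rewrite /GRing.scale/= -[(id - cst (c j)) _]/(x ord0 j - c j).
  by rewrite expr1 subr0 mulr1; field.
have he := has_partials_comp (is_derive_expR _) hq.
apply: has_partials_eq he _ => i.
rewrite (bigD1 i)//= eqxx mulr1 big1 ?addr0; last first.
  by move=> j /negPf ji; rewrite eq_sym ji mulr0.
by ring.
Qed.

Lemma has_partials_trig (u u' : R -> R) b x :
  (forall t : R, is_derive t 1 u (u' t)) ->
  has_partials (fun x => u (gphase b x)) x (fun i => u' (gphase b x) * b i).
Proof.
move=> du.
have hq : has_partials (gphase b) x (fun i => \sum_j b j * (i == j)%:R).
  by apply: has_partials_sum => j; apply: has_partialsZ; exact: has_partials_coord.
have he := has_partials_comp (du _) hq.
apply: has_partials_eq he _ => i; congr (_ * _).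
rewrite (bigD1 i)//= eqxx mulr1 big1 ?addr0// => j /negPf ji.
by rewrite eq_sym ji mulr0.
Qed.

(* Unlike the modulated Gaussians, this class is stable under partial derivatives. *)
Inductive polygauss : (V -> R) -> Prop :=
| polygauss_cos l c b : (forall i, 0 < l i) ->
    polygauss (fun x => expR (gq l c x) * cos (gphase b x))
| polygauss_sin l c b : (forall i, 0 < l i) ->
    polygauss (fun x => expR (gq l c x) * sin (gphase b x))
| polygauss_coord i h : polygauss h -> polygauss (fun x => x ord0 i * h x)
| polygauss_scale k h : polygauss h -> polygauss (fun x => k * h x)
| polygauss_add g h : polygauss g -> polygauss h -> polygauss (fun x => g x + h x).

Lemma polygauss_partials h : polygauss h -> exists dh : 'I_n -> V -> R,
  (forall i, polygauss (dh i)) /\ forall x, has_partials h x (dh^~ x).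
Proof.
have affine (i : 'I_n) (k1 k2 : R) h' : polygauss h' -> polygauss (fun x => k1 * (x ord0 i * h' x) + k2 * h' x).
  by move=> ph'; apply: polygauss_add; apply: polygauss_scale => //; exact: polygauss_coord.
elim=> [l c b l0|l c b l0|i {}h ph [dh [p1 p2]]|k {}h ph [dh [p1 p2]]|
    g {}h pg [dg [q1 q2]] ph [dh [p1 p2]]].
- exists (fun i (x : V) => (- l i * (x ord0 i * (expR (gq l c x) * cos (gphase b x))) +
     l i * c i * (expR (gq l c x) * cos (gphase b x))) +
     - b i * (expR (gq l c x) * sin (gphase b x))); split.
    move=> i; apply: polygauss_add; first by apply: affine; exact: polygauss_cos.
    by apply: polygauss_scale; exact: polygauss_sin.
  move=> x; apply: has_partials_eq (has_partialsM (has_partials_gexp l c x)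
    (has_partials_trig b x (@is_derive_cos R))) _ => i.
  by ring.
- exists (fun i (x : V) => (- l i * (x ord0 i * (expR (gq l c x) * sin (gphase b x))) +
     l i * c i * (expR (gq l c x) * sin (gphase b x))) +
     b i * (expR (gq l c x) * cos (gphase b x))); split.
    move=> i; apply: polygauss_add; first by apply: affine; exact: polygauss_sin.
    by apply: polygauss_scale; exact: polygauss_cos.
  move=> x; apply: has_partials_eq (has_partialsM (has_partials_gexp l c x)
    (has_partials_trig b x (@is_derive_sin R))) _ => i.
  by ring.
- exists (fun j (x : V) => x ord0 i * dh j x + (j == i)%:R * h x); split.
    by move=> j; apply: polygauss_add; [exact: polygauss_coord|exact: polygauss_scale].
  move=> x; apply: has_partials_eq (has_partialsM (has_partials_coord i x) (p2 x)) _ => j.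
  by rewrite [h x * _]mulrC.
- exists (fun j (x : V) => k * dh j x); split; first by move=> j; exact: polygauss_scale.
  by move=> x; exact: has_partialsZ.
- exists (fun j (x : V) => dg j x + dh j x); split; first by move=> j; exact: polygauss_add.
  by move=> x; exact: has_partialsD.
Qed.

(** Each factor |x| is absorbed by halving the precision, hence the induction for all [l]. *)
Lemma gexp_exp (l c : R) (k : nat) : 0 < l -> exists2 M : R, 0 <= M &
  forall x : R, `|x| ^+ k * gexp l c x <= M.
Proof.
elim: k l => [|k IH] l l0.
  by exists 1 => // x; rewrite expr0 mul1r gexp_le1// ltW.
have l20 : 0 < l / 2 by rewrite divr_gt0.
have [M M0 hM] := IH _ l20; have [K K0 hK] := gexp_lin c l0.
exists (M * (K + `|c|)); first by rewrite mulr_ge0// addr_ge0.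
move=> x; have e1 : gexp l c x <= gexp (l / 2) c x.
  rewrite ler_expR lerN2 ler_pM2r ?invr_gt0// ler_wpM2r ?sqr_ge0//.
  by move: l0; lra.
have e2 : `|x| * gexp l c x <= (K + `|c|) * gexp (l / 2) c x.
  apply: (@le_trans _ _ ((`|x - c| + `|c|) * gexp l c x)).
    by rewrite ler_wpM2r ?gexp_ge0// -{1}(subrK c x) ler_normD.
  by rewrite !mulrDl lerD// ler_wpM2l.
rewrite exprSr -mulrA; apply: le_trans (ler_wpM2l (exprn_ge0 _ (normr_ge0 x)) e2) _.
rewrite mulrCA mulrC ler_wpM2r ?addr_ge0//; exact: hM.
Qed.

Lemma expR_gq l c x : expR (gq l c x) = \prod_i gexp (l i) (c i) (x ord0 i).
Proof. by rewrite expR_sum. Qed.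

(** A coordinate factor of h is moved into the monomial, where it raises one exponent; so the
    induction has to run over all exponents at once. *)
Lemma polygauss_bound h : polygauss h -> forall al : 'I_n -> nat,
  exists M : R, forall x : V, `|(\prod_i x ord0 i ^+ al i) * h x| <= M.
Proof.
have base l c (u : V -> R) : (forall i, 0 < l i) -> (forall x, `|u x| <= 1) ->
    forall al : 'I_n -> nat, exists M : R, forall x : V,
    `|(\prod_i x ord0 i ^+ al i) * (expR (gq l c x) * u x)| <= M.
  move=> l0 u1 al.
  have /choice[M hM] : forall i, exists M : R, 0 <= M /\
      forall x : R, `|x| ^+ al i * gexp (l i) (c i) x <= M.
    by move=> i; have [M] := gexp_exp (c i) (al i) (l0 i); exists M.
  exists (\prod_i M i) => x.
  apply: (@le_trans _ _ `|(\prod_i x ord0 i ^+ al i) * expR (gq l c x)|).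
    by rewrite mulrA normrM ler_piMr.
  rewrite expR_gq -big_split/= normr_prod; apply: ler_prod => i _.
  rewrite normr_ge0/= normrM normrX (ger0_norm (gexp_ge0 _ _ _)).
  exact: (hM i).2.
elim=> [l c b l0|l c b l0|i {}h ph IH|k {}h ph IH|g {}h pg IHg ph IH] al.
- by apply: base => // x; rewrite ler_norml cos_geN1 cos_le1.
- by apply: base => // x; rewrite ler_norml sin_geN1 sin_le1.
- have [M hM] := IH (fun j => ((j == i) + al j)%N); exists M => x.
  apply: le_trans (hM x); rewrite le_eqVlt; apply/orP; left; apply/eqP; congr `|_|.
  rewrite mulrA; congr (_ * _); rewrite mulrC.
  under [in RHS]eq_bigr do rewrite exprD.
  rewrite big_split/=; congr (_ * _).
  by rewrite (bigD1 i)//= eqxx expr1 big1 ?mulr1// => j /negPf ->.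
- have [M hM] := IH al; exists (`|k| * M) => x.
  by rewrite mulrCA normrM ler_wpM2l.
- have [M hM] := IH al; have [N hN] := IHg al; exists (N + M) => x.
  by rewrite mulrDr (le_trans (ler_normD _ _))// lerD.
Qed.

Lemma polygauss_schwartz h : polygauss h -> schwartz_real h.
Proof.
have H s : forall h, polygauss h -> polygauss (pderiv s h).
  elim: s => [//|i s IH] h' /IH ph'.
  have [dh [p1 p2]] := polygauss_partials ph'.
  rewrite /pderiv/= -/(pderiv s h') (_ : (fun _ => _) = dh i)//.
  by apply/funext => x; have [_ ->] := p2 x.
move=> ph; split=> [s x|s al].
  by have [dh [_ p2]] := polygauss_partials (H s _ ph); have [] := p2 x.
exact: polygauss_bound (H s _ ph) al.
Qed.

End PartialDerivatives.

Section SchwartzIntegrable.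
Context (R : realType) (n : nat).
Local Notation V := 'rV[R]_n.
Local Notation mu := (@leb R n).

Lemma integrable_oneDsqrV : (@lebesgue_measure R).-integrable setT
  (fun x => ((1 + x ^+ 2)^-1)%:E).
Proof.
have g0 (x : R) : 0 <= (1 + x ^+ 2)^-1 by rewrite invr_ge0 addr_ge0// sqr_ge0.
have cg : continuous (fun x : R => (1 + x ^+ 2)^-1) by exact: continuous_oneDsqrV.
apply/integrableP; split.
  by apply/measurable_EFinP; exact: continuous_measurable_fun.
under eq_integral do rewrite gee0_abs ?lee_fin//.
rewrite ge0_symfun_integralT//=; last by move=> x /=; rewrite sqrrN.
rewrite (_ : [set x | _] = `[0, +oo[%classic); last first.
  by apply/seteqP; split => x/=; rewrite in_itv/= andbT.
by rewrite integral0y_oneDsqr -EFinM ltry.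
Qed.

Lemma prod_oneDsqr (x : V) : \prod_i (1 + x ord0 i ^+ 2) =
  \sum_(J : {set 'I_n}) \prod_i x ord0 i ^+ (if i \in J then 2 else 0).
Proof.
under eq_bigr do rewrite addrC.
rewrite bigA_distr; apply: eq_bigr => J _; apply: eq_bigr => i _.
by case: ifP.
Qed.

(** The product of the 1 + x_i^2 expands into monomials indexed by subsets, and each monomial times
    h is bounded. So h is dominated by a multiple of an integrable product of one-variable
    functions. *)
Lemma schwartz_real_integrable (h : V -> R) : schwartz_real h ->
  mu.-integrable setT (fun x => (h x)%:E).
Proof.
move=> [dh bh].
have mh : measurable_fun [set: Rn R n] (h : Rn R n -> R).
  apply: measurable_fun_borel; apply: borel_continuous => x.
  exact: (differentiable_continuous (dh [::] x)).
have /choice[M hM] := bh [::].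
pose K := \sum_(J : {set 'I_n}) M (fun i => if i \in J then 2 else 0)%N.
have hK x : `|h x| <= K * \prod_i (1 + x ord0 i ^+ 2)^-1.
  have p0 : 0 < \prod_i (1 + x ord0 i ^+ 2).
    by apply: prodr_gt0 => i _; rewrite ltr_pwDl// sqr_ge0.
  rewrite prodfV ler_pdivlMr//.
  rewrite -[X in _ * X <= _](ger0_norm (ltW p0)) -normrM prod_oneDsqr mulr_sumr.
  apply: le_trans (ler_norm_sum _ _ _) _; apply: ler_sum => J _.
  by rewrite mulrC; exact: hM.
have [i1 _] := Rintegral_leb_prod (fun _ : 'I_n => integrable_oneDsqrV).
have i2 := integrableZl measurableT K i1.
apply: (le_integrable measurableT _ _ i2); first exact/measurable_EFinP.
move=> x _; rewrite -EFinM lee_fin; apply: le_trans (hK x) (ler_norm _).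
Qed.

Lemma schwartz_integrable (u : V -> R[i]) : schwartz u -> cintegrable mu u.
Proof. by move=> [h1 h2]; split; exact: schwartz_real_integrable. Qed.

Definition atom (l c b : 'I_n -> R) (x : V) : R[i] :=
  \prod_i gatom (l i) (c i) (b i) (x ord0 i).

Lemma atomE l c b x : atom l c b x = (expR (gq l c x))%:C%C * cis (gphase b x).
Proof. by rewrite expR_gq rmorph_prod cis_sum -big_split. Qed.

Lemma cabs_atom l c b x : cabs (atom l c b x) = \prod_i gexp (l i) (c i) (x ord0 i).
Proof. by rewrite cabs_prod; apply: eq_bigr => i _; exact: cabs_gatom. Qed.

(** The dense class on which Fourier analysis is explicit: its members are Schwartz functions, and
    it is stable under the transform, conjugation and multiplication by Gaussians. *)
Inductive gspan : (V -> R[i]) -> Prop :=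
| gspan_atom l c b : (forall i, 0 < l i) -> gspan (atom l c b)
| gspan_scale k h : gspan h -> gspan (fun x => k * h x)
| gspan_add g h : gspan g -> gspan h -> gspan (fun x => g x + h x).

Lemma gspan_schwartz h : gspan h -> schwartz h.
Proof.
move=> gh; suff [p1 p2] : polygauss (Re \o h) /\ polygauss (Im \o h).
  by split; exact: polygauss_schwartz.
elim: gh => [l c b l0|k {}h _ [p1 p2]|g {}h _ [q1 q2] _ [p1 p2]].
- rewrite (_ : _ \o _ = (fun x => expR (gq l c x) * cos (gphase b x))); last first.
    by apply/funext => x; rewrite /= atomE /= mul0r subr0.
  rewrite (_ : Im \o _ = (fun x => expR (gq l c x) * sin (gphase b x))); last first.
    by apply/funext => x; rewrite /= atomE /= mul0r addr0.
  by split; [exact: polygauss_cos|exact: polygauss_sin].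
- rewrite (_ : _ \o _ = (fun x => Re k * Re (h x) + - Im k * Im (h x))); last first.
    by apply/funext => x; rewrite /= ReM mulNr.
  rewrite (_ : Im \o _ = (fun x => Re k * Im (h x) + Im k * Re (h x))); last first.
    by apply/funext => x; rewrite /= ImM.
  by split; apply: polygauss_add; exact: polygauss_scale.
- rewrite (_ : _ \o _ = (fun x => Re (g x) + Re (h x))); last first.
    by apply/funext => x; rewrite /= ReD.
  rewrite (_ : Im \o _ = (fun x => Im (g x) + Im (h x))); last first.
    by apply/funext => x; rewrite /= ImD.
  by split; exact: polygauss_add.
Qed.

End SchwartzIntegrable.

(** * Fourier integrals, inversion and Parseval for Gaussians *)

Section FourierIntegral.
Context (R : realType) (n : nat).
Local Notation V := 'rV[R]_n.
Local Notation T := (Rn R n).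
Local Notation mu := (@leb R n).
Local Notation FT := (@fourier_schwartz R n).
Local Notation lam := (@lebesgue_measure R).
Implicit Types (u v h : V -> R[i]).

Lemma dotvC (x xi : V) : dotv x xi = dotv xi x.
Proof. by apply: eq_bigr => i _; rewrite mulrC. Qed.

Lemma fourierE u xi : FT u xi = cint mu (fun x => u x * cis (- dotv x xi)).
Proof. by []. Qed.

Lemma measurable_dotv : measurable_fun [set: T * T] (fun z => dotv z.1 z.2).
Proof.
apply: measurable_sum => i; apply: measurable_funM.
  exact: (measurableT_comp (@measurable_coord R n i) measurable_fst).
exact: (measurableT_comp (@measurable_coord R n i) measurable_snd).
Qed.

Lemma cmeasurable_kernel : cmeasurable (fun z : T * T => cis (- dotv z.1 z.2)).
Proof.
apply: cmeasurable_cis; apply: measurableT_comp => //; exact: measurable_dotv.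
Qed.

Lemma measurable_dotvl (xi : V) : measurable_fun [set: T] (fun x : T => dotv x xi).
Proof.
by apply: measurable_sum => i; apply: measurable_funM; [exact: measurable_coord|exact: measurable_cst].
Qed.

Lemma cmeasurable_cisl (xi : V) : cmeasurable (fun x : T => cis (- dotv x xi)).
Proof.
apply: cmeasurable_cis; exact: (measurableT_comp (@oppr_measurable R setT) (measurable_dotvl xi)).
Qed.

Lemma cintegrable_cis u (k : T -> R[i]) : cmeasurable k -> (forall x, cabs (k x) <= 1) ->
  cintegrable mu u -> cintegrable mu (fun x => u x * k x).
Proof.
move=> mk k1 ui; have mu_ := cintegrable_meas ui.
apply: (cintegrable_dom (cmeasurable_mul mu_ mk) (cintegrable_cabs ui)) => x.
by rewrite lee_fin cabsM ger0_norm ?cabs_ge0// ler_piMr// cabs_ge0.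
Qed.

Lemma cintegrable_fourier u xi : cintegrable mu u ->
  cintegrable mu (fun x => u x * cis (- dotv x xi)).
Proof.
by apply: cintegrable_cis; [exact: cmeasurable_cisl|move=> x; rewrite cabs_cis].
Qed.

Lemma fourier_tensor u v : cintegrable mu u -> cintegrable mu v ->
  cintegrable (@lebs R n \x @lebs R n)%E (fun z => u z.1 * v z.2 * cis (- dotv z.1 z.2)).
Proof.
move=> iu iv; apply: (cintegrable_tensor (m1 := @lebs R n) (m2 := @lebs R n) iu iv).
  exact: cmeasurable_kernel.
by move=> z; rewrite cabs_cis.
Qed.

Lemma multiplication_formula u v : cintegrable mu u -> cintegrable mu v ->
  cint mu (fun xi => FT u xi * v xi) = cint mu (fun x => u x * FT v x).
Proof.
move=> iu iv; have h := cint_fubini (fourier_tensor iu iv).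
transitivity (cint mu (fun y => cint mu (fun x => u x * v y * cis (- dotv x y)))).
  apply: eq_cint => xi; rewrite mulrC fourierE -cintZ; last exact: cintegrable_fourier.
  by apply: eq_cint => x; ring.
rewrite -[LHS]h; apply: eq_cint => x.
rewrite fourierE -cintZ; last exact: cintegrable_fourier.
by apply: eq_cint => y; rewrite dotvC; ring.
Qed.

Lemma fourier_bound u xi : cintegrable mu u ->
  ((cabs (FT u xi))%:E <= 2%:E * \int[mu]_x (cabs (u x))%:E)%E.
Proof.
move=> iu; apply: le_trans (cint_le (cintegrable_fourier xi iu)) _.
by under eq_integral do rewrite cabsM cabs_cis mulr1.
Qed.

Lemma fourierD u v : cintegrable mu u -> cintegrable mu v ->
  FT (fun x => u x + v x) = (fun xi => FT u xi + FT v xi).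
Proof.
move=> iu iv; apply/funext => xi; rewrite !fourierE -cintD; try exact: cintegrable_fourier.
by apply: eq_cint => x; rewrite mulrDl.
Qed.

Lemma fourierZ k u : cintegrable mu u -> FT (fun x => k * u x) = (fun xi => k * FT u xi).
Proof.
move=> iu; apply/funext => xi; rewrite !fourierE -cintZ; last exact: cintegrable_fourier.
by apply: eq_cint => x; rewrite mulrA.
Qed.

Lemma atom_fourier_integrable (l c b : 'I_n -> R) xi : (forall i, 0 < l i) ->
  (forall i, cintegrable lam (fun x => gatom (l i) (c i) (b i) x * cis (- (x * xi i)))).
Proof.
move=> l0 i; apply: (cintegrable_dom _ (integrable_gexp (c i) (l0 i))).
  apply: cmeasurable_mul; first exact: cmeasurable_gatom.
  by apply: cmeasurable_cis; apply: measurableT_comp => //; exact: measurable_funM.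
by move=> x; rewrite cabsM cabs_cis mulr1 cabs_gatom /= ger0_norm// gexp_ge0.
Qed.

Lemma cintegrable_atom (l c b : 'I_n -> R) : (forall i, 0 < l i) ->
  cintegrable mu (atom l c b).
Proof.
move=> l0; have [//|//] := @cint_leb_prod R n (fun i => gatom (l i) (c i) (b i)).
by move=> i; exact: cintegrable_gatom.
Qed.

Lemma fourier_atom (l c b : 'I_n -> R) : (forall i, 0 < l i) ->
  FT (atom l c b) = (fun xi =>
    (\prod_i ((Num.sqrt (2 * pi / l i))%:C%C * cis (b i * c i))) *
    atom (fun i => (l i)^-1) b (fun i => - c i) xi).
Proof.
move=> l0; apply/funext => xi; rewrite fourierE.
have [_ h] := @cint_leb_prod R n (fun i x => gatom (l i) (c i) (b i) x * cis (- (x * xi ord0 i)))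
  (atom_fourier_integrable c b (fun i => xi ord0 i) l0).
transitivity (cint mu (fun x => \prod_i (gatom (l i) (c i) (b i) (x ord0 i) *
    cis (- (x ord0 i * xi ord0 i))))).
  by apply: eq_cint => x; rewrite big_split/= -cis_sum sumrN.
rewrite h -big_split/=; apply: eq_bigr => i _; exact: gatom_fourier.
Qed.

Lemma gspan_integrable h : gspan h -> cintegrable mu h.
Proof. by move=> /gspan_schwartz /schwartz_integrable. Qed.

Lemma gspan_fourier h : gspan h -> gspan (FT h).
Proof.
elim=> [l c b l0|k {}h gh IH|g {}h gg IHg gh IH].
- rewrite fourier_atom//; apply: gspan_scale; apply: gspan_atom => i.
  by rewrite invr_gt0.
- by rewrite (fourierZ k (gspan_integrable gh)); exact: gspan_scale.
- by rewrite (fourierD (gspan_integrable gg) (gspan_integrable gh)); exact: gspan_add.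
Qed.

Lemma conj_atom (l c b : 'I_n -> R) (x : V) :
  conjc (atom l c b x) = atom l c (fun i => - b i) x.
Proof.
rewrite /atom conjc_prod; apply: eq_bigr => i _.
by rewrite /gatom conjcM mulNr cisN; congr (_ * _); exact: conjc_real.
Qed.

Lemma gspan_conj h : gspan h -> gspan (fun x => conjc (h x)).
Proof.
elim=> [l c b l0|k {}h gh IH|g {}h gg IHg gh IH].
- by under eq_fun do rewrite conj_atom; exact: gspan_atom.
- by under eq_fun do rewrite conjcM; exact: gspan_scale.
- by under eq_fun do rewrite conjcD; exact: gspan_add.
Qed.

Lemma gspan_sqi h : gspan h -> sqi mu h.
Proof.
elim=> [l c b l0|k {}h gh IH|g {}h gg IHg gh IH]; [|exact: sqiZ|exact: sqiD].
have ia := cintegrable_atom c b l0.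
have /cintegrableP[ma fa] := ia; split=> //.
apply: le_lt_trans fa; apply: ge0_le_integral; first exact: measurableT.
- by move=> x _; rewrite lee_fin sqr_ge0.
- exact: measurable_sq.
- exact/measurable_EFinP/cmeasurable_cabs.
- move=> x _; rewrite lee_fin expr2 ler_piMr ?cabs_ge0// cabs_atom.
  rewrite -[leRHS](@big1_eq R 1 *%R 'I_n (index_enum _) predT).
  by apply: ler_prod => i _; rewrite gexp_ge0 gexp_le1// ltW.
Qed.

Definition twopin : R[i] := ((2 * pi : R) ^+ n)%:C%C.

(** Conjugation replaces the kernel of the inverse transform. Both sides are conjugate linear in h,
    so atoms suffice; for them the factors sqrt (2 pi / l) and sqrt (2 pi l) of the two transforms
    multiply to 2 pi in each coordinate. *)
Lemma fourier_inversion h : gspan h ->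
  FT (fun xi => conjc (FT h xi)) = (fun x => twopin * conjc (h x)).
Proof.
elim=> [l c b l0|k {}h gh IH|g {}h gg IHg gh IH].
- rewrite fourier_atom//.
  under eq_fun do rewrite conjcM conj_atom.
  have li0 i : 0 < (l i)^-1 by rewrite invr_gt0.
  rewrite fourierZ; last exact: cintegrable_atom.
  rewrite fourier_atom//; apply/funext => x.
  rewrite conj_atom mulrA; congr (_ * _); last first.
    by rewrite /atom; apply: eq_bigr => i _; rewrite invrK opprK.
  rewrite conjc_prod -big_split /twopin rmorphXn.
  rewrite -[in RHS](card_ord n) -prodr_const; apply: eq_bigr => i _.
  rewrite -[LHS]/(conjc _ * (_ * _)) -[RHS]/((2 * pi)%:C)%C.
  rewrite conjcM -cisN mulrACA -cisD opprK [c i * b i]mulrC addNr cis0 mulr1.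
  rewrite (conjc_real (Num.sqrt (2 * pi / l i))) -rmorphM invrK.
  congr (_%:C%C); rewrite -sqrtrM; last by rewrite divr_ge0// ?mulr_ge0 ?pi_ge0// ltW.
  rewrite mulrACA mulVf ?mulr1; last exact: lt0r_neq0.
  by rewrite -expr2 sqrtr_sqr ger0_norm// mulr_ge0// pi_ge0.
- have iF := gspan_integrable (gspan_conj (gspan_fourier gh)).
  rewrite (fourierZ k (gspan_integrable gh)).
  under eq_fun do rewrite conjcM.
  by rewrite (fourierZ _ iF) IH; apply/funext => x; rewrite conjcM mulrCA.
- have iF := gspan_integrable (gspan_conj (gspan_fourier gh)).
  have iG := gspan_integrable (gspan_conj (gspan_fourier gg)).
  rewrite (fourierD (gspan_integrable gg) (gspan_integrable gh)).
  under eq_fun do rewrite conjcD.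
  by rewrite (fourierD iG iF) IH IHg; apply/funext => x; rewrite conjcD mulrDr.
Qed.

Lemma cint_sqn d (S : measurableType d) (m : {measure set S -> \bar R}) (f : S -> R[i]) :
  cint m (fun x => f x * conjc (f x)) = (fine (sqn m f))%:C%C.
Proof.
rewrite -[RHS](cint_real m (fun x => cabs (f x) ^+ 2)); apply: eq_cint => x.
case: (f x) => a b /=; apply: cext => /=.
  by rewrite sqr_sqrtr ?addr_ge0 ?sqr_ge0//; ring.
by ring.
Qed.

(** The multiplication formula for h and conj (F h), with the inversion formula on the right-hand
    side. *)
Lemma gspan_parseval h : gspan h ->
  sqn mu (FT h) = (((2 * pi) ^+ n)%:E * sqn mu h)%E.
Proof.
move=> gh; have gF := gspan_fourier gh.
have [mf f2] := gspan_sqi gh; have [mF F2] := gspan_sqi gF.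
have f2f : sqn mu h \is a fin_num by rewrite ge0_fin_numE ?sqn_ge0.
have F2f : sqn mu (FT h) \is a fin_num by rewrite ge0_fin_numE ?sqn_ge0.
have iF := gspan_integrable (gspan_conj gF).
have := multiplication_formula (gspan_integrable gh) iF.
rewrite cint_sqn fourier_inversion//.
under eq_cint do rewrite mulrCA.
rewrite cintZ; last by apply: sqi_mul; [|apply: sqi_conj]; exact: gspan_sqi.
rewrite cint_sqn /twopin -rmorphM => /complexI h1.
by rewrite -(fineK F2f) -(fineK f2f) h1 EFinM.
Qed.

End FourierIntegral.

(** * Density of Gaussians in L^2 *)

Section GaussDensity.
Context (R : realType) (n : nat).
Local Notation V := 'rV[R]_n.
Local Notation T := (Rn R n).
Local Notation mu := (@leb R n).

(* Threshold polynomials: bump k y tends to 1 for y > 1/2 and to 0 for y <= 1/2,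
   and has no constant term. *)
Definition bump (k : nat) (y : R) : R :=
  1 - (1 - y ^+ (k ^ 2 + k)) ^+ (2 ^ (k ^ 2)).

Lemma bump_ge0 k y : 0 <= y <= 1 -> 0 <= bump k y <= 1.
Proof.
move=> /andP[y0 y1].
have h1 : 0 <= 1 - y ^+ (k ^ 2 + k) by rewrite subr_ge0 exprn_ile1.
have h2 : 1 - y ^+ (k ^ 2 + k) <= 1 by rewrite gerBl exprn_ge0.
by rewrite /bump subr_ge0 gerBl exprn_ge0// exprn_ile1.
Qed.

Lemma bernoulli (t : R) N : 0 <= t <= 1 -> 1 - N%:R * t <= (1 - t) ^+ N.
Proof.
move=> /andP[t0 t1]; elim: N => [|N IH]; first by rewrite mul0r subr0 expr0.
rewrite exprS; have := ler_wpM2l (_ : 0 <= 1 - t) IH; rewrite subr_ge0 => /(_ t1).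
have N0 : 0 <= N%:R :> R by [].
by apply: le_trans; rewrite -natr1; nra.
Qed.

Lemma bump_le k y : 0 <= y <= 1 -> bump k y <= (2 * y) ^+ (k ^ 2) * y ^+ k.
Proof.
move=> /andP[y0 y1]; rewrite /bump lerBlDr -lerBlDl.
have := @bernoulli (y ^+ (k ^ 2 + k)) (2 ^ (k ^ 2)); rewrite exprn_ge0// exprn_ile1//.
move=> /(_ isT); apply: le_trans; rewrite lerD2l lerN2.
by rewrite exprD mulrA exprMn natrX.
Qed.

(** A bound uniform in [k] and proportional to [y]: it lets one Gaussian dominate all approximants
    of the indicator of a box. *)
Lemma bump_le2 k y : 0 <= y <= 1 -> bump k.+1 y <= 2 * y.
Proof.
move=> y01; have /andP[y0 y1] := y01; have [h|h] := leP (2 * y) 1.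
  apply: le_trans (bump_le _ y01) _.
  have h0 : 0 <= 2 * y by rewrite mulr_ge0.
  apply: (@le_trans _ _ (1 * y ^+ k.+1)).
    by rewrite ler_wpM2r ?exprn_ge0// exprn_ile1.
  rewrite mul1r exprS; apply: (@le_trans _ _ y); first by rewrite ler_piMr// exprn_ile1.
  by rewrite ler_peMl// ler1n.
have /andP[_] := bump_ge0 k.+1 y01; move=> /le_trans; apply; exact: ltW.
Qed.

Lemma bernoulli_add (t : R) N : 0 <= t -> 1 + N%:R * t <= (1 + t) ^+ N.
Proof.
move=> t0; elim: N => [|N IH]; first by rewrite mul0r addr0 expr0.
rewrite exprS; have := ler_wpM2l (_ : 0 <= 1 + t) IH.
rewrite addr_ge0// => /(_ isT); have N0 : 0 <= N%:R :> R by [].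
by apply: le_trans; rewrite -natr1; nra.
Qed.

Lemma one_sub_exp_le (t : R) N : 0 <= t <= 1 -> (1 - t) ^+ N * (1 + N%:R * t) <= 1.
Proof.
move=> /andP[t0 t1].
have h := bernoulli_add N t0.
have h1 : 0 <= (1 - t) ^+ N by rewrite exprn_ge0// subr_ge0.
apply: le_trans (ler_wpM2l h1 h) _; rewrite -exprMn exprn_ile1//.
  by rewrite mulr_ge0// ?subr_ge0// addr_ge0.
by have := sqr_ge0 t; nra.
Qed.

(** The exponents are such that 2^(k^2) y^(k^2 + k) = ((2 y)^k y)^k. For y <= 1/2 this bounds [bump]
    and is at most 2^-k. For y > 1/2 the base (2 y)^k y eventually reaches 2, and (1 - t)^N (1 + N
    t) <= 1 drives the subtracted power to 0. *)
Lemma bump_cvg y : 0 <= y <= 1 ->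
  bump k y @[k --> \oo] --> (((2^-1 < y)%R : bool)%:R : R).
Proof.
move=> y01; have /andP[y0 y1] := y01.
have [yh|yh] := ltP 2^-1 y; last first.
  apply: (@squeeze_cvgr _ _ _ _ (cst 0) (fun k => 2^-1 ^+ k)).
  - apply: nearW => k; have /andP[-> _] /= := bump_ge0 k y01.
    apply: le_trans (bump_le _ y01) _; rewrite -[leRHS]mul1r; apply: ler_pM.
    + by rewrite exprn_ge0// mulr_ge0.
    + by rewrite exprn_ge0.
    + by rewrite exprn_ile1 ?mulr_ge0//; lra.
    + by rewrite lerXn2r ?nnegrE// invr_ge0.
  - exact: cvg_cst.
  - by apply: cvg_expr; rewrite ger0_norm ?invr_ge0// invf_lt1// ltr1n.
have y0' : 0 < y by apply: lt_trans yh; rewrite invr_gt0.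
have y21 : 1 < 2 * y by move: yh; lra.
rewrite -[X in _ --> X](subr0 (1 : R)); apply: cvgB; first exact: cvg_cst.
apply: (@squeeze_cvgr _ _ _ _ (cst 0) (fun k => 2^-1 ^+ k)).
- have : \forall k \near \oo, 2 / y <= (2 * y) ^+ k.
    have t0 : 0 < 2 * y - 1 by rewrite subr_gt0.
    have : \forall k \near \oo, 2 / y / (2 * y - 1) < k%:R by exact: nbhs_infty_gtr.
    apply: filterS => k; rewrite ltr_pdivrMr// => hk.
    have := bernoulli_add k (ltW t0); rewrite [1 + _ in X in _ <= X]addrC subrK.
    by apply: le_trans; rewrite (le_trans (ltW hk))// lerDr.
  apply: filterS => k hk.
  have t01 : 0 <= y ^+ (k ^ 2 + k) <= 1 by rewrite exprn_ge0//= exprn_ile1.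
  have s0 : 0 <= (1 - y ^+ (k ^ 2 + k)) ^+ (2 ^ k ^ 2).
    by rewrite exprn_ge0// subr_ge0; case/andP: t01.
  rewrite s0/=; have := one_sub_exp_le (2 ^ k ^ 2) t01.
  set s := (1 - _) ^+ _ in s0 *.
  have -> : (2 ^ k ^ 2)%:R * y ^+ (k ^ 2 + k) = ((2 * y) ^+ k * y) ^+ k.
    by rewrite natrX exprD mulrA -exprMn [RHS]exprMn -[in RHS]exprM mulnn.
  move=> h; rewrite exprVn -[leRHS]mul1r ler_pdivlMr ?exprn_gt0//.
  apply: le_trans h; rewrite ler_wpM2l// -[leLHS]add0r lerD//.
  have h2 : 2 <= (2 * y) ^+ k * y by rewrite -ler_pdivrMr.
  by rewrite lerXn2r ?nnegrE// (le_trans _ h2).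
- exact: cvg_cst.
- by apply: cvg_expr; rewrite ger0_norm ?invr_ge0// invf_lt1// ltr1n.
Qed.

End GaussDensity.

Section GaussDense.
Context (R : realType) (n : nat).
Local Notation V := 'rV[R]_n.
Local Notation T := (Rn R n).
Local Notation mu := (@leb R n).
Local Notation cindic := (@cindic _ T R).
Implicit Types (g h : V -> R[i]).

(** Constants need not lie in [gspan] but they multiply it into itself; polynomials in Gaussians are
    therefore built as multipliers. *)
Definition gmultiplier h := forall g, gspan g -> gspan (fun x => g x * h x).

Lemma gmultiplier_cst k : gmultiplier (fun=> k).
Proof. by move=> g gg; under eq_fun do rewrite mulrC; exact: gspan_scale. Qed.

Lemma gmultiplierM h1 h2 : gmultiplier h1 -> gmultiplier h2 ->
  gmultiplier (fun x => h1 x * h2 x).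
Proof. by move=> m1 m2 g gg; under eq_fun do rewrite mulrA; exact/m2/m1. Qed.

Lemma gmultiplierB h1 h2 : gmultiplier h1 -> gmultiplier h2 ->
  gmultiplier (fun x => h1 x - h2 x).
Proof.
move=> m1 m2 g gg.
rewrite (_ : (fun _ => _) = (fun x => g x * h1 x + (-1) * (g x * h2 x))).
  by apply: gspan_add; [exact: m1|apply: gspan_scale; exact: m2].
by apply/funext => x; ring.
Qed.

Lemma gmultiplierX h N : gmultiplier h -> gmultiplier (fun x => h x ^+ N).
Proof.
move=> mh; elim: N => [|N IH]; first by under eq_fun do rewrite expr0; exact: gmultiplier_cst.
by under eq_fun do rewrite exprS; exact: gmultiplierM.
Qed.

Lemma gmultiplier_prod (I : Type) (s : seq I) (F : I -> V -> R[i]) :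
  (forall i, gmultiplier (F i)) -> gmultiplier (fun x => \prod_(i <- s) F i x).
Proof.
move=> mF; elim: s => [|i s IH].
  by under eq_fun do rewrite big_nil; exact: gmultiplier_cst.
by under eq_fun do rewrite big_cons; exact: gmultiplierM.
Qed.

Lemma gexpM (l l' c c' x : R) : 0 < l + l' -> gexp l c x * gexp l' c' x =
  expR (- (l * l' / (l + l') * (c - c') ^+ 2 / 2)) *
  gexp (l + l') ((l * c + l' * c') / (l + l')) x.
Proof.
move=> ll; rewrite /gexp -!expRD; congr expR; field; exact: lt0r_neq0.
Qed.

(** The product of two Gaussians is a Gaussian up to a constant, by completing the square in the
    coordinate [i]. *)
Lemma gmultiplier_gexp (l c : R) i : 0 < l ->
  gmultiplier (fun x => (gexp l c (x ord0 i))%:C%C).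
Proof.
move=> l0 g; elim=> [l' c' b' l'0|k {}g gg IH|g1 g2 gg1 IH1 gg2 IH2].
- pose l2 j := if j == i then l' j + l else l' j.
  pose c2 j := if j == i then (l' j * c' j + l * c) / (l' j + l) else c' j.
  have ll : 0 < l' i + l by rewrite addr_gt0.
  rewrite (_ : (fun _ => _) = (fun x =>
     (expR (- (l' i * l / (l' i + l) * (c' i - c) ^+ 2 / 2)))%:C%C * atom l2 c2 b' x)).
    apply: gspan_scale; apply: gspan_atom => j.
    by rewrite /l2; case: eqP => // ->.
  apply/funext => x; rewrite /atom (bigD1 i)//= [in RHS](bigD1 i)//=.
  rewrite mulrAC [in RHS]mulrA; congr (_ * _); last first.
    by apply: eq_bigr => j /negPf ji; rewrite /l2 /c2 ji.
  rewrite /gatom /l2 /c2 eqxx mulrAC [in RHS]mulrA; congr (_ * _).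
  by rewrite -!rmorphM gexpM.
- under eq_fun do rewrite -mulrA; exact: gspan_scale.
- under eq_fun do rewrite mulrDl; exact: gspan_add.
Qed.

Lemma cvg_prod (I : Type) (s : seq I) (a : I -> nat -> R) (b : I -> R) :
  (forall i, a i k @[k --> \oo] --> b i) ->
  \prod_(i <- s) a i k @[k --> \oo] --> \prod_(i <- s) b i.
Proof.
move=> ab; elim: s => [|i s IH].
  by rewrite big_nil; under eq_fun do rewrite big_nil; exact: cvg_cst.
rewrite big_cons; under eq_fun do rewrite big_cons; exact: cvgM.
Qed.

Definition obox (al be : 'I_n -> R) : set T := [set x | forall i, al i < x ord0 i < be i].

Lemma measurable_obox al be : measurable (obox al be).
Proof.
rewrite (_ : obox al be = [set x | forall i, `]al i, be i[%classic (x ord0 i)]).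
  by apply: measurable_borel; exact: (@borel_forall R n (fun i => `]al i, be i[%classic)).
by apply/seteqP; split => x h i; have := h i; rewrite /= in_itv.
Qed.

Definition gdense (f : T -> R[i]) : Prop := forall e : R, 0 < e ->
  exists g, gspan g /\ (sqn mu (fun x => f x - g x)%R <= e%:E)%E.

(** The wide Gaussian of precision 1/(k+1) tends to 1 and brings the polynomial in Gaussians, which
    is only a multiplier, into [gspan]. The shift [k.+1] excludes [bump 0], the constant 1, to which
    [bump_le2] does not apply. *)
Definition box_approx (l c : 'I_n -> R) (k : nat) (x : V) : R :=
  \prod_i (gexp k.+1%:R^-1 0 (x ord0 i) * bump k.+1 (gexp (l i) (c i) (x ord0 i))).

Lemma gspan_box_approx l c k : (forall i, 0 < l i) ->
  gspan (fun x => (box_approx l c k x)%:C%C).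
Proof.
move=> l0; pose y i (x : V) : R[i] := (gexp (l i) (c i) (x ord0 i))%:C%C.
rewrite (_ : (fun _ => _) = (fun x => atom (fun=> k.+1%:R^-1) (fun=> 0) (fun=> 0) x *
   \prod_i (1 - (1 - y i x ^+ (k.+1 ^ 2 + k.+1)) ^+ (2 ^ (k.+1 ^ 2))))).
  apply: gmultiplier_prod.
    move=> i; apply: gmultiplierB; first exact: gmultiplier_cst.
    apply: gmultiplierX; apply: gmultiplierB; first exact: gmultiplier_cst.
    by apply: gmultiplierX; exact: gmultiplier_gexp.
  by apply: gspan_atom => i; rewrite invr_gt0.
apply/funext => x; rewrite /box_approx /atom rmorph_prod -big_split; apply: eq_bigr => i _.
rewrite -[RHS]/(_ * _) rmorphM; congr (_ * _).
  by rewrite /gatom mul0r cis0 mulr1.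
by rewrite /bump /y !(rmorphB, rmorphXn, rmorph1).
Qed.

(** This precision gives the Gaussian the value 1/2 exactly at distance [r] from its centre, so
    thresholding at 1/2 cuts out an open interval. *)
Lemma gexp_threshold (l c x r : R) : 0 < r -> l = 2 * ln 2 / r ^+ 2 ->
  (2^-1 < gexp l c x) = (`|x - c| < r).
Proof.
move=> r0 ->; rewrite /gexp -[X in X < _]lnK ?posrE ?invr_gt0// ltr_expR.
rewrite lnV ?posrE// ltrN2.
have ln20 : 0 < ln 2 :> R by rewrite ln_gt0// ltr1n.
rewrite (_ : _ / 2 = ln 2 * ((x - c) ^+ 2 / r ^+ 2)); last by field; rewrite gt_eqF.
rewrite -{2}[ln 2]mulr1 ltr_pM2l// ltr_pdivrMr ?exprn_gt0// mul1r.
by rewrite -[in LHS](real_normK (num_real (x - c))) ltr_sqr ?nnegrE// ltW.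
Qed.

Lemma gdense_obox al be : gdense (cindic (obox al be)).
Proof.
have [ab|/existsNP[i /negP]] := pselect (forall i, al i < be i); last first.
  rewrite -leNgt => h e e0.
  have zs : gspan (fun x : V => 0 * atom (fun=> 1) (fun=> 0) (fun=> 0) x).
    by apply: gspan_scale; apply: gspan_atom.
  exists (fun x => 0 * atom (fun=> 1) (fun=> 0) (fun=> 0) x); split => //.
  rewrite (_ : obox al be = set0).
    have E : (fun x : T => cindic set0 x - 0 * atom (fun=> 1) (fun=> 0) (fun=> 0) x) = fun=> 0.
      by apply/funext => x; rewrite /cindic indic0 mul0r subrr.
    by rewrite E sqn0 lee_fin ltW.
  rewrite -subset0 => x /(_ i) /andP[h1 h2].
  by have := lt_le_trans (lt_trans h1 h2) h; rewrite ltxx.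
pose r i := (be i - al i) / 2; pose c i := (al i + be i) / 2.
pose l i := 2 * ln 2 / r i ^+ 2.
have r0 i : 0 < r i by rewrite divr_gt0// subr_gt0.
have ln20 : 0 < ln 2 :> R by rewrite ln_gt0// ltr1n.
have l0 i : 0 < l i.
  by rewrite /l; apply: divr_gt0; [exact: mulr_gt0|exact: exprn_gt0].
have y01 i (t : R) : 0 <= gexp (l i) (c i) t <= 1 by rewrite gexp_ge0 gexp_le1// ltW.
(* Dominates the indicator, since inside the box each Gaussian exceeds 1/2, and also the
   approximants, since [bump] is at most twice its argument. *)
pose g (x : T) : R := 2 ^+ n * cabs (atom l c (fun=> 0) x).
have gE x : g x = \prod_i (2 * gexp (l i) (c i) (x ord0 i)).
  by rewrite /g cabs_atom big_split/= prodr_const card_ord.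
have boxE (x : T) : \1_(obox al be) x =
    \prod_i ((2^-1 < gexp (l i) (c i) (x ord0 i))%R : bool)%:R :> R.
  have th i : (2^-1 < gexp (l i) (c i) (x ord0 i)) = (al i < x ord0 i < be i).
    rewrite (gexp_threshold _ _ (r0 i) erefl) ltr_norml /c /r.
    by apply/andP/andP => -[h1 h2]; split; lra.
  rewrite indicE; case: (asboolP (obox al be x)) => hx.
    by rewrite mem_set// big1// => i _; rewrite th hx.
  rewrite memNset//; apply/esym/eqP/prodf_eq0.
  have [i /negP hi] : exists i, ~ (al i < x ord0 i < be i) by apply/existsNP.
  by exists i => //; rewrite th (negPf hi).
have sa : sqi mu (atom l c (fun=> 0)) by apply: gspan_sqi; exact: gspan_atom.
have [ma a2] := sa.
have ub k x : 0 <= box_approx l c k x <= g x.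
  rewrite gE /box_approx; apply/andP; split.
    by apply: prodr_ge0 => i _; rewrite mulr_ge0 ?gexp_ge0//; case/andP: (bump_ge0 k.+1 (y01 i (x ord0 i))).
  apply: ler_prod => i _; have /andP[b0 b1] := bump_ge0 k.+1 (y01 i (x ord0 i)).
  rewrite mulr_ge0 ?gexp_ge0//= -[leRHS]mul1r; apply: ler_pM => //.
  - exact: gexp_ge0.
  - by rewrite gexp_le1// invr_ge0.
  - exact: bump_le2.
have ib x : 0 <= (\1_(obox al be) x : R) <= g x.
  rewrite boxE gE; apply/andP; split; first by apply: prodr_ge0.
  apply: ler_prod => i _; rewrite ler0n/=; case: ltP => h.
    by rewrite (_ : true%:R = 1 :> R)//; move: h; set y := gexp _ _ _; lra.
  by rewrite mulr_ge0// gexp_ge0.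
have mu_ k : cmeasurable (fun x : T => (box_approx l c k x)%:C%C).
  by case: (gspan_sqi (gspan_box_approx c k l0)).
have mg : measurable_fun setT g.
  by apply: measurable_funM; [exact: measurable_cst|exact: cmeasurable_cabs].
move=> e e0.
have mb : cmeasurable (cindic (obox al be) : T -> R[i]).
  exact: (cmeasurable_cindic R (measurable_obox al be)).
have ig : (\int[mu]_x (g x ^+ 2)%:E < +oo)%E.
  rewrite (_ : integral _ _ _ = sqn mu (fun x => (2 ^+ n)%:C%C * atom l c (fun=> 0) x)%R).
    by rewrite sqnZ// lte_mul_pinfty// lee_fin sqr_ge0.
  apply: eq_integral => x _; congr (_ ^+ 2)%:E.
  by rewrite cabsM cabsr ger0_norm// exprn_ge0.
have [||k hk] := filter_ex (sqn_dct mu_ mb mg ig _ _ e0).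
- move=> k x; rewrite /cindic -rmorphB cabsr.
  have /andP[h1 h2] := ub k x; have /andP[h3 h4] := ib x.
  by rewrite ler_norml; lra.
- move=> x; under eq_fun do rewrite /cindic -rmorphB cabsr.
  rewrite -(@normr0 _ R) -(subrr (\1_(obox al be) x : R)); apply: cvg_norm.
  apply: cvgB; last exact: cvg_cst.
  rewrite boxE; apply: cvg_prod => i; rewrite -[X in _ --> X]mul1r; apply: cvgM.
    rewrite -[X in _ --> X](@expR0 R) /gexp; under eq_fun do rewrite subr0.
    apply: continuous_cvg; first exact: continuous_expR.
    rewrite -oppr0; apply: cvgN.
    rewrite (_ : 0 = 0 * (x ord0 i ^+ 2 / 2)); last by rewrite mul0r.
    under eq_fun do rewrite -mulrA.
    by apply: cvgM; [exact: cvg_harmonic|exact: cvg_cst].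
  by have := bump_cvg (y01 i (x ord0 i)); rewrite -[X in X -> _]cvg_shiftS.
exists (fun x => (box_approx l c k x)%:C%C); split; first exact: gspan_box_approx.
rewrite (_ : sqn _ _ = sqn mu (fun x => (box_approx l c k x)%:C%C - cindic (obox al be) x)%R)//.
by apply: eq_integral => x _; rewrite cabsB.
Qed.

Lemma gdense_closed (f : T -> R[i]) : sqi mu f -> (forall e : R, 0 < e -> exists g,
    [/\ sqi mu g, gdense g & (sqn mu (fun x => f x - g x)%R <= e%:E)%E]) -> gdense f.
Proof.
move=> [mf _] h e e0; have e4 : 0 < e / 4 by rewrite divr_gt0.
have [g [[mg _] dg fg]] := h _ e4; have [w [gw hw]] := dg _ e4.
exists w; split => //.
have [mw _] := gspan_sqi gw.
rewrite (_ : (fun _ => _) = (fun x => (f x - g x) + (g x - w x))); last first.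
  by apply/funext => x; ring.
apply: le_trans (sqnD _ _ _) _; [exact: cmeasurable_sub|exact: cmeasurable_sub|].
apply: (@le_trans _ _ (2%:E * (e / 4)%:E + 2%:E * (e / 4)%:E)%E).
  by apply: leeD; rewrite lee_pmul2l.
by rewrite -!EFinM -EFinD lee_fin; lra.
Qed.

Lemma gdense_hbox al be : gdense (cindic (hbox al be : set T)).
Proof.
have mh : cmeasurable (cindic (hbox al be : set T) : T -> R[i]).
  exact: (cmeasurable_cindic R (measurable_hbox al be)).
have sh : sqi mu (cindic (hbox al be : set T)).
  exact: (sqi_cindic (measurable_hbox al be) (leb_hbox_fin al be)).
apply: (gdense_closed sh) => e e0.
pose be' i := be i + 1; pose C : set T := hbox al be'.
have sC : sqi mu (cindic C).
  exact: (sqi_cindic (measurable_hbox al be') (leb_hbox_fin al be')).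
have [mC C2] := sC.
(* Open boxes with upper ends raised by 1/(k+1) decrease to the half-open box and all lie in [C]. *)
pose O k : set T := obox al (fun i => be i + k.+1%:R^-1).
have mO k : cmeasurable (cindic (O k) : T -> R[i]).
  exact: (cmeasurable_cindic R (measurable_obox _ _)).
have k1 k : 0 < (k.+1%:R^-1 : R) <= 1.
  by rewrite invr_gt0 ltr0n/= invf_le1// ler1n.
have OC k x : O k x -> C x.
  move=> h i; have /andP[h1 h2] := h i; rewrite h1/= (le_trans (ltW h2))// lerD2l.
  by case/andP: (k1 k).
have HO k x : (hbox al be : set T) x -> O k x.
  move=> h i; have /andP[h1 h2] := h i; rewrite h1/= (le_lt_trans h2)// ltrDl.
  by case/andP: (k1 k).
have ig : (\int[mu]_x ((\1_C x : R) ^+ 2)%:E < +oo)%E.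
  rewrite (_ : integral _ _ _ = sqn mu (cindic C))//.
  by apply: eq_integral => x _; rewrite cabs_cindic.
have mgC : measurable_fun [set: T] (\1_C : T -> R).
  by apply: measurable_indic; exact: measurable_hbox.
have [||k hk] := filter_ex (sqn_dct mO mh mgC ig _ _ e0).
- move=> k x; rewrite cabs_cindicB !indicE.
  have [xO|xO] := pselect (O k x).
    rewrite (mem_set xO) (mem_set (OC _ _ xO)); case: (_ \in _); by rewrite ?subrr ?subr0 ?normr0 ?normr1.
  rewrite (memNset xO) memNset ?subrr ?normr0//; by move=> /(HO k).
- move=> x; apply: cvg_near_cst.
  have [xH|xH] := pselect ((hbox al be : set T) x).
    by apply: nearW => k; rewrite cabs_cindicB !indicE (mem_set xH) (mem_set (HO k _ xH)) subrr normr0.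
  suff : \forall k \near \oo, ~ O k x.
    apply: filterS => k xO; rewrite cabs_cindicB !indicE (memNset xH) (memNset xO) subrr normr0//.
  have /existsNP[i hi] := xH.
  have [ali|ali] := ltP (al i) (x ord0 i); last first.
    by apply: nearW => k /(_ i) /andP[]; rewrite ltNge ali.
  have bi : 0 < x ord0 i - be i by rewrite subr_gt0 ltNge; apply/negP => h; apply: hi; rewrite ali h.
  have := near_infty_natSinv_lt (PosNum bi).
  apply: filterS => k /= hk /(_ i) /andP[_]; rewrite -ltrBlDl => h.
  by have := lt_trans h hk; rewrite ltxx.
exists (cindic (O k)); split.
- apply: (sqi_le (mO k) sC) => x; rewrite !cabs_cindic !indicE.
  have [xO|xO] := pselect (O k x); last by rewrite (memNset xO).
  by rewrite (mem_set xO) (mem_set (OC _ _ xO)).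
- exact: gdense_obox.
- rewrite (_ : sqn _ _ = sqn mu (fun x => cindic (O k) x - cindic (hbox al be : set T) x)%R)//.
  by apply: eq_integral => x _; rewrite cabsB.
Qed.

Lemma gspan_dense (f : T -> R[i]) : sqi mu f -> gdense f.
Proof.
apply: (@sqi_ind R n gdense).
- move=> f1 f2 [m1 _] [m2 _] d1 d2 e e0; have e4 : 0 < e / 4 by rewrite divr_gt0.
  have [g1 [s1 h1]] := d1 _ e4; have [g2 [s2 h2]] := d2 _ e4.
  exists (fun x => g1 x + g2 x); split; first exact: gspan_add.
  have [mg1 _] := gspan_sqi s1; have [mg2 _] := gspan_sqi s2.
  rewrite (_ : (fun _ => _) = (fun x => (f1 x - g1 x) + (f2 x - g2 x))); last first.
    by apply/funext => x; ring.
  apply: le_trans (sqnD _ _ _) _; [exact: cmeasurable_sub|exact: cmeasurable_sub|].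
  apply: (@le_trans _ _ (2%:E * (e / 4)%:E + 2%:E * (e / 4)%:E)%E).
    by apply: leeD; rewrite lee_pmul2l.
  by rewrite -!EFinM -EFinD lee_fin; lra.
- move=> k {}f [mf _] df e e0.
  have k0 : 0 < cabs k ^+ 2 + 1 by rewrite ltr_wpDl// sqr_ge0.
  have ek : 0 < e / (cabs k ^+ 2 + 1) by rewrite divr_gt0.
  have [g [gg hg]] := df _ ek; have [mg _] := gspan_sqi gg.
  exists (fun x => k * g x); split; first exact: gspan_scale.
  rewrite (_ : (fun _ => _) = (fun x => k * (f x - g x))); last first.
    by apply/funext => x; rewrite mulrBr.
  rewrite sqnZ; last exact: cmeasurable_sub.
  apply: (@le_trans _ _ ((cabs k ^+ 2)%:E * (e / (cabs k ^+ 2 + 1))%:E)%E).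
    by rewrite lee_wpmul2l// lee_fin sqr_ge0.
  by rewrite -EFinM lee_fin mulrA ler_pdivrMr// mulrC ler_wpM2l ?ltW// ltrDl.
- exact: gdense_closed.
- exact: gdense_hbox.
Qed.

End GaussDense.

(** * Luxemburg norms *)

Section LuxemburgMore.
Context d (T : measurableType d) (R : realType).
Variable mu : {measure set T -> \bar R}.
Variables (q : T -> R) (q1 : forall x, 1 < q x) (mq : measurable_fun setT q).
Implicit Types (g h : T -> \bar R) (l c : R).
Local Open Scope ereal_scope.
Local Notation lux := (luxemburg mu q).

Lemma poweR_le (a b : \bar R) (r : R) : (0 <= r)%R -> 0 <= a -> a <= b -> a `^ r <= b `^ r.
Proof.
move=> r0 a0 ab; apply: gt0_ler_poweR => //; rewrite in_itv/= leey andbT//.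
exact: le_trans ab.
Qed.

Lemma modular_ge0 g : (forall x, 0 <= g x) -> modular mu q g = \int[mu]_x (g x `^ q x).
Proof. by move=> g0; apply: eq_integral => x _; rewrite gee0_abs. Qed.

Let q0 x : (0 <= q x)%R. Proof. by rewrite (le_trans _ (ltW (q1 x))). Qed.

Lemma measurable_scaled l g : measurable_fun setT g ->
  measurable_fun setT (fun x => l%:E * g x).
Proof. by move=> mg; apply: emeasurable_funM. Qed.

Lemma scaled_ge0 l g : (0 <= l)%R -> (forall x, 0 <= g x) -> forall x, 0 <= l%:E * g x.
Proof. by move=> l0 g0 x; rewrite mule_ge0// lee_fin. Qed.

Lemma le_modular g h : measurable_fun setT g -> measurable_fun setT h ->
  (forall x, 0 <= g x) -> (forall x, g x <= h x) -> modular mu q g <= modular mu q h.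
Proof.
move=> mg mh g0 gh.
have h0 x : 0 <= h x by exact: le_trans (gh x).
rewrite !modular_ge0//; apply: ge0_le_integral => //.
- by move=> x _; exact: poweR_ge0.
- exact: measurable_poweR_var.
- exact: measurable_poweR_var.
- by move=> x _; exact: poweR_le.
Qed.

Lemma le_lux g h : measurable_fun setT g -> measurable_fun setT h ->
  (forall x, 0 <= g x) -> (forall x, g x <= h x) -> lux g <= lux h.
Proof.
move=> mg mh g0 gh; rewrite !luxE; apply: le_ereal_inf => _ [l [l0 m1] <-].
have li0 : (0 <= l^-1)%R by rewrite invr_ge0 ltW.
exists l => //; split=> //; apply: le_trans m1; apply: le_modular.
- exact: measurable_scaled.
- exact: measurable_scaled.
- exact: scaled_ge0.
- by move=> x; rewrite lee_wpmul2l// lee_fin.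
Qed.

(** The strict inequality leaves room for an admissible parameter below [l], so the infimum need not
    be attained. *)
Lemma lux_modular g l : measurable_fun setT g -> (forall x, 0 <= g x) ->
  lux g < l%:E -> modular mu q (fun x => l^-1%:E * g x) <= 1.
Proof.
move=> mg g0 /lux_lt[m [m0 m1]]; rewrite lte_fin => ml.
have l0 : (0 < l)%R by exact: lt_trans ml.
have li0 : (0 <= l^-1)%R by rewrite invr_ge0 ltW.
apply: le_trans m1; apply: le_modular.
- exact: measurable_scaled.
- exact: measurable_scaled.
- exact: scaled_ge0.
- by move=> x; rewrite lee_wpmul2r// lee_fin lef_pV2 ?posrE// ltW.
Qed.

Lemma lux_sum (g : nat -> T -> \bar R) m : (forall k, measurable_fun setT (g k)) ->
  (forall k x, 0 <= g k x) -> lux (fun x => \sum_(k < m) g k x) <= \sum_(k < m) lux (g k).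
Proof.
move=> mg g0; elim: m => [|m IH].
  rewrite big_ord0; under eq_fun do rewrite big_ord0.
  by rewrite -[leRHS](@lux0 _ _ _ mu q)// => x; exact: lt_trans (q1 x).
rewrite big_ord_recr/=; under eq_fun do rewrite big_ord_recr/=.
apply: le_trans (leeD2r _ IH); apply: lux_triangle => //.
- exact: emeasurable_sum.
- by apply: emeasurable_funD => //; exact: emeasurable_sum.
- by move=> x; exact: sume_ge0.
- by move=> x; apply: adde_ge0 => //; exact: sume_ge0.
Qed.

(* The factor 4 spares the continuity of the power function: below half of the
   sum, some partial sum is already larger. *)
Lemma lux_series (g : nat -> T -> \bar R) h (c : nat -> R) (b : R) :
  (forall k, measurable_fun setT (g k)) -> measurable_fun setT h ->
  (forall k x, 0 <= g k x) -> (forall x, 0 <= h x) ->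
  (forall x (y : R), y%:E < h x -> exists m, y%:E < \sum_(k < m) g k x) ->
  (forall k, lux (g k) <= (c k)%:E) -> (0 < b)%R -> (forall m, \sum_(k < m) c k <= b)%R ->
  lux h <= (4 * b)%:E.
Proof.
move=> mg mh g0 h0 hg gc b0 cb.
have b2 : (0 < 2 * b)%R by rewrite mulr_gt0.
have b4 : (0 < 4 * b)%R by rewrite mulr_gt0.
pose S m x := \sum_(k < m) g k x.
have S0 m x : 0 <= S m x by exact: sume_ge0.
have mS m : measurable_fun setT (S m) by exact: emeasurable_sum.
have ndS x : {homo S ^~ x : m m' / (m <= m')%N >-> m <= m'}.
  move=> m m' mm'; rewrite /S -!(big_mkord xpredT (fun k => g k x)).
  by rewrite [leRHS](big_cat_nat (n := m))//= leeDl// sume_ge0.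
have lS m : lux (S m) < (2 * b)%:E.
  apply: (@le_lt_trans _ _ b%:E); last by rewrite lte_fin; lra.
  apply: le_trans (lux_sum _ mg g0) _.
  apply: (@le_trans _ _ (\sum_(k < m) (c k)%:E)); first exact: lee_sum.
  by rewrite sumEFin lee_fin.
pose ph m x := ((2 * b)^-1%:E * S m x) `^ q x.
have bi0 : (0 <= (2 * b)^-1)%R by rewrite invr_ge0 ltW.
have sc m x : 0 <= (2 * b)^-1%:E * S m x by exact: scaled_ge0.
have mph m : measurable_fun setT (ph m).
  by apply: measurable_poweR_var => //; exact: measurable_scaled.
have ndph x : {homo ph ^~ x : m m' / (m <= m')%N >-> m <= m'}.
  by move=> m m' mm'; apply: poweR_le => //; rewrite lee_wpmul2l ?lee_fin//; exact: ndS.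
have b4i : (0 <= (4 * b)^-1)%R by rewrite invr_ge0 ltW.
apply: lux_le => //; rewrite modular_ge0; last exact: scaled_ge0.
apply: (@le_trans _ _ (\int[mu]_x limn (ph ^~ x))); last first.
  rewrite (monotone_convergence mu measurableT)//; last first.
    by move=> m x _; exact: poweR_ge0.
  apply: lime_le.
    apply: ereal_nondecreasing_is_cvgn => m m' mm'.
    by apply: ge0_le_integral => // x _; [exact: poweR_ge0|exact: ndph].
  apply: nearW => m; have := lux_modular (mS m) (S0 m) (lS m).
  by rewrite modular_ge0.
apply: ge0_le_integral => //.
- by move=> x _; exact: poweR_ge0.
- apply: measurable_poweR_var => //; [exact: scaled_ge0|exact: measurable_scaled].
- apply: (@emeasurable_fun_cvg _ _ _ setT ph) => // x _.
  exact: (ereal_nondecreasing_is_cvgn (ndph x)).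
move=> x _.
have phle m : ph m x <= limn (ph ^~ x).
  by rewrite (cvg_lim _ (ereal_nondecreasing_cvgn (ndph x)))//; apply: ereal_sup_ubound; exists m.
(* Where h is infinite, some partial sum exceeds 2 b max (1, A), and y <= y^q for y >= 1; so the
   limit exceeds every [A]. *)
have [hy|hy] := eqVneq (h x) +oo.
  suff -> : limn (ph ^~ x) = +oo by rewrite leey.
  apply/eqyP => A A0.
  have [m Sm] : exists m, (2 * b * Num.max 1 A)%:E < S m x by apply: hg; rewrite hy ltry.
  apply: le_trans (phle m); rewrite /ph.
  have t1 : (1 <= Num.max 1 A)%R by rewrite le_max lexx.
  apply: (@le_trans _ _ ((Num.max 1 A)%:E `^ q x)).
    rewrite poweR_EFin lee_fin; apply: (@le_trans _ _ (Num.max 1 A)%R); first by rewrite le_max lexx orbT.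
    by rewrite -[leLHS]powRr1 ?(le_trans _ t1)//; apply: ler_powR => //; exact: ltW.
  apply: poweR_le => //; first by rewrite lee_fin (le_trans _ t1).
  by rewrite lee_pdivlMl// -EFinM; exact: ltW.
have [-> |hn0] := eqVneq (h x) 0.
  by rewrite mule0 poweR0r ?gt_eqF ?(lt_trans _ (q1 x))//; apply: le_trans (phle 0%N); exact: poweR_ge0.
have hf : h x \is a fin_num by rewrite ge0_fin_numE ?ltey.
have hp : (0 < fine (h x))%R by rewrite fine_gt0// lt0e hn0 h0 ltey hy.
have [|m Sm] := hg x (fine (h x) / 2)%R.
  by rewrite -[ltRHS]fineK// lte_fin; lra.
apply: le_trans (phle m); apply: poweR_le => //; first exact: scaled_ge0.
rewrite lee_pdivlMl// muleA -EFinM.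
have -> : (2 * b * (4 * b)^-1 = 2^-1)%R by field; rewrite gt_eqF.
by rewrite -(fineK hf) -EFinM mulrC ltW.
Qed.

Lemma lux_lty_ae g : measurable_fun setT g -> (forall x, 0 <= g x) ->
  lux g < +oo -> {ae mu, forall x, g x < +oo}.
Proof.
move=> mg g0 /lux_lt[l [l0 m1 _]].
have li0 : (0 <= l^-1)%R by rewrite invr_ge0 ltW.
have mp : measurable_fun setT (fun x => (l^-1%:E * g x) `^ q x).
  by apply: measurable_poweR_var => //; [exact: scaled_ge0|exact: measurable_scaled].
have ip : mu.-integrable setT (fun x => (l^-1%:E * g x) `^ q x).
  apply/integrableP; split=> //.
  under eq_integral do rewrite gee0_abs ?poweR_ge0//.
  rewrite modular_ge0 in m1; last exact: scaled_ge0.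
  by apply: le_lt_trans m1 _; rewrite ltry.
have := integrable_ae measurableT ip; apply: filterS => x /(_ I) px.
rewrite ltey; apply/negP => /eqP gx; move: px.
by rewrite gx gt0_muley ?lte_fin ?invr_gt0// poweRyr// gt_eqF// (lt_trans _ (q1 x)).
Qed.

End LuxemburgMore.

Section LuxemburgSeriesAe.
Context d (T : measurableType d) (R : realType).
Variable mu : {measure set T -> \bar R}.
Variables (q : T -> R) (q1 : forall x, 1 < q x) (mq : measurable_fun setT q).
Local Open Scope ereal_scope.
Local Notation lux := (luxemburg mu q).

Lemma ae_le_lux (g h : T -> \bar R) : measurable_fun setT g -> measurable_fun setT h ->
  (forall x, 0 <= g x) -> (forall x, 0 <= h x) -> {ae mu, forall x, g x <= h x} ->
  lux g <= lux h.
Proof.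
move=> mg mh g0 h0 gh.
have mk : measurable_fun setT (g \min h) by exact: measurable_mine.
rewrite (ae_eq_lux q1 mq mg mk); last first.
  by apply: filterS gh => x gx _; rewrite /= min_l.
apply: le_lux => // x; first by rewrite le_min g0 h0.
by rewrite ge_min lexx orbT.
Qed.

Lemma lux_series_ae (g : nat -> T -> \bar R) (h : T -> \bar R) (c : nat -> R) (b : R) :
  (forall k, measurable_fun setT (g k)) -> measurable_fun setT h ->
  (forall k x, 0 <= g k x) -> (forall x, 0 <= h x) ->
  {ae mu, forall x, forall y : R, y%:E < h x -> exists m, y%:E < \sum_(k < m) g k x} ->
  (forall k, lux (g k) <= (c k)%:E) -> (0 < b)%R -> (forall m, \sum_(k < m) c k <= b)%R ->
  lux h <= (4 * b)%:E.
Proof.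
move=> mg mh g0 h0 [N [mN N0 hN]] gc b0 cb.
pose h' x := if x \in N then 0 else h x.
have mh' : measurable_fun setT h'.
  apply: measurable_fun_ifT => //; apply: (measurable_fun_bool true).
  by rewrite (_ : _ @^-1` _ = N)// ?setTI//; apply/seteqP; split => x /=; [exact: set_mem|exact: mem_set].
rewrite (ae_eq_lux q1 mq mh mh'); last first.
  exists N; split => // x /= xN; apply: contrapT => xN'; apply: xN => _.
  by rewrite /h' memNset.
apply: (@lux_series _ _ _ mu q q1 mq g _ c) => //.
  by move=> x; rewrite /h'; case: ifP.
move=> x y; rewrite /h'; case: ifPn => [_ y0|xN].
  by exists 0%N; rewrite big_ord0.
apply: contrapT => yS; move: xN; rewrite notin_setE; apply; apply: hN => /= H.
by apply: yS; exact: H.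
Qed.

End LuxemburgSeriesAe.

Section CompletenessReal.
Context (R : realType).

Lemma bounded_variation_cvg (a : nat -> R) (b : R) :
  (forall m, \sum_(k < m) `|a k.+1 - a k| <= b) -> cvgn a.
Proof.
move=> ab.
have E : a = (fun m => a 0%N + series (fun k => a k.+1 - a k) m).
  by apply/funext => m; rewrite /series/= telescope_sumr// addrC subrK.
rewrite E; apply: is_cvgD; first exact: is_cvg_cst.
apply: (@normed_cvg R R^o); apply: nondecreasing_is_cvgn.
  apply: nondecreasing_series => k _ _; exact: normr_ge0.
exists b => _ [m _ <-]; by have := ab m; rewrite -(big_mkord xpredT (fun k => `|a k.+1 - a k|)).
Qed.

End CompletenessReal.

(** * Completeness of weighted variable Lebesgue spaces *)

Section Completeness.
Context d (T : measurableType d) (R : realType).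
Variable mu : {measure set T -> \bar R}.
Variables (p : exponent T R) (w : weight mu).
Local Notation N f := (luxemburg mu p (wabs w f)).
Implicit Types (f g : T -> R[i]).
Local Open Scope ereal_scope.

Let p1 := @exponent_gt1 _ _ _ p.
Let mp := measurable_exponent p.

Lemma luxwD f g : cmeasurable f -> cmeasurable g ->
  N (fun x => f x + g x)%R <= N f + N g.
Proof.
move=> mf mg; apply: lux_triangle => //; try exact: measurable_wabs; try exact: wabs_ge0.
  by apply: measurable_wabs; exact: cmeasurable_add.
move=> x; rewrite /wabs -ge0_muleDl ?lee_fin ?cabs_ge0//.
by apply: lee_wpmul2r; [exact: weight_ge0|rewrite -EFinD lee_fin ler_cabsD].
Qed.

Lemma le_luxw f g : cmeasurable f -> cmeasurable g ->
  {ae mu, forall x, cabs (f x) <= cabs (g x)}%R -> N f <= N g.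
Proof.
move=> mf mg fg; apply: ae_le_lux => //; try exact: measurable_wabs; try exact: wabs_ge0.
by apply: filterS fg => x fg; apply: lee_wpmul2r; [exact: weight_ge0|rewrite lee_fin].
Qed.

Lemma ae_eq_luxw f g : cmeasurable f -> cmeasurable g ->
  {ae mu, forall x, f x = g x} -> N f = N g.
Proof.
by move=> mf mg fg; apply/eqP; rewrite eq_le !le_luxw//; apply: filterS fg => x ->.
Qed.

Lemma luxwN f : N (fun x => - f x)%R = N f.
Proof. by congr luxemburg; apply/funext => x; rewrite /wabs cabsN. Qed.

Lemma luxwB f g : cmeasurable f -> cmeasurable g ->
  N (fun x => f x - g x)%R <= N f + N g.
Proof. by move=> mf mg; rewrite -(luxwN g); apply: luxwD => //; exact: cmeasurable_opp. Qed.

Lemma luxwBC f g : N (fun x => f x - g x)%R = N (fun x => g x - f x)%R.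
Proof. by rewrite -luxwN; congr luxemburg; apply/funext => x; rewrite /wabs opprB. Qed.

Lemma luxwZ (c : R[i]) f : N (fun x => c * f x)%R = (cabs c)%:E * N f.
Proof.
have [->|c0] := eqVneq c 0%R.
  rewrite cabs0 mul0e -[RHS](@lux0 _ _ _ mu p); last by move=> x; exact: lt_trans (p1 x).
  by congr luxemburg; apply/funext => x; rewrite /wabs mul0r cabs0 mul0e.
rewrite -luxZ; last first.
  by rewrite lt_neqAle cabs_ge0 andbT eq_sym; apply: contra c0 => /eqP/cabs_eq0 ->.
by congr luxemburg; apply/funext => x; rewrite /wabs cabsM EFinM muleA.
Qed.

Lemma luxw_eq0 f : cmeasurable f -> N f = 0 -> {ae mu, forall x, f x = 0%R}.
Proof.
move=> mf f0; have h := lux_eq0 p1 mp (measurable_wabs w mf) (wabs_ge0 w _) f0.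
apply: filterS2 h (weight_ae w) => x /= /(_ I) + /andP[w0 _].
rewrite /wabs => /eqP; rewrite mule_eq0 (gt_eqF w0) orbF eqe => /eqP.
exact: cabs_eq0.
Qed.

(** Riesz-Fischer. The distance of the limit to [u k] is estimated by the series of increments from
    [k] on, whose norms add up to at most 2 * 2^-k; the factor 4 of [lux_series_ae] makes it 8. *)
Lemma luxw_complete (u : nat -> T -> R[i]) : (forall k, cmeasurable (u k)) ->
  (forall k, N (fun x => u k.+1 x - u k x)%R <= (2^-1 ^+ k)%:E) ->
  exists F, cmeasurable F /\ forall k, N (fun x => F x - u k x)%R <= (8 * 2^-1 ^+ k)%:E.
Proof.
move=> mu_ cu.
pose du k x := (u k.+1 x - u k x)%R.
have mdu k : cmeasurable (du k) by exact: cmeasurable_sub.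
have mg k : measurable_fun setT (wabs w (du k)) by exact: measurable_wabs.
have g0 k x : 0 <= wabs w (du k) x by exact: wabs_ge0.
have geo m : (\sum_(k < m) 2^-1 ^+ k <= (2:R))%R.
  have -> : (\sum_(k < m) 2^-1 ^+ k = (2:R) - 2 * 2^-1 ^+ m)%R.
    elim: m => [|m IH]; first by rewrite big_ord0 expr0; ring.
    by rewrite big_ord_recr/= IH exprS; field.
  by rewrite gerBl mulr_ge0// exprn_ge0.
pose h x := limn (fun m => \sum_(k < m) wabs w (du k) x).
have nd x : {homo (fun m => \sum_(k < m) wabs w (du k) x) : m m' / (m <= m')%N >-> m <= m'}.
  move=> m m' mm'; rewrite -!(big_mkord xpredT (fun k => wabs w (du k) x)).
  by rewrite [leRHS](big_cat_nat (n := m))//= leeDl// sume_ge0.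
have hsup x : h x = ereal_sup (range (fun m => \sum_(k < m) wabs w (du k) x)).
  by apply: cvg_lim => //; exact: ereal_nondecreasing_cvgn (nd x).
have mh : measurable_fun setT h.
  apply: (@emeasurable_fun_cvg _ _ _ setT (fun m x => \sum_(k < m) wabs w (du k) x)) => [m|x _].
    exact: emeasurable_sum.
  exact: ereal_nondecreasing_is_cvgn (nd x).
have h0 x : 0 <= h x.
  by rewrite hsup; apply: le_trans (_ : \sum_(k < 0) wabs w (du k) x <= _); [rewrite big_ord0|apply: ereal_sup_ubound; exists 0%N].
have hfin : {ae mu, forall x, h x < +oo}.
  apply: (lux_lty_ae p1 mp mh h0); apply: le_lt_trans (ltry (4 * 2)).
  apply: (@lux_series _ _ _ mu p p1 mp (fun k => wabs w (du k)) _ (fun k => 2^-1 ^+ k)%R) => //.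
  by move=> x y; rewrite hsup => /ereal_sup_gt[_ [m _ <-]]; exists m.
(* Where the weight is positive and finite it can be divided out, which leaves the bounded variation
   of the sequence itself. *)
have bd : {ae mu, forall x, exists b : R, forall m, (\sum_(k < m) cabs (du k x) <= b)%R}.
  apply: filterS2 hfin (weight_ae w) => x hx /andP[w0 wy].
  have wf : w x \is a fin_num by rewrite ge0_fin_numE// ltW.
  have hf : h x \is a fin_num by rewrite ge0_fin_numE.
  have fw0 : (0 < fine (w x))%R by rewrite fine_gt0// w0.
  exists (fine (h x) / fine (w x))%R => m; rewrite ler_pdivlMr// -lee_fin fineK//.
  rewrite hsup EFinM (fineK wf) -sumEFin ge0_sume_distrl => [|k _]; last by rewrite lee_fin cabs_ge0.
  by apply: ereal_sup_ubound; exists m.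
(* The upper limit is measurable whether or not the sequence converges; almost everywhere it is the
   limit. *)
pose F x := (fine (limn_esup (fun k => (Re (u k x))%:E)) +i*
             fine (limn_esup (fun k => (Im (u k x))%:E)))%C.
have mF : cmeasurable F.
  have m1 k : measurable_fun setT (fun x => (Re (u k x))%:E).
    by apply/measurable_EFinP; case: (mu_ k).
  have m2 k : measurable_fun setT (fun x => (Im (u k x))%:E).
    by apply/measurable_EFinP; case: (mu_ k).
  split; apply: measurableT_comp => //; first exact: (measurable_fun_limn_esup m1).
  exact: (measurable_fun_limn_esup m2).
exists F; split=> // k.
have E : (8 * 2^-1 ^+ k = 4 * (2 * 2^-1 ^+ k) :> R)%R by ring.
rewrite E.
apply: (@lux_series_ae _ _ _ mu p p1 mp (fun j => wabs w (du (k + j)%N)) _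
   (fun j => 2^-1 ^+ (k + j))%R) => //.
- by apply: measurable_wabs; exact: cmeasurable_sub.
- exact: wabs_ge0.
- apply: filterS2 bd (weight_ae w) => x [b hb] /andP[w0 wy] y yF.
  apply: contrapT => /forallNP Hy.
  have wf : w x \is a fin_num by rewrite ge0_fin_numE// ltW.
  have fw0 : (0 < fine (w x))%R by rewrite fine_gt0// w0.
  have part m : (cabs (u (k + m)%N x - u k x) <= \sum_(j < m) cabs (du (k + j)%N x))%R.
    elim: m => [|m IH]; first by rewrite addn0 subrr cabs0 big_ord0.
    rewrite big_ord_recr/= (_ : (u (k + m.+1)%N x - u k x =
      (u (k + m)%N x - u k x) + du (k + m)%N x)%R).
      by apply: le_trans (ler_cabsD _ _) _; rewrite lerD2r.
    by rewrite /du addnS; ring.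
  have lee m : (cabs (u (k + m)%N x - u k x) <= y / fine (w x))%R.
    apply: le_trans (part m) _; rewrite ler_pdivlMr// -lee_fin EFinM (fineK wf).
    rewrite -sumEFin ge0_sume_distrl => [|j _]; last by rewrite lee_fin cabs_ge0.
    by rewrite leNgt; apply/negP; exact: Hy.
  have cvgpart (a : R[i] -> R) : (forall z z', a (z - z') = a z - a z')%R ->
      (forall z, `|a z| <= cabs z)%R ->
      (a (u m x)) @[m --> \oo] --> fine (limn_esup (fun m => (a (u m x))%:E)).
    move=> aB ac; have ca : cvgn (fun m => a (u m x)).
      apply: (@bounded_variation_cvg R _ b) => m; apply: le_trans (hb m).
      by apply: ler_sum => j _; rewrite -aB ac.
    have ce : (a (u m x))%:E @[m --> \oo] --> (limn (fun m => a (u m x)))%:E.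
      by apply: cvg_EFin; [exact: nearW|exact: ca].
    rewrite is_cvg_limn_esupE; last by apply/cvg_ex; eexists; exact: ce.
    by rewrite (cvg_lim _ ce).
  have cR := cvgpart (fun z => Re z) (fun z z' => etrans (ReD _ _) (congr1 _ (ReN _))) (@ler_Re_cabs R).
  have cI := cvgpart (fun z => Im z) (fun z z' => etrans (ImD _ _) (congr1 _ (ImN _))) (@ler_Im_cabs R).
  have : (cabs (F x - u k x) <= y / fine (w x))%R.
    apply/ler_addgt0Pr => e e0; have e2 : (0 < e / 2)%R by rewrite divr_gt0.
    have /cvgrPdist_lt/(_ _ e2) nR := cR; have /cvgrPdist_lt/(_ _ e2) nI := cI.
    have [m [h1 [h2 /= h3]]] := filter_ex (filterI nR (filterI nI (nbhs_infty_ge k))).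
    have := lee (m - k)%N; rewrite subnKC// => h4.
    have -> : (F x - u k x = (u m x - u k x) + (F x - u m x))%R by ring.
    apply: le_trans (ler_cabsD _ _) _; apply: lerD => //.
    apply: le_trans (ler_cabs_ReIm _) _.
    rewrite ReD ReN ImD ImN [leRHS]splitr; apply: lerD; exact: ltW.
  rewrite ler_pdivlMr// -lee_fin EFinM (fineK wf) leNgt => /negP; apply; exact: yF.
- move=> j; exact: cu.
- move=> m; under eq_bigr do rewrite exprD.
  by rewrite -mulr_sumr mulrC ler_wpM2r// exprn_ge0.
Qed.

End Completeness.

Section LuxemburgHolder.
Context d (T : measurableType d) (R : realType).
Variable mu : {measure set T -> \bar R}.
Local Open Scope ereal_scope.

Lemma young_poweR (a b : \bar R) (r s : R) : (1 < r)%R -> (1 < s)%R ->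
  (r^-1 + s^-1 = 1)%R -> 0 <= a -> 0 <= b -> a * b <= a `^ r + b `^ s.
Proof.
move=> r1 s1 rs a0 b0.
have r0 : (0 < r)%R by exact: lt_trans r1.
have s0 : (0 < s)%R by exact: lt_trans s1.
have [->|ay] := eqVneq a +oo.
  rewrite poweRyr ?gt_eqF// addye ?leey// gt_eqF// (lt_le_trans ltNy0)// poweR_ge0//.
have [->|by_] := eqVneq b +oo.
  rewrite (poweRyr (r := s)) ?gt_eqF// addey ?leey// gt_eqF// (lt_le_trans ltNy0)// poweR_ge0//.
case: a ay a0 => [a _|//|//]; case: b by_ b0 => [b _|//|//].
rewrite !lee_fin => b0 a0; apply: le_trans (conjugate_powR a0 b0 r0 s0 rs) _.
by apply: lerD; rewrite ler_piMr ?powR_ge0// invf_le1// ltW.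
Qed.

(** Young's inequality for g / l and h / m, its coefficients 1/q and 1/q' being bounded by 1: hence
    the constant 2. *)
Lemma lux_holder (q q' : T -> R) (g h : T -> \bar R) (l m : R) :
  (forall x, 1 < q x)%R -> (forall x, 1 < q' x)%R ->
  (forall x, (q x)^-1 + (q' x)^-1 = 1)%R ->
  measurable_fun setT q -> measurable_fun setT q' ->
  measurable_fun setT g -> measurable_fun setT h ->
  (forall x, 0 <= g x) -> (forall x, 0 <= h x) -> (0 < l)%R -> (0 < m)%R ->
  luxemburg mu q g < l%:E -> luxemburg mu q' h < m%:E ->
  \int[mu]_x (g x * h x) <= (2 * l * m)%:E.
Proof.
move=> q1 q'1 qq' mq mq' mg mh g0 h0 l0 m0 gl hm.
have li : (0 <= l^-1)%R by rewrite invr_ge0 ltW.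
have mi : (0 <= m^-1)%R by rewrite invr_ge0 ltW.
have := lux_modular q1 mq mg g0 gl; rewrite modular_ge0; last exact: scaled_ge0.
have := lux_modular q'1 mq' mh h0 hm; rewrite modular_ge0; last exact: scaled_ge0.
move=> Hm Hl.
have mlg := measurable_scaled l^-1 mg; have mmh := measurable_scaled m^-1 mh.
have glq : measurable_fun setT (fun x => (l^-1%:E * g x) `^ q x).
  by apply: measurable_poweR_var => //; exact: scaled_ge0.
have hmq : measurable_fun setT (fun x => (m^-1%:E * h x) `^ q' x).
  by apply: measurable_poweR_var => //; exact: scaled_ge0.
have mgh : measurable_fun setT (fun x => g x * h x) by exact: emeasurable_funM.
have H : \int[mu]_x ((l^-1 * m^-1)%:E * (g x * h x)) <= 1 + 1.
  apply: le_trans (leeD Hl Hm); rewrite -ge0_integralD//; try by move=> *; exact: poweR_ge0.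
  apply: ge0_le_integral => //.
  - by move=> x _; rewrite mule_ge0// ?lee_fin ?mulr_ge0// mule_ge0.
  - exact: measurable_scaled.
  - exact: emeasurable_funD.
  - move=> x _; rewrite EFinM muleACA; apply: young_poweR => //; exact: scaled_ge0.
rewrite ge0_integralZl_EFin// in H; last 2 first.
- by move=> x _; exact: mule_ge0.
- by rewrite mulr_ge0.
have lm0 : (0 < l * m)%R by rewrite mulr_gt0.
rewrite -invfM lee_pdivrMl// in H; apply: le_trans H _.
by rewrite -EFinD -EFinM lee_fin -mulrA [in leRHS]mulrC.
Qed.

End LuxemburgHolder.

Section LuxemburgTruncation.
Context d (T : measurableType d) (R : realType).
Variable mu : {measure set T -> \bar R}.
Variables (q : T -> R) (q1 : forall x, 1 < q x) (mq : measurable_fun setT q).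
Hypothesis q_bounded : (ess_sup mu (EFin \o q) < +oo)%E.
Local Open Scope ereal_scope.
Local Notation lux := (luxemburg mu q).

(** A bounded exponent makes the modulars at the scales [l] and [e] comparable. So the modular at
    scale [e] is finite, and dominated convergence brings its restriction to [A k] below 1. The
    density of L^2 in the weighted space rests on this. *)
Lemma lux_tail_cvg0 (g : T -> \bar R) (A : nat -> set T) (e : R) :
  measurable_fun setT g -> (forall x, 0 <= g x) -> (forall k, measurable (A k)) ->
  (forall x, \forall k \near \oo, ~ A k x) -> lux g < +oo -> (0 < e)%R ->
  exists k, lux (fun x => g x * (\1_(A k) x)%:E) <= e%:E.
Proof.
move=> mg g0 mA Ainf gy e0.
have [l [l0 lm _]] := lux_lt gy.
have [P0 hP0] := ess_supr_bounded q_bounded.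
pose P := Num.max 1%R P0.
pose C := (Num.max 1 (l / e) `^ P)%R.
have t1 : (1 <= Num.max 1 (l / e))%R by rewrite le_max lexx.
have li : (0 <= l^-1)%R by rewrite invr_ge0 ltW.
have ei : (0 <= e^-1)%R by rewrite invr_ge0 ltW.
pose ph x := (e^-1%:E * g x) `^ q x.
have mph : measurable_fun setT ph.
  by apply: measurable_poweR_var => //; [exact: scaled_ge0|exact: measurable_scaled].
have ph0 x : 0 <= ph x by exact: poweR_ge0.
have mlg : measurable_fun setT (fun x => (l^-1%:E * g x) `^ q x).
  by apply: measurable_poweR_var => //; [exact: scaled_ge0|exact: measurable_scaled].
have iph : mu.-integrable setT ph.
  apply/integrableP; split=> //; under eq_integral do rewrite gee0_abs//.
  apply: (@le_lt_trans _ _ (\int[mu]_x (C%:E * (l^-1%:E * g x) `^ q x))).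
    apply: ae_ge0_le_integral => //.
    - by move=> x _; rewrite mule_ge0 ?lee_fin ?powR_ge0// poweR_ge0.
    - exact: measurable_scaled.
    apply: filterS hP0 => x qP _.
    have q0 : (0 <= q x)%R by rewrite (le_trans _ (ltW (q1 x))).
    apply: (@le_trans _ _ (((Num.max 1 (l / e))%:E * (l^-1%:E * g x)) `^ q x)).
      apply: poweR_le => //; first exact: scaled_ge0.
      rewrite muleA -EFinM lee_wpmul2r// lee_fin ler_pdivlMr// mulrC.
      by rewrite le_max; apply/orP; right.
    rewrite poweRM ?lee_fin ?(le_trans _ t1)//; last exact: scaled_ge0.
    rewrite lee_wpmul2r ?poweR_ge0// poweR_EFin lee_fin.
    by apply: ler_powR => //; rewrite le_max qP orbT.
  rewrite ge0_integralZl_EFin//; last 2 first.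
  - by move=> x _; exact: poweR_ge0.
  - exact: powR_ge0.
  rewrite modular_ge0 in lm; last exact: scaled_ge0.
  by rewrite lte_mul_pinfty// ?lee_fin ?powR_ge0//; apply: le_lt_trans lm _; rewrite ltry.
have mind k : measurable_fun setT (fun x => (\1_(A k) x)%:E : \bar R).
  by apply/measurable_EFinP; exact: measurable_indic.
have mphk k : measurable_fun setT (fun x => ph x * (\1_(A k) x)%:E).
  by apply: emeasurable_funM.
have [||_ _] := @dominated_convergence _ _ _ mu setT measurableT
  (fun k x => ph x * (\1_(A k) x)%:E) (cst 0) ph mphk (@measurable_cst _ _ _ _ _ _) _ iph.
- apply: aeW => x _; apply: cvg_near_cst; apply: filterS (Ainf x) => k Ak.
  by rewrite indicE memNset// mule0.
- apply: aeW => x k _; rewrite gee0_abs ?mule_ge0 ?lee_fin//.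
  by rewrite indicE; case: (_ \in _); rewrite ?mule1 ?mule0.
rewrite integral0 => h.
have [_ /cvgrPdist_lt/(_ 1%R ltr01)] := (fine_cvgP _ _).1 h.
have [hfin _] := (fine_cvgP _ _).1 h.
move=> /(filterI hfin)/filter_ex[k [fk]]; rewrite sub0r normrN => hk.
exists k; apply: lux_le => //; rewrite modular_ge0; last first.
  by move=> x; rewrite mule_ge0 ?lee_fin// mule_ge0// lee_fin.
rewrite (eq_integral (fun x => ph x * (\1_(A k) x)%:E)); last first.
  move=> x _; rewrite /ph indicE; case: (_ \in _); rewrite ?mule1 ?mule0//.
  by rewrite poweR0r// gt_eqF// (lt_trans _ (q1 x)).
apply: (@le_trans _ _ (fine (\int[mu]_x (ph x * (\1_(A k) x)%:E)))%:E).
  by rewrite fineK.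
by rewrite lee_fin; apply/ltW/(le_lt_trans (ler_norm _)); exact: hk.
Qed.

End LuxemburgTruncation.

Section SquareNorm.
Context d (T : measurableType d) (R : realType).
Variable mu : {measure set T -> \bar R}.
Local Open Scope ereal_scope.

Lemma poweR2_le (x : \bar R) (l : R) : 0 <= x -> (0 <= l)%R ->
  (x `^ 2 <= (l ^+ 2)%:E) = (x <= l%:E).
Proof.
move=> x0 l0; case: x x0 => [x|_|//].
  by rewrite !lee_fin => x0; rewrite powR_mulrn// ler_sqr.
by rewrite poweRyr// !leye_eq.
Qed.

Fact cst2_gt1 (x : T) : ((1 : R) < 2)%R. Proof. exact: ltr1n. Qed.

(** L^2 is the variable Lebesgue space with constant exponent 2 and weight 1, so its completeness is
    an instance of [luxw_complete]. *)
Definition exponent2 : exponent T R :=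
  Exponent (@measurable_cst _ _ _ _ setT (2%R : R)) cst2_gt1.

Fact cst1_weight_ae : {ae mu, forall x : T, 0 < cst (1 : \bar R) x < +oo}.
Proof. by apply: nearW => x; rewrite lte01 ltry. Qed.

Definition weight1 : weight mu :=
  @Weight _ T R mu (cst 1) (@measurable_cst _ _ _ _ setT _) (fun=> lee01) cst1_weight_ae.

Local Notation lux2 f := (luxemburg mu exponent2 (wabs weight1 f)).

Lemma modular2 (f : T -> R[i]) (c : R) : cmeasurable f -> (0 <= c)%R ->
  modular mu exponent2 (fun x => c%:E * wabs weight1 f x) = (c ^+ 2)%:E * sqn mu f.
Proof.
move=> mf c0; rewrite /modular /sqn -ge0_integralZl//; last 3 first.
- exact: measurable_sq.
- by move=> x _; rewrite lee_fin sqr_ge0.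
- by rewrite lee_fin sqr_ge0.
apply: eq_integral => x _; rewrite (_ : wabs _ _ _ = (cabs (f x))%:E); last exact: mule1.
rewrite -EFinM gee0_abs; last by rewrite lee_fin mulr_ge0// cabs_ge0.
by rewrite poweR_EFin powR_mulrn ?mulr_ge0 ?cabs_ge0// exprMn EFinM.
Qed.

Lemma lux2_le (f : T -> R[i]) (l : R) : cmeasurable f -> (0 < l)%R ->
  sqn mu f <= (l ^+ 2)%:E -> lux2 f <= l%:E.
Proof.
move=> mf l0 fl; apply: lux_le => //; rewrite (@modular2 f l^-1)//; last by rewrite invr_ge0 ltW.
by rewrite exprVn lee_pdivrMl ?exprn_gt0// mule1.
Qed.

Lemma lux2_lt (f : T -> R[i]) (l : R) : cmeasurable f -> (0 < l)%R ->
  lux2 f < l%:E -> sqn mu f <= (l ^+ 2)%:E.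
Proof.
move=> mf l0 fl; have := lux_modular cst2_gt1 (@measurable_cst _ _ _ _ _ _) (measurable_wabs weight1 mf) (wabs_ge0 weight1 _) fl.
rewrite (@modular2 f l^-1)//; last by rewrite invr_ge0 ltW.
by rewrite exprVn lee_pdivrMl ?exprn_gt0// mule1.
Qed.

Lemma sqn_complete (u : nat -> T -> R[i]) : (forall k, cmeasurable (u k)) ->
  (forall k, sqn mu (fun x => u k.+1 x - u k x)%R <= ((2^-1 ^+ k) ^+ 2)%:E) ->
  exists F, cmeasurable F /\
    forall k, sqn mu (fun x => F x - u k x)%R <= ((9 * 2^-1 ^+ k) ^+ 2)%:E.
Proof.
move=> mu_ hu; have [|F [mF hF]] := @luxw_complete _ _ _ mu exponent2 weight1 u mu_.
  by move=> k; apply: lux2_le => //; exact: cmeasurable_sub.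
have t0 k : (0 < 2^-1 ^+ k :> R)%R by exact: exprn_gt0.
(* [lux2_lt] asks for a strict inequality, hence 9 above the 8 of [luxw_complete]. *)
exists F; split=> // k; apply: lux2_lt; [exact: cmeasurable_sub|by rewrite mulr_gt0|].
by apply: le_lt_trans (hF k) _; rewrite lte_fin ltr_pM2r// ltr_nat.
Qed.

End SquareNorm.

Section AlmostEverywhere.
Context d (T : measurableType d) (R : realType) (mu : {measure set T -> \bar R}).
Implicit Types P Q S : T -> Prop.

Lemma aeS P Q : (forall x, P x -> Q x) ->
  {ae mu, forall x, P x} -> {ae mu, forall x, Q x}.
Proof. by move=> PQ; apply: filterS. Qed.

Lemma aeS2 P Q S : (forall x, P x -> Q x -> S x) ->
  {ae mu, forall x, P x} -> {ae mu, forall x, Q x} -> {ae mu, forall x, S x}.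
Proof. by move=> PQ; apply: filterS2. Qed.

Lemma aeT P : (forall x, P x) -> {ae mu, forall x, P x}.
Proof. by move=> HP; apply: nearW. Qed.

End AlmostEverywhere.

(** * The Fourier transform and multipliers on L^2 *)

Section FourierL2.
Context (R : realType) (n : nat).
Local Notation V := 'rV[R]_n.
Local Notation T := (Rn R n).
Local Notation mu := (@leb R n).
Local Notation FT := (@fourier_schwartz R n).
Implicit Types (f g h u v : V -> R[i]).

Lemma L2_normE f : (L2_norm f `^ 2 = sqn mu f)%E.
Proof.
rewrite /L2_norm poweR_Lnorm//; apply: eq_integral => x _.
by rewrite /= ger0_norm ?cabs_ge0// powR_mulrn ?cabs_ge0.
Qed.

Lemma L2_norm_le f (l : R) : 0 <= l -> (L2_norm f <= l%:E)%E = (sqn mu f <= (l ^+ 2)%:E)%E.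
Proof. by move=> l0; rewrite -L2_normE poweR2_le// Lnorm_ge0. Qed.

Lemma L2_norm_lty f : (L2_norm f < +oo)%E = (sqn mu f < +oo)%E.
Proof.
rewrite -L2_normE; have := Lnorm_ge0 mu 2%:E (EFin \o (cabs \o f)).
by rewrite -/(L2_norm f); case: (L2_norm f) => [r _|_|//]; rewrite ?poweRyr// !ltry.
Qed.

Lemma L2P f : L2 f <-> sqi mu f.
Proof. by rewrite /L2 L2_norm_lty; split=> [[? ?]|[? ?]]; split. Qed.

Lemma L2_norm_cvg0 (u_ : nat -> V -> R[i]) :
  L2_norm (u_ k) @[k --> \oo] --> 0%E <->
  forall e : R, 0 < e -> \forall k \near \oo, (sqn mu (u_ k) <= e%:E)%E.
Proof.
split=> [h e e0|h].
  have s0 : 0 < Num.sqrt e by rewrite sqrtr_gt0.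
  have [hfin /cvgrPdist_lt/(_ _ s0)] := (fine_cvgP _ _).1 h.
  move/(filterI hfin); apply: filterS => k [fk]; rewrite sub0r normrN => hk.
  rewrite -(sqr_sqrtr (ltW e0)) -L2_norm_le; last exact: ltW.
  by rewrite -(fineK fk) lee_fin; apply/ltW/(le_lt_trans (ler_norm _)).
apply/fine_cvgP; split.
  apply: filterS (h _ ltr01) => k hk; rewrite ge0_fin_numE ?Lnorm_ge0//.
  by rewrite L2_norm_lty; apply: le_lt_trans hk _; rewrite ltry.
apply/cvgrPdist_le => e e0; apply: filterS (h _ (exprn_gt0 2 e0)) => k.
rewrite -L2_norm_le; last exact: ltW.
move=> hk /=; rewrite sub0r normrN ger0_norm ?fine_ge0 ?Lnorm_ge0//.
rewrite -lee_fin fineK// ge0_fin_numE ?Lnorm_ge0//.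
by apply: le_lt_trans hk _; rewrite ltry.
Qed.

Definition gaussn : V -> R[i] := atom (fun=> 1) (fun=> 0) (fun=> 0).

Lemma gspan_gaussn : gspan gaussn.
Proof. by apply: gspan_atom => i; exact: ltr01. Qed.

Lemma gaussnE x : gaussn x = (expR (gq (fun=> 1) (fun=> 0) x))%:C%C.
Proof.
rewrite /gaussn atomE (_ : gphase _ x = 0) ?cis0 ?mulr1//.
by apply: big1 => i _; rewrite mul0r.
Qed.

Lemma gaussn_inv x : gaussn x * (expR (- gq (fun=> 1) (fun=> 0) x))%:C%C = 1.
Proof. by rewrite gaussnE -rmorphM -expRD subrr expR0. Qed.

Lemma cmeasurable_gaussn_inv : cmeasurable (fun x : T => (expR (- gq (fun=> 1) (fun=> 0) x))%:C%C).
Proof.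
apply: cmeasurable_real; apply: (measurableT_comp (@measurable_expR R)).
apply: (measurableT_comp (@oppr_measurable R setT)); apply: measurable_sum => i.
have mc : measurable_fun [set: T] (fun x : T => (x ord0 i - 0) ^+ 2).
  apply: measurable_funX; apply: measurable_funB; [exact: measurable_coord|exact: measurable_cst].
rewrite (_ : (fun _ => _) = (fun x : T => - (1 / 2) * (x ord0 i - 0) ^+ 2)).
  by apply: measurable_funM => //; exact: measurable_cst.
by apply/funext => x; field.
Qed.

(** The kernel has modulus 1, so there is no decay in the frequency. Fubini is applied after
    multiplication by a Gaussian in that variable, which is then divided out. *)
Lemma cmeasurable_fourier u : cintegrable mu u -> cmeasurable (FT u : T -> R[i]).
Proof.
move=> iu; have ig := gspan_integrable gspan_gaussn.
have := cintegrable_F (m1 := @lebs R n) (m2 := @lebs R n) (fourier_tensor ig iu).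
move=> /cintegrable_meas mF.
have := cmeasurable_mul mF cmeasurable_gaussn_inv.
congr cmeasurable; apply/funext => x.
rewrite (_ : cint _ _ = gaussn x * FT u x); first by rewrite mulrAC gaussn_inv mul1r.
rewrite fourierE -cintZ; last exact: cintegrable_fourier.
by apply: eq_cint => y; rewrite mulrA dotvC.
Qed.

(** If the [v k] are Gaussian combinations tending to conj h, the integral of |h|^2 equals that of h
    (conj h - v k), which tends to 0. *)
Lemma gspan_separates h : sqi mu h ->
  (forall v, gspan v -> cint mu (fun x => h x * v x) = 0) -> {ae mu, forall x, h x = 0}.
Proof.
move=> sh hv; have [mh h2] := sh.
have sch : sqi mu (fun x => conjc (h x)) by exact: sqi_conj.
have /choice[v hv'] : forall k : nat, exists v, gspan v /\
    (sqn mu (fun x => conjc (h x) - v x)%R <= (k.+1%:R^-1)%:E)%E.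
  by move=> k; apply: gspan_dense => //; rewrite invr_gt0.
have : cint mu (fun x => h x * conjc (h x)) = 0.
  apply: (@cint_mul_cvg0 _ _ _ mu (fun k x => conjc (h x) - v k x) (fun=> 0) _ h sh) => [k|e e0|k].
  - by apply: sqiB; [exact: sch|apply: gspan_sqi; case: (hv' k)].
  - have := near_infty_natSinv_lt (PosNum e0).
    by apply: filterS => k /= ke; have [_ +] := hv' k; move/le_trans; apply; rewrite lee_fin ltW.
  - rewrite -[LHS]subr0 -(hv (v k)); last by case: (hv' k).
    rewrite -cintB; last 2 first.
    + exact: sqi_mul.
    + by apply: sqi_mul; [exact: sh|apply: gspan_sqi; case: (hv' k)].
    by apply: eq_cint => x; ring.
rewrite cint_sqn => /complexI E.
have I0 : (\int[mu]_x `|(cabs (h x) ^+ 2)%:E| = 0)%E.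
  under eq_integral do rewrite gee0_abs ?lee_fin ?sqr_ge0//.
  by rewrite -/(sqn mu h) -[LHS]fineK ?E// ge0_fin_numE ?sqn_ge0.
move/(ae_eq_integral_abs mu measurableT (measurable_sq mh)) : I0.
apply: aeS => x /= /(_ I) [] /eqP; rewrite sqrf_eq0 => /eqP; exact: cabs_eq0.
Qed.

(* The Fourier transform on L^2 characterized by duality with the Gaussians. *)
Definition frel f g : Prop :=
  forall v, gspan v -> cint mu (fun x => g x * v x) = cint mu (fun x => f x * FT v x).

Lemma frel_uniq f g g' : sqi mu g -> sqi mu g' -> frel f g -> frel f g' ->
  {ae mu, forall x, g x = g' x}.
Proof.
move=> sg sg' fg fg'.
have h : {ae mu, forall x, g x - g' x = 0}.
  apply: gspan_separates; first exact: sqiB.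
  move=> v gv; have sv := gspan_sqi gv.
  under eq_cint do rewrite mulrBl.
  by rewrite cintB; [rewrite fg// fg'// subrr|exact: sqi_mul|exact: sqi_mul].
by apply: aeS h => x /eqP; rewrite subr_eq0 => /eqP.
Qed.

Lemma frel_ae f f' g g' : cmeasurable (f : T -> R[i]) -> cmeasurable (f' : T -> R[i]) ->
  cmeasurable (g : T -> R[i]) -> cmeasurable (g' : T -> R[i]) ->
  {ae mu, forall x, f x = f' x} -> {ae mu, forall x, g x = g' x} -> frel f g -> frel f' g'.
Proof.
move=> mf mf' mg mg' ff gg fg v gv; have [mv _] := gspan_sqi gv.
have [mFv _] := gspan_sqi (gspan_fourier gv).
transitivity (cint mu (fun x => g x * v x)).
  by apply: ae_eq_cint; [exact: cmeasurable_mul..|apply: aeS gg => x ->].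
rewrite fg//.
by apply: ae_eq_cint; [exact: cmeasurable_mul..|apply: aeS ff => x ->].
Qed.

Lemma frelD f f' g g' : sqi mu f -> sqi mu f' -> sqi mu g -> sqi mu g' ->
  frel f g -> frel f' g' -> frel (fun x => f x + f' x) (fun x => g x + g' x).
Proof.
move=> sf sf' sg sg' fg fg' v gv; have sv := gspan_sqi gv.
have sFv := gspan_sqi (gspan_fourier gv).
under eq_cint do rewrite mulrDl; under [RHS]eq_cint do rewrite mulrDl.
by rewrite !cintD; [rewrite fg// fg'//|exact: sqi_mul..].
Qed.

Lemma frelZ (c : R[i]) f g : sqi mu f -> sqi mu g ->
  frel f g -> frel (fun x => c * f x) (fun x => c * g x).
Proof.
move=> sf sg fg v gv; have sv := gspan_sqi gv.
have sFv := gspan_sqi (gspan_fourier gv).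
under eq_cint do rewrite -mulrA; under [RHS]eq_cint do rewrite -mulrA.
by rewrite !cintZ; [rewrite fg|exact: sqi_mul..].
Qed.

Lemma frel_gspan u : gspan u -> frel u (FT u).
Proof. by move=> gu v gv; apply: multiplication_formula; exact: gspan_integrable. Qed.

Local Notation twopin := (@twopin R n).

Lemma twopin_neq0 : twopin != 0.
Proof.
rewrite /twopin; apply/negP => /eqP/complexI/eqP.
by rewrite expf_eq0 mulf_eq0 (gt_eqF (pi_gt0 R)) pnatr_eq0 !andbF.
Qed.

Lemma gspan_preimage v : gspan v -> exists2 v', gspan v' & FT v' = v.
Proof.
move=> gv; exists (fun x => twopin^-1 * conjc (FT (fun y => conjc (v y)) x)).
  by apply: gspan_scale; apply: gspan_conj; apply: gspan_fourier; exact: gspan_conj.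
have gF := gspan_conj (gspan_fourier (gspan_conj gv)).
rewrite (fourierZ _ (gspan_integrable gF)) (fourier_inversion (gspan_conj gv)).
apply/funext => x; rewrite mulrA mulVf ?twopin_neq0// mul1r.
by case: (v x) => a b; rewrite /= opprK.
Qed.

(** Injectivity of the transform: every element of [gspan] is the transform of another one, so g
    determines all pairings of f with [gspan]. *)
Lemma frel_inj f f' g g' : sqi mu f -> sqi mu f' -> sqi mu g -> sqi mu g' ->
  {ae mu, forall x, g x = g' x} ->
  frel f g -> frel f' g' -> {ae mu, forall x, f x = f' x}.
Proof.
move=> sf sf' sg sg' gg fg fg'.
have h : {ae mu, forall x, f x - f' x = 0}.
  apply: gspan_separates; first exact: sqiB.
  move=> v gv; have [v' gv' <-] := gspan_preimage gv.
  have sv := gspan_sqi gv'; have sF := gspan_sqi (gspan_fourier gv').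
  under eq_cint do rewrite mulrBl.
  rewrite cintB; [rewrite -fg// -fg'//|exact: sqi_mul|exact: sqi_mul].
  apply/eqP; rewrite subr_eq0; apply/eqP.
  have [mg _] := sg; have [mg' _] := sg'; have [mv _] := sv.
  by apply: ae_eq_cint; [exact: cmeasurable_mul..|apply: aeS gg => x ->].
by apply: aeS h => x /eqP; rewrite subr_eq0 => /eqP.
Qed.

End FourierL2.

Section FourierTransform.
Context (R : realType) (n : nat).
Local Notation V := 'rV[R]_n.
Local Notation T := (Rn R n).
Local Notation mu := (@leb R n).
Local Notation FT := (@fourier_schwartz R n).
Local Notation twopin := (@twopin R n).
Implicit Types (f g h u v a : V -> R[i]).

(** The multiplication formula holds for the Schwartz approximants and passes to the limit. The
    definition by sequences thus becomes the dual description, which makes linearity and uniqueness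
    easy. *)
Lemma is_fourier_frel f g : sqi mu f -> is_fourier f g -> sqi mu g /\ frel f g.
Proof.
move=> sf [/L2P sg [u_ [su uf ug]]]; split=> // v gv.
have iu k := schwartz_integrable (su k).
have mu_ k := cintegrable_meas (iu k).
have mFu k := cmeasurable_fourier (iu k).
have [mf _] := sf; have [mg _] := sg.
move/L2_norm_cvg0 : uf => uf; move/L2_norm_cvg0 : ug => ug.
(* Square integrability of the approximants is read off their distances to f and g, known to be
   finite only from some [N] on; hence the shift of indices. *)
have [N _ hN] := filterI (uf _ ltr01) (ug _ ltr01).
have s1 k : sqi mu (fun x => u_ (k + N)%N x - f x).
  have [h1 _] := hN (k + N)%N (leq_addl _ _).
  by split; [exact: cmeasurable_sub|exact: le_lt_trans h1 (ltry _)].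
have s2 k : sqi mu (fun x => FT (u_ (k + N)%N) x - g x).
  have [_ h2] := hN (k + N)%N (leq_addl _ _).
  by split; [exact: cmeasurable_sub|exact: le_lt_trans h2 (ltry _)].
have shift (P : nat -> Prop) : (\forall k \near \oo, P k) -> \forall k \near \oo, P (k + N)%N.
  by move=> [M _ hM]; exists M => // k /= Mk; apply: hM => /=; exact: leq_trans Mk (leq_addr _ _).
have sv := gspan_sqi gv; have sFv := gspan_sqi (gspan_fourier gv).
have su' k : sqi mu (u_ (k + N)%N).
  rewrite (_ : u_ _ = fun x => (u_ (k + N)%N x - f x) + f x); last first.
    by apply/funext => x; rewrite subrK.
  exact: sqiD.
have sFu' k : sqi mu (FT (u_ (k + N)%N)).
  rewrite (_ : FT _ = fun x => (FT (u_ (k + N)%N) x - g x) + g x); last first.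
    by apply/funext => x; rewrite subrK.
  exact: sqiD.
have E k : cint mu (fun x => FT (u_ (k + N)%N) x * v x) =
           cint mu (fun x => u_ (k + N)%N x * FT v x).
  by apply: multiplication_formula => //; exact: gspan_integrable.
have lim0 (z : R[i]) (a b : nat -> V -> R[i]) (v1 v2 : V -> R[i]) :
    sqi mu v1 -> sqi mu v2 -> (forall k, sqi mu (a k)) -> (forall k, sqi mu (b k)) ->
    (forall e : R, 0 < e -> \forall k \near \oo, (sqn mu (a k) <= e%:E)%E) ->
    (forall e : R, 0 < e -> \forall k \near \oo, (sqn mu (b k) <= e%:E)%E) ->
    (forall k, z = cint mu (fun x => a k x * v1 x) - cint mu (fun x => b k x * v2 x)) ->
    z = 0.
  move=> sv1 sv2 sa sb a0 b0 zE; apply: cabs_eq0; apply/eqP; rewrite eq_le cabs_ge0 andbT.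
  apply/ler_addgt0Pr => e e0; rewrite add0r.
  have half (c : nat -> V -> R[i]) (v' : V -> R[i]) : sqi mu v' -> (forall k, sqi mu (c k)) ->
      (forall e : R, 0 < e -> \forall k \near \oo, (sqn mu (c k) <= e%:E)%E) ->
      \forall k \near \oo, cabs (cint mu (fun x => c k x * v' x)) <= e / 2.
    move=> sv' sc c0.
    have gfin : sqn mu v' \is a fin_num by rewrite ge0_fin_numE ?sqn_ge0//; case: sv'.
    set G := fine (sqn mu v').
    have G0 : 0 <= G by rewrite fine_ge0// sqn_ge0.
    have G1 : 0 < G + 1 by rewrite ltr_wpDl.
    pose t := (G + 1) * 4 / e.
    have t0 : 0 < t by rewrite /t divr_gt0// mulr_gt0.
    have et0 : 0 < e / 4 / t by apply: divr_gt0 => //; apply: divr_gt0.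
    apply: filterS (c0 _ et0) => k ck.
    rewrite -lee_fin; apply: le_trans (cint_mul_le t0 (sc k) sv') _.
    apply: (@le_trans _ _ ((e / 4)%:E + (e / 4)%:E)%E); last by rewrite -EFinD lee_fin; lra.
    apply: leeD.
      apply: (@le_trans _ _ (t%:E * (e / 4 / t)%:E)%E); first by rewrite lee_pmul2l.
      by rewrite -EFinM lee_fin mulrC divfK// gt_eqF.
    rewrite -(fineK gfin) -/G -EFinM lee_fin -subr_ge0 (_ : _ - _ = e / (4 * (G + 1))).
      by rewrite divr_ge0 ?(ltW e0)// mulr_ge0// ltW.
    by rewrite /t; field; rewrite (gt_eqF G1) (gt_eqF e0).
  have [k [h1 h2]] := filter_ex (filterI (half a v1 sv1 sa a0) (half b v2 sv2 sb b0)).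
  by rewrite (zE k); apply: le_trans (ler_cabsB _ _) _; rewrite [leRHS]splitr lerD.
apply/eqP; rewrite -subr_eq0; apply/eqP.
apply: (lim0 _ (fun k x => u_ (k + N)%N x - f x) (fun k x => FT (u_ (k + N)%N) x - g x)
  (FT v) v sFv sv s1 s2).
- by move=> e e0; exact: (shift _ (uf _ e0)).
- by move=> e e0; exact: (shift _ (ug _ e0)).
move=> k.
have E1 : cint mu (fun x => (u_ (k + N)%N x - f x) * FT v x) =
    cint mu (fun x => u_ (k + N)%N x * FT v x) - cint mu (fun x => f x * FT v x).
  rewrite -(cintB (sqi_mul (su' k) sFv) (sqi_mul sf sFv)).
  by apply: eq_cint => x; rewrite mulrBl.
have E2 : cint mu (fun x => (FT (u_ (k + N)%N) x - g x) * v x) =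
    cint mu (fun x => FT (u_ (k + N)%N) x * v x) - cint mu (fun x => g x * v x).
  rewrite -(cintB (sqi_mul (sFu' k) sv) (sqi_mul sg sv)).
  by apply: eq_cint => x; rewrite mulrBl.
rewrite E1 E2 E; ring.
Qed.

Lemma is_fourier_exists f : sqi mu f -> exists g, is_fourier f g.
Proof.
move=> sf; have [mf _] := sf.
pose c : R := (2 * pi) ^+ n.
have c0 : 0 < c by rewrite exprn_gt0// mulr_gt0// pi_gt0.
(* The 4 compensates the 2 + 2 of [sqnB] and [c] the constant of Parseval, so that consecutive
   transforms are at squared distance at most (2^-k)^2, as [sqn_complete] requires. *)
pose e k : R := (2^-1 ^+ k) ^+ 2 / (4 * c).
have t0 k : 0 < 2^-1 ^+ k :> R by exact: exprn_gt0.
have e0 k : 0 < e k by rewrite divr_gt0 ?exprn_gt0// mulr_gt0.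
have /choice[h hh] : forall k : nat, exists v, gspan v /\
    (sqn mu (fun x => f x - v x)%R <= (e k)%:E)%E.
  by move=> k; exact: gspan_dense.
have gh k : gspan (h k) by case: (hh k).
have gF k := gspan_fourier (gh k).
have mh k : cmeasurable (h k : T -> R[i]) by have [] := gspan_sqi (gh k).
have mF k : cmeasurable (FT (h k) : T -> R[i]) by have [] := gspan_sqi (gF k).
have hd k : (sqn mu (fun x => FT (h k.+1) x - FT (h k) x)%R <= ((2^-1 ^+ k) ^+ 2)%:E)%E.
  have ghd : gspan (fun x => h k.+1 x + (-1) * h k x) by apply: gspan_add => //; exact: gspan_scale.
  have := gspan_parseval ghd.
  rewrite (fourierD (gspan_integrable (gh _)) (gspan_integrable (gspan_scale _ (gh k)))).
  rewrite (fourierZ _ (gspan_integrable (gh k))) => P.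
  have -> : (fun x => FT (h k.+1) x - FT (h k) x) = (fun x => FT (h k.+1) x + (-1) * FT (h k) x).
    by apply/funext => x; rewrite mulN1r.
  rewrite P -/c.
  have -> : (fun x => h k.+1 x + (-1) * h k x) = (fun x => (f x - h k x) - (f x - h k.+1 x)).
    by apply/funext => x; ring.
  have le1 : e k.+1 <= e k.
    rewrite /e ler_pM2r ?invr_gt0 ?mulr_gt0// ler_sqr ?nnegrE ?(ltW (t0 _))// exprS.
    by rewrite ler_piMl ?(ltW (t0 _))// invf_le1// ler1n.
  apply: (@le_trans _ _ (c%:E * (2%:E * (e k)%:E + 2%:E * (e k)%:E))%E).
    rewrite lee_pmul2l//; apply: le_trans (sqnB _ _ _) _; try exact: cmeasurable_sub.
    apply: leeD; rewrite lee_pmul2l//; first by case: (hh k).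
    by apply: le_trans (_ : (e k.+1)%:E <= _)%E; [case: (hh k.+1)|rewrite lee_fin].
  have -> : (2%:E * (e k)%:E + 2%:E * (e k)%:E = (4 * e k)%:E)%E.
    by rewrite -EFinM -EFinD; congr EFin; ring.
  rewrite -EFinM lee_fin le_eqVlt; apply/orP; left; apply/eqP.
  by rewrite /e; field; rewrite gt_eqF.
have [G [mG hG]] := sqn_complete mF hd.
have sG : sqi mu G.
  rewrite (_ : G = fun x => (G x - FT (h 0%N) x) + FT (h 0%N) x); last first.
    by apply/funext => x; rewrite subrK.
  apply: sqiD; last exact: gspan_sqi.
  by split; [exact: cmeasurable_sub|exact: le_lt_trans (hG 0%N) (ltry _)].
have pow0 (d : R) : 0 < d -> \forall k \near \oo, (2^-1 ^+ k : R) < d.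
  move=> d0; have l1 : `|2^-1 : R| < 1 by rewrite ger0_norm ?invr_ge0// invf_lt1// ltr1n.
  have /cvgrPdist_lt/(_ _ d0) := cvg_expr l1.
  by apply: filterS => k; rewrite sub0r normrN ger0_norm// (ltW (t0 k)).
exists G; split; first exact/L2P.
exists h; split; first by move=> k; exact: gspan_schwartz.
  apply/L2_norm_cvg0 => d d0.
  have dc : 0 < Num.min (d * c) 1 by rewrite lt_min mulr_gt0//= ltr01.
  apply: filterS (pow0 _ dc) => k; rewrite lt_min => /andP[k1 k2].
  rewrite (_ : sqn _ _ = sqn mu (fun x => f x - h k x)%R); last first.
    by apply: eq_integral => x _; rewrite cabsB.
  apply: (@le_trans _ _ (e k)%:E); first by case: (hh k).
  rewrite lee_fin /e ler_pdivrMr ?mulr_gt0//.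
  have := t0 k; nra.
apply/L2_norm_cvg0 => d d0.
(* (9 t)^2 <= 81 t for 0 < t <= 1, where t = 2^-k. *)
have dc : 0 < Num.min (d / 81) 1 by rewrite lt_min divr_gt0//= ltr01.
apply: filterS (pow0 _ dc) => k; rewrite lt_min => /andP[k1 k2].
rewrite (_ : sqn _ _ = sqn mu (fun x => G x - FT (h k) x)%R); last first.
  by apply: eq_integral => x _; rewrite cabsB.
apply: le_trans (hG k) _; rewrite lee_fin.
have := t0 k; move: k1; rewrite ltr_pdivlMr//; nra.
Qed.

Lemma fourierP f : sqi mu f -> sqi mu (fourier f) /\ frel f (fourier f).
Proof.
move=> sf; have [g fg] := is_fourier_exists sf.
exact: (is_fourier_frel sf (xgetPex 0 (ex_intro _ g fg))).
Qed.

(** Surjectivity by conjugation: (2 pi)^-n times the conjugate of the transform of conj g. It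
    provides the witness that makes the [xget] in [inv_fourier] meaningful. *)
Lemma frel_preimage g : sqi mu g -> exists f, sqi mu f /\ frel f g.
Proof.
move=> sg; have [sF Fg] := fourierP (sqi_conj sg).
exists (fun x => twopin^-1 * conjc (fourier (fun y => conjc (g y)) x)); split.
  by apply: sqiZ; exact: sqi_conj.
move=> v gv; have gFv := gspan_fourier gv; have gc := gspan_conj gFv.
have := Fg _ gc; rewrite (fourier_inversion gv) => E.
under [RHS]eq_cint do rewrite -mulrA.
rewrite cintZ; last by apply: sqi_mul; [exact: sqi_conj|exact: gspan_sqi].
have -> : cint mu (fun x => conjc (fourier (fun y => conjc (g y)) x) * FT v x) =
    conjc (cint mu (fun x => fourier (fun y => conjc (g y)) x * conjc (FT v x))).
  rewrite -cint_conj; last by apply: sqi_mul; [exact: sF|exact: gspan_sqi].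
  by apply: eq_cint => x; rewrite [RHS]conjcM conjcK.
rewrite E -cint_conj; last first.
  apply: sqi_mul; first exact: sqi_conj.
  by apply: sqiZ; apply: sqi_conj; exact: gspan_sqi.
under [X in _ * X]eq_cint do rewrite !conjcM !conjcK mulrCA.
rewrite cintZ; last by apply: sqi_mul; [exact: sg|exact: gspan_sqi].
by rewrite /twopin [conjc _]conjc_real mulrA mulVf ?mul1r//; exact: twopin_neq0.
Qed.

Lemma inv_fourierP g : sqi mu g -> sqi mu (inv_fourier g) /\ frel (inv_fourier g) g.
Proof.
move=> sg; have [f [sf fg]] := frel_preimage sg.
have [sF fF] := fourierP sf.
have : L2 (inv_fourier g) /\ {ae mu, forall xi, fourier (inv_fourier g) xi = g xi}.
  apply: (xgetPex 0 (P := [set f | L2 f /\ {ae mu, forall xi, fourier f xi = g xi}])).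
  by exists f; split; [exact/L2P|exact: frel_uniq sF sg fF fg].
move=> [/L2P sI Ig]; split=> //.
have [sFI FI] := fourierP sI.
have [mI _] := sI; have [mFI _] := sFI; have [mg _] := sg.
by apply: (frel_ae mI mI mFI mg _ Ig FI); exact: aeT.
Qed.

(* Multiplying by a Gaussian reduces the bounded function on the right to a
   square integrable one. *)
Lemma frel_sup_bound f h (b : R) : sqi mu f -> sqi mu h -> cintegrable mu h -> frel f h ->
  (\int[mu]_x (cabs (h x))%:E <= b%:E)%E ->
  {ae mu, forall x, cabs (f x) <= 2 * b / (2 * pi) ^+ n}.
Proof.
move=> sf sh ih fh hb.
have c0 : (0 : R) < (2 * pi) ^+ n by rewrite exprn_gt0// mulr_gt0// pi_gt0.
have ihc := cintegrable_conj ih.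
(* The inversion integral of h, which satisfies the bound everywhere; it remains to see that f
   equals it almost everywhere. *)
pose G x := twopin^-1 * conjc (FT (fun y => conjc (h y)) x).
have mG : cmeasurable (G : T -> R[i]).
  apply: cmeasurable_mul; first exact: cmeasurable_cst.
  by apply: cmeasurable_conj; exact: cmeasurable_fourier.
have Gb x : cabs (G x) <= 2 * b / (2 * pi) ^+ n.
  have E : cabs (twopin^-1) = ((2 * pi) ^+ n)^-1.
    rewrite /twopin -[X in cabs X](rmorphV (real_complex R)) ?unitfE ?gt_eqF//.
    by rewrite [LHS]cabsr ger0_norm// invr_ge0 ltW.
  rewrite /G cabsM E cabsC mulrC ler_wpM2r ?invr_ge0 ?(ltW c0)// -lee_fin.
  apply: le_trans (fourier_bound x ihc) _; under eq_integral do rewrite cabsC.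
  by rewrite EFinM lee_pmul2l.
suff : {ae mu, forall x, gaussn x * (f x - G x) = 0}.
  apply: aeS => x /eqP; rewrite mulf_eq0 subr_eq0 => /orP[/eqP g0|/eqP ->//].
  by have := gaussn_inv x; rewrite g0 mul0r => /eqP; rewrite eq_sym oner_eq0.
have sg := gspan_sqi (gspan_gaussn R n).
have [mg _] := sg; have [mf _] := sf.
have g1 (x : V) : cabs (gaussn x) <= 1.
  rewrite cabs_atom; apply: (@le_trans _ _ (\prod_(i < n) (1 : R))); last by rewrite big1_eq.
  by apply: ler_prod => i _; rewrite gexp_ge0 gexp_le1.
have b0 : 0 <= 2 * b / (2 * pi) ^+ n by exact: le_trans (cabs_ge0 _) (Gb 0).
have sgf : sqi mu (fun x => gaussn x * f x).
  apply: (sqi_le (cmeasurable_mul mg mf) sf) => x.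
  by rewrite cabsM ler_piMl// cabs_ge0.
have sgG : sqi mu (fun x => gaussn x * G x).
  apply: (sqi_le (cmeasurable_mul mg mG) (sqiZ (2 * b / (2 * pi) ^+ n)%:C%C sg)) => x.
  rewrite [leLHS]cabsM [leRHS]cabsM cabsr ger0_norm// mulrC.
  by apply: ler_wpM2r; [exact: cabs_ge0|exact: Gb].
apply: gspan_separates => [|v gv].
  by under eq_fun do rewrite mulrBr; exact: sqiB.
have gmul : gspan (fun x => v x * gaussn x).
  rewrite (_ : (fun _ => _) = (fun x => v x * \prod_i (gexp 1 0 (x ord0 i))%:C%C)).
    by apply: (@gmultiplier_prod R n _ _ (fun i x => (gexp 1 0 (x ord0 i))%:C%C)) => // i; exact: gmultiplier_gexp.
  apply/funext => x; congr (_ * _); rewrite /gaussn /atom; apply: eq_bigr => i _.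
  by rewrite /gatom mul0r cis0 mulr1.
have [v' gv' v'E] := gspan_preimage gmul.
have iv := gspan_integrable gmul.
transitivity (cint mu (fun x => f x * (v x * gaussn x)) - cint mu (fun x => G x * (v x * gaussn x))).
  rewrite -cintB; last 2 first.
  - by apply: sqi_mul; [exact: sf|exact: gspan_sqi].
  - rewrite (_ : (fun _ => _) = (fun x => (gaussn x * G x) * v x)); last by apply/funext => x; ring.
    by apply: sqi_mul; [exact: sgG|exact: gspan_sqi].
  by apply: eq_cint => x; ring.
apply/eqP; rewrite subr_eq0; apply/eqP.
transitivity (cint mu (fun x => h x * v' x)).
  by rewrite fh// v'E.
rewrite /G; under [RHS]eq_cint do rewrite -mulrA.
have gvc := gspan_conj gmul; have ivc := gspan_integrable gvc.
have iP : cintegrable mu (fun x => conjc (FT (fun y => conjc (h y)) x) * (v x * gaussn x)).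
  have := cintegrableZ twopin (sqi_mul sgG (gspan_sqi gv)).
  congr cintegrable; apply/funext => x; rewrite /G; have := twopin_neq0 R n.
  set z := twopin => z0.
  by field.
rewrite cintZ//.
have -> : cint mu (fun x => conjc (FT (fun y => conjc (h y)) x) * (v x * gaussn x)) =
    conjc (cint mu (fun x => FT (fun y => conjc (h y)) x * conjc (v x * gaussn x))).
  rewrite -cint_conj; first by apply: eq_cint => x; rewrite [RHS]conjcM conjcK.
  have := cintegrable_conj iP; congr cintegrable.
  by apply/funext => x; rewrite [LHS]conjcM conjcK.
rewrite (multiplication_formula ihc ivc).
have -> : (fun x => conjc (v x * gaussn x)) = (fun x => conjc (FT v' x)) by rewrite v'E.
rewrite (fourier_inversion gv').
have gv'c := gspan_conj gv'.
rewrite -cint_conj; last first.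
  by apply: sqi_mul; [exact: sqi_conj|apply: sqiZ; exact: gspan_sqi].
under [X in _ * X]eq_cint do rewrite !conjcM !conjcK mulrCA.
rewrite cintZ; last by apply: sqi_mul; [exact: sh|exact: gspan_sqi].
by rewrite /twopin [conjc _]conjc_real mulrA mulVf ?mul1r//; exact: twopin_neq0.
Qed.

End FourierTransform.

Section FourierMultipliers.
Context (R : realType) (n : nat).
Local Notation V := 'rV[R]_n.
Local Notation T := (Rn R n).
Local Notation mu := (@leb R n).
Local Notation FT := (@fourier_schwartz R n).
Implicit Types (f g h u v a : V -> R[i]).

Lemma leb_setT_gt0 : (0 < mu setT)%E.
Proof.
apply: (@lt_le_trans _ _ (mu (hbox (fun=> 0) (fun=> 1 : R)))).
  by rewrite leb_hbox// big1 ?lte01// => i _; rewrite subr0.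
by apply: le_measure; rewrite ?inE//; exact: measurable_hbox.
Qed.

Lemma Linfty_normE a : Linfty_norm a = ess_sup mu (fun x : T => (cabs (a x))%:E).
Proof.
rewrite /Linfty_norm unlock leb_setT_gt0; apply: eq_ess_sup; apply: aeT => x /=.
by rewrite ger0_norm ?cabs_ge0.
Qed.

Lemma Linfty_bound a : Linfty a -> exists2 A : R, 0 <= A &
  {ae mu, forall x, cabs (a x) <= A}.
Proof.
move=> [ma]; rewrite Linfty_normE => /ess_supr_bounded[A hA].
exists (Num.max 0 A); first by rewrite le_max lexx.
by apply: aeS hA => x xA; rewrite le_max xA orbT.
Qed.

Section Fixed.
Variable a : V -> R[i].
Hypotheses (ma : cmeasurable (a : T -> R[i])).
Variable A : R.
Hypotheses (A0 : 0 <= A) (aA : {ae mu, forall x, cabs (a x) <= A}).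

Lemma sqi_mul_bounded g : sqi mu g -> sqi mu (fun x => a x * g x).
Proof.
move=> [mg g2]; have mag := cmeasurable_mul ma mg; split=> //.
apply: (@le_lt_trans _ _ (sqn mu (fun x => A%:C%C * g x))).
  apply: ae_ge0_le_integral => //.
  - by move=> x _; rewrite lee_fin sqr_ge0.
  - exact: measurable_sq mag.
  - by move=> x _; rewrite lee_fin sqr_ge0.
  - exact: measurable_sq (cmeasurable_mul (cmeasurable_cst _ _) mg).
  apply: aeS aA => x xA _; rewrite lee_fin ler_sqr ?nnegrE ?cabs_ge0//.
  rewrite [leLHS]cabsM [leRHS]cabsM cabsr ger0_norm//.
  by apply: ler_wpM2r => //; exact: cabs_ge0.
by rewrite sqnZ// lte_mul_pinfty// lee_fin sqr_ge0.
Qed.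

Lemma fourier_multP u : sqi mu u -> sqi mu (fourier_mult a u) /\
  frel (fourier_mult a u) (fun x => a x * fourier u x).
Proof. by move=> su; apply: inv_fourierP; apply: sqi_mul_bounded; case: (fourierP su). Qed.

(** [fourier] selects a representative and may select differently for arguments equal almost
    everywhere; [frel] pins the result down up to null sets. *)
Lemma fourier_mult_ae u v : sqi mu u -> sqi mu v -> {ae mu, forall x, u x = v x} ->
  {ae mu, forall x, fourier_mult a u x = fourier_mult a v x}.
Proof.
move=> su sv uv; have [sFu Fu] := fourierP su; have [sFv Fv] := fourierP sv.
have [s1 f1] := fourier_multP su; have [s2 f2] := fourier_multP sv.
have [mu_ _] := su; have [mv _] := sv; have [mFu _] := sFu.
have Fvu : frel v (fourier u).
  by apply: (frel_ae mu_ mv mFu mFu uv _ Fu); exact: aeT.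
have FF := frel_uniq sFu sFv Fvu Fv.
apply: (frel_inj s1 s2 (sqi_mul_bounded sFu) (sqi_mul_bounded sFv) _ f1 f2).
by apply: aeS FF => x ->.
Qed.

Lemma fourier_multD u v : sqi mu u -> sqi mu v ->
  {ae mu, forall x, fourier_mult a (fun y => u y + v y) x = fourier_mult a u x + fourier_mult a v x}.
Proof.
move=> su sv; have [sFu Fu] := fourierP su; have [sFv Fv] := fourierP sv.
have [s1 f1] := fourier_multP su; have [s2 f2] := fourier_multP sv.
have suv := sqiD su sv; have [sF Fuv] := fourierP suv.
have [s3 f3] := fourier_multP suv.
have FF := frel_uniq sF (sqiD sFu sFv) Fuv (frelD su sv sFu sFv Fu Fv).
apply: (frel_inj s3 (sqiD s1 s2) (sqi_mul_bounded sF)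
  (sqiD (sqi_mul_bounded sFu) (sqi_mul_bounded sFv)) _ f3).
  by apply: aeS FF => x ->; rewrite mulrDr.
exact: (frelD s1 s2 (sqi_mul_bounded sFu) (sqi_mul_bounded sFv) f1 f2).
Qed.

Lemma fourier_multZ c u : sqi mu u ->
  {ae mu, forall x, fourier_mult a (fun y => c * u y) x = c * fourier_mult a u x}.
Proof.
move=> su; have [sFu Fu] := fourierP su; have [s1 f1] := fourier_multP su.
have scu := sqiZ c su; have [sF Fcu] := fourierP scu.
have [s3 f3] := fourier_multP scu.
have FF := frel_uniq sF (sqiZ c sFu) Fcu (@frelZ R n c _ _ su sFu Fu).
apply: (frel_inj s3 (sqiZ c s1) (sqi_mul_bounded sF) (sqiZ c (sqi_mul_bounded sFu)) _ f3).
  by apply: aeS FF => x ->; rewrite mulrCA.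
exact: (@frelZ R n c _ _ s1 (sqi_mul_bounded sFu) f1).
Qed.

Lemma fourier_multB u v : sqi mu u -> sqi mu v ->
  {ae mu, forall x, fourier_mult a (fun y => u y - v y) x = fourier_mult a u x - fourier_mult a v x}.
Proof.
move=> su sv; have h1 := fourier_multD su (sqiZ (-1) sv); have h2 := fourier_multZ (-1) sv.
rewrite (_ : (fun y => u y - v y) = (fun y => u y + (-1) * v y)).
  by apply: aeS2 h1 h2 => x -> ->; rewrite mulN1r.
by apply/funext => x; rewrite mulN1r.
Qed.

(** F^-1 a F u - z u has the transform (a - z) F u, and the L^1 norm of a transform bounds the sup
    norm of the function. Information on [a] near one frequency becomes a pointwise estimate in
    space. *)
Lemma fourier_mult_near_cst u (z : R[i]) (b : R) : gspan u ->
  (\int[mu]_x (cabs ((a x - z) * FT u x))%:E <= b%:E)%E ->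
  {ae mu, forall x, cabs (fourier_mult a u x - z * u x) <= 2 * b / (2 * pi) ^+ n}.
Proof.
move=> gu hb; have su := gspan_sqi gu; have [s1 f1] := fourier_multP su.
have gF := gspan_fourier gu; have sFT := gspan_sqi gF.
have [sF Fu] := fourierP su.
have FF := frel_uniq sF sFT Fu (frel_gspan gu).
have mFT : cmeasurable (FT u : T -> R[i]) by case: sFT.
have f1' : frel (fourier_mult a u) (fun x => a x * FT u x).
  have [m1 _] := s1; have [mF _] := sF.
  apply: (frel_ae m1 m1 (cmeasurable_mul ma mF) (cmeasurable_mul ma mFT) _ _ f1).
    exact: aeT.
  by apply: aeS FF => x ->.
have s3 := sqi_mul_bounded sFT.
have f2 : frel (fun x => (- z) * u x) (fun x => (- z) * FT u x).
  exact: (@frelZ R n (- z) _ _ su sFT (frel_gspan gu)).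
have f3 := frelD s1 (sqiZ (- z) su) s3 (sqiZ (- z) sFT) f1' f2.
have E1 : (fun x => fourier_mult a u x + (- z) * u x) = (fun x => fourier_mult a u x - z * u x).
  by apply/funext => x; rewrite mulNr.
have E2 : (fun x => a x * FT u x + (- z) * FT u x) = (fun x => (a x - z) * FT u x).
  by apply/funext => x; rewrite mulrBl mulNr.
have s4 := sqiD s1 (sqiZ (- z) su); have s5 := sqiD s3 (sqiZ (- z) sFT).
rewrite E1 in s4 f3; rewrite E2 in s5 f3.
apply: (frel_sup_bound s4 s5 _ f3 hb).
apply/cintegrableP; split; first by case: s5.
exact: le_lt_trans hb (ltry _).
Qed.

End Fixed.
End FourierMultipliers.

(** * Dyadic cells and density points *)

Section DyadicCells.
Context (R : realType) (n : nat).
Local Notation V := 'rV[R]_n.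
Local Notation T := (Rn R n).
Local Notation mu := (@leb R n).
Local Notation cindic := (@cindic _ T R).
Implicit Types (x y : V) (k : nat).

Definition cell k x : {ffun 'I_n -> int} := [ffun i => Num.floor (2 ^+ k * x ord0 i)].

Definition cellset k (z : {ffun 'I_n -> int}) : set T := [set x | cell k x = z].

Let p2 k : 0 < 2 ^+ k :> R. Proof. exact: exprn_gt0. Qed.

Lemma measurable_cobox (al be : 'I_n -> R) k :
  measurable ([set x : T | forall i, al i <= 2 ^+ k * x ord0 i < be i]).
Proof.
apply: measurable_borel.
rewrite (_ : [set x : T | _] = [set x | forall i, (`[al i / 2 ^+ k, be i / 2 ^+ k[%classic) (x ord0 i)]).
  exact: (@borel_forall R n (fun i => `[al i / 2 ^+ k, be i / 2 ^+ k[%classic)).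
apply/seteqP; split => x h i; have := h i; rewrite /= in_itv /=.
  by rewrite ler_pdivrMr// ltr_pdivlMr// ![_ * 2 ^+ k]mulrC.
by rewrite ler_pdivrMr// ltr_pdivlMr// ![_ * 2 ^+ k]mulrC.
Qed.

Lemma cellsetE k z : cellset k z =
  [set x : T | forall i, (z i)%:~R <= 2 ^+ k * x ord0 i < (z i + 1)%:~R].
Proof.
apply/seteqP; split => x /=.
  by move=> <- i; rewrite ffunE floor_itv.
by move=> h; apply/ffunP => i; rewrite ffunE; apply: floor_def.
Qed.

Lemma measurable_cellset k z : measurable (cellset k z).
Proof. by rewrite cellsetE; exact: measurable_cobox. Qed.

(** With m = floor t, floor (2 t) is 2 m or 2 m + 1, so it determines m. *)
Lemma cellS k x y : cell k.+1 x = cell k.+1 y -> cell k x = cell k y.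
Proof.
move=> /ffunP xy; apply/ffunP => i; have := xy i; rewrite !ffunE.
rewrite exprS -!mulrA; move: (2 ^+ k * x ord0 i) (2 ^+ k * y ord0 i) => t s E.
apply/esym/floor_def; set m := Num.floor t.
have /andP[h1 h2] := floor_itv t; rewrite -/m intrD in h1 h2.
have i1 : m *+ 2 <= Num.floor (2 * t) by rewrite floor_ge_int mulr2n intrD; lra.
have i2 : Num.floor (2 * t) < m *+ 2 + 2 by rewrite floor_lt_int mulr2n !intrD; lra.
rewrite E in i1 i2; move: i1 i2; rewrite floor_ge_int floor_lt_int mulr2n !intrD.
by move=> i1 i2; apply/andP; split; lra.
Qed.

Definition cell_constant k (g : V -> R[i]) : Prop := forall x y, cell k x = cell k y -> g x = g y.

Lemma cell_constant_le k l g : (k <= l)%N -> cell_constant k g -> cell_constant l g.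
Proof.
move=> /subnK <- gk; elim: (l - k)%N => [//|m IH] x y xy.
by apply: IH; apply: cellS; rewrite -addSn.
Qed.

Definition cell_approx (f : T -> R[i]) : Prop := forall e : R, 0 < e -> exists g k,
  [/\ sqi mu g, cell_constant k g & (sqn mu (fun x => f x - g x)%R <= e%:E)%E].

Definition corner k x : V := \row_i ((cell k x i)%:~R / 2 ^+ k).

Lemma corner_bound k x i : corner k x ord0 i <= x ord0 i < corner k x ord0 i + 2 ^- k.
Proof.
rewrite mxE ffunE; have /andP[h1 h2] := floor_itv (2 ^+ k * x ord0 i).
rewrite ler_pdivrMr// [x ord0 i * _]mulrC h1/=.
rewrite (_ : _ + _ = ((Num.floor (2 ^+ k * x ord0 i))%:~R + 1) / 2 ^+ k); last by rewrite mulrDl mul1r.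
by rewrite ltr_pdivlMr// [x ord0 i * _]mulrC; move: h2; rewrite intrD.
Qed.

Lemma measurable_corner_hbox k al be : measurable (corner k @^-1` hbox al be : set T).
Proof.
rewrite (_ : _ @^-1` _ = [set x : T | forall i, (Num.floor (al i * 2 ^+ k) + 1)%:~R <=
   2 ^+ k * x ord0 i < (Num.floor (be i * 2 ^+ k) + 1)%:~R]); first exact: measurable_cobox.
have E x i : (al i < corner k x ord0 i <= be i) =
    ((Num.floor (al i * 2 ^+ k) + 1)%:~R <= 2 ^+ k * x ord0 i < (Num.floor (be i * 2 ^+ k) + 1)%:~R).
  rewrite mxE ffunE ltr_pdivlMr// ler_pdivrMr//; congr (_ && _).
    by rewrite -floor_ge_int lezD1 -floor_lt_int.
  by rewrite -floor_lt_int ltzD1 floor_ge_int.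
by apply/seteqP; split => x h i; have := h i; rewrite /= E.
Qed.

Lemma cell_approx_hbox al be : cell_approx (cindic (hbox al be : set T)).
Proof.
move=> e e0; pose C : set T := hbox al (fun i => be i + 1).
(* The cells whose lower corner lies in the box. Corners tend to the point from below, so for large
   [k] membership agrees with that in a box open below and closed above. *)
pose O k : set T := corner k @^-1` hbox al be.
have mO k : cmeasurable (cindic (O k) : T -> R[i]).
  exact: (cmeasurable_cindic R (measurable_corner_hbox k al be)).
have mh : cmeasurable (cindic (hbox al be : set T) : T -> R[i]).
  exact: (cmeasurable_cindic R (measurable_hbox al be)).
have sC : sqi mu (cindic C).
  exact: (sqi_cindic (measurable_hbox al _) (leb_hbox_fin al _)).
have ig : (\int[mu]_x ((\1_C x : R) ^+ 2)%:E < +oo)%E.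
  have [_] := sC; rewrite (_ : integral _ _ _ = sqn mu (cindic C))//.
  by apply: eq_integral => x _; rewrite cabs_cindic.
have mgC : measurable_fun [set: T] (\1_C : T -> R).
  by apply: measurable_indic; exact: measurable_hbox.
have k1 k : 2 ^- k <= 1 :> R by rewrite invf_le1// exprn_ege1// ler1n.
have OC k x : O k x -> C x.
  move=> h i; have /andP[h1 h2] := h i; have /andP[h3 h4] := corner_bound k x i.
  by have := k1 k; rewrite (lt_le_trans h1 h3)/=; lra.
have HC x : (hbox al be : set T) x -> C x.
  by move=> h i; have /andP[h1 h2] := h i; rewrite h1/=; lra.
have pow0 (d : R) : 0 < d -> \forall k \near \oo, 2 ^- k < d.
  move=> d0; have l1 : `|2^-1 : R| < 1 by rewrite ger0_norm ?invr_ge0// invf_lt1// ltr1n.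
  have /cvgrPdist_lt/(_ _ d0) := cvg_expr l1.
  by apply: filterS => k; rewrite sub0r normrN ger0_norm ?exprVn// invr_ge0 ltW.
have [||k hk] := filter_ex (sqn_dct mO mh mgC ig _ _ e0).
- move=> k x; rewrite cabs_cindicB !indicE.
  have [xC|xC] := pselect (C x).
    rewrite (mem_set xC); case: (_ \in _); case: (_ \in _);
      by rewrite ?subrr ?subr0 ?sub0r ?normrN ?normr0 ?normr1.
  have xO : ~ O k x by move/OC.
  have xH : ~ (hbox al be : set T) x by move/HC.
  by rewrite (memNset xC) (memNset xO) (memNset xH) subrr normr0.
- move=> x; apply: cvg_near_cst.
  suff : \forall k \near \oo, O k x <-> (hbox al be : set T) x.
    apply: filterS => k xO; rewrite cabs_cindicB !indicE.
    by have -> : (x \in O k) = (x \in (hbox al be : set T)); [apply/idP/idP; rewrite !inE; tauto|rewrite subrr normr0].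
  have [xH|xH] := pselect ((hbox al be : set T) x).
    have : \forall k \near \oo, forall i, 2 ^- k < x ord0 i - al i.
      apply: filter_forall => i; apply: pow0.
      by have /andP[h1 _] := xH i; rewrite subr_gt0.
    apply: filterS => k hk; split=> // _ i; have /andP[h1 h2] := xH i.
    by have /andP[h3 h4] := corner_bound k x i; have := hk i; lra.
  have /existsNP[i hi] := xH.
  have [ali|ali] := ltP (al i) (x ord0 i); last first.
    apply: nearW => k; split=> // h; exfalso; have /andP[h1 _] := h i.
    by have /andP[h3 _] := corner_bound k x i; lra.
  have bi : 0 < x ord0 i - be i by rewrite subr_gt0 ltNge; apply/negP => h; apply: hi; rewrite ali h.
  apply: filterS (pow0 _ bi) => k hk; split=> // h; exfalso; have /andP[_ h2] := h i.
  by have /andP[_ h4] := corner_bound k x i; lra.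
exists (cindic (O k)), k; split.
- apply: (sqi_le (mO k) sC) => x; rewrite !cabs_cindic !indicE.
  have [xO|xO] := pselect (O k x); last by rewrite (memNset xO).
  by rewrite (mem_set xO) (mem_set (OC _ _ xO)).
- move=> x y xy; rewrite /cindic !indicE.
  have cE : corner k x = corner k y by rewrite /corner xy.
  have -> // : (x \in O k) = (y \in O k).
  by apply/idP/idP; rewrite !inE /O /preimage /= cE.
- rewrite (_ : sqn _ _ = sqn mu (fun x => cindic (O k) x - cindic (hbox al be : set T) x)%R)//.
  by apply: eq_integral => x _; rewrite cabsB.
Qed.

Lemma cell_approx_sqi (f : T -> R[i]) : sqi mu f -> cell_approx f.
Proof.
apply: (@sqi_ind R n cell_approx).
- move=> f1 f2 [m1 _] [m2 _] d1 d2 e e0; have e4 : 0 < e / 4 by rewrite divr_gt0.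
  have [g1 [k1 [s1 c1 h1]]] := d1 _ e4; have [g2 [k2 [s2 c2 h2]]] := d2 _ e4.
  exists (fun x => g1 x + g2 x), (maxn k1 k2); split; first exact: sqiD.
    move=> x y xy; congr (_ + _).
      by apply: (cell_constant_le (leq_maxl k1 k2) c1).
    by apply: (cell_constant_le (leq_maxr k1 k2) c2).
  have [mg1 _] := s1; have [mg2 _] := s2.
  rewrite (_ : (fun _ => _) = (fun x => (f1 x - g1 x) + (f2 x - g2 x))); last first.
    by apply/funext => x; ring.
  apply: le_trans (sqnD _ _ _) _; [exact: cmeasurable_sub|exact: cmeasurable_sub|].
  apply: (@le_trans _ _ (2%:E * (e / 4)%:E + 2%:E * (e / 4)%:E)%E).
    by apply: leeD; rewrite lee_pmul2l.
  by rewrite -!EFinM -EFinD lee_fin; lra.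
- move=> c {}f [mf _] df e e0.
  have k0 : 0 < cabs c ^+ 2 + 1 by rewrite ltr_wpDl// sqr_ge0.
  have ek : 0 < e / (cabs c ^+ 2 + 1) by rewrite divr_gt0.
  have [g [k [sg cg hg]]] := df _ ek; have [mg _] := sg.
  exists (fun x => c * g x), k; split; first exact: sqiZ.
    by move=> x y xy; congr (_ * _); exact: cg.
  rewrite (_ : (fun _ => _) = (fun x => c * (f x - g x))); last first.
    by apply/funext => x; rewrite mulrBr.
  rewrite sqnZ; last exact: cmeasurable_sub.
  apply: (@le_trans _ _ ((cabs c ^+ 2)%:E * (e / (cabs c ^+ 2 + 1))%:E)%E).
    by rewrite lee_wpmul2l// lee_fin sqr_ge0.
  by rewrite -EFinM lee_fin mulrA ler_pdivrMr// mulrC ler_wpM2l ?(ltW e0)// lerDl.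
- move=> {}f [mf _] h e e0; have e4 : 0 < e / 4 by rewrite divr_gt0.
  have [g [[mg _] dg fg]] := h _ e4; have [w [k [sw cw hw]]] := dg _ e4.
  exists w, k; split => //; have [mw _] := sw.
  rewrite (_ : (fun _ => _) = (fun x => (f x - g x) + (g x - w x))); last first.
    by apply/funext => x; ring.
  apply: le_trans (sqnD _ _ _) _; [exact: cmeasurable_sub|exact: cmeasurable_sub|].
  apply: (@le_trans _ _ (2%:E * (e / 4)%:E + 2%:E * (e / 4)%:E)%E).
    by apply: leeD; rewrite lee_pmul2l.
  by rewrite -!EFinM -EFinD lee_fin; lra.
- exact: cell_approx_hbox.
Qed.

End DyadicCells.

Lemma sqn_chebyshev d (T : measurableType d) (R : realType) (mu : {measure set T -> \bar R})
    (f : T -> R[i]) (D : set T) (c : R) : cmeasurable f -> measurable D -> 0 <= c ->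
  (forall x, D x -> c <= cabs (f x)) -> ((c ^+ 2)%:E * mu D <= sqn mu f)%E.
Proof.
move=> mf mD c0 hD.
have mi : measurable_fun setT (fun x => (\1_D x)%:E : \bar R).
  exact/measurable_EFinP/measurable_indic.
rewrite -(setIT D) -integral_indic// /sqn -ge0_integralZl//; last by rewrite lee_fin sqr_ge0.
apply: ge0_le_integral => //.
- by move=> x _; rewrite -EFinM lee_fin mulr_ge0// sqr_ge0.
- by apply: emeasurable_funM.
- exact: measurable_sq.
- move=> x _; rewrite -EFinM lee_fin indicE; case: (boolP (x \in D)) => [|_].
    by rewrite inE => /hD h; rewrite mulr1 ler_sqr ?nnegrE ?cabs_ge0.
  by rewrite mulr0 sqr_ge0.
Qed.

Section DensityPoint.
Context (R : realType) (n : nat).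
Local Notation V := 'rV[R]_n.
Local Notation T := (Rn R n).
Local Notation mu := (@leb R n).
Implicit Types (k : nat) (z : {ffun 'I_n -> int}).

(** Cells of level [k] enumerated by natural numbers, with the empty set at numbers that code no
    index, so that measures add up as a series. *)
Let F k (j : nat) : set T :=
  if pickle_inv j is Some z then @cellset R n k z else set0.

Let mF k j : measurable (F k j).
Proof. by rewrite /F; case: pickle_inv => [z|]; [exact: measurable_cellset|exact: measurable0]. Qed.

Lemma measure_cells k (A : set T) : measurable A ->
  (mu A = \sum_(0 <= j <oo) mu (A `&` F k j))%E.
Proof.
move=> mA; rewrite -measure_semi_bigcup.
- congr (mu _); apply/seteqP; split=> [x Ax|x [j _ []]//].
  exists (pickle (cell k x)) => //; split=> //.
  by rewrite /F pickleK_inv.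
- by move=> j; exact: measurableI.
- move=> i j _ _ [x [[_ Fi] [_ Fj]]]; move: Fi Fj; rewrite /F.
  case Ei : (pickle_inv i) => [z|//]; case Ej : (pickle_inv j) => [z'|//].
  rewrite /cellset /= => zE z'E; have zz : z = z' by rewrite -zE -z'E.
  have := @pickle_invK {ffun 'I_n -> int} i; have := @pickle_invK {ffun 'I_n -> int} j.
  by rewrite Ei Ej /= zz => <- <-.
- by apply: bigcup_measurable => j _; exact: measurableI.
Qed.

Lemma measure_cells_le k (A B : set T) (c : R) : measurable A -> measurable B ->
  0 <= c -> (forall z, c%:E * mu (A `&` cellset k z) <= mu (B `&` cellset k z))%E ->
  (c%:E * mu A <= mu B)%E.
Proof.
move=> mA mB c0 AB; rewrite (measure_cells k mA) (measure_cells k mB).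
rewrite -nneseriesZl => [|j _]; last exact: measure_ge0.
apply: lee_nneseries => [j _ _|j _].
  by rewrite mule_ge0// lee_fin.
by rewrite /F; case: pickle_inv => [z|]; rewrite ?AB// !setI0 !measure0 mule0.
Qed.

(** Cells are closed below and [hbox] is open below, so the cell is enlarged by one side downwards.
    The box has side 2 * 2^-k, four times the half-side of the cell. *)
Lemma cellset_le k z (E : set T) (d : R) : 0 <= d ->
  (mu (cellset k z `\` E) <= d%:E * mu (cellset k z) ->
   mu (cellset k z `\` E) <= (d * (4 * (2^-1 / 2 ^+ k)) ^+ n)%:E)%E.
Proof.
move=> d0 /le_trans; apply; rewrite EFinM lee_wpmul2l ?lee_fin//.
pose al i : R := ((z i)%:~R - 1) / 2 ^+ k; pose be i : R := ((z i)%:~R + 1) / 2 ^+ k.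
have p2 : 0 < 2 ^+ k :> R by exact: exprn_gt0.
apply: (@le_trans _ _ (mu (hbox al be : set T))).
  apply: le_measure; rewrite ?inE; [exact: measurable_cellset|exact: measurable_hbox|].
  move=> x; rewrite cellsetE => h i; have /andP[h1 h2] := h i.
  rewrite intrD in h2.
  rewrite ltr_pdivrMr// ler_pdivlMr// [x ord0 i * _]mulrC (ltW h2) andbT.
  by apply: lt_le_trans h1; rewrite ltrBlDr ltrDl.
rewrite leb_hbox => [|i]; last by rewrite ler_pM2r ?invr_gt0//; lra.
rewrite lee_fin (eq_bigr (fun=> 4 * (2^-1 / 2 ^+ k))) => [|i _].
  by rewrite prodr_const card_ord.
by rewrite /al /be -mulrBl; field; rewrite gt_eqF.
Qed.

(** Otherwise let g be a dyadic step function close to the indicator of E, and G the set where |g|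
    >= 1/2, a union of cells. By Chebyshev E \ G and G \ E have measure at most 4 e, while d mu G <=
    mu (G \ E); hence mu E <= 4 e (1 + 1/d). *)
Lemma density_cell (E : set T) (d : R) : measurable E -> (0 < mu E)%E -> (mu E < +oo)%E ->
  0 < d -> exists k z, (mu (cellset k z `\` E) <= d%:E * mu (cellset k z))%E.
Proof.
move=> mE E0 Eoo d0.
have Ef : mu E \is a fin_num by rewrite ge0_fin_numE.
pose m := fine (mu E); have m0 : 0 < m by rewrite fine_gt0// E0.
(* Turns 4 e (1 + 1/d) into half of mu E, which is the contradiction. *)
pose e : R := m / 8 / (1 + d^-1).
have dd : 0 < 1 + d^-1 by rewrite addr_gt0// invr_gt0.
have e0 : 0 < e by apply: divr_gt0 => //; apply: divr_gt0.
have sE := sqi_cindic mE Eoo; have [mcE _] := sE.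
have [g [k [sg gk hg]]] := cell_approx_sqi sE e0; have [mg g2] := sg.
pose G : set T := [set x | 2^-1 <= cabs (g x)].
have mG : measurable G.
  rewrite (_ : G = (fun x => cabs (g x)) @^-1` `[2^-1, +oo[%classic).
    by rewrite -[X in measurable X]setTI; apply: (cmeasurable_cabs mg).
  by apply/seteqP; split => x /=; rewrite in_itv/= andbT.
have cheb (D : set T) : measurable D -> (forall x, D x -> 2^-1 <= cabs (cindic R E x - g x)) ->
    (mu D <= (4 * e)%:E)%E.
  move=> mD hD.
  have h0 : 0 <= 2^-1 :> R by rewrite invr_ge0.
  have := le_trans (sqn_chebyshev mu (cmeasurable_sub mcE mg) mD h0 hD) hg.
  rewrite exprVn lee_pdivrMl ?exprn_gt0// -EFinM => /le_trans; apply.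
  by rewrite lee_fin; have := e0; rewrite expr2; lra.
have h1 : (mu (E `\` G) <= (4 * e)%:E)%E.
  apply: cheb; first exact: measurableD.
  move=> x [Ex /negP]; rewrite -ltNge => gx.
  apply: le_trans (ler_cabs_sub _ _); rewrite cabs_cindic indicE mem_set//=; lra.
have h2 : (mu (G `\` E) <= (4 * e)%:E)%E.
  apply: cheb; first exact: measurableD.
  by move=> x [Gx Ex]; rewrite /cindic indicE memNset//= sub0r cabsN.
apply: contrapT => /forallNP H.
have Hz z : (d%:E * mu (cellset k z) <= mu (cellset k z `\` E))%E.
  have /forallNP/(_ z)/negP := H k; rewrite -ltNge; exact: ltW.
have h3 : (d%:E * mu G <= mu (G `\` E))%E.
  apply: (measure_cells_le (k := k)) => //; [exact: measurableD|exact: ltW|move=> z].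
  have [[x [Gx xz]]|nG] := pselect (exists x, G x /\ cellset k z x).
    have zG : cellset k z `<=` G.
      by move=> y yz; rewrite /G /= (gk y x)//; rewrite yz xz.
    rewrite (_ : G `&` _ = cellset k z); last by rewrite setIC; apply/setIidPl.
    rewrite (_ : _ `&` _ = cellset k z `\` E)//.
    by apply/seteqP; split => [y [[_ ?] ?]//|y [yz ?]]; split=> //; split=> //; exact: zG.
  rewrite (_ : G `&` _ = set0) ?measure0 ?mule0//.
  by apply/seteqP; split => // y [Gy yz]; apply: nG; exists y.
have h4 : (mu E <= (4 * e)%:E + mu G)%E.
  rewrite (measureDI mu mE mG); apply: leeD => //.
  by apply: le_measure; rewrite ?inE//; exact: measurableI.
have h5 : (mu G <= (d^-1 * (4 * e))%:E)%E.
  by rewrite EFinM -lee_pdivrMl ?invr_gt0// invrK; exact: le_trans h2.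
have : (mu E <= (4 * e + d^-1 * (4 * e))%:E)%E by apply: le_trans h4 _; rewrite EFinD leeD2l.
rewrite -(fineK Ef) lee_fin -/m (_ : _ + _ = m / 2); first by move: m0; lra.
have d1 : 0 < d + 1 by rewrite addr_gt0.
by rewrite /e; field; rewrite (gt_eqF d1) (gt_eqF d0).
Qed.

(** [Q] is a dyadic cell with centre [b] and half-side [r]. The defect is measured against r^n so
    that it scales with the width of the packet chosen later. *)
Lemma density_box (E : set T) (d : R) : measurable E -> (0 < mu E)%E -> 0 < d ->
  exists (b : V) (r : R) (Q : set T), [/\ 0 < r, measurable Q,
    forall x, ~ Q x -> exists i, r <= `|x ord0 i - b ord0 i| &
    (mu (Q `\` E) <= (d * r ^+ n)%:E)%E].
Proof.
move=> mE E0 d0.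
pose K N : set T := E `&` @cube0 R n N.
have mK N : measurable (K N) by apply: measurableI => //; exact: measurable_hbox.
have [N KN] : exists N, (0 < mu (K N))%E.
  apply: contrapT => /forallNP H.
  have : (mu E <= \sum_(0 <= N <oo) mu (K N))%E.
    apply: measure_sigma_subadditive => //.
    by move=> x Ex; have [N _ hN] := cube0_cvg x; exists N => //; split=> //; exact: (hN N (leqnn _)).
  rewrite eseries0 => [|N _ _]; first by rewrite leNgt E0.
  by apply/eqP; rewrite eq_le measure_ge0 andbT leNgt; apply/negP; exact: H.
have Koo : (mu (K N) < +oo)%E.
  apply: le_lt_trans (leb_hbox_fin (fun=> - N%:R) (fun=> N%:R : R)).
  by apply: le_measure; rewrite ?inE//; [exact: measurable_hbox|move=> x []].
(* Compensates the factor 4 per coordinate of [cellset_le]. *)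
pose d' := d / 4 ^+ n; have d'0 : 0 < d' by rewrite divr_gt0// exprn_gt0.
have [k [z kz]] := density_cell (mK N) KN Koo d'0.
have p2 : 0 < 2 ^+ k :> R by exact: exprn_gt0.
exists (\row_i (((z i)%:~R + 2^-1) / 2 ^+ k)), (2^-1 / 2 ^+ k), (cellset k z); split.
- by rewrite divr_gt0// invr_gt0.
- exact: measurable_cellset.
- move=> x; rewrite cellsetE => /existsNP[i /negP hi]; exists i; rewrite mxE.
  have E2 : x ord0 i - ((z i)%:~R + 2^-1) / 2 ^+ k = (2 ^+ k * x ord0 i - ((z i)%:~R + 2^-1)) / 2 ^+ k.
    by field; rewrite gt_eqF.
  have i2 : 0 <= (2 ^+ k)^-1 :> R by rewrite invr_ge0 ltW.
  rewrite E2 normrM (ger0_norm i2) ler_pM2r ?invr_gt0//.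
  move: hi; rewrite intrD negb_and -ltNge -leNgt => /orP[h|h]; rewrite ler_normr.
    by apply/orP; right; lra.
  by apply/orP; left; lra.
have kzE : (mu (cellset k z `\` E) <= mu (cellset k z `\` K N))%E.
  apply: le_measure; rewrite ?inE; [exact: (measurableD (measurable_cellset _ _))|exact: (measurableD (measurable_cellset _ _))|].
  by move=> x [zx Ex]; split=> // -[].
apply: le_trans kzE _; apply: le_trans (cellset_le (ltW d'0) kz) _.
by rewrite lee_fin exprMn /d' mulrA divfK// gt_eqF// exprn_gt0.
Qed.

(** The values of [a] of modulus above [c] are covered by countably many squares of side [e] with
    rational centres. The preimage of one of them has positive measure, and z is its centre. *)
Lemma essential_value (a : V -> R[i]) (c e : R) : cmeasurable (a : T -> R[i]) -> 0 < e ->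
  ~ {ae mu, forall x, cabs (a x) <= c} ->
  exists (z : R[i]) (E : set T), [/\ measurable E, (0 < mu E)%E,
    forall x, E x -> cabs (a x - z) <= e & c - e <= cabs z].
Proof.
move=> ma e0 nc; have [m1 m2] := ma.
pose A : set T := [set x | c < cabs (a x)].
have mA : measurable A.
  rewrite (_ : A = (fun x => cabs (a x)) @^-1` `]c, +oo[%classic).
    by rewrite -[X in measurable X]setTI; apply: (cmeasurable_cabs ma).
  by apply/seteqP; split => x /=; rewrite in_itv/= andbT.
pose e2 := e / 2; have e20 : 0 < e2 by rewrite divr_gt0.
pose D (q : rat * rat) : set T := A `&` ([set x | ratr q.1 - e2 < Re (a x) < ratr q.1 + e2] `&`
   [set x | ratr q.2 - e2 < Im (a x) < ratr q.2 + e2]).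
have mD q : measurable (D q).
  apply: measurableI => //; apply: measurableI.
    rewrite (_ : [set x | _] = (Re \o a) @^-1` `]ratr q.1 - e2, ratr q.1 + e2[%classic).
      by rewrite -[X in measurable X]setTI; exact: m1.
    by apply/seteqP; split => x /=; rewrite in_itv.
  rewrite (_ : [set x | _] = (Im \o a) @^-1` `]ratr q.2 - e2, ratr q.2 + e2[%classic).
    by rewrite -[X in measurable X]setTI; exact: m2.
  by apply/seteqP; split => x /=; rewrite in_itv.
have near_rat (t : R) : exists q, ratr q - e2 < t < ratr q + e2.
  have : t - e2 < t + e2 by lra.
  by move=> /rat_in_itvoo[q]; rewrite in_itv/= => /andP[h1 h2]; exists q; apply/andP; split; lra.
have [q Dq] : exists q, (0 < mu (D q))%E.
  apply: contrapT => /forallNP H; apply: nc.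
  have Aneg : mu.-negligible A.
    have := @negligible_bigcup _ T R mu (fun j => if pickle_inv j is Some q then D q else set0).
    move=> h; apply: negligibleS (h _) => [|j].
      move=> x Ax; have [q1 h1] := near_rat (Re (a x)); have [q2 h2] := near_rat (Im (a x)).
      exists (pickle (q1, q2)); first exact: I.
      rewrite pickleK_inv; exact: (conj Ax (conj h1 h2)).
    case: pickle_inv => [q|]; last exact: negligible_set0.
    apply/negligibleP => //; apply/eqP; rewrite eq_le measure_ge0 andbT leNgt.
    by apply/negP; exact: H.
  apply: negligibleS Aneg => x /= /negP; rewrite -ltNge; exact.
exists (ratr q.1 +i* ratr q.2)%C, (D q); split=> //.
  move=> x [_ [/andP[h1 h2] /andP[h3 h4]]].
  apply: le_trans (ler_cabs_ReIm _) _; rewrite ReD ImD ReN ImN /=.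
  rewrite [leRHS]splitr; apply: lerD; rewrite ler_norml; apply/andP; split;
    move: h1 h2 h3 h4; rewrite /e2; lra.
have [x [Ax [/andP[h1 h2] /andP[h3 h4]]]] : exists x, D q x.
  by apply: contrapT => /forallNP H; move: Dq; rewrite (_ : D q = set0) ?measure0 ?ltxx//; apply/seteqP; split.
set z : R[i] := (_ +i* _)%C.
have h : cabs (a x - z) <= e.
  apply: le_trans (ler_cabs_ReIm _) _; rewrite ReD ImD ReN ImN /=.
  rewrite [leRHS]splitr; apply: lerD; rewrite ler_norml; apply/andP; split;
    move: h1 h2 h3 h4; rewrite /e2; lra.
have := ler_cabs_sub (a x) (a x - z); rewrite opprB addrCA subrr addr0.
by move: Ax; rewrite /A /= => Ax; lra.
Qed.

End DensityPoint.

(** * Wiener-Hopf operators on weighted variable Lebesgue spaces *)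

Section WeightedSpace.
Context d (T : measurableType d) (R : realType).
Variable mu : {measure set T -> \bar R}.
Variables (p : exponent T R) (w : weight mu) (Om : set T) (mOm : measurable Om).
Local Notation X := (LpwSpace p w Om).
Local Notation N f := (luxemburg mu p (wabs w f)).
Implicit Types (f g : T -> R[i]) (x y : X).

Lemma ext0_in f t : Om t -> ext0 Om f t = f t.
Proof. by move=> Ot; rewrite /ext0 /patch mem_set. Qed.

Lemma ext0_out f t : ~ Om t -> ext0 Om f t = 0.
Proof. by move=> Ot; rewrite /ext0 /patch memNset. Qed.

Lemma ext0_cindic f : ext0 Om f = (fun t => f t * cindic R Om t).
Proof.
apply/funext => t; rewrite /cindic indicE; have [Ot|Ot] := pselect (Om t).
  by rewrite ext0_in// mem_set// mulr1.
by rewrite ext0_out// memNset// mulr0.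
Qed.

Lemma ext0_id f : (forall t, ~ Om t -> f t = 0) -> ext0 Om f = f.
Proof.
move=> f0; apply/funext => t; have [Ot|Ot] := pselect (Om t); first exact: ext0_in.
by rewrite ext0_out// f0.
Qed.

Lemma cmeasurable_ext0 f : cmeasurable f -> cmeasurable (ext0 Om f).
Proof.
by move=> mf; rewrite ext0_cindic; apply: cmeasurable_mul => //; exact: cmeasurable_cindic.
Qed.

Lemma Lpw_norm_ext0 f : Lpw_norm p w Om f = N (ext0 Om f).
Proof. by []. Qed.

Lemma Lpw_space_valP x : cmeasurable (ext0 Om x) /\ (N (ext0 Om x) < +oo)%E.
Proof. exact/LpwP/Lpw_valP. Qed.

Lemma Lpw_space_normE x : (`|x|%:E = N (ext0 Om x))%E.
Proof. by rewrite -[RHS]fineK//; exact: Lpw_norm_fin. Qed.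

Lemma Lpw_space_exists f : cmeasurable (ext0 Om f) -> (N (ext0 Om f) < +oo)%E ->
  exists x : X, {ae mu, forall t, Om t -> x t = f t}.
Proof.
move=> mf nf; have fL : f \in Lpw p w Om by apply/LpwP; split.
by exists (Lpw_class (MkLpwFun fL)); exact: Lpw_reprK.
Qed.

Lemma Lpw_space_eqP x y : x = y <-> {ae mu, forall t, Om t -> x t = y t}.
Proof. by rewrite -Lpw_classP !Lpw_classK. Qed.

Lemma Lpw_space_lin (c : R[i]) x y :
  {ae mu, forall t, Om t -> Lpw_repr (c *: x + y) t = c * x t + y t}.
Proof.
have h1 : {ae mu, forall t, Om t -> Lpw_repr (c *: x) t = c * x t} by exact: Lpw_reprK.
have h2 : {ae mu, forall t, Om t -> Lpw_repr (c *: x + y) t = Lpw_repr (c *: x) t + y t}.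
  have := Lpw_reprK (repr (c *: x) + repr y); rewrite Lpw_classD !Lpw_classK; exact.
by apply: aeS2 h1 h2 => t h1 h2 Ot; rewrite h2// h1.
Qed.

Lemma ae_ext0 f g : {ae mu, forall t, Om t -> f t = g t} ->
  {ae mu, forall t, ext0 Om f t = ext0 Om g t}.
Proof.
apply: aeS => t fg; have [Ot|Ot] := pselect (Om t); first by rewrite !ext0_in// fg.
by rewrite !ext0_out.
Qed.

Lemma Lpw_space_norm_ae x f : cmeasurable (ext0 Om f) ->
  {ae mu, forall t, Om t -> x t = f t} -> (`|x|%:E = N (ext0 Om f))%E.
Proof.
move=> mf xf; rewrite Lpw_space_normE; apply: ae_eq_luxw => //.
  by case: (Lpw_space_valP x).
exact: ae_ext0.
Qed.

Lemma Lpw_space_normB_ae x y f g : cmeasurable (ext0 Om f) -> cmeasurable (ext0 Om g) ->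
  {ae mu, forall t, Om t -> x t = f t} -> {ae mu, forall t, Om t -> y t = g t} ->
  (`|x - y|%:E = N (fun t => ext0 Om f t - ext0 Om g t)%R)%E.
Proof.
move=> mf mg xf yg.
have E : (fun t => ext0 Om f t - ext0 Om g t) = ext0 Om (fun t => f t - g t).
  apply/funext => t; have [Ot|Ot] := pselect (Om t); first by rewrite !ext0_in.
  by rewrite !ext0_out// subrr.
rewrite E; apply: Lpw_space_norm_ae.
  by rewrite -E; exact: cmeasurable_sub.
have := Lpw_space_lin (-1) y x; rewrite scaleN1r addrC.
by move=> h; apply: filterS3 h xf yg => t h1 h2 h3 Ot; rewrite h1// h2// h3// mulN1r addrC.
Qed.

End WeightedSpace.

Lemma le_of_ediv (R : realType) (x y : \bar R) (r : R) : 0 < r ->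
  (x / r%:E <= y)%E -> (x <= y * r%:E)%E.
Proof. by move=> r0; rewrite inver (gt_eqF r0) lee_pdivrMr. Qed.

Section WienerHopfExtension.
Context (R : realType) (n : nat).
Local Notation V := 'rV[R]_n.
Local Notation T := (Rn R n).
Local Notation mu := (@leb R n).
Variables (p : exponent T R) (w : weight mu).
Local Notation N f := (luxemburg mu p (wabs w f)).
Implicit Types (f g u v : V -> R[i]).

(** The supremum in [multiplier] runs over nonzero classes; here it becomes an inequality for
    functions. The zero class is treated apart, through the compatibility of the multiplier with
    equality almost everywhere. *)
Lemma multiplier_bound a : multiplier p w a -> exists2 M : R, 0 <= M &
  forall f, sqi mu f -> (N f < +oo)%E -> (N (fourier_mult a f) <= M%:E * N f)%E.
Proof.
move=> [La supM]; have [ma _] := La; have [A A0 aA] := Linfty_bound La.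
set S := ereal_sup _ in supM.
exists (Num.max 0 (fine S)); first by rewrite le_max lexx.
move=> f sf Nf; have [mf _] := sf.
have eT (g : T -> R[i]) : ext0 setT g = g by apply: ext0_id => t /(_ I).
have mSf : cmeasurable (fourier_mult a f : T -> R[i]).
  by have [[]] := fourier_multP ma A0 aA sf.
have [u uf] : exists u : LpwSpace p w setT, {ae mu, forall t, setT t -> u t = f t}.
  by apply: Lpw_space_exists; rewrite eT.
have {}uf : {ae mu, forall t, u t = f t} by apply: aeS uf => t; exact.
have [mu_ Nu] := Lpw_space_valP u; rewrite eT in mu_ Nu.
have su : sqi mu u.
  by split=> //; rewrite (ae_eq_sqn mu_ mf uf); case: sf.
have NuE : N u = N f by exact: ae_eq_luxw.
have [sSu _] := fourier_multP ma A0 aA su; have [mSu _] := sSu.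
have NS : N (fourier_mult a u) = N (fourier_mult a f).
  by apply: ae_eq_luxw => //; exact: (fourier_mult_ae ma A0 aA su sf uf).
have [u0|u0] := eqVneq u 0.
  have Nf0 : N f = 0%E.
    by rewrite -NuE -[u in N u]eT -Lpw_space_normE u0 normr0.
  have f0 := luxw_eq0 mf Nf0.
  have s0 : sqi mu (fun=> 0 : R[i]) by rewrite (_ : (fun=> 0) = (fun t => 0 * f t)); [exact: sqiZ|apply/funext => t; rewrite mul0r].
  have h1 := fourier_mult_ae ma A0 aA sf s0 f0.
  have h2 := fourier_multZ ma A0 aA 0 sf.
  have h3 : {ae mu, forall t, fourier_mult a f t = 0}.
    rewrite (_ : (fun y => 0 * f y) = (fun=> 0)) in h2; last by apply/funext => t; rewrite mul0r.
    by apply: aeS2 h1 h2 => t -> ->; rewrite mul0r.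
  rewrite Nf0 mule0 (ae_eq_luxw p w mSf (cmeasurable_cst _ 0) h3).
  by have := luxwZ p w 0 (fun=> 0); rewrite cabs0 mul0e; under eq_fun do rewrite mul0r; move=> ->.
have np : 0 < `|u| by rewrite normr_gt0.
have : (N (fourier_mult a u) / `|u|%:E <= S)%E.
  by apply: ereal_sup_ubound; exists u; [split=> //; exact/L2P|rewrite Lpw_norm_ext0 eT].
move=> /(le_of_ediv np) h; rewrite -NS; apply: (le_trans h); rewrite Lpw_space_normE eT NuE.
apply: lee_wpmul2r; first exact: lux_ge0.
clear h; case: S supM => [s _|//|_]; first by rewrite lee_fin le_max lexx orbT.
by rewrite leNye.
Qed.

Section Domain.
Variables (Om : set T) (mOm : measurable Om).
Hypothesis p_bounded : (ess_sup mu (EFin \o p) < +oo)%E.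
Local Notation X := (LpwSpace p w Om).

(** f is cut to the part of a cube where |f| <= k, and [lux_tail_cvg0] handles the remainder. The
    approximant vanishes where f does, so it keeps its support in the domain. *)
Lemma square_integrable_dense f (e : R) : cmeasurable (f : T -> R[i]) -> (N f < +oo)%E ->
  0 < e -> exists g, [/\ sqi mu g, forall t, f t = 0 -> g t = 0, (N g < +oo)%E &
    (N (fun t => g t - f t)%R <= e%:E)%E].
Proof.
move=> mf Nf e0.
pose B k : set T := @cube0 R n k `&` [set t | cabs (f t) <= k%:R].
pose A k : set T := ~` B k.
have mB k : measurable (B k).
  apply: measurableI; first exact: measurable_hbox.
  rewrite (_ : [set t | _] = (fun t => cabs (f t)) @^-1` `]-oo, k%:R]%classic).
    by rewrite -[X in measurable X]setTI; apply: (cmeasurable_cabs mf).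
  by apply/seteqP; split => t /=; rewrite in_itv.
have mA k : measurable (A k) by exact: measurableC.
have Ainf t : \forall k \near \oo, ~ A k t.
  have c1 := cube0_cvg t.
  have c2 : \forall k \near \oo, cabs (f t) <= k%:R by exact: nbhs_infty_ger.
  by apply: filterS2 c1 c2 => k h1 h2; rewrite /A /setC /=; apply; split.
have mwf := measurable_wabs w mf.
have [k hk] := lux_tail_cvg0 (@exponent_gt1 _ _ _ p) (measurable_exponent p) p_bounded mwf
  (wabs_ge0 w f) mA Ainf Nf e0.
have mcB : cmeasurable (cindic R (B k) : T -> R[i]) by exact: cmeasurable_cindic.
pose g t := f t * cindic R (B k) t.
have mg : cmeasurable (g : T -> R[i]) by exact: cmeasurable_mul.
have Boo : (mu (B k) < +oo)%E.
  apply: le_lt_trans (leb_hbox_fin (fun=> - k%:R) (fun=> k%:R : R)).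
  by apply: le_measure; rewrite ?inE//; [exact: measurable_hbox|move=> t []].
exists g; split.
- apply: (sqi_le mg (sqiZ k%:R%:C%C (sqi_cindic (mB k) Boo))) => t.
  rewrite [leLHS]cabsM [leRHS]cabsM cabsr cabs_cindic indicE.
  case: (boolP (t \in B k)) => [|_]; last by rewrite !mulr0.
  by rewrite inE => -[_ /= ft]; rewrite !mulr1 ger0_norm.
- by move=> t ft; rewrite /g ft mul0r.
- apply: le_lt_trans Nf; apply: le_luxw => //; apply: aeT => t.
  rewrite /g cabsM cabs_cindic indicE; case: (_ \in _); rewrite ?mulr1 ?mulr0 ?cabs_ge0//.
- apply: le_trans hk; rewrite le_eqVlt; apply/orP; left; apply/eqP.
  congr luxemburg; apply/funext => t; rewrite /wabs /g /cindic !indicE /A in_setC.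
  case: (t \in B k); first by rewrite mulr1 subrr cabs0 mul0e mule0.
  by rewrite mulr0 sub0r cabsN mule1.
Qed.

Variable a : V -> R[i].
Hypotheses (ma : cmeasurable (a : T -> R[i])).
Variables (A M : R).
Hypotheses (A0 : 0 <= A) (aA : {ae mu, forall x, cabs (a x) <= A}).
Hypotheses (M0 : 0 <= M) (aM : forall f, sqi mu f -> (N f < +oo)%E ->
  (N (fourier_mult a f) <= M%:E * N f)%E).
Local Notation S := (fourier_mult a).

Let mS f : sqi mu f -> cmeasurable (S f : T -> R[i]).
Proof. by move=> sf; have [[]] := fourier_multP ma A0 aA sf. Qed.

(* Graph of the extension by continuity of F^-1 a F to L^p(w). *)
Definition extends f F : Prop := cmeasurable (F : T -> R[i]) /\
  forall e : R, 0 < e -> exists g, [/\ sqi mu g, (N g < +oo)%E,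
    (N (fun t => g t - f t)%R <= e%:E)%E & (N (fun t => S g t - F t)%R <= e%:E)%E].

Lemma extends_total f : cmeasurable (f : T -> R[i]) -> (N f < +oo)%E -> exists F, extends f F.
Proof.
move=> mf Nf.
(* Consecutive approximants are at distance at most 2 e k, hence their images at distance at most
   2^-k M / (M + 1), as [luxw_complete] requires. M + 1 allows M = 0. *)
pose e k : R := 2^-1 ^+ k / (2 * (M + 1)).
have M1 : 0 < M + 1 by rewrite ltr_wpDl.
have t0 k : 0 < 2^-1 ^+ k :> R by exact: exprn_gt0.
have e0 k : 0 < e k by rewrite divr_gt0// mulr_gt0.
have /choice[g hg] : forall k, exists g, [/\ sqi mu g, (N g < +oo)%E & (N (fun t => g t - f t)%R <= (e k)%:E)%E].
  by move=> k; have [g [? _ ? ?]] := square_integrable_dense mf Nf (e0 k); exists g.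
have sg k : sqi mu (g k) by case: (hg k).
have mg k : cmeasurable (g k : T -> R[i]) by case: (sg k).
have Ng k : (N (g k) < +oo)%E by case: (hg k).
have gf k : (N (fun t => g k t - f t)%R <= (e k)%:E)%E by case: (hg k).
have le1 k : e k.+1 <= e k.
  rewrite /e ler_pM2r ?invr_gt0 ?mulr_gt0// exprS.
  by rewrite ler_piMl ?(ltW (t0 _))// invf_le1// ler1n.
have dg k : (N (fun t => g k.+1 t - g k t)%R <= (2 * e k)%:E)%E.
  have -> : (fun t => g k.+1 t - g k t) = (fun t => (g k.+1 t - f t) - (g k t - f t)).
    by apply/funext => t; ring.
  apply: le_trans (luxwB p w (cmeasurable_sub (mg _) mf) (cmeasurable_sub (mg _) mf)) _.
  rewrite mulr_natl mulr2n EFinD; apply: leeD; last exact: gf.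
  by apply: le_trans (gf _) _; rewrite lee_fin.
have [|F [mF hF]] := @luxw_complete _ _ _ mu p w (fun k => S (g k)) (fun k => mS (sg k)).
  move=> k; have sd := sqiB (sg k.+1) (sg k).
  have Nd : (N (fun t => g k.+1 t - g k t)%R < +oo)%E by apply: le_lt_trans (dg k) (ltry _).
  rewrite -(ae_eq_luxw p w (mS sd) (cmeasurable_sub (mS (sg _)) (mS (sg _)))
    (fourier_multB ma A0 aA (sg _) (sg _))).
  apply: le_trans (aM sd Nd) _; apply: le_trans (lee_wpmul2l _ (dg k)) _; first by rewrite lee_fin.
  rewrite -EFinM lee_fin /e.
  have -> : M * (2 * (2^-1 ^+ k / (2 * (M + 1)))) = 2^-1 ^+ k * (M / (M + 1)).
    by field; rewrite gt_eqF.
  by rewrite ler_piMr ?(ltW (t0 k))// ler_pdivrMr// mul1r lerDl.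
exists F; split=> // d d0.
have l1 : `|2^-1 : R| < 1 by rewrite ger0_norm ?invr_ge0// invf_lt1// ltr1n.
have d80 : 0 < d / 8 by rewrite divr_gt0.
have /cvgrPdist_lt/(_ _ d80)/filter_ex[k] := cvg_expr l1.
rewrite sub0r normrN ger0_norm ?(ltW (t0 k))// => hk.
exists (g k); split=> //.
  apply: le_trans (gf k) _; rewrite lee_fin /e ler_pdivrMr ?mulr_gt0//.
  apply: (@le_trans _ _ d); first by move: hk d0; lra.
  by apply: ler_peMr; [exact: ltW|move: M0; lra].
rewrite luxwBC; apply: le_trans (hF k) _; rewrite lee_fin.
by move: hk; rewrite ltr_pdivlMr// mulrC => /ltW.
Qed.

Lemma extends_lin (c : R[i]) f F g G : cmeasurable (f : T -> R[i]) -> cmeasurable (g : T -> R[i]) ->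
  extends f F -> extends g G ->
  extends (fun t => c * f t + g t) (fun t => c * F t + G t).
Proof.
move=> mf mg [mF hF] [mG hG].
have mc : cmeasurable (fun t : T => c) by exact: cmeasurable_cst.
split; first exact: (cmeasurable_add (cmeasurable_mul mc mF) mG).
move=> e e0; have c1 : 0 < cabs c + 1 by rewrite ltr_wpDl// cabs_ge0.
pose d := e / (2 * (cabs c + 1)); have d0 : 0 < d by rewrite divr_gt0// mulr_gt0.
have de : cabs c * d + d = e / 2 by rewrite /d; field; rewrite gt_eqF.
have e2 : e / 2 <= e by lra.
have [u [su Nu uf uF]] := hF _ d0; have [v [sv Nv vg vG]] := hG _ d0.
have [mu_ _] := su; have [mv _] := sv.
have mcu := cmeasurable_mul mc mu_.
have scu := sqiZ c su; have scuv := sqiD scu sv.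
have dist (u' f' v' g' : V -> R[i]) : cmeasurable (u' : T -> R[i]) -> cmeasurable (f' : T -> R[i]) ->
    cmeasurable (v' : T -> R[i]) -> cmeasurable (g' : T -> R[i]) ->
    (N (fun t => u' t - f' t)%R <= d%:E)%E -> (N (fun t => v' t - g' t)%R <= d%:E)%E ->
    (N (fun t => (c * u' t + v' t) - (c * f' t + g' t))%R <= e%:E)%E.
  move=> m1 m2 m3 m4 h1 h2.
  have -> : (fun t => (c * u' t + v' t) - (c * f' t + g' t)) =
      (fun t => c * (u' t - f' t) + (v' t - g' t)) by apply/funext => t; ring.
  have m5 := cmeasurable_sub m1 m2; have m6 := cmeasurable_sub m3 m4.
  apply: le_trans (luxwD p w (cmeasurable_mul mc m5) m6) _.
  apply: (@le_trans _ _ ((cabs c * d)%:E + d%:E)%E); last by rewrite -EFinD lee_fin de.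
  by apply: leeD => //; rewrite luxwZ EFinM lee_wpmul2l// lee_fin cabs_ge0.
exists (fun t => c * u t + v t); split; first exact: scuv.
- apply: le_lt_trans (luxwD p w mcu mv) _; rewrite lte_add_pinfty// luxwZ.
  by rewrite lte_mul_pinfty// lee_fin cabs_ge0.
- exact: (dist _ _ _ _ mu_ mf mv mg uf vg).
have h1 := fourier_multD ma A0 aA scu sv; have h2 := fourier_multZ ma A0 aA c su.
have mSu := mS su; have mSv := mS sv; have mSuv := mS scuv.
have mFG := cmeasurable_add (cmeasurable_mul mc mF) mG.
have E : {ae mu, forall t, S (fun t => c * u t + v t) t - (c * F t + G t) =
    (c * S u t + S v t) - (c * F t + G t)} by apply: aeS2 h1 h2 => t -> ->.
rewrite (ae_eq_luxw p w (cmeasurable_sub mSuv mFG)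
  (cmeasurable_sub (cmeasurable_add (cmeasurable_mul mc mSu) mSv) mFG) E).
exact: (dist _ _ _ _ mSu mF mSv mG uF vG).
Qed.

Lemma extends_bound f F : cmeasurable (f : T -> R[i]) -> extends f F -> (N F <= M%:E * N f)%E.
Proof.
move=> mf [mF hF].
apply/lee_addgt0Pr => e e0; have M1 : 0 < M + 1 by rewrite ltr_wpDl.
have d0 : 0 < e / (M + 1) by rewrite divr_gt0.
have [g [sg Ng gf gF]] := hF _ d0; have [mg _] := sg; have mSg := mS sg.
apply: (@le_trans _ _ (N (S g) + (e / (M + 1))%:E)%E).
  have -> : F = (fun t => S g t - (S g t - F t)) by apply/funext => t; ring.
  apply: le_trans (luxwB p w mSg (cmeasurable_sub mSg mF)) _.
  by apply: leeD2l.
apply: (@le_trans _ _ (M%:E * (N f + (e / (M + 1))%:E) + (e / (M + 1))%:E)%E).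
  rewrite leeD2r//; apply: le_trans (aM sg Ng) _; rewrite lee_wpmul2l ?lee_fin//.
  have -> : g = (fun t => f t + (g t - f t)) by apply/funext => t; ring.
  apply: le_trans (luxwD p w mf (cmeasurable_sub mg mf)) _.
  by apply: leeD2l; move: gf; congr (N _ <= _)%E; apply/funext => t; ring.
rewrite ge0_muleDr ?lux_ge0 ?lee_fin ?(ltW d0)// -addeA leeD2l//.
rewrite -EFinM -EFinD lee_fin le_eqVlt; apply/orP; left; apply/eqP.
by field; rewrite gt_eqF.
Qed.

(** By linearity the difference of two values at f is a value at 0, and [extends_bound] makes its
    norm 0. *)
Lemma extends_uniq f F G : cmeasurable (f : T -> R[i]) -> extends f F -> extends f G ->
  {ae mu, forall t, F t = G t}.
Proof.
move=> mf fF fG; have [mF _] := fF; have [mG _] := fG.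
have m1 := @cmeasurable_cst _ T R (-1).
have mf2 := cmeasurable_add (cmeasurable_mul m1 mf) mf.
have h := extends_bound mf2 (extends_lin (-1) mf mf fF fG).
have N0 : N (fun t => (-1) * f t + f t)%R = 0%E.
  rewrite (_ : (fun t => _) = (fun t => 0 * f t)); last by apply/funext => t; ring.
  by rewrite luxwZ cabs0 mul0e.
rewrite N0 mule0 in h.
have mFG := cmeasurable_add (cmeasurable_mul m1 mF) mG.
have := @luxw_eq0 _ _ _ mu p w _ mFG; rewrite (_ : luxemburg _ _ _ = 0%E); last first.
  by apply/eqP; rewrite eq_le h lux_ge0.
move=> /(_ erefl); apply: aeS => t /eqP; rewrite mulN1r addrC subr_eq0 => /eqP ->//.
Qed.

Lemma extends_sqi f : sqi mu f -> (N f < +oo)%E -> extends f (S f).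
Proof.
move=> sf Nf; split; first exact: mS.
move=> e e0; exists f; split=> //.
  rewrite (_ : (fun t => _) = (fun t => 0 * f t)); last by apply/funext => t; ring.
  by rewrite luxwZ cabs0 mul0e lee_fin ltW.
rewrite (_ : (fun t => _) = (fun t => 0 * S f t)); last by apply/funext => t; ring.
by rewrite luxwZ cabs0 mul0e lee_fin ltW.
Qed.

Lemma extends_ae f g F : cmeasurable (f : T -> R[i]) -> cmeasurable (g : T -> R[i]) ->
  {ae mu, forall t, f t = g t} -> extends f F -> extends g F.
Proof.
move=> mf mg fg [mF hF]; split=> // e e0; have [u [su Nu uf uF]] := hF e e0.
have [mu_ _] := su.
have E : {ae mu, forall t, u t - f t = u t - g t} by apply: aeS fg => t ->.
by exists u; split=> //; rewrite -(ae_eq_luxw p w (cmeasurable_sub mu_ mf) (cmeasurable_sub mu_ mg) E).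
Qed.

End Domain.
End WienerHopfExtension.

Section WienerHopfOperator.
Context (R : realType) (n : nat).
Local Notation V := 'rV[R]_n.
Local Notation T := (Rn R n).
Local Notation mu := (@leb R n).
Variables (p : exponent T R) (w : weight mu).
Local Notation N f := (luxemburg mu p (wabs w f)).
Variables (Om : set T) (mOm : measurable Om).
Hypothesis p_bounded : (ess_sup mu (EFin \o p) < +oo)%E.
Local Notation X := (LpwSpace p w Om).
Variable a : V -> R[i].
Hypothesis pa : multiplier p w a.
Local Notation W := (wiener_hopf p w Om a).

(** [wiener_hopf] is an [xget]; a bounded operator obtained by choice from the graph [extends] and
    restriction to Om shows that the set it selects from is inhabited. *)
Lemma wiener_hopf_spec : bounded_linear W /\
  forall x : X, L2 (ext0 Om x) ->
    {ae mu, forall t, Om t -> W x t = fourier_mult a (ext0 Om x) t}.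
Proof.
have [La _] := pa; have [ma _] := La; have [A A0 aA] := Linfty_bound La.
have [M M0 aM] := multiplier_bound pa.
pose ext := @extends R n p w a.
have ex (x : X) : exists y : X, exists2 F, ext (ext0 Om x) F & {ae mu, forall t, Om t -> y t = F t}.
  have [mx Nx] := Lpw_space_valP x.
  have [F xF] := extends_total p_bounded ma A0 aA M0 aM mx Nx.
  have mF : cmeasurable (F : T -> R[i]) by case: xF.
  have mF0 := cmeasurable_ext0 mOm mF.
  have [|y yF] := Lpw_space_exists (p := p) (w := w) mF0; last by exists y, F.
  apply: (@le_lt_trans _ _ (N F)).
    apply: le_luxw => //; apply: aeT => t; have [Ot|Ot] := pselect (Om t).
      by rewrite ext0_in.
    by rewrite ext0_out// cabs0 cabs_ge0.
  apply: le_lt_trans (extends_bound ma A0 aA M0 aM mx xF) _.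
  by rewrite lte_mul_pinfty// lee_fin.
have /choice[W0 hW0] := ex.
suff h : exists W1 : X -> X, bounded_linear W1 /\ forall x : X, L2 (ext0 Om x) ->
    {ae mu, forall t, Om t -> W1 x t = fourier_mult a (ext0 Om x) t}.
  exact: (xgetPex (fun=> 0) h).
exists W0; split; [split|].
- move=> c x y; apply/Lpw_space_eqP.
  have [F xF WxF] := hW0 x; have [G yG WyG] := hW0 y; have [H xyH WH] := hW0 (c *: x + y).
  have [mx Nx] := Lpw_space_valP x; have [my Ny] := Lpw_space_valP y.
  have [mxy Nxy] := Lpw_space_valP (c *: x + y).
  have mc := @cmeasurable_cst _ T R c.
  have mcxy := cmeasurable_add (cmeasurable_mul mc mx) my.
  have hl := extends_lin ma A0 aA c mx my xF yG.
  have E : {ae mu, forall t, ext0 Om (Lpw_repr (c *: x + y)) t = c * ext0 Om (Lpw_repr x) t + ext0 Om (Lpw_repr y) t}.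
    have := Lpw_space_lin c x y; apply: aeS => t ht; have [Ot|Ot] := pselect (Om t).
      by rewrite !ext0_in// ht.
    by rewrite !ext0_out// mulr0 addr0.
  have h2 := extends_ae mxy mcxy E xyH.
  have HE := extends_uniq ma A0 aA M0 aM mcxy h2 hl.
  have L := Lpw_space_lin c (W0 x) (W0 y).
  have h3 := aeS2 (fun t h1 h2 => conj h1 h2) WxF WyG.
  have h4 := aeS2 (fun t h1 h2 => conj h1 h2) WH HE.
  have h5 := aeS2 (fun t h1 h2 => conj h1 h2) h3 h4.
  apply: (aeS2 _ h5 L) => t [[h6 h7] [h8 h9]] h10 Ot.
  by rewrite h10// h8// h6// h7// h9.
- exists M => x; have [F xF WxF] := hW0 x; have [mx Nx] := Lpw_space_valP x.
  have mF : cmeasurable (F : T -> R[i]) by case: xF.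
  have mF0 := cmeasurable_ext0 mOm mF.
  rewrite -lee_fin EFinM (Lpw_space_norm_ae mF0 WxF) Lpw_space_normE.
  apply: le_trans (extends_bound ma A0 aA M0 aM mx xF).
  apply: le_luxw => //; apply: aeT => t; have [Ot|Ot] := pselect (Om t).
    by rewrite ext0_in.
  by rewrite ext0_out// cabs0 cabs_ge0.
- move=> x /L2P sx; have [F xF WxF] := hW0 x; have [mx Nx] := Lpw_space_valP x.
  have h := extends_uniq ma A0 aA M0 aM mx xF (extends_sqi ma A0 aA sx Nx).
  by apply: aeS2 WxF h => t h1 h2 Ot; rewrite h1// h2.
Qed.

Lemma wiener_hopf_bounded : bounded_linear W.
Proof. by case: wiener_hopf_spec. Qed.

Lemma wiener_hopfE (x : X) f : sqi mu f -> (forall t, ~ Om t -> f t = 0) ->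
  {ae mu, forall t, Om t -> x t = f t} ->
  {ae mu, forall t, Om t -> W x t = fourier_mult a f t}.
Proof.
move=> sf f0 xf; have [La _] := pa; have [ma _] := La; have [A A0 aA] := Linfty_bound La.
have [mf _] := sf; have [mx _] := Lpw_space_valP x.
have E : {ae mu, forall t, ext0 Om x t = f t}.
  apply: aeS xf => t xf; have [Ot|Ot] := pselect (Om t); first by rewrite ext0_in// xf.
  by rewrite ext0_out// f0.
have sx : sqi mu (ext0 Om x).
  by split=> //; rewrite (ae_eq_sqn mx mf E); case: sf.
have [_ /(_ x (iffRL (L2P _) sx))] := wiener_hopf_spec.
move=> h; have h2 := fourier_mult_ae ma A0 aA sx sf E.
by apply: aeS2 h h2 => t h1 <- Ot; rewrite h1.
Qed.

End WienerHopfOperator.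

(** * Wave packets in a weighted space *)

Lemma measurable_fun_ge0_inve d (T : measurableType d) (R : realType) (w : T -> \bar R) :
  measurable_fun setT w -> (forall x, 0 <= w x)%E -> measurable_fun setT (fun x => (w x)^-1)%E.
Proof.
move=> mw w0.
rewrite (_ : (fun _ => _) = (fun x => if w x == +oo then 0 else
    if w x == 0 then +oo else (expR (- ln (fine (w x))))%:E)%E); last first.
  apply/funext => x; have := w0 x; case: (w x) => [r r0||//]; last by rewrite invey.
  rewrite inver eqe; case: eqVneq => [->|rn0]//=.
  by rewrite expRN lnK// posrE lt_neqAle eq_sym rn0.
apply: measurable_fun_ifT => //; first by apply: measurable_fun_eqe.
apply: measurable_fun_ifT => //; first by apply: measurable_fun_eqe.
apply/measurable_EFinP; apply: (measurableT_comp (@measurable_expR R)).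
apply: (measurableT_comp (@oppr_measurable R setT)).
by apply: (measurableT_comp (@measurable_ln R)); exact: measurableT_comp.
Qed.

Section Doubling.
Context (R : realType) (n : nat).
Local Notation V := 'rV[R]_n.
Local Notation T := (Rn R n).
Local Notation mu := (@leb R n).
Implicit Types (x y : V) (h r : R).

Definition cube y h : set T := hbox (fun i => y ord0 i - h) (fun i => y ord0 i + h).

Lemma measurable_cube y h : measurable (cube y h).
Proof. exact: measurable_hbox. Qed.

Lemma leb_cube y h : 0 <= h -> mu (cube y h) = ((2 * h) ^+ n)%:E.
Proof.
move=> h0; rewrite leb_hbox => [|i]; last by lra.
rewrite (eq_bigr (fun=> 2 * h)) => [|i _]; last by ring.
by rewrite prodr_const card_ord.
Qed.

Lemma cube_sub y h k : h <= k -> cube y h `<=` cube y k.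
Proof. by move=> hk x xh i; have /andP[h1 h2] := xh i; apply/andP; split; lra. Qed.

Lemma cube_eball y h r : 0 <= h -> n.+1%:R * h < r -> cube y h `<=` eball y r.
Proof.
move=> h0 hr x xh; have n1 : 0 <= n.+1%:R * h by rewrite mulr_ge0.
rewrite /eball /=; apply: le_lt_trans hr.
rewrite -(ger0_norm n1) -sqrtr_sqr ler_wsqrtr//.
apply: (@le_trans _ _ (\sum_(i < n) h ^+ 2)).
  apply: ler_sum => i _; rewrite !mxE -expr2 -ler_sqrt ?sqr_ge0// !sqrtr_sqr (ger0_norm h0).
  have /andP[h1 h2] := xh i; rewrite ler_norml; apply/andP; split; lra.
rewrite sumr_const card_ord -[leLHS]mulr_natl exprMn ler_wpM2r ?sqr_ge0//.
by rewrite -natrX ler_nat (leq_trans (leqnSn n))// -{1}[n.+1]expn1 leq_pexp2l.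
Qed.

Lemma eball_cube y r : eball y r `<=` cube y r.
Proof.
move=> x /= xr i.
suff : `|x ord0 i - y ord0 i| < r by rewrite ltr_norml => /andP[h1 h2]; apply/andP; split; lra.
apply: le_lt_trans xr; rewrite -[leLHS]sqrtr_sqr ler_wsqrtr//.
rewrite /dotv (bigD1 i)//= !mxE -expr2 lerDl sumr_ge0// => j _.
by rewrite -expr2 sqr_ge0.
Qed.

Lemma measurable_eball y r : measurable (eball y r : set T).
Proof.
have m1 : measurable_fun [set: T] (fun x : T => dotv (x - y) (x - y)).
  apply: measurable_sum => i; rewrite (_ : (fun x : T => _) = (fun x : T => (x ord0 i - y ord0 i) * (x ord0 i - y ord0 i))).
    by apply: measurable_funM; apply: measurable_funB; [exact: measurable_coord|exact: measurable_cst|exact: measurable_coord|exact: measurable_cst].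
  by apply/funext => x; rewrite !mxE.
have m2 := measurableT_comp (continuous_measurable_fun (@sqrt_continuous R)) m1.
rewrite (_ : eball y r = (fun x : T => Num.sqrt (dotv (x - y) (x - y))) @^-1` `]-oo, r[%classic).
  by rewrite -[X in measurable X]setTI; apply: m2.
by apply/seteqP; split => x /=; rewrite in_itv.
Qed.

Variables (p : exponent T R) (p' : V -> R) (w : weight mu).
Hypothesis pp' : forall x, (p x)^-1 + (p' x)^-1 = 1.
Hypothesis A_p : muckenhoupt p p' w.
Local Notation N f := (luxemburg mu p (wabs w f)).

Let p0 x : 0 < p x. Proof. exact: exponent_gt0. Qed.

Let ip' x : 0 < (p' x)^-1 < 1.
Proof.
have -> : (p' x)^-1 = 1 - (p x)^-1 by rewrite -(pp' x) addrC addKr.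
by rewrite subr_gt0 invf_lt1// exponent_gt1/= ltrBlDr ltrDl invr_gt0.
Qed.

Lemma conj_exponent_gt1 x : 1 < p' x.
Proof.
have /andP[h1 h2] := ip' x; rewrite invr_gt0 in h1.
by move: h2; rewrite invf_lt1.
Qed.

Lemma measurable_conj_exponent : measurable_fun [set: T] p'.
Proof.
have E : p' = (fun x : T => expR (- ln (1 - expR (- ln (p x))))).
  apply/funext => x; have /andP[h1 _] := ip' x.
  have -> : expR (- ln (p x)) = (p x)^-1 by rewrite expRN lnK// posrE.
  have -> : 1 - (p x)^-1 = (p' x)^-1 by rewrite -(pp' x) addrC addKr.
  by rewrite expRN lnK ?posrE// invrK.
have me := @measurable_expR R; have ml := @measurable_ln R.
rewrite E; apply: (measurableT_comp me); apply: (measurableT_comp (@oppr_measurable R setT)); apply: (measurableT_comp ml).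
apply: measurable_funB; first exact: measurable_cst.
apply: (measurableT_comp me); apply: (measurableT_comp (@oppr_measurable R setT)); apply: (measurableT_comp ml).
exact: measurable_exponent.
Qed.

Lemma measurable_winv : measurable_fun [set: T] (fun x => (w x)^-1)%E.
Proof.
exact: (measurable_fun_ge0_inve (measurable_weight w) (weight_ge0 w)).
Qed.

Lemma winv_ge0 x : (0 <= (w x)^-1)%E.
Proof. by rewrite inve_ge0 weight_ge0. Qed.

Local Notation N' E := (luxemburg mu p' (fun x => (w x)^-1 * (\1_E x)%:E)%E).

Lemma lux_weight_indic (E : set T) :
  luxemburg mu p (fun x => w x * (\1_E x)%:E)%E = N (cindic R E).
Proof. by congr luxemburg; apply/funext => x; rewrite /wabs cabs_cindic muleC. Qed.

Lemma cindic_luxw_gt0 (E : set T) : measurable E -> (0 < mu E)%E -> (0 < N (cindic R E))%E.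
Proof.
move=> mE E0; rewrite lt0e lux_ge0 andbT; apply/eqP => h.
have := luxw_eq0 (cmeasurable_cindic R mE) h; move=> [Z [mZ Z0 sZ]].
move: E0; rewrite lt_neqAle => /andP[/eqP + _]; apply.
apply/esym/eqP; rewrite eq_le measure_ge0 andbT -[leRHS]Z0; apply: le_measure; rewrite ?inE//.
apply: subset_trans sZ => x Ex /= h0.
by have := cabs_cindic R E x; rewrite h0 cabs0 indicE mem_set// => /eqP; rewrite eq_sym oner_eq0.
Qed.

Let mindic (E : set T) : measurable E -> measurable_fun [set: T] (fun x => (\1_E x)%:E : \bar R).
Proof. by move=> mE; apply/measurable_EFinP; exact: measurable_indic. Qed.

Let mwinvE (E : set T) : measurable E ->
  measurable_fun [set: T] (fun x => (w x)^-1 * (\1_E x)%:E)%E.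
Proof. by move=> mE; exact: (emeasurable_funM measurable_winv (mindic mE)). Qed.

Let winvE_ge0 (E : set T) x : (0 <= (w x)^-1 * (\1_E x)%:E)%E.
Proof. by rewrite mule_ge0 ?winv_ge0// lee_fin. Qed.

Lemma dual_luxw_gt0 (E : set T) : measurable E -> (0 < mu E)%E -> (0 < N' E)%E.
Proof.
move=> mE E0; rewrite lt0e lux_ge0 andbT; apply/eqP => h.
have := @lux_eq0 _ T R mu p' _ conj_exponent_gt1 measurable_conj_exponent (mwinvE mE) (winvE_ge0 E) h.
move=> h1; have h2 := weight_ae w.
have [Z [mZ Z0 sZ]] : {ae mu, forall x, ~ E x}.
  apply: aeS2 h1 h2 => x /(_ I) + /andP[w0 wy] Ex.
  rewrite indicE mem_set// mule1 => /= h3.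
  have wf : w x \is a fin_num by rewrite ge0_fin_numE// ltW.
  have fw : 0 < fine (w x) by rewrite fine_gt0// w0.
  by move: h3; rewrite -(fineK wf) inver (gt_eqF fw) => /eqP; rewrite eqe invr_eq0 (gt_eqF fw).
move: E0; rewrite lt_neqAle => /andP[/eqP + _]; apply.
apply/esym/eqP; rewrite eq_le measure_ge0 andbT -[leRHS]Z0; apply: le_measure; rewrite ?inE//.
by apply: subset_trans sZ => x Ex /=; exact.
Qed.

Lemma eball_measure y r : 0 < r -> (0 < mu (eball y r) <= ((2 * r) ^+ n)%:E)%E.
Proof.
move=> r0; apply/andP; split; last first.
  rewrite -(leb_cube y (ltW r0)); apply: le_measure; rewrite ?inE;
    [exact: measurable_eball|exact: measurable_cube|exact: eball_cube].
pose h := r / (2 * n.+1%:R).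
have n0 : 0 < 2 * n.+1%:R :> R by rewrite mulr_gt0// ltr0n.
have h0 : 0 < h by rewrite divr_gt0.
apply: (@lt_le_trans _ _ (mu (cube y h))).
  by rewrite (leb_cube y (ltW h0)) lte_fin exprn_gt0// mulr_gt0.
apply: le_measure; rewrite ?inE; [exact: measurable_cube|exact: measurable_eball|].
apply: cube_eball; first exact: ltW.
have -> : n.+1%:R * h = r / 2.
  rewrite /h; have : 0 < n.+1%:R :> R by rewrite ltr0n.
  by move: (n.+1%:R : R) => t t0; field; rewrite gt_eqF.
by lra.
Qed.

(** The measure of a ball matters only up to constants, so that of the circumscribed cube, which is
    explicit, takes its place. *)
Lemma muckenhoupt_ball : exists2 K : R, 0 <= K & forall y r, 0 < r ->
  (N (cindic R (eball y r : set T)) * N' (eball y r) <= (K * (2 * r) ^+ n)%:E)%E.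
Proof.
have := A_p; rewrite /muckenhoupt; set S := ereal_sup _ => Soo.
exists (Num.max 0 (fine S)); first by rewrite le_max lexx.
move=> y r r0; have /andP[B0 Bl] := eball_measure y r0.
have Bf : mu (eball y r) \is a fin_num.
  by rewrite ge0_fin_numE ?measure_ge0//; exact: le_lt_trans Bl (ltry _).
pose m := fine (mu (eball y r)).
have m0 : 0 < m by rewrite fine_gt0// B0/= -ge0_fin_numE ?measure_ge0.
have : ((mu (eball y r))^-1 * luxemburg mu p (fun x => w x * (\1_(eball y r) x)%:E) *
   N' (eball y r) <= S)%E by apply: ereal_sup_ubound; exists y => //; exists r.
rewrite lux_weight_indic -(fineK Bf) -/m inver (gt_eqF m0) -muleA lee_pdivrMl//.
move=> /le_trans; apply.
apply: (@le_trans _ _ (m%:E * (Num.max 0 (fine S))%:E)%E).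
  apply: lee_wpmul2l; first by rewrite lee_fin ltW.
  case: S Soo => [s _|//|_]; first by rewrite lee_fin le_max lexx orbT.
  by rewrite leNye.
rewrite -EFinM lee_fin mulrC ler_wpM2l ?le_max ?lexx// -lee_fin.
by rewrite fineK.
Qed.

(** Let B be a ball containing the cube Q and its double. Hoelder applied to w and 1/w bounds |Q| by
    8 N(Q) N'(B), and the Muckenhoupt condition bounds N(B) N'(B) by a multiple of |B|. As |B| and
    |Q| are comparable, N(B) is at most a constant times N(Q). *)
Lemma doubling : exists2 D : R, 1 <= D & forall y h, 0 < h ->
  (0 < N (cindic R (cube y h)) < +oo)%E /\
  (N (cindic R (cube y (2 * h))) <= D%:E * N (cindic R (cube y h)))%E.
Proof.
have [K K0 hK] := muckenhoupt_ball.
pose c : R := 8 * K * (4 * n.+1%:R) ^+ n.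
exists (Num.max 1 c); first by rewrite le_max lexx.
(* [cube_eball] puts the cube of half-side 2 h into balls of radius above 2 (n + 1) h; [r] is twice
   this. *)
move=> y h h0; pose Q := cube y h; pose r := 4 * n.+1%:R * h.
have n0 : 0 < n.+1%:R :> R by rewrite ltr0n.
have nh0 : 0 < n.+1%:R * h by rewrite mulr_gt0.
have r0 : 0 < r by rewrite !mulr_gt0.
pose B : set T := eball y r.
have mQ : measurable Q by exact: measurable_cube.
have mB : measurable B by exact: measurable_eball.
have Q2B : cube y (2 * h) `<=` B.
  by apply: cube_eball; [rewrite mulr_ge0// ltW|move: nh0; rewrite /r; nra].
have QB : Q `<=` B.
  by apply: subset_trans Q2B; apply: cube_sub; lra.
have Q0 : (0 < mu Q)%E by rewrite (leb_cube y (ltW h0)) lte_fin exprn_gt0// mulr_gt0.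
have /andP[B0 Bl] := eball_measure y r0.
have NQ0 := cindic_luxw_gt0 mQ Q0; have NB0 := cindic_luxw_gt0 mB B0.
have N'B0 := dual_luxw_gt0 mB B0.
have hB := hK y _ r0; rewrite -/B in hB.
(* Both norms are positive, so their finite product forces each of them to be finite. *)
have NBoo : (N (cindic R B) < +oo)%E.
  rewrite ltey; apply/negP => /eqP h1; by move: hB; rewrite h1 gt0_mulye.
have N'Boo : (N' B < +oo)%E.
  rewrite ltey; apply/negP => /eqP h1; by move: hB; rewrite h1 gt0_muley.
have le_ind (E F : set T) : measurable E -> measurable F -> E `<=` F ->
    (N (cindic R E) <= N (cindic R F))%E.
  move=> mE mF EF; apply: le_luxw; [exact: cmeasurable_cindic|exact: cmeasurable_cindic|].
  apply: aeT => x; rewrite !cabs_cindic !indicE; case: (boolP (x \in E)) => //.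
  by rewrite inE => /EF xF; rewrite mem_set.
have NQB := le_ind _ _ mQ mB QB.
have NQoo : (N (cindic R Q) < +oo)%E by exact: le_lt_trans NBoo.
split; first by rewrite NQ0.
apply: le_trans (le_ind _ _ (measurable_cube _ _) mB Q2B) _.
have fQ : N (cindic R Q) \is a fin_num by rewrite ge0_fin_numE ?lux_ge0.
have fB : N (cindic R B) \is a fin_num by rewrite ge0_fin_numE ?lux_ge0.
have f'B : N' B \is a fin_num by rewrite ge0_fin_numE ?lux_ge0.
set q := fine (N (cindic R Q)); set b := fine (N (cindic R B)); set b' := fine (N' B).
have q0 : 0 < q by rewrite fine_gt0// NQ0.
have b'0 : 0 < b' by rewrite fine_gt0// N'B0.
have hB' : b * b' <= K * (2 * r) ^+ n by rewrite -lee_fin EFinM !fineK.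
have NQE : N (cindic R Q) = q%:E by rewrite /q fineK.
(* 8 = 2 * 2 * 2: the constant of [lux_holder], and two doublings that produce the strict
   inequalities it asks for. *)
have holder : (2 * h) ^+ n <= 8 * q * b'.
  have -> : 8 * q * b' = 2 * (2 * q) * (2 * b') by ring.
  rewrite -lee_fin -(leb_cube y (ltW h0)) -/Q.
  have mwQ := measurable_wabs w (cmeasurable_cindic R mQ).
  apply: le_trans (_ : (\int[mu]_x (wabs w (cindic R Q) x * ((w x)^-1 * (\1_B x)%:E)) <= _)%E); last first.
    apply: (@lux_holder _ T R mu p p' _ _ _ _ (@exponent_gt1 _ _ _ p) conj_exponent_gt1 pp' (measurable_exponent p)
      measurable_conj_exponent mwQ (mwinvE mB) (wabs_ge0 w _) (winvE_ge0 B)).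
    - by rewrite mulr_gt0.
    - by rewrite mulr_gt0.
    - by rewrite NQE lte_fin (ltr_pMl _ q0) ltr1n.
    - apply: (@le_lt_trans _ _ b'%:E); first by rewrite /b' (fineK f'B).
      by rewrite lte_fin (ltr_pMl _ b'0) ltr1n.
  rewrite -[X in mu X]setIT -integral_indic//.
  apply: (ae_ge0_le_integral measurableT).
  - by move=> x _; rewrite lee_fin.
  - exact: mindic.
  - by move=> x _; apply: mule_ge0; [exact: wabs_ge0|exact: winvE_ge0].
  - exact: (emeasurable_funM mwQ (mwinvE mB)).
  apply: aeS (weight_ae w) => x /andP[w0 wy] _.
  rewrite /wabs cabs_cindic !indicE; case: (boolP (x \in Q)) => [|_]; last by rewrite !mul0e.
  rewrite inE => /QB xB; rewrite (mem_set xB) mul1e mule1.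
  have wf : w x \is a fin_num by rewrite ge0_fin_numE// ltW.
  have fw : 0 < fine (w x) by rewrite fine_gt0// w0.
  by rewrite -(fineK wf) inver (gt_eqF fw) -EFinM mulfV// gt_eqF.
rewrite -(fineK fB) -(fineK fQ) -EFinM lee_fin -/b -/q.
have rE : 2 * r = (4 * n.+1%:R) * (2 * h) by rewrite /r; ring.
have k0 : 0 <= (4 * n.+1%:R) ^+ n :> R by rewrite exprn_ge0// mulr_ge0.
apply: (@le_trans _ _ (c * q)); last by rewrite ler_wpM2r ?(ltW q0)// le_max lexx orbT.
rewrite -(ler_pM2r b'0); apply: (le_trans hB').
rewrite rE exprMn mulrA (_ : c * q * b' = K * (4 * n.+1%:R) ^+ n * (8 * q * b')); last by rewrite /c; ring.
by rewrite ler_wpM2l// mulr_ge0.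
Qed.

End Doubling.

(** * Size and tails of wave packets *)

Section GaussianTestFunctions.
Context (R : realType) (n : nat).
Local Notation V := 'rV[R]_n.
Local Notation T := (Rn R n).
Local Notation mu := (@leb R n).
Implicit Types (x y b : V) (s t : R).

(** A Gaussian of width [s] around [y], modulated with frequency [b]; its transform has width 1/s
    around [b]. *)
Definition wavepacket s y b : V -> R[i] :=
  atom (fun=> (s ^+ 2)^-1) (fun i => y ord0 i) (fun i => b ord0 i).

Lemma gspan_wavepacket s y b : 0 < s -> gspan (wavepacket s y b).
Proof. by move=> s0; apply: gspan_atom => i; rewrite invr_gt0 exprn_gt0. Qed.

Lemma cabs_wavepacket s y b x : cabs (wavepacket s y b x) =
  \prod_i gexp (s ^+ 2)^-1 (y ord0 i) (x ord0 i).
Proof. exact: cabs_atom. Qed.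

Lemma wavepacket_ge s y b x : 0 < s -> cube y s x ->
  expR (- 2^-1) ^+ n <= cabs (wavepacket s y b x).
Proof.
move=> s0 xy; rewrite cabs_wavepacket -[in leLHS](card_ord n) -prodr_const.
apply: ler_prod => i _; rewrite expR_ge0/= ler_expR lerN2 ler_pdivrMr// mulVf ?pnatr_eq0//.
rewrite mulrC ler_pdivrMr ?exprn_gt0// mul1r -ler_sqrt ?sqr_ge0// !sqrtr_sqr (ger0_norm (ltW s0)).
have /andP[h1 h2] := xy i; rewrite ler_norml; apply/andP; split; lra.
Qed.

Lemma wavepacket_off s y b x c : 0 < s -> 0 <= c -> ~ cube y (c * s) x ->
  cabs (wavepacket s y b x) <= expR (- (c ^+ 2 / 2)).
Proof.
move=> s0 c0 /existsNP[i /negP hi]; rewrite cabs_wavepacket (bigD1 i)//=.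
have s2 : 0 < s ^+ 2 by rewrite exprn_gt0.
have si : 0 <= (s ^+ 2)^-1 by rewrite invr_ge0 ltW.
rewrite -[leRHS]mulr1; apply: ler_pM; rewrite ?gexp_ge0//.
- by apply: prodr_ge0 => j _; exact: gexp_ge0.
- rewrite ler_expR lerN2 ler_pM2r ?invr_gt0// mulrC ler_pdivlMr//.
  rewrite -exprMn -ler_sqrt ?sqr_ge0// !sqrtr_sqr.
  have cs : 0 <= c * s by rewrite mulr_ge0// ltW.
  rewrite (ger0_norm cs) ler_normr; move: hi; rewrite negb_and -leNgt -ltNge.
  by case/orP => h; apply/orP; [right|left]; lra.
- apply: (@le_trans _ _ (\prod_(j < n | j != i) (1 : R))); last by rewrite big1_eq.
  by apply: ler_prod => j _; rewrite gexp_ge0 gexp_le1.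
Qed.

Lemma gauss_beats_geometric (D : R) : 1 <= D -> exists J0 : nat, forall j, (J0 <= j)%N ->
  expR (- ((2 ^+ j) ^+ 2 / 2)) * D ^+ j.+1 <= 2^-1 ^+ j.+1.
Proof.
move=> D1; have D0 : 0 < D by exact: lt_le_trans D1.
have D20 : 0 < 2 * D by rewrite mulr_gt0.
(* exp (- c (j + 1)) is (2 D)^-(j + 1), and (2^j)^2 / 2 >= (j + 1)^2 / 2 >= c (j + 1) as soon as 2 c
   <= j + 1. *)
pose c := ln (2 * D).
have [J0 hJ] : exists J0 : nat, 2 * c <= J0%:R.
  by have [J0 _ hJ] := @nbhs_infty_ger R (2 * c); exists J0; apply: hJ => /=.
exists J0 => j Jj.
have cj : 2 * c <= j.+1%:R.
  by apply: le_trans hJ _; rewrite ler_nat; exact: leq_trans Jj (leqnSn j).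
have p2 : j.+1%:R <= 2 ^+ j :> R by rewrite -natrX ler_nat; exact: ltn_expl.
have j0 : 0 < j.+1%:R :> R by rewrite ltr0n.
apply: (@le_trans _ _ (expR (- (c * j.+1%:R)) * D ^+ j.+1)).
  rewrite ler_wpM2r ?exprn_ge0 ?(ltW D0)// ler_expR lerN2 ler_pdivlMr//.
  apply: (@le_trans _ _ (j.+1%:R ^+ 2)).
    by rewrite expr2 mulrAC ler_wpM2r ?(ltW j0)// mulrC.
  by rewrite ler_sqr ?nnegrE ?(ltW j0) ?exprn_ge0.
rewrite -mulNr expRM_natr expRN lnK ?posrE// -exprMn invfM -mulrA mulVf ?mulr1//.
by rewrite gt_eqF.
Qed.

Variables (p : exponent T R) (w : weight mu).
Local Notation N f := (luxemburg mu p (wabs w f)).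
Local Notation Nc y h := (N (cindic R (@cube R n y h))).
Variable D : R.
Hypotheses (D1 : 1 <= D) (N_cube : forall y h, 0 < h -> (0 < Nc y h < +oo)%E /\
   (Nc y (2 * h) <= D%:E * Nc y h)%E).

Lemma cube_iter y h j : 0 < h -> (Nc y (2 ^+ j * h) <= (D ^+ j)%:E * Nc y h)%E.
Proof.
move=> h0; elim: j => [|j IH]; first by rewrite !expr0 mul1r mul1e.
have h1 : 0 < 2 ^+ j * h by rewrite mulr_gt0// exprn_gt0.
rewrite [2 ^+ j.+1]exprS -mulrA; apply: le_trans (N_cube y h1).2 _.
rewrite exprS EFinM -muleA lee_wpmul2l// lee_fin; exact: le_trans D1.
Qed.

(** The complement of the cube splits into dyadic shells, on which the Gaussian decay beats the
    growth D^(J + k + 1) of the norms of the cubes. The decay is measured in multiples of [s], so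
    [J] precedes the width. *)
Lemma wavepacket_tail (th : R) : 0 < th -> exists J : nat, forall y b s, 0 < s ->
  (N (fun x => wavepacket s y b x * cindic R (~` cube y (2 ^+ J * s)) x)%R <= th%:E * Nc y s)%E.
Proof.
move=> th0; have [J0 hJ0] := gauss_beats_geometric D1.
have th4 : 0 < th / 4 by rewrite divr_gt0.
have l1 : `|2^-1 : R| < 1 by rewrite ger0_norm ?invr_ge0// invf_lt1// ltr1n.
have /cvgrPdist_lt/(_ _ th4) := cvg_expr l1.
move=> /(filterI (nbhs_infty_ge J0))/filter_ex[J [/= JJ]].
have t0 j : 0 < 2^-1 ^+ j :> R by exact: exprn_gt0.
rewrite sub0r normrN ger0_norm ?(ltW (t0 J))// => hJ.
exists J => y b s s0.
have [/andP[nu0 nuoo] _] := N_cube y s0.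
have nuf : Nc y s \is a fin_num by rewrite ge0_fin_numE ?lux_ge0.
set nu := fine (Nc y s).
have nuE : Nc y s = nu%:E by rewrite /nu fineK.
have nup : 0 < nu by rewrite -lte_fin -nuE.
pose e k : R := expR (- ((2 ^+ (J + k)) ^+ 2 / 2)).
have e0 k : 0 <= e k by exact: expR_ge0.
pose g k : V -> R[i] := fun x => (e k)%:C%C * cindic R (cube y (2 ^+ (J + k).+1 * s)) x.
have mg k : cmeasurable (g k : T -> R[i]).
  apply: cmeasurable_mul; first exact: cmeasurable_cst.
  exact: (cmeasurable_cindic R (measurable_cube y _)).
have mA : measurable (~` cube y (2 ^+ J * s)) by apply: measurableC; exact: measurable_cube.
pose h : V -> R[i] := fun x => wavepacket s y b x * cindic R (~` cube y (2 ^+ J * s)) x.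
have mh : cmeasurable (h : T -> R[i]).
  apply: cmeasurable_mul; last exact: (cmeasurable_cindic R mA).
  by have [] := gspan_sqi (gspan_wavepacket y b s0).
have geo m : \sum_(k < m) 2^-1 ^+ (J + k).+1 <= 2^-1 ^+ J :> R.
  have -> : \sum_(k < m) 2^-1 ^+ (J + k).+1 = 2^-1 ^+ J - 2^-1 ^+ (J + m) :> R.
    elim: m => [|m IH]; first by rewrite big_ord0 addn0 subrr.
    by rewrite big_ord_recr/= IH addnS exprS; field.
  by rewrite gerBl ltW.
have Ng k : (N (g k) <= (nu * 2^-1 ^+ (J + k).+1)%:E)%E.
  rewrite luxwZ cabsr ger0_norm//.
  apply: le_trans (lee_wpmul2l _ (cube_iter y (J + k).+1 s0)) _; first by rewrite lee_fin.
  rewrite nuE -!EFinM lee_fin mulrA mulrC ler_wpM2l ?(ltW nup)//.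
  by apply: hJ0; exact: leq_trans JJ (leq_addr _ _).
have pw x (z : R) : (z%:E < wabs w h x)%E -> exists m, (z%:E < \sum_(k < m) wabs w (g k) x)%E.
  rewrite /wabs /h cabsM cabs_cindic indicE.
  have [xJ|xJ] := pselect (cube y (2 ^+ J * s) x).
    rewrite memNset; last by move=> /(_ xJ).
    by rewrite mulr0 mul0e => z0; exists 0%N; rewrite big_ord0.
  rewrite (mem_set (A := ~` _))// mulr1 => zx.
  have exk : exists k, `[< cube y (2 ^+ (J + k).+1 * s) x >].
    have [k1 _ hk] := cube0_cvg (x - y).
    have [k2 _ hk2] := @nbhs_infty_ger R (k1.+1%:R / s).
    exists k2; apply/asboolP.
    have h1 := hk k1 (leqnn _); have h2 := hk2 k2 (leqnn _).
    have h3 : k1.+1%:R < 2 ^+ (J + k2).+1 * s.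
      rewrite -ltr_pdivrMr//; apply: le_lt_trans h2 _.
      rewrite -natrX ltr_nat; apply: leq_trans (ltn_expl k2 (ltnSn 1)) _.
      by rewrite leq_exp2l// leqW// leq_addl.
    have h4 : (k1%:R : R) < k1.+1%:R by rewrite ltr_nat.
    by move=> i; have /andP[] := h1 i; rewrite !mxE => h5 h6; apply/andP; split;
      move: h3 h4 h5 h6; clear; lra.
  (* The minimal k locates x in a shell: inside the cube of exponent J + k + 1 and outside that of
     exponent J + k, which for k = 0 is the assumption [xJ]. *)
  case: (ex_minnP exk) => k /asboolP xk kmin.
  have xnk : ~ cube y (2 ^+ (J + k) * s) x.
    case: k xk kmin => [|k] xk kmin; first by rewrite addn0.
    move=> xk'; suff : (k.+1 <= k)%N by rewrite ltnn.
    by apply: kmin; apply/asboolP; rewrite -addnS.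
  exists k.+1; apply: lt_le_trans zx _.
  rewrite big_ord_recr/=; apply: (@le_trans _ _ (wabs w (g k) x)).
    rewrite /wabs /g cabsM cabs_cindic indicE mem_set// mulr1 cabsr ger0_norm//.
    apply: lee_wpmul2r; first exact: weight_ge0.
    by rewrite lee_fin; apply: wavepacket_off => //; exact: exprn_ge0.
  by rewrite leeDr// sume_ge0// => j _; exact: (wabs_ge0 w (g j) x).
have b0 : 0 < nu * 2^-1 ^+ J by rewrite mulr_gt0.
apply: (@le_trans _ _ (4 * (nu * 2^-1 ^+ J))%:E).
  apply: (@lux_series _ _ _ mu p (@exponent_gt1 _ _ _ p) (measurable_exponent p)
     (fun k => wabs w (g k)) (wabs w h) (fun k => nu * 2^-1 ^+ (J + k).+1) _
     (fun k => measurable_wabs w (mg k)) (measurable_wabs w mh)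
     (fun k => wabs_ge0 w (g k)) (wabs_ge0 w h) pw Ng b0) => m.
  by rewrite -mulr_sumr ler_wpM2l ?(ltW nup).
rewrite nuE -EFinM lee_fin mulrCA mulrC ler_wpM2r ?(ltW nup)//.
by move: hJ; rewrite ltr_pdivlMr// mulrC => /ltW.
Qed.

End GaussianTestFunctions.

Lemma ge0_integral_comb3 d (T : measurableType d) (R : realType) (mu : {measure set T -> \bar R})
    (c1 c2 c3 : R) (f1 f2 f3 : T -> R) : 0 <= c1 -> 0 <= c2 -> 0 <= c3 ->
  (forall x, 0 <= f1 x) -> (forall x, 0 <= f2 x) -> (forall x, 0 <= f3 x) ->
  measurable_fun setT f1 -> measurable_fun setT f2 -> measurable_fun setT f3 ->
  (\int[mu]_x (c1 * f1 x + (c2 * f2 x + c3 * f3 x))%:E = c1%:E * \int[mu]_x (f1 x)%:E +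
    (c2%:E * \int[mu]_x (f2 x)%:E + c3%:E * \int[mu]_x (f3 x)%:E))%E.
Proof.
move=> c10 c20 c30 f10 f20 f30 m1 m2 m3.
have Z0 (q : R) (f : T -> R) : 0 <= q -> (forall x, 0 <= f x) ->
    forall x, [set: T] x -> (0 <= q%:E * (f x)%:E)%E.
  by move=> q0 f0 x _; rewrite -EFinM lee_fin mulr_ge0.
have mZ (q : R) (f : T -> R) : measurable_fun [set: T] f ->
    measurable_fun [set: T] (fun x => q%:E * (f x)%:E)%E.
  by move=> mf; apply: emeasurable_funM; [exact: measurable_cst|exact/measurable_EFinP].
have Zl (q : R) (f : T -> R) : 0 <= q -> (forall x, 0 <= f x) -> measurable_fun [set: T] f ->
    (\int[mu]_x (q%:E * (f x)%:E) = q%:E * \int[mu]_x (f x)%:E)%E.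
  move=> q0 f0 mf; rewrite ge0_integralZl//; first exact/measurable_EFinP.
  by move=> x _; rewrite lee_fin.
under eq_integral do rewrite !EFinD !EFinM.
rewrite ge0_integralD//; try (exact: Z0); try (exact: mZ).
- by rewrite ge0_integralD//; try (exact: Z0); try (exact: mZ); rewrite !Zl.
- by move=> x _; apply: adde_ge0; exact: Z0.
- by apply: emeasurable_funD; exact: mZ.
Qed.

(** * Concentration of wave packets in frequency *)

Section PacketLocalization.
Context (R : realType) (n : nat).
Local Notation V := 'rV[R]_n.
Local Notation T := (Rn R n).
Local Notation mu := (@leb R n).
Local Notation FT := (@fourier_schwartz R n).
Local Notation lam := (@lebesgue_measure R).
Implicit Types (x y b : V).

(** For suitable [k] and [L], the modulus of the transform of a packet. The centre of the packet
    does not enter, hence the uniformity of the localization. *)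
Definition gprod (k L : R) b (x : V) : R := \prod_i (k * gexp L (b ord0 i) (x ord0 i)).

Lemma gprod_ge0 k L b x : 0 <= k -> 0 <= gprod k L b x.
Proof. by move=> k0; apply: prodr_ge0 => i _; rewrite mulr_ge0// gexp_ge0. Qed.

Lemma gprod_integral k L b : 0 < L -> 0 <= k ->
  mu.-integrable setT (EFin \o gprod k L b) /\
  (\int[mu]_x (gprod k L b x)%:E = ((k * Num.sqrt (2 * pi / L)) ^+ n)%:E)%E.
Proof.
move=> L0 k0.
have gi (i : 'I_n) : lam.-integrable setT (EFin \o (fun t => k * gexp L (b ord0 i) t)).
  have := integrableZl measurableT k (integrable_gexp (b ord0 i) L0).
  by congr (_.-integrable _ _); apply/funext => t /=; rewrite EFinM.
have [h1 h2] := @Rintegral_leb_prod R n (fun i t => k * gexp L (b ord0 i) t) gi.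
split=> //; rewrite -[LHS]fineK; last exact: (integrable_fin_num measurableT h1).
congr EFin; rewrite -[LHS]/(\int[mu]_x gprod k L b x) h2.
rewrite (eq_bigr (fun=> k * Num.sqrt (2 * pi / L))) => [|i _].
  by rewrite prodr_const card_ord.
by rewrite RintegralZl// ?Rintegral_gexp//; exact: integrable_gexp.
Qed.

Lemma cabs_fourier_wavepacket s y b xi : 0 < s ->
  cabs (FT (wavepacket s y b) xi) = gprod (Num.sqrt (2 * pi * s ^+ 2)) (s ^+ 2) b xi.
Proof.
move=> s0; have s2 : 0 < s ^+ 2 by rewrite exprn_gt0.
rewrite /wavepacket fourier_atom => [|i]; last by rewrite invr_gt0.
rewrite cabsM cabs_atom cabs_prod /gprod big_split; congr (_ * _).
  apply: eq_bigr => i _; rewrite [LHS]cabsM cabs_cis mulr1 [LHS]cabsr invrK.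
  by rewrite ger0_norm// sqrtr_ge0.
by apply: eq_bigr => i _; rewrite invrK.
Qed.

(** Half of the exponent pays for the distance [r]; the other half remains as an integrable
    Gaussian. *)
Lemma gexp_far (L c t r : R) : 0 < L -> 0 <= r -> r <= `|t - c| ->
  gexp L c t <= expR (- (L * r ^+ 2 / 4)) * gexp (L / 2) c t.
Proof.
move=> L0 r0 rt; rewrite /gexp -expRD ler_expR.
have h : r ^+ 2 <= (t - c) ^+ 2.
  by rewrite -[leRHS]real_normK ?num_real// ler_sqr ?nnegrE.
have : L * r ^+ 2 <= L * (t - c) ^+ 2 by rewrite ler_pM2l.
lra.
Qed.

Lemma gprod_far (k L r : R) b x : 0 <= k -> 0 < L -> 0 <= r ->
  (exists i, r <= `|x ord0 i - b ord0 i|) ->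
  gprod k L b x <= expR (- (L * r ^+ 2 / 4)) * gprod k (L / 2) b x.
Proof.
move=> k0 L0 r0 [i hi]; rewrite /gprod (bigD1 i)//= [in leRHS](bigD1 i)//= mulrA.
have g0 (l t c : R) : 0 <= k * gexp l c t by rewrite mulr_ge0// gexp_ge0.
apply: ler_pM => //.
- by apply: prodr_ge0.
- by rewrite mulrCA ler_wpM2l// gexp_far.
- apply: ler_prod => j _; rewrite g0/= ler_wpM2l// /gexp ler_expR lerN2.
  have : 0 <= L * (x ord0 j - b ord0 j) ^+ 2 by rewrite mulr_ge0 ?sqr_ge0// ltW.
  lra.
Qed.

Lemma gprod_le (k L : R) b x : 0 <= k -> 0 <= L -> gprod k L b x <= k ^+ n.
Proof.
move=> k0 L0; rewrite -[in leRHS](card_ord n) -prodr_const; apply: ler_prod => i _.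
by rewrite mulr_ge0 ?gexp_ge0//= ler_piMr// gexp_le1.
Qed.

Lemma exp_sqr_small (t : R) : 0 < t -> exists2 S : R, 0 < S & expR (- (S ^+ 2 / 4)) <= t.
Proof.
move=> t0; exists (2 * (1 + `|ln t|)); first by rewrite mulr_gt0// ltr_pwDl.
rewrite -[leRHS]lnK ?posrE// ler_expR.
have h0 := normr_ge0 (ln t); have h1 := ler_norm (- ln t); rewrite normrN in h1.
have : (2 * (1 + `|ln t|)) ^+ 2 / 4 = 1 + 2 * `|ln t| + `|ln t| ^+ 2 by field.
move=> ->; have := sqr_ge0 `|ln t|; lra.
Qed.

(** In the L^1 norm of (a - z) F u, the factor a - z is small on E, the measure of Q \ E is small,
    and the Gaussian is small outside Q. These contribute at most e c, e c / 4 and e c / 4, which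
    [fourier_mult_near_cst] turns into 3 e. *)
Lemma packet_localization (a : V -> R[i]) (A e : R) (z : R[i]) (E : set T) :
  cmeasurable (a : T -> R[i]) -> 0 <= A -> {ae mu, forall x, cabs (a x) <= A} ->
  measurable E -> (0 < mu E)%E -> 0 < e -> (forall x, E x -> cabs (a x - z) <= e) ->
  exists s b, 0 < s /\ forall y, {ae mu, forall x,
    cabs (fourier_mult a (wavepacket s y b) x - z * wavepacket s y b x) <= 3 * e}.
Proof.
move=> ma A0 aA mE E0 e0 aE.
pose A' := A + cabs z + 1; have A'0 : 0 < A' by rewrite ltr_wpDl// addr_ge0// cabs_ge0.
pose c : R := (2 * pi) ^+ n.
have pi2 : 0 < 2 * pi :> R by rewrite mulr_gt0// pi_gt0.
have c0 : 0 < c by rewrite exprn_gt0.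
pose K2 : R := Num.sqrt (8 * pi ^+ 2) ^+ n.
have K20 : 0 < K2 by rewrite exprn_gt0// sqrtr_gt0 mulr_gt0// exprn_gt0// pi_gt0.
have t0 : 0 < e * c / (4 * A' * K2) by rewrite divr_gt0 ?mulr_gt0.
(* [S] will be the product s r. Fixing it first makes the Gaussian tail and the admissible defect
   [d] independent of the size [r] of the box. *)
have [S S0 hS] := exp_sqr_small t0.
(* On Q \ E the transform is at most k^n, where k r = sqrt (2 pi) S; so A' k^n times d r^n is e c /
   4. *)
pose d := e * c / (4 * A' * (Num.sqrt (2 * pi) * S) ^+ n).
have sp : 0 < Num.sqrt (2 * pi) * S by rewrite mulr_gt0// sqrtr_gt0.
have d0 : 0 < d by rewrite divr_gt0 ?mulr_gt0// exprn_gt0.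
have [b [r [Q [r0 mQ Qfar QE]]]] := density_box mE E0 d0.
pose s := S / r; have s0 : 0 < s by rewrite divr_gt0.
have s2 : 0 < s ^+ 2 by rewrite exprn_gt0.
exists s, b; split=> // y.
pose k := Num.sqrt (2 * pi * s ^+ 2).
have k0 : 0 <= k by rewrite sqrtr_ge0.
have kE : k = Num.sqrt (2 * pi) * s by rewrite /k sqrtrM ?(ltW pi2)// sqrtr_sqr gtr0_norm.
have [i1 v1] := gprod_integral b s2 k0.
have s22 : 0 < s ^+ 2 / 2 by rewrite divr_gt0.
have [i2 v2] := gprod_integral b s22 k0.
have gu := gspan_wavepacket y b s0.
pose G1 x := gprod k (s ^+ 2) b x; pose G2 x := gprod k (s ^+ 2 / 2) b x.
pose w := expR (- (S ^+ 2 / 4)).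
have G10 x : 0 <= G1 x by exact: gprod_ge0.
have G20 x : 0 <= G2 x by exact: gprod_ge0.
have mG1 : measurable_fun [set: T] G1 by apply/measurable_EFinP; exact: measurable_int i1.
have mG2 : measurable_fun [set: T] G2 by apply/measurable_EFinP; exact: measurable_int i2.
have mQE : measurable (Q `\` E) by exact: measurableD.
have mI : measurable_fun [set: T] (\1_(Q `\` E) : T -> R) by exact: measurable_indic.
have mFT : cmeasurable (FT (wavepacket s y b) : T -> R[i]).
  by have [] := gspan_sqi (gspan_fourier gu).
have mdom : cmeasurable (fun x : T => (a x - z) * FT (wavepacket s y b) x).
  by apply: cmeasurable_mul mFT; apply: cmeasurable_sub ma _; exact: cmeasurable_cst.
have w0 : 0 <= w by exact: expR_ge0.
have pw : {ae mu, forall x, cabs ((a x - z) * FT (wavepacket s y b) x) <=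
    e * G1 x + (A' * w * G2 x + A' * k ^+ n * \1_(Q `\` E) x)}.
  apply: aeS aA => x ax; rewrite cabsM cabs_fourier_wavepacket// -/k -/(G1 x).
  have az : cabs (a x - z) <= A'.
    by apply: le_trans (ler_cabsB _ _) _; rewrite /A' -addrA lerD// lerDl.
  have t1 : 0 <= A' * w * G2 x by rewrite !mulr_ge0// ltW.
  have t2 : 0 <= A' * k ^+ n * \1_(Q `\` E) x by rewrite !mulr_ge0// ?exprn_ge0// ltW.
  have t3 : 0 <= e * G1 x by rewrite mulr_ge0// ltW.
  have [xE|xE] := pselect (E x).
    by apply: le_trans (ler_wpM2r (G10 x) (aE x xE)) _; rewrite lerDl addr_ge0.
  apply: le_trans (ler_wpM2r (G10 x) az) _; rewrite addrC ler_wpDr//.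
  have [xQ|xQ] := pselect (Q x).
    have : A' * G1 x <= A' * k ^+ n * \1_(Q `\` E) x.
      rewrite indicE mem_set// mulr1 ler_wpM2l ?(ltW A'0)//.
      by apply: gprod_le => //; exact: ltW.
    by move/le_trans; apply; rewrite lerDr.
  have := gprod_far k0 s2 (ltW r0) (Qfar x xQ); rewrite -/(G1 x) -/(G2 x).
  have -> : expR (- (s ^+ 2 * r ^+ 2 / 4)) = w.
    by rewrite /w /s -exprMn divfK// gt_eqF.
  by move=> /(ler_wpM2l (ltW A'0)); rewrite mulrA => /le_trans; apply; rewrite lerDl.
have bound : (\int[mu]_x (cabs ((a x - z) * FT (wavepacket s y b) x))%:E <= (3 / 2 * e * c)%:E)%E.
  have e0' := ltW e0; have Aw0 : 0 <= A' * w by rewrite mulr_ge0// ltW.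
  have Ak0 : 0 <= A' * k ^+ n by rewrite mulr_ge0 ?exprn_ge0// ltW.
  have I0 x : 0 <= \1_(Q `\` E) x :> R by [].
  apply: (@le_trans _ _ (\int[mu]_x (e * G1 x + (A' * w * G2 x + A' * k ^+ n * \1_(Q `\` E) x))%:E)%E).
    apply: (ae_ge0_le_integral measurableT).
    - by move=> x _; rewrite lee_fin cabs_ge0.
    - exact/measurable_EFinP/cmeasurable_cabs.
    - by move=> x _; rewrite lee_fin; apply: addr_ge0; [|apply: addr_ge0]; apply: mulr_ge0.
    - apply/measurable_EFinP; apply: measurable_funD; [|apply: measurable_funD];
        (apply: measurable_funM; first exact: measurable_cst); [exact: mG1|exact: mG2|exact: mI].
    - by apply: aeS pw => x h _; rewrite lee_fin.
  rewrite (ge0_integral_comb3 mu e0' Aw0 Ak0 G10 G20 I0 mG1 mG2 mI).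
  rewrite v1 v2 integral_indic// setIT.
  have ks2 : 0 <= 2 * pi * s ^+ 2 by apply: mulr_ge0; exact: ltW.
  have E1 : k * Num.sqrt (2 * pi / s ^+ 2) = 2 * pi.
    rewrite /k -(sqrtrM _ ks2).
    have -> : 2 * pi * s ^+ 2 * (2 * pi / s ^+ 2) = (2 * pi) ^+ 2.
      by move: (s ^+ 2) s2 => t t1; field; rewrite gt_eqF.
    by rewrite sqrtr_sqr gtr0_norm.
  have E2 : k * Num.sqrt (2 * pi / (s ^+ 2 / 2)) = Num.sqrt (8 * pi ^+ 2).
    rewrite /k -(sqrtrM _ ks2).
    have -> // : 2 * pi * s ^+ 2 * (2 * pi / (s ^+ 2 / 2)) = 8 * pi ^+ 2.
    by move: (s ^+ 2) s2 => t t1; field; rewrite gt_eqF.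
  rewrite E1 E2 -/c -/K2.
  have b2 : A' * w * K2 <= e * c / 4.
    rewrite -ler_pdivlMr// -ler_pdivlMl//; apply: le_trans hS _.
    by rewrite le_eqVlt; apply/orP; left; apply/eqP; field; rewrite (gt_eqF K20) (gt_eqF A'0).
  have b3 : ((A' * k ^+ n)%:E * mu (Q `\` E) <= (e * c / 4)%:E)%E.
    apply: le_trans (lee_wpmul2l _ QE) _; first by rewrite lee_fin.
    rewrite -EFinM lee_fin kE /d /s le_eqVlt; apply/orP; left; apply/eqP.
    rewrite !exprMn exprVn.
    have r1 := exprn_gt0 n r0; have S1 := exprn_gt0 n S0.
    have q1 : 0 < Num.sqrt (2 * pi) ^+ n :> R by rewrite exprn_gt0// sqrtr_gt0.
    move: (r ^+ n) r1 (S ^+ n) S1 (Num.sqrt (2 * pi) ^+ n) q1 => r' r1 S' S1 q' q1.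
    by field; rewrite (gt_eqF r1) (gt_eqF S1) (gt_eqF q1) (gt_eqF A'0).
  apply: (@le_trans _ _ ((e * c)%:E + ((e * c / 4)%:E + (e * c / 4)%:E))%E).
    by rewrite -!EFinM; apply: leeD => //; apply: leeD => //; rewrite lee_fin.
  by rewrite -!EFinD lee_fin; lra.
have := fourier_mult_near_cst ma A0 aA gu bound.
apply: aeS => x /le_trans; apply.
by rewrite -/c le_eqVlt; apply/orP; left; apply/eqP; field; rewrite gt_eqF.
Qed.

End PacketLocalization.

(** * Disjoint cubes in a cone *)

Section ConeCubes.
Context (R : realType) (n : nat).
Local Notation V := 'rV[R]_n.

(** The centres are dilates of one point x1. A neighbourhood of x1 grows with the dilation until it
    contains the cube, and the dilates spread out in a coordinate where x1 does not vanish. *)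
Lemma open_cone_cubes (K : set V) (L : R) : (0 < n)%N -> open_cone K -> K !=set0 -> 0 < L ->
  exists y : nat -> V, (forall k, cube (y k) L `<=` K) /\
    forall j k x, j != k -> cube (y j) L x -> ~ cube (y k) L x.
Proof.
move=> n0 [oK cK] [x0 Kx0] L0; pose i0 := Ordinal n0.
have bK x : K x -> exists2 rho : R, 0 < rho & forall t : V,
    (forall i, `|x ord0 i - t ord0 i| < rho) -> K t.
  move=> Kx; have /nbhs_ballP[rho rho0 hrho] := open_nbhs_nbhs (conj oK Kx).
  exists rho => // t ht; apply: hrho; split=> // i j; rewrite (ord1 i); exact: ht.
(* Openness of the cone allows a small move off the hyperplane where this coordinate vanishes. *)
have [x1 Kx1 x1n] : exists2 x1, K x1 & x1 ord0 i0 != 0.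
  have [x00|] := eqVneq (x0 ord0 i0) 0; last by exists x0.
  have [rho rho0 hrho] := bK x0 Kx0.
  exists (x0 + (rho / 2) *: delta_mx ord0 i0).
    apply: hrho => i; rewrite !mxE opprD addNKr normrN eqxx/=.
    case: eqP => _; rewrite ?mulr1 ?mulr0 ?normr0// ger0_norm; lra.
  by rewrite !mxE x00 !eqxx/= mulr1 add0r gt_eqF// divr_gt0.
have [rho rho0 hrho] := bK x1 Kx1.
pose q := `|x1 ord0 i0|; have q0 : 0 < q by rewrite normr_gt0.
(* The first summand gives La rho > L, so the cubes fit in the cone; the second gives La q >= 2 L,
   so they are disjoint. *)
pose La := 2 * L / rho + 2 * L / q.
have l1 : 0 < 2 * L / rho by rewrite divr_gt0 ?mulr_gt0.
have l2 : 0 < 2 * L / q by rewrite divr_gt0 ?mulr_gt0.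
have La0 : 0 < La by rewrite addr_gt0.
have Lrho : L < La * rho.
  apply: (@lt_le_trans _ _ (2 * L / rho * rho)); first by rewrite divfK ?gt_eqF//; lra.
  by rewrite ler_pM2r// lerDl ltW.
have Lq : 2 * L <= La * q.
  apply: (@le_trans _ _ (2 * L / q * q)); first by rewrite divfK ?gt_eqF.
  by rewrite ler_pM2r// lerDr ltW.
pose m (k : nat) : R := La * k.+1%:R.
have m0 k : 0 < m k by rewrite mulr_gt0// ltr0n.
exists (fun k => m k *: x1); split.
  move=> k t ht; rewrite -[t]scale1r -(@mulfV _ (m k)) ?gt_eqF// -scalerA; apply: cK => //.
  apply: hrho => i; have := ht i; rewrite !mxE => /andP[h1 h2].
  have -> : x1 ord0 i - (m k)^-1 * t ord0 i = (m k * x1 ord0 i - t ord0 i) / m k.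
    by field; rewrite gt_eqF.
  rewrite normrM normfV (gtr0_norm (m0 k)) ltr_pdivrMr//.
  apply: (@le_lt_trans _ _ L); first by rewrite ler_norml; apply/andP; split; lra.
  apply: (lt_le_trans Lrho); rewrite [leRHS]mulrC ler_wpM2r ?(ltW rho0)//.
  by rewrite /m ler_peMr ?(ltW La0)// ler1n.
move=> j k x jk /(_ i0) + /(_ i0); rewrite !mxE => /andP[h1 h2] /andP[h3 h4].
have : `|m j * x1 ord0 i0 - m k * x1 ord0 i0| < 2 * L.
  by rewrite ltr_norml; apply/andP; split; lra.
apply/negP; rewrite -leNgt -mulrBl normrM -/q /m -mulrBr normrM (gtr0_norm La0).
apply: (le_trans Lq); rewrite ler_wpM2r ?(ltW q0)// ler_peMr ?(ltW La0)//.
wlog kj : j k jk {h1 h2 h3 h4} / (k < j)%N.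
  move=> H; have [/H|/H|jk'] := ltngtP k j; first exact.
    by rewrite distrC; apply; rewrite eq_sym.
  by rewrite jk' eqxx in jk.
rewrite -natrB ?ltnS ?(ltnW kj)// ger0_norm// ler1n subSS subn_gt0//.
Qed.

End ConeCubes.

(** * Images of truncated packets *)

Section PacketEstimates.
Context (R : realType) (n : nat).
Local Notation V := 'rV[R]_n.
Local Notation T := (Rn R n).
Local Notation mu := (@leb R n).
Variables (p : exponent T R) (w : weight mu).
Local Notation N f := (luxemburg mu p (wabs w f)).
Local Notation Nc y h := (N (cindic R (@cube R n y h))).
Implicit Types (f g : V -> R[i]) (y : V).

Lemma luxw_le3 f f1 f2 f3 : cmeasurable (f : T -> R[i]) -> cmeasurable (f1 : T -> R[i]) ->
  cmeasurable (f2 : T -> R[i]) -> cmeasurable (f3 : T -> R[i]) ->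
  {ae mu, forall x, cabs (f x) <= cabs (f1 x) + (cabs (f2 x) + cabs (f3 x))} ->
  (N f <= N f1 + (N f2 + N f3))%E.
Proof.
move=> mf m1 m2 m3 h.
have ma (g : T -> R[i]) : cmeasurable g -> cmeasurable (fun x : T => (cabs (g x))%:C%C).
  by move=> mg; apply: cmeasurable_real; exact: cmeasurable_cabs.
have Na (g : T -> R[i]) : N (fun x : T => (cabs (g x))%:C%C) = N g.
  by congr luxemburg; apply/funext => x; rewrite /wabs cabsr ger0_norm ?cabs_ge0.
have m23 := cmeasurable_add (ma _ m2) (ma _ m3).
have m123 := cmeasurable_add (ma _ m1) m23.
apply: (@le_trans _ _ (N (fun x => (cabs (f1 x))%:C%C + ((cabs (f2 x))%:C%C + (cabs (f3 x))%:C%C))%R)).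
  apply: (le_luxw p w mf m123); apply: aeS h => x hx; apply: (le_trans hx).
  by rewrite -!rmorphD cabsr ler_norm.
apply: le_trans (luxwD p w (ma _ m1) m23) _; rewrite Na; apply: leeD2l.
by apply: le_trans (luxwD p w (ma _ m2) (ma _ m3)) _; rewrite !Na.
Qed.

Variables (a : V -> R[i]) (A M D th e : R) (z : R[i]) (s : R) (b : V) (J : nat).
Hypotheses (ma : cmeasurable (a : T -> R[i])) (A0 : 0 <= A)
  (aA : {ae mu, forall x, cabs (a x) <= A}).
Hypotheses (M0 : 0 <= M) (aM : forall f, sqi mu f -> (N f < +oo)%E ->
  (N (fourier_mult a f) <= M%:E * N f)%E).
Hypotheses (D1 : 1 <= D) (N_cube : forall y h, 0 < h -> (0 < Nc y h < +oo)%E /\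
   (Nc y (2 * h) <= D%:E * Nc y h)%E).
Hypotheses (s0 : 0 < s) (th0 : 0 < th) (e0 : 0 < e).
Local Notation S := (fourier_mult a).
Local Notation u y := (wavepacket s y b).
Let Q y : set T := cube y (2 ^+ J * s).
Let u' y : V -> R[i] := fun x => u y x * cindic R (~` Q y) x.
Hypothesis tail : forall y, (N (u' y) <= th%:E * Nc y s)%E.
Hypothesis loc : forall y, {ae mu, forall x, cabs (S (u y) x - z * u y x) <= e}.

Definition packet y : V -> R[i] := fun x => u y x * cindic R (Q y) x.
(** A lower bound of the packet on the core cube of half-side [s]. Hence the norm [nu y] of the
    packet is at least [c0] times [m y], the norm of the indicator of the core, in which all errors
    are measured. *)
Let c0 : R := expR (- 2^-1) ^+ n.
Let m y : R := fine (Nc y s).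
Let nu y : R := fine (N (packet y)).

Let mQ y : measurable (Q y). Proof. exact: measurable_cube. Qed.
Let mcQ y : cmeasurable (cindic R (Q y)). Proof. exact: cmeasurable_cindic. Qed.

Let su y : sqi mu (u y). Proof. exact: gspan_sqi (gspan_wavepacket y b s0). Qed.

Let cut (E : set T) f : measurable E -> sqi mu f -> sqi mu (fun x => f x * cindic R E x).
Proof.
move=> mE [mf f2]; have mfE := cmeasurable_mul mf (cmeasurable_cindic R mE).
split; first exact: mfE.
apply: le_lt_trans f2; apply: (le_sqn mu mfE mf) => x.
by rewrite cabsM cabs_cindic indicE ler_piMr ?cabs_ge0//; case: (_ \in _).
Qed.

Lemma sqi_packet y : sqi mu (packet y). Proof. exact: (cut (mQ y) (su y)). Qed.
Let su' y : sqi mu (u' y). Proof. exact: (cut (measurableC (mQ y)) (su y)). Qed.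

Let mE y : Nc y s = (m y)%:E.
Proof. by have [/andP[h1 h2] _] := N_cube y s0; rewrite fineK// ge0_fin_numE ?lux_ge0. Qed.

Lemma m_gt0 y : 0 < m y.
Proof. by rewrite -lte_fin -mE; have [/andP[]] := N_cube y s0. Qed.

Let p2 : 1 <= 2 ^+ J :> R. Proof. by rewrite exprn_ege1// ler1n. Qed.

Let N_Q y : (N (cindic R (Q y)) <= (D ^+ J * m y)%:E)%E.
Proof. by have := cube_iter D1 N_cube y J s0; rewrite mE EFinM. Qed.

Let u_le1 y x : cabs (u y x) <= 1.
Proof.
rewrite cabs_wavepacket; apply: (@le_trans _ _ (\prod_(i < n) (1 : R))); last by rewrite big1_eq.
by apply: ler_prod => i _; rewrite gexp_ge0 gexp_le1// invr_ge0 sqr_ge0.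
Qed.

Let N_packet_le y : (N (packet y) <= (D ^+ J * m y)%:E)%E.
Proof.
apply: le_trans (N_Q y); have [mp _] := sqi_packet y.
apply: (le_luxw p w mp (mcQ y)); apply: aeT => x.
by rewrite /packet cabsM ler_piMl ?cabs_ge0.
Qed.

Let nuE y : N (packet y) = (nu y)%:E.
Proof. by rewrite fineK// ge0_fin_numE ?lux_ge0//; exact: le_lt_trans (N_packet_le y) (ltry _). Qed.

Lemma nu_ge y : c0 * m y <= nu y.
Proof.
rewrite -lee_fin EFinM -mE -nuE -[c0 in leLHS]ger0_norm ?exprn_ge0 ?expR_ge0// -cabsr -luxwZ.
have [mp _] := sqi_packet y.
have mc := cmeasurable_cindic R (measurable_cube y s).
apply: (le_luxw p w (cmeasurable_mul (cmeasurable_cst _ _) mc) mp); apply: aeT => x.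
rewrite [leLHS]cabsM cabs_cindic cabsr ger0_norm ?exprn_ge0 ?expR_ge0// indicE.
have [xs|xs] := pselect (cube y s x); last by rewrite memNset// mulr0 cabs_ge0.
rewrite mem_set// mulr1 /packet cabsM cabs_cindic indicE mem_set; last first.
  by apply: (cube_sub _ xs); rewrite ler_peMl// ltW.
by rewrite mulr1; exact: wavepacket_ge.
Qed.

Let c00 : 0 < c0. Proof. by rewrite exprn_gt0// expR_gt0. Qed.

Lemma nu_gt0 y : 0 < nu y.
Proof. by apply: lt_le_trans (nu_ge y); rewrite mulr_gt0// m_gt0. Qed.

Let mS f : sqi mu f -> cmeasurable (S f : T -> R[i]).
Proof. by move=> sf; have [[]] := fourier_multP ma A0 aA sf. Qed.

Let N_u' y : (N (u' y) <= (th * m y)%:E)%E.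
Proof. by apply: le_trans (tail y) _; rewrite mE EFinM. Qed.

Let N_Su' y : (N (S (u' y)) <= (M * th * m y)%:E)%E.
Proof.
have h := N_u' y.
apply: le_trans (aM (su' y) (le_lt_trans h (ltry _))) _.
by rewrite -mulrA EFinM lee_wpmul2l// lee_fin.
Qed.

Let Sv y : {ae mu, forall x, S (u y) x = S (packet y) x + S (u' y) x}.
Proof.
have E : (fun x => packet y x + u' y x) = u y.
  apply/funext => x; rewrite /packet /u' -mulrDr /cindic !indicE in_setC.
  by case: (x \in Q y); rewrite ?addr0 ?add0r mulr1.
by have := fourier_multD ma A0 aA (sqi_packet y) (su' y); rewrite E.
Qed.

(** On [Q y], z times the packet is its image minus the localization error plus the image of the
    tail [u' y]. The error costs e D^J m y on the cube; the tail costs M th m y, by the bound of the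
    multiplier. *)
Lemma packet_diag y : ((cabs z * nu y)%:E <=
  N (fun x => S (packet y) x * cindic R (Q y) x)%R + (((e * D ^+ J + M * th) * m y)%R)%:E)%E.
Proof.
have [mp _] := sqi_packet y; have mSp := mS (sqi_packet y); have mSu' := mS (su' y).
rewrite EFinM -nuE -luxwZ.
apply: (@le_trans _ _ (N (fun x => S (packet y) x * cindic R (Q y) x)%R +
    (N (fun x => e%:C%C * cindic R (Q y) x)%R + N (S (u' y))))%E).
  apply: (luxw_le3 (cmeasurable_mul (cmeasurable_cst _ _) mp) (cmeasurable_mul mSp (mcQ y))
    (cmeasurable_mul (cmeasurable_cst _ _) (mcQ y)) mSu').
  apply: aeS2 (Sv y) (loc y) => x; move: (S (u y) x) (S (packet y) x) (S (u' y) x) => t1 t2 t3 -> h.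
  rewrite /packet !cabsM !cabs_cindic cabsr (ger0_norm (ltW e0)) indicE.
  case: (x \in Q y); last by rewrite !mulr0 !add0r cabs_ge0.
  rewrite !mulr1 -cabsM.
  have -> : z * u y x = t2 - ((t2 + t3 - z * u y x) - t3) by ring.
  apply: le_trans (ler_cabsB _ _) _; apply: lerD => //.
  by apply: le_trans (ler_cabsB _ _) _; rewrite lerD2r.
apply: leeD2l; rewrite luxwZ cabsr (ger0_norm (ltW e0)) mulrDl EFinD; apply: leeD => //.
by rewrite -mulrA EFinM lee_wpmul2l// lee_fin ltW.
Qed.

(** Off [Q y] the function u coincides with its tail u', so the image of the packet is the
    localization error plus z u' - S u'. The error is paid on the cube of [y2], hence in units of
    [m y2]. *)
Lemma packet_off y y2 : (forall x, Q y2 x -> ~ Q y x) ->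
  (N (fun x => S (packet y) x * cindic R (Q y2) x)%R <=
   ((cabs z * th + M * th) * m y + e * D ^+ J * m y2)%:E)%E.
Proof.
move=> disj.
have [mp _] := sqi_packet y; have mSp := mS (sqi_packet y); have mSu' := mS (su' y).
have [mu' _] := su' y.
apply: (@le_trans _ _ (N (fun x => e%:C%C * cindic R (Q y2) x)%R +
    (N (fun x => z * u' y x)%R + N (S (u' y))))%E).
  apply: (luxw_le3 (cmeasurable_mul mSp (mcQ y2)) (cmeasurable_mul (cmeasurable_cst _ _) (mcQ y2))
    (cmeasurable_mul (cmeasurable_cst _ _) mu') mSu').
  apply: aeS2 (Sv y) (loc y) => x.
  move: (S (u y) x) (S (packet y) x) (S (u' y) x) => t1 t2 t3 -> h.
  rewrite [in leLHS]cabsM [cabs (e%:C%C * _)]cabsM !cabs_cindic cabsr (ger0_norm (ltW e0)) indicE.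
  case: (boolP (x \in Q y2)) => [xQ|_]; last by rewrite !mulr0 add0r addr_ge0 ?cabs_ge0.
  rewrite inE in xQ; rewrite !mulr1.
  have -> : u' y x = u y x.
    by rewrite /u' /cindic indicE mem_set ?mulr1//; exact: disj.
  have -> : t2 = (t2 + t3 - z * u y x) + (z * u y x - t3) by ring.
  apply: le_trans (ler_cabsD _ _) _; apply: lerD => //; exact: ler_cabsB.
rewrite !luxwZ cabsr (ger0_norm (ltW e0)) [X in (_ <= X%:E)%E]addrC EFinD; apply: leeD.
  by rewrite -mulrA EFinM lee_wpmul2l// lee_fin ltW.
rewrite mulrDl EFinD; apply: leeD => //.
by rewrite -mulrA EFinM lee_wpmul2l// lee_fin cabs_ge0.
Qed.

Definition unit_packet y : V -> R[i] := fun x => ((nu y)^-1)%:C%C * packet y x.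

Lemma sqi_unit_packet y : sqi mu (unit_packet y).
Proof. exact: (sqiZ _ (sqi_packet y)). Qed.

Let nuV_gt0 y : 0 < (nu y)^-1. Proof. by rewrite invr_gt0 nu_gt0. Qed.

Lemma unit_packet_norm y : N (unit_packet y) = 1%E.
Proof.
by rewrite luxwZ nuE -EFinM cabsr gtr0_norm// mulVf// gt_eqF// nu_gt0.
Qed.

Lemma unit_packet_off y x : ~ Q y x -> unit_packet y x = 0.
Proof. by move=> xQ; rewrite /unit_packet /packet /cindic indicE memNset// !mulr0. Qed.

Let k : R := e * D ^+ J + M * th.
Let k_ge0 : 0 <= k.
Proof.
by rewrite addr_ge0// mulr_ge0 ?exprn_ge0 ?(ltW e0) ?(ltW th0)// (le_trans ler01).
Qed.

Let Nscaled y E : N (fun x => (((nu y)^-1)%:C%C * S (packet y) x) * cindic R E x)%R =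
  ((nu y)^-1%:E * N (fun x => S (packet y) x * cindic R E x)%R)%E.
Proof.
rewrite -[((nu y)^-1)%:E](_ : (cabs ((nu y)^-1)%:C%C)%:E = _) -?luxwZ; last first.
  by rewrite cabsr gtr0_norm.
by congr luxemburg; congr wabs; apply/funext => x; rewrite mulrA.
Qed.

Let mSp y : cmeasurable (S (packet y) : T -> R[i]). Proof. exact: mS (sqi_packet y). Qed.

Lemma unit_packet_diag y :
  ((cabs z - k / c0)%:E <= N (fun x => S (unit_packet y) x * cindic R (Q y) x)%R)%E.
Proof.
have h := fourier_multZ ma A0 aA ((nu y)^-1)%:C%C (sqi_packet y).
have mG : cmeasurable (S (unit_packet y) : T -> R[i]) := mS (sqi_unit_packet y).
have mH := cmeasurable_mul (cmeasurable_cst _ ((nu y)^-1)%:C%C) (mSp y).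
rewrite (ae_eq_luxw p w (cmeasurable_mul mG (mcQ y)) (cmeasurable_mul mH (mcQ y))); last first.
  by apply: aeS h => x hx; rewrite -hx.
rewrite Nscaled; have := packet_diag y; rewrite -/k.
case: (N _) (lux_ge0 mu p (wabs w (fun x => S (packet y) x * cindic R (Q y) x)%R)) => [r|_ _|//].
  rewrite !lee_fin => r0 h1; rewrite lerBlDr -(ler_pM2r (nu_gt0 y)) (le_trans h1)//.
  have -> : ((nu y)^-1 * r + k / c0) * nu y = r + k / c0 * nu y.
    by rewrite mulrDl [_ * r]mulrC mulfVK// gt_eqF// nu_gt0.
  rewrite lerD2l.
  by rewrite -mulrA ler_wpM2l// mulrC ler_pdivlMr// mulrC; exact: nu_ge.
by rewrite gt0_muley ?lte_fin// leey.
Qed.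

(** Normalization divides by nu y, while the localization error is proportional to m y2: this is
    where m y2 <= m y enters. *)
Lemma unit_packet_off_diag y y2 : (forall x, Q y2 x -> ~ Q y x) -> m y2 <= m y ->
  (N (fun x => S (unit_packet y) x * cindic R (Q y2) x)%R <= ((cabs z * th + k) / c0)%:E)%E.
Proof.
move=> disj m21.
have h := fourier_multZ ma A0 aA ((nu y)^-1)%:C%C (sqi_packet y).
have mG : cmeasurable (S (unit_packet y) : T -> R[i]) := mS (sqi_unit_packet y).
have mH := cmeasurable_mul (cmeasurable_cst _ ((nu y)^-1)%:C%C) (mSp y).
rewrite (ae_eq_luxw p w (cmeasurable_mul mG (mcQ y2)) (cmeasurable_mul mH (mcQ y2))); last first.
  by apply: aeS h => x hx; rewrite -hx.
rewrite Nscaled; apply: (le_trans (lee_wpmul2l _ (packet_off disj))).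
  by rewrite lee_fin ltW.
have eD : 0 <= e * D ^+ J by rewrite mulr_ge0 ?exprn_ge0 ?(ltW e0)// (le_trans ler01).
rewrite -EFinM lee_fin mulrC ler_pdivrMr ?nu_gt0//.
apply: (@le_trans _ _ ((cabs z * th + k) * m y)).
  rewrite /k [e * _ + _]addrC addrA [leRHS]mulrDl lerD2l.
  exact: ler_wpM2l.
rewrite -mulrA; apply: ler_wpM2l.
  by apply: addr_ge0 => //; rewrite mulr_ge0 ?cabs_ge0// ltW.
by rewrite mulrC ler_pdivlMr// mulrC; exact: nu_ge.
Qed.

(** [G] is prescribed on the two cubes only, so that the difference of the images cut to the cone is
    covered. *)
Lemma unit_packet_sep y y2 G : (forall x, Q y2 x -> ~ Q y x) -> cmeasurable (G : T -> R[i]) ->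
  {ae mu, forall x, Q y x \/ Q y2 x -> G x = S (unit_packet y) x - S (unit_packet y2) x} ->
  ((cabs z - (k + (cabs z * th + k)) / c0)%:E <= N G)%E.
Proof.
wlog m21 : y y2 G / m y2 <= m y => [hwlog disj mG GE|disj mG GE].
  have [m21|/ltW m12] := leP (m y2) (m y); first exact: (hwlog y y2 G m21 disj mG GE).
  have mN : cmeasurable (fun x : T => - G x).
    have := cmeasurable_sub (@cmeasurable_cst _ T R 0) mG; congr cmeasurable.
    by apply/funext => x; rewrite sub0r.
  have disj' x : Q y x -> ~ Q y2 x by move=> h1 h2; exact: (disj x).
  rewrite -luxwN; apply: (hwlog y2 y (fun x => - G x) m12 disj' mN).
  by apply: aeS GE => x h; rewrite orC => /h ->; rewrite opprB.
have mS1 : cmeasurable (S (unit_packet y) : T -> R[i]) := mS (sqi_unit_packet y).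
have mS2 : cmeasurable (S (unit_packet y2) : T -> R[i]) := mS (sqi_unit_packet y2).
have h : (N (fun x => S (unit_packet y2) x * cindic R (Q y2) x)%R <=
    N G + N (fun x => S (unit_packet y) x * cindic R (Q y2) x)%R)%E.
  have mG1 := cmeasurable_mul mG (mcQ y2); have mS1Q := cmeasurable_mul mS1 (mcQ y2).
  apply: (@le_trans _ _ (N (fun x => G x * cindic R (Q y2) x - S (unit_packet y) x * cindic R (Q y2) x)%R)).
    apply: (le_luxw p w (cmeasurable_mul mS2 (mcQ y2)) (cmeasurable_sub mG1 mS1Q)).
    apply: aeS GE => x h; rewrite /cindic indicE.
    move: (G x) (S (unit_packet y) x) (S (unit_packet y2) x) h => g t1 t2 h.
    have [xQ|_] := boolP (x \in Q y2).
      by rewrite (h (or_intror (set_mem xQ))) !mulr1 addrAC subrr sub0r cabsN.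
    by rewrite !mulr0 subrr.
  apply: le_trans (luxwB p w mG1 mS1Q) _; apply: leeD => //.
  apply: (le_luxw p w mG1 mG); apply: aeT => x; rewrite cabsM cabs_cindic indicE.
  by case: (_ \in _); rewrite ?mulr1// mulr0 cabs_ge0.
have := le_trans (unit_packet_diag y2) h.
have := unit_packet_off_diag disj m21.
set t := N (fun x => S (unit_packet y) x * cindic R (Q y2) x)%R.
move=> h1 h2; rewrite mulrDl opprD addrA EFinB leeBlDr//.
by apply: le_trans h2 _; exact: leeD2l.
Qed.

End PacketEstimates.

(** [q] stands for the localization error and [t] for the tail tolerance, both relative to the lower
    bound of the packets. The loss from c to z and the terms c t, 6 q and 2 M t take at most a
    quarter of [e] each. *)
Lemma error_budget (R : realType) (c e z M q t : R) : 0 <= c -> 0 <= e -> 0 < t -> t <= 2^-1 ->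
  t * (8 * (M + 1)) <= e -> t * (4 * (c + 1)) <= e -> 24 * q <= e -> c - e / 4 <= z ->
  c - e <= z * (1 - t) - 2 * (3 * q + M * t).
Proof.
move=> c0 e0 t0 t2 tM tc q1 zc.
have h : (c - e / 4) * (1 - t) <= z * (1 - t) by apply: ler_wpM2r => //; lra.
have h2 : 0 <= e / 4 * t by rewrite mulr_ge0 ?divr_ge0 ?(ltW t0).
lra.
Qed.

Section Separation.
Context (R : realType) (n : nat).
Local Notation V := 'rV[R]_n.
Local Notation T := (Rn R n).
Local Notation mu := (@leb R n).
Variables (p : exponent T R) (w : weight mu) (p' : V -> R) (a : V -> R[i]) (K : set V).
Local Notation N f := (luxemburg mu p (wabs w f)).
Hypotheses (n_gt0 : (0 < n)%N) (p_bounded : (ess_sup mu (EFin \o p) < +oo)%E)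
  (pp' : forall x, (p x)^-1 + (p' x)^-1 = 1) (Ap : muckenhoupt p p' w)
  (K_cone : open_cone K) (K_neq0 : K !=set0) (pa : multiplier p w a).
Local Notation X := (LpwSpace p w (K : set T)).
Local Notation W := (wiener_hopf p w (K : set T) a).

Let mK : measurable (K : set T).
Proof. by apply: measurable_borel; apply: borel_open; case: K_cone. Qed.

(** The common source of the norm, noncompactness and compactness claims. The negated bound says
    that c lies below the essential supremum of |a|, in the form needed by [essential_value]. *)
Lemma separated_images (c e : R) : 0 <= c -> 0 < e -> ~ {ae mu, forall x, cabs (a x) <= c} ->
  exists x : nat -> X, forall k, [/\ `|x k| <= 1, c - e <= `|W (x k)| &
    forall j, j != k -> c - e <= `|W (x j) - W (x k)|].
Proof.
move=> c0 e0 ac; have [La _] := pa; have [ma _] := La; have [A A0 aA] := Linfty_bound La.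
have [M M0 aM] := multiplier_bound pa; have [D D1 N_cube] := doubling pp' Ap.
set d : R := expR (- 2^-1) ^+ n.
have d0 : 0 < d by rewrite exprn_gt0// expR_gt0.
(* The three entries serve [error_budget]. The tail tolerance is d t because normalization divides
   the errors by the lower bound [d]. *)
set t : R := Num.min 2^-1 (Num.min (e / (8 * (M + 1))) (e / (4 * (c + 1)))).
have M1 : 0 < M + 1 by rewrite ltr_wpDl.
have c1 : 0 < c + 1 by rewrite ltr_wpDl.
have t0 : 0 < t by rewrite !lt_min invr_gt0 ltr0n/= !divr_gt0// mulr_gt0// ltr0n.
have t2 : t <= 2^-1 by rewrite ge_min lexx.
have tM : t * (8 * (M + 1)) <= e by rewrite -ler_pdivlMr ?mulr_gt0 ?ltr0n// !ge_min lexx !orbT.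
have tc : t * (4 * (c + 1)) <= e by rewrite -ler_pdivlMr ?mulr_gt0 ?ltr0n// !ge_min lexx !orbT.
have th0 : 0 < d * t by rewrite mulr_gt0.
have [J tail] := wavepacket_tail (p := p) (w := w) D1 N_cube th0.
have DJ : 0 < D ^+ J by rewrite exprn_gt0// (lt_le_trans ltr01).
(* Chosen after [J], since the localization error 3 r gets multiplied by D^J / d; the first entry
   controls the loss in |z|. *)
set r : R := Num.min (e / 4) (d * e / (24 * D ^+ J)).
have r0 : 0 < r by rewrite lt_min !divr_gt0 ?mulr_gt0 ?ltr0n.
have re : r <= e / 4 by rewrite ge_min lexx.
have rD : r * (24 * D ^+ J) <= d * e.
  by rewrite -ler_pdivlMr ?mulr_gt0 ?ltr0n// !ge_min lexx orbT.
have [z [E [mE E0 aE zc]]] := essential_value ma r0 ac.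
have [s [b [s0 loc]]] := packet_localization ma A0 aA mE E0 r0 aE.
have r30 : 0 < 3 * r by rewrite mulr_gt0 ?ltr0n.
have L0 : 0 < 2 ^+ J * s by rewrite mulr_gt0 ?exprn_gt0 ?ltr0n.
have [y [yK ydis]] := open_cone_cubes n_gt0 K_cone K_neq0 L0.
have tail' y0 := tail y0 b s s0.
pose v k := unit_packet p w s b J (y k).
have sv k : sqi mu (v k) by exact: (sqi_unit_packet p w b J s0).
have Nv k : N (v k) = 1%E by exact: (unit_packet_norm b J D1 N_cube s0).
have v0 k x : ~ K x -> v k x = 0.
  by move=> Kx; apply: unit_packet_off => /yK.
have mv k : cmeasurable (ext0 (K : set T) (v k)).
  by rewrite ext0_id; [case: (sv k)|exact: v0].
have vE k : ext0 (K : set T) (v k) = v k by apply: ext0_id; exact: v0.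
have ex k : exists x : X, {ae mu, forall t, K t -> x t = v k t}.
  by apply: Lpw_space_exists; [exact: mv|rewrite vE Nv ltry].
have /choice[x xv] := ex; exists x.
have Wx k := wiener_hopfE mK p_bounded pa (sv k) (v0 k) (xv k).
have mS k : cmeasurable (fourier_mult a (v k) : T -> R[i]).
  by have [[]] := fourier_multP ma A0 aA (sv k).
have mSe k := cmeasurable_ext0 mK (mS k).
set kk := 3 * r * D ^+ J + M * (d * t).
have kE : kk / d = 3 * (r * D ^+ J / d) + M * t.
  by rewrite /kk; field; rewrite gt_eqF.
have q0 : 0 <= r * D ^+ J / d by rewrite divr_ge0 ?mulr_ge0 ?ltW.
have q1 : 24 * (r * D ^+ J / d) <= e.
  by rewrite mulrA ler_pdivrMr// mulrCA [leRHS]mulrC.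
have k0 : 0 <= kk / d.
  by rewrite kE; apply: addr_ge0; apply: mulr_ge0 => //; exact: ltW.
have mainE : cabs z - (kk + (cabs z * (d * t) + kk)) / d = cabs z * (1 - t) - 2 * (kk / d).
  by field; rewrite gt_eqF.
have zt : 0 <= cabs z * t by rewrite mulr_ge0 ?cabs_ge0// ltW.
have main : c - e <= cabs z * (1 - t) - 2 * (kk / d).
  by rewrite kE; apply: (error_budget c0 (ltW e0) t0 t2 tM tc q1); apply: le_trans zc; rewrite lerB.
have main' : c - e <= cabs z - kk / d.
  by apply: le_trans main _; rewrite mulrBr mulr1 mulr2n mulrDl mul1r -addrA lerD2l -opprD
    lerN2 addrC -addrA lerDl addr_ge0.
move=> k; split.
- by rewrite -lee_fin (Lpw_space_norm_ae (mv k) (xv k)) vE Nv.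
- rewrite -lee_fin (Lpw_space_norm_ae (mSe k) (Wx k)).
  apply: (@le_trans _ _ (cabs z - kk / d)%:E); first by rewrite lee_fin.
  apply: le_trans (unit_packet_diag ma A0 aA M0 aM D1 N_cube s0 th0 r30 tail' loc (y k)) _.
  apply: (le_luxw p w (cmeasurable_mul (mS k) (cmeasurable_cindic R (measurable_cube _ _))) (mSe k)).
  apply: aeT => x0; rewrite cabsM cabs_cindic indicE.
  have [xQ|_] := boolP (x0 \in _); last by rewrite mulr0 cabs_ge0.
  by rewrite mulr1 (ext0_in _ (yK k _ (set_mem xQ))).
- move=> j jk.
  rewrite -lee_fin (Lpw_space_normB_ae (mSe j) (mSe k) (Wx j) (Wx k)).
  apply: (@le_trans _ _ (cabs z - (kk + (cabs z * (d * t) + kk)) / d)%:E); first by rewrite lee_fin mainE.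
  have disj x0 : cube (y k) (2 ^+ J * s) x0 -> ~ cube (y j) (2 ^+ J * s) x0.
    by move=> h1 h2; exact: (ydis j k x0 jk h2).
  apply: (unit_packet_sep ma A0 aA M0 aM D1 N_cube s0 th0 r30 tail' loc disj
    (cmeasurable_sub (mSe j) (mSe k))).
  apply: aeT => x0 xQ; have Kx : K x0 by case: xQ => /yK.
  have h1 := ext0_in (fourier_mult a (v j) : T -> R[i]) Kx.
  have h2 := ext0_in (fourier_mult a (v k) : T -> R[i]) Kx.
  exact: (f_equal2 (fun u1 u2 => u1 - u2) h1 h2).
Qed.

End Separation.

(** * Separated sequences and noncompactness *)

Section SeparatedSequences.
Context (R : realType) (X : pseudoMetricNormedZmodType R).
Variables (G : set X) (x : nat -> X) (c : R).
Hypotheses (Gx : forall k, G (x k)) (sep : forall j k, j != k -> c <= `|x j - x k|).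

(** Pigeonhole: of m + 1 terms of the sequence two lie in the same of m covering sets, whose
    diameter is then at least [c]. *)
Lemma kuratowski_ge : (c%:E <= kuratowski G)%E.
Proof.
apply: le_ereal_inf_tmp => _ [r [r0 [m [S [GS dS]]]] <-].
have /choice[f fS] : forall k, exists i, S i (x k).
  by move=> k; have [i _ Si] := GS _ (Gx k); exists i.
have /injectivePn[j [k jk fjk]] : ~~ injectiveb (fun i : 'I_m.+1 => f i).
  apply/negP => /injectiveP /leq_card; rewrite !card_ord ltnn.
  by [].
apply: le_trans (dS (f j)); apply: (@le_trans _ _ (`|x j - x k|%:E)).
  by rewrite lee_fin; apply: sep; apply: contra jk => /eqP jk; apply/eqP/val_inj.
by apply: ereal_sup_ubound => /=; exists (x j) => //; exists (x k) => //; rewrite fjk.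
Qed.

(** The sequence would have a cluster point, and two different terms within c / 2 of it. *)
Lemma separated_not_precompact : 0 < c -> ~ precompact G.
Proof.
move=> c0; rewrite /precompact /compact_near => -[U GU [cU _]].
have c20 : 0 < c / 2 by rewrite divr_gt0.
have [|y [_ ycl]] := cU (x @ \oo) _; first by exists 0%N => // k _; apply: GU; exact: Gx.
have by_ := nbhsx_ballx y (c / 2) c20.
have h0 N : (x @ \oo) [set x k | k in [set k | (N <= k)%N]].
  by exists N => // k Nk; exists k.
have [_ [[j _ <-] yj]] := ycl _ _ (h0 0%N) by_.
have [_ [[k jk <-] yk]] := ycl _ _ (h0 j.+1) by_.
have /sep : k != j by rewrite gt_eqF.
apply/negP; rewrite -ltNge.
by have := ball_splitr yk yj; rewrite -ball_normE.
Qed.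

End SeparatedSequences.

(** * Essential supremum and the zero multiplier *)

Section ZeroMultiplier.
Context (R : realType) (n : nat).
Local Notation V := 'rV[R]_n.
Local Notation T := (Rn R n).
Local Notation mu := (@leb R n).
Variables (p : exponent T R) (w : weight mu).
Local Notation N f := (luxemburg mu p (wabs w f)).

(** Testing the levels [c] that fail to bound |a| matches the hypothesis of [separated_images] and
    covers finite and infinite [B] alike. *)
Lemma Linfty_norm_le (a : V -> R[i]) (B : \bar R) : (0 <= B)%E ->
  (forall c : R, 0 <= c -> ~ {ae mu, forall x, cabs (a x) <= c} -> (c%:E <= B)%E) ->
  (Linfty_norm a <= B)%E.
Proof.
move=> B0 h; rewrite Linfty_normE; case: B B0 h => [r|_ _|//]; last by rewrite leey.
rewrite lee_fin => r0 h; apply/lee_addgt0Pr => e e0; apply/ess_supP.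
have : {ae mu, forall x, cabs (a x) <= r + e}.
  apply: contrapT => /(h _ (addr_ge0 r0 (ltW e0))).
  by rewrite lee_fin gerDl leNgt e0.
by apply: aeS => x; rewrite -EFinD lee_fin.
Qed.

Lemma ae_neq0_bounded_below (a : V -> R[i]) : ~ {ae mu, forall x, a x = 0} ->
  exists2 c : R, 0 < c & ~ {ae mu, forall x, cabs (a x) <= c}.
Proof.
move=> a0; apply: contrapT => h; apply: a0.
have h1 (k : nat) : {ae mu, forall x, cabs (a x) <= k.+1%:R^-1}.
  by apply: contrapT => h1; apply: h; exists k.+1%:R^-1.
apply: aeS (ae_foralln h1) => x hx; apply: ComplexField.Normc.eq0_normc.
apply/eqP; rewrite eq_le cabs_ge0 andbT; apply/ler_addgt0Pr => e e0; rewrite add0r.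
have [k hk] := ltr_add_invr e0.
by apply: le_trans (hx k) _; rewrite ltW// -[X in X < _]add0r.
Qed.

Lemma fourier_mult0 (a f : V -> R[i]) : cmeasurable (a : T -> R[i]) ->
  {ae mu, forall x, a x = 0} -> sqi mu f -> {ae mu, forall x, fourier_mult a f x = 0}.
Proof.
move=> ma a0 sf.
have aA : {ae mu, forall x, cabs (a x) <= 0} by apply: aeS a0 => x ->; rewrite cabs0.
have [sg fg] := fourier_multP ma (lexx 0) aA sf.
have s0 : sqi mu (fun _ : T => 0 : R[i]).
  have := sqiZ 0 sf; congr sqi; apply/funext => x; exact: mul0r.
have sag : sqi mu (fun x => a x * fourier f x).
  by apply: (sqi_mul_bounded ma (lexx 0) aA); case: (fourierP sf).
apply: (frel_inj sg s0 sag s0 _ fg); first by apply: aeS a0 => x ->; rewrite mul0r.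
by move=> v _; apply: eq_cint => x; rewrite !mul0r.
Qed.

(** On square integrable functions the operator vanishes by its formula; boundedness and density
    extend this to the whole space. *)
Lemma wiener_hopf0 (Om : set T) (a : V -> R[i]) : measurable Om ->
  (ess_sup mu (EFin \o p) < +oo)%E -> multiplier p w a -> {ae mu, forall x, a x = 0} ->
  forall x : LpwSpace p w Om, wiener_hopf p w Om a x = 0.
Proof.
move=> mOm pb pa a0 x; have [[ma _] _] := pa.
have [lW [M hM]] := wiener_hopf_bounded mOm pb pa.
have [mx Nx] := Lpw_space_valP x.
apply/eqP; rewrite -normr_le0; apply/ler_addgt0Pr => e e0; rewrite add0r.
(* [bounded_linear] leaves the sign of [M] open. *)
have M1 : 0 < `|M| + 1 by rewrite ltr_wpDl.
have [g [sg g0 Ng gx]] := square_integrable_dense pb mx Nx (divr_gt0 e0 M1).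
have gOm t : ~ Om t -> g t = 0 by move=> Ot; apply: g0; exact: ext0_out.
have mg : cmeasurable (ext0 Om g) by rewrite (ext0_id gOm); case: sg.
have [|y yg] := Lpw_space_exists (p := p) (w := w) mg; first by rewrite (ext0_id gOm).
have Wy : wiener_hopf p w Om a y = 0.
  apply/Lpw_space_eqP.
  have h1 := wiener_hopfE mOm pb pa sg gOm yg.
  have h2 := fourier_mult0 ma a0 sg.
  have h3 : {ae mu, forall t, Om t -> Lpw_repr (0 : LpwSpace p w Om) t = 0}.
    have := Lpw_space_lin (-1) (0 : LpwSpace p w Om) 0; rewrite scaler0 addr0.
    by apply: aeS => t h Ot; have := h Ot; rewrite mulN1r addNr.
  have h4 := aeS2 (fun t e1 e2 => conj e1 e2) h1 h2.
  by apply: (aeS2 _ h4 h3) => t [e1 e2] e3 Ot; rewrite e1// e2 e3.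
have -> : wiener_hopf p w Om a x = wiener_hopf p w Om a (x - y).
  have := lW (-1) y x; rewrite scaleN1r Wy scaler0 add0r addrC.
  by move=> ->.
apply: le_trans (hM _) _.
have h : `|x - y| <= e / (`|M| + 1).
  rewrite -lee_fin distrC.
  have xx : {ae mu, forall t, Om t -> x t = ext0 Om x t} by apply: aeT => t Ot; rewrite ext0_in.
  have mxx := cmeasurable_ext0 mOm mx.
  rewrite (Lpw_space_normB_ae mg mxx yg xx) (ext0_id gOm) ext0_id// => t Ot.
  exact: ext0_out.
apply: (@le_trans _ _ ((`|M| + 1) * `|x - y|)).
  by apply: ler_wpM2r => //; rewrite (le_trans (ler_norm M))// lerDl.
by rewrite mulrC -ler_pdivlMr.
Qed.

End ZeroMultiplier.

(** * The two lower bounds and the compactness criterion *)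

Section Conclusion.
Context (R : realType) (n : nat).
Local Notation V := 'rV[R]_n.
Local Notation T := (Rn R n).
Local Notation mu := (@leb R n).
Variables (p : exponent T R) (w : weight mu) (p' : V -> R) (a : V -> R[i]) (K : set V).
Hypotheses (n_gt0 : (0 < n)%N) (p_bounded : (ess_sup mu (EFin \o p) < +oo)%E)
  (pp' : forall x, (p x)^-1 + (p' x)^-1 = 1) (Ap : muckenhoupt p p' w)
  (K_cone : open_cone K) (K_neq0 : K !=set0) (pa : multiplier p w a).
Local Notation X := (LpwSpace p w (K : set T)).
Local Notation W := (wiener_hopf p w (K : set T) a).

Let sep c e := @separated_images R n p w p' a K n_gt0 p_bounded pp' Ap K_cone K_neq0 pa c e.

Lemma wiener_hopf_norm_ge : (Linfty_norm a <= op_norm W)%E.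
Proof.
apply: Linfty_norm_le.
  apply: (@le_trans _ _ `|W 0|%:E); first by rewrite lee_fin.
  by apply: ereal_sup_ubound; exists 0 => //; rewrite /unit_ball /= normr0.
move=> c c0 ac; apply/lee_addgt0Pr => e e0; have [x hx] := sep c0 e0 ac.
have [x1 Wx _] := hx 0%N.
rewrite -leeBlDr//; apply: (@le_trans _ _ `|W (x 0%N)|%:E); first by rewrite -EFinB lee_fin.
by apply: ereal_sup_ubound; exists (x 0%N).
Qed.

(** The factor 1/2 is the one in [op_kappa]: the Kuratowski number of the image of the ball is
    itself at least the norm of [a], as the separation is as large as the images. *)
Lemma wiener_hopf_kappa_ge : (2^-1%:E * Linfty_norm a <= op_kappa W)%E.
Proof.
rewrite /op_kappa; apply: lee_wpmul2l; first by rewrite lee_fin.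
apply: Linfty_norm_le; first by apply: le_ereal_inf_tmp => _ [r [r0 _] <-]; rewrite lee_fin.
move=> c c0 ac; apply/lee_addgt0Pr => e e0; have [x hx] := sep c0 e0 ac.
rewrite -leeBlDr// -EFinB; apply: (@kuratowski_ge _ _ _ (fun k => W (x k))).
  by move=> k; exists (x k) => //; case: (hx k).
by move=> j k jk; case: (hx k) => _ _; exact.
Qed.

Lemma wiener_hopf_compactP : compact_linear W <-> {ae mu, forall x, a x = 0}.
Proof.
split=> [[_ cW]|a0].
  apply: contrapT => /ae_neq0_bounded_below[c c0 ac].
  have c20 : 0 < c / 2 by rewrite divr_gt0.
  have [x hx] := sep (ltW c0) c20 ac.
  apply: (@separated_not_precompact _ _ _ (fun k => W (x k)) (c - c / 2) _ _ _ cW).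
  - by move=> k; exists (x k) => //; case: (hx k).
  - by move=> j k jk; case: (hx k) => _ _; exact.
  - by rewrite subr_gt0 ltr_pdivrMr// mulr_natr mulr2n ltrDl.
have mK : measurable (K : set T).
  by apply: measurable_borel; apply: borel_open; case: K_cone.
split; first exact: wiener_hopf_bounded.
apply: (@precompact_subset _ _ [set 0]).
  by move=> _ [x _ <-]; exact: wiener_hopf0.
apply: compact_precompact; [exact: norm_hausdorff|exact: compact_set1].
Qed.

End Conclusion.

Theorem theorem6p1 (R : realType) (n : nat) (n_gt0 : (0 < n)%N)
  (p : exponent (Rn R n) R) (p' : 'rV[R]_n -> R) (w : weight (@leb R n))
  (C : set 'rV[R]_n) (a : 'rV[R]_n -> R[i]) :
  (1 < ess_inf leb (EFin \o p))%E ->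
  (ess_sup leb (EFin \o p) < +oo)%E ->
  (forall x, (p x)^-1 + (p' x)^-1 = 1) ->
  muckenhoupt p p' w ->
  C !=set0 ->
  open_cone C ->
  multiplier p w a ->
  [/\ (Linfty_norm a <= op_norm (wiener_hopf p w C a))%E,
      (2^-1%:E * Linfty_norm a <= op_kappa (wiener_hopf p w C a))%E,
      compact_linear (wiener_hopf p w setT a) <->
        {ae @leb R n, forall x, a x = 0} &
      compact_linear (wiener_hopf p w C a) <->
        {ae @leb R n, forall x, a x = 0}].
Proof.
move=> _ p_bounded pp' Ap C_neq0 C_cone pa.
(* The whole space is an open cone, so its compactness criterion is an instance of the one for
   cones. *)
have T_cone : open_cone (setT : set 'rV[R]_n) by split=> //; exact: openT.
have T_neq0 : (setT : set 'rV[R]_n) !=set0 by exists 0.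
split.
- exact: (wiener_hopf_norm_ge n_gt0 p_bounded pp' Ap C_cone C_neq0 pa).
- exact: (wiener_hopf_kappa_ge n_gt0 p_bounded pp' Ap C_cone C_neq0 pa).
- exact: (wiener_hopf_compactP n_gt0 p_bounded pp' Ap T_cone T_neq0 pa).
- exact: (wiener_hopf_compactP n_gt0 p_bounded pp' Ap C_cone C_neq0 pa).
Qed.
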